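(* Let $T\in(0,\infty)$ and let $\varphi\in C^2(L^2,\mathbb R)$ have bounded first and second order Fréchet derivatives. For $M\in\mathbb N$ define $u_M:[0,T]\times H_M\to\mathbb R$ by $u_M(t,x)=\mathbb E[\varphi(X_M^x(t))]$. (i) Let $\alpha\in[0,1)$ and $\delta,\epsilon\in(0,\infty)$. There exists $C_{\alpha,\delta,\epsilon}(T,Q,\varphi)\in(0,\infty)$ such that for all $M\in\mathbb N$, all $x,h\in H_M$ and all $t\in(0,T]$, \[|Du_M(t,x).(h)|\le C_{\alpha,\delta,\epsilon}(T,Q,\varphi)\,t^{-\alpha}e^{\epsilon\|x\|_{L^2}^2}\bigl(1+\|(-A)^{\frac14+\delta}x\|_{L^2}^6\bigr)\|(-A)^{-\alpha}h\|_{L^2}.\] (ii) Let $\alpha,\beta\in[0,1)$ with $\alpha+\beta<1$ and $\delta,\epsilon\in(0,\infty)$. There exists $C_{\alpha,\beta,\delta,\epsilon}(T,Q,\varphi)\in(0,\infty)$ such that for all $M\in\mathbb N$, all $x,g,h\in H_M$ and all $t\in(0,T]$, \[|D^2u_M(t,x).(g,h)|\le C_{\alpha,\beta,\delta,\epsilon}(T,Q,\varphi)\,t^{-(\alpha+\beta)}e^{\epsilon\|x\|_{L^2}^2}\bigl(1+\|(-A)^{\frac14+\delta}x\|_{L^2}^{16}\bigr)\|(-A)^{-\alpha}g\|_{L^2}\|(-A)^{-\beta}h\|_{L^2}.\]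
   Context: $L^2=L^2(0,1)$ (real); $W^{1,2}_0=\{f\in W^{1,2}(0,1):f(0)=f(1)=0\}$; $\nabla$ is the derivative in $z\in(0,1)$. $h_k=\sqrt2\sin(k\pi\cdot)$, $k\in\mathbb N$; $A$ is the Dirichlet Laplacian $Ax=-\sum_k(\pi k)^2\langle x,h_k\rangle_{L^2}h_k$; for $\alpha\ge0$, $(-A)^{\pm\alpha}x=\sum_k(\pi k)^{\pm2\alpha}\langle x,h_k\rangle_{L^2}h_k$ (with $D((-A)^\alpha)$ the set of $x$ for which the $+\alpha$ series converges in $L^2$). $H_M=\mathrm{span}(h_1,\dots,h_M)$, $P_M$ the orthogonal projection onto $H_M$. $B[x_1,x_2]=x_1\nabla x_2+x_2\nabla x_1$, $B_M[x_1,x_2]=P_MB[P_Mx_1,P_Mx_2]$, $B_M(x)=B_M[x,x]$. $Q$ is a positive self-adjoint trace-class operator on $L^2$ with eigenbasis $(e_k)$ and eigenvalues $(q_k)$; $W^Q(t)=\sum_k\sqrt{q_k}W^{(k)}(t)e_k$ with $(W^{(k)})$ independent standard Brownian motions on a filtered probability space. For $x\in H_M$, $X_M^x$ is the unique $H_M$-valued continuous adapted process with $X_M^x(t)=x+\int_0^t[AX_M^x(s)+B_M(X_M^x(s))]ds+P_MW^Q(t)$, $t\ge0$. $Du_M(t,x)$ and $D^2u_M(t,x)$ are the first and second Fréchet derivatives with respect to $x\in H_M$. *)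

(* Defs.v *)
From HB Require Import structures.
From mathcomp Require Import all_boot all_order all_algebra.
From mathcomp Require Import all_classical all_reals all_analysis.

Set Implicit Arguments.
Unset Strict Implicit.
Unset Printing Implicit Defensive.

Import Order.TTheory GRing.Theory Num.Theory.
Import numFieldNormedType.Exports.

Local Open Scope classical_set_scope.
Local Open Scope ring_scope.

Section defs.
Context {R : realType}.

Definition I01 : set R := `]0, 1[.

Definition hk (k : nat) : R -> R := fun z => Num.sqrt 2 * sin (k%:R * pi * z).

(** Elements of L^2(0,1) are represented by real functions (only their
    values on (0,1) matter) that are measurable and square integrable. *)
Definition L2fun (f : R -> R) : Prop :=
  measurable_fun I01 f /\
  (\int[lebesgue_measure]_(z in I01) ((f z) ^+ 2)%:E < +oo)%E.

Definition ip (f g : R -> R) : R :=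
  Rintegral lebesgue_measure I01 (fun z => f z * g z).
Definition l2norm (f : R -> R) : R := Num.sqrt (ip f f).

Definition C2_bounded_L2 (phi : (R -> R) -> R) : Prop :=
  exists (Dphi : (R -> R) -> (R -> R) -> R)
         (D2phi : (R -> R) -> (R -> R) -> (R -> R) -> R) (K1 K2 : R),
  forall x, L2fun x ->
   (forall a b h k, L2fun h -> L2fun k ->
      Dphi x (fun z => a * h z + b * k z) = a * Dphi x h + b * Dphi x k) /\
   (forall h, L2fun h -> `|Dphi x h| <= K1 * l2norm h) /\
   (forall eps, 0 < eps -> exists2 del, 0 < del &
      forall h, L2fun h -> l2norm h < del ->
        `|phi (fun z => x z + h z) - phi x - Dphi x h| <= eps * l2norm h) /\
   (forall a b g h k, L2fun g -> L2fun h -> L2fun k ->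
      D2phi x (fun z => a * g z + b * h z) k
        = a * D2phi x g k + b * D2phi x h k /\
      D2phi x k (fun z => a * g z + b * h z)
        = a * D2phi x k g + b * D2phi x k h) /\
   (forall g h, L2fun g -> L2fun h ->
      `|D2phi x g h| <= K2 * l2norm g * l2norm h) /\
   (forall eps, 0 < eps -> exists2 del, 0 < del &
      forall g, L2fun g -> l2norm g < del -> forall h, L2fun h ->
        `|Dphi (fun z => x z + g z) h - Dphi x h - D2phi x g h|
          <= eps * l2norm g * l2norm h) /\
   (forall eps, 0 < eps -> exists2 del, 0 < del &
      forall g, L2fun g -> l2norm g < del -> forall h k, L2fun h -> L2fun k ->
        `|D2phi (fun z => x z + g z) h k - D2phi x h k|
          <= eps * l2norm h * l2norm k).

(** Coordinates: H_M is identified with 'rV_M through the basis h_1..h_M. *)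
Definition embM (M : nat) (c : 'rV[R]_M) : R -> R :=
  fun z => \sum_(i < M) c ord0 i * hk i.+1 z.

Definition coordPM (M : nat) (y : R -> R) : 'rV[R]_M :=
  \row_(i < M) ip y (hk i.+1).

Definition Bform (x1 x2 : R -> R) : R -> R :=
  fun z => x1 z * derive1 x2 z + x2 z * derive1 x1 z.

(** coordinates of A x + B_M(x) for x in H_M (A x has coordinates
    -(pi k)^2 <x, h_k>) *)
Definition drift (M : nat) (c : 'rV[R]_M) : 'rV[R]_M :=
  \row_(i < M) (- (pi * i.+1%:R) ^+ 2 * ip (embM c) (hk i.+1))
  + coordPM M (Bform (embM c) (embM c)).

(** (-A)^a f for f in H_M (all coefficients of index > M vanish). *)
Definition powA (M : nat) (a : R) (f : R -> R) : R -> R :=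
  fun z => \sum_(i < M) (pi * i.+1%:R) `^ (2 * a) * ip f (hk i.+1) * hk i.+1 z.

Definition indep_std_BMs d (Om : measurableType d) (P : probability Om R)
    (W : nat -> R -> Om -> R) : Prop :=
  (forall k t, measurable_fun setT (W k t)) /\
  (forall k w, W k 0 w = 0) /\
  (forall k w, {within `[(0:R), +oo[, continuous (fun t => W k t w)}) /\
  (forall (n m : nat) (t : nat -> R) (A : nat -> nat -> set R),
     0 <= t 0%N -> (forall j, t j < t j.+1) ->
     (forall k j, measurable (A k j)) ->
     P [set w | forall k j, (k < n)%N -> (j < m)%N ->
                 A k j (W k (t j.+1) w - W k (t j) w)]
     = (\prod_(k < n) \prod_(j < m)
          normal_prob 0 (Num.sqrt (t j.+1 - t j)) (A k j))%E).

(** Q = sum_k q_k <., e_k> e_k positive self-adjoint trace class,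
    with orthonormal eigenbasis (e_k) of L^2. *)
Definition trace_class_eig (e : nat -> R -> R) (q : nat -> R) : Prop :=
  (forall k, L2fun (e k)) /\
  (forall i j, ip (e i) (e j) = (i == j)%:R) /\
  (forall f, L2fun f ->
     (fun n => \sum_(k < n) ip f (e k) ^+ 2) @ \oo --> ip f f) /\
  (forall k, 0 <= q k) /\
  (exists l : R, (fun n => \sum_(k < n) q k) @ \oo --> l).

(** X solves X(t) = x + int_0^t [A X + B_M(X)] ds + P_M W^Q(t), t >= 0,
    where P_M W^Q(t) = sum_k sqrt(q_k) W^(k)(t) P_M e_k. *)
Definition galerkin_sol d (Om : measurableType d) (P : probability Om R)
    (W : nat -> R -> Om -> R) (e : nat -> R -> R) (q : nat -> R)
    (M : nat) (x : 'rV[R]_M) (X : R -> Om -> 'rV[R]_M) : Prop :=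
  (forall w, {within `[(0:R), +oo[, continuous (fun t => X t w)}) /\
  (forall t (i : 'I_M), 0 <= t -> measurable_fun setT (fun w => X t w ord0 i)) /\
  (forall t, 0 <= t -> {ae P, forall w, forall i : 'I_M,
     (fun n => \sum_(k < n) Num.sqrt (q k) * W k t w * ip (e k) (hk i.+1))
       @ \oo -->
     (X t w - x
        - \row_(j < M) Rintegral lebesgue_measure `[(0:R), t]
                         (fun s => drift (X s w) ord0 j)) ord0 i}).

Definition uM d (Om : measurableType d) (P : probability Om R)
    (phi : (R -> R) -> R) (M : nat) (X : 'rV[R]_M -> R -> Om -> 'rV[R]_M)
    (t : R) (x : 'rV[R]_M) : R :=
  Rintegral P setT (fun w => phi (embM (X x t w))).

End defs.

(* Main.v *)
(** Everything is reduced to finite differences in the initial datum. For Galerkin solutions driven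
    by the same noise, the difference [D] of two solves [D' = A D + B(S, D)] with [S] their sum. As
    the transport form costs only a subquadratic power of [|S|_1], Gronwall in [H^-1], then
    in [L^2] with a weight in time, gives [|D(t)| <= C t^-alpha |(- A)^-alpha h| theta]; the second
    difference, forced by the product of two first differences, is bounded in the same way
    through the mild formulation, with [theta^3]. Here [theta] is a multiple of
    [exp(eps int |X|_1^2)] times a power of moments of [X] and of the stochastic convolution. Its
    moments are at most [C e^(eps |x|^2)]: the exponential Lyapunov function is propagated one
    Gaussian innovation at a time through a tamed Euler scheme, and Fatou's lemma passes to the limit.

    Differentiating under the expectation is avoided altogether: the bounds on first and second
    differences of [u] make [u] asymptotically additive near each point, hence differentiable, and a
    qualitative bound [o(1) |g| |h|] on third differences does the same for [Du]. *)

Require Import Defs.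
From HB Require Import structures.
From mathcomp Require Import all_boot all_order all_algebra.
From mathcomp Require Import all_classical all_reals all_analysis.
From mathcomp Require Import measurable_realfun lebesgue_integral ring lra.

Set Implicit Arguments.
Unset Strict Implicit.
Unset Printing Implicit Defensive.

Import Order.TTheory GRing.Theory Num.Theory.
Import numFieldNormedType.Exports.

Local Open Scope classical_set_scope.
Local Open Scope ring_scope.

(** * Calculus on the line and Gronwall lemmas *)

(** The heat flow of an initial difference [h] is only [O(s^-alpha)] in [L^2], not square integrable
    for [alpha >= 1/2], so no [L^2] energy estimate can start at time 0. The remainder
    [D - e^(sA) h] starts at 0 and is forced by [B(S, e^(sA) h)]; tested in [H^-1] this costs
    [|S|_oo s^-alpha], one integrable power. The supremum norm is where the initial datum enters:
    the nonlinear part of [X] and, the trace of [Q] being finite, the stochastic convolution are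
    bounded in [H^1], but [e^(sA) x] only through [H^sigma] with [sigma > 1/2]. The resulting factor
    is linear in that norm; a first difference uses it once and a second difference three times, so
    powers 1 and 3 come out, below 6 and 16. Exponential moments of [int |X|_1^2] exist for small
    coefficients only. The subquadratic cost of transport, [e |S|_1^2 + 3 / e^2] for any [e > 0], is
    what makes Gronwall factors integrable. The estimates compare finitely many initial points on
    one exceptional set; path functionals are not known to be measurable and are handled by upper
    expectations. *)

HB.lock Definition cint {R : realType} (a b : R) (f : R -> R) : R :=
  Rintegral (@lebesgue_measure R) `[a, b] f.

Section calculus.
Context {R : realType}.
Implicit Types (f g y : R -> R) (a b t : R).
Local Notation mu := (@lebesgue_measure R).

Lemma cont_integrable a b f : continuous f -> mu.-integrable `[a, b] (EFin \o f).
Proof.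
move=> cf; apply: continuous_compact_integrable; first exact: segment_compact.
by apply: continuous_subspaceT.
Qed.

Lemma cintD a b f g : continuous f -> continuous g ->
  cint a b (fun x => f x + g x) = cint a b f + cint a b g.
Proof. by rewrite cint.unlock => cf cg; apply: RintegralD => //; exact: cont_integrable. Qed.

Lemma cintZ a b c f : continuous f -> cint a b (fun x => c * f x) = c * cint a b f.
Proof. by rewrite cint.unlock => cf; apply: RintegralZl => //; exact: cont_integrable. Qed.

Lemma le_cint a b f g : continuous f -> continuous g ->
  (forall x, a <= x <= b -> f x <= g x) -> cint a b f <= cint a b g.
Proof.
rewrite cint.unlock => cf cg fg; apply: le_Rintegral; [by []|exact: cont_integrable|exact: cont_integrable|].
by move=> x /=; rewrite in_itv /= => /fg.
Qed.

Lemma cint_ge0 a b f : (forall x, 0 <= f x) -> 0 <= cint a b f.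
Proof. by rewrite cint.unlock => h; apply: Rintegral_ge0 => x _. Qed.

Lemma cint_cst a b c : a <= b -> cint a b (fun=> c) = c * (b - a).
Proof.
move=> ab; rewrite cint.unlock Rintegral_cst//=; congr (_ * _).
by rewrite lebesgue_measure_itv/= lte_fin; case: ltP => //= ba; lra.
Qed.

Lemma eq_cint a b f g : (forall x, a <= x <= b -> f x = g x) -> cint a b f = cint a b g.
Proof.
by rewrite cint.unlock => fg; apply: eq_Rintegral => x; rewrite inE/= in_itv/= => /fg.
Qed.

Lemma cint_cat a b c f : continuous f -> a <= b -> b <= c ->
  cint a c f = cint a b f + cint b c f.
Proof.
move=> cf; rewrite le_eqVlt => /predU1P[->|ab].
  move=> bc; rewrite [cint b b f](_ : _ = 0) ?add0r//.
  by rewrite cint.unlock set_itv1 Rintegral_set1.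
move=> bc; rewrite cint.unlock.
have := @Rintegral_itvB R f (BLeft a) (BRight c) b (cont_integrable a c cf).
rewrite !bnd_simp => /(_ (ltW ab) bc) E.
have -> : Rintegral mu `[b, c] f = Rintegral mu `]b, c] f.
  rewrite Rintegral_itv_obnd_cbnd//.
  have := cont_integrable b c cf => /integrableS; apply => //.
  by apply: subset_itvr; rewrite bnd_simp.
by rewrite -E; lra.
Qed.

Lemma cint_FTC f (F : R -> R) a b : a < b -> continuous f ->
  (forall x : R, is_derive x 1 F (f x)) -> cint a b f = F b - F a.
Proof.
move=> ab cf dF; rewrite cint.unlock /Rintegral.
have cF : continuous F.
  by move=> x; apply/differentiable_continuous/derivable1_diffP; case: (dF x).
rewrite (@continuous_FTC2 R f F a b)//.
- exact: continuous_subspaceT.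
- split.
  + by move=> x _; case: (dF x).
  + exact: cvg_at_right_filter (cF a).
  + exact: cvg_at_left_filter (cF b).
- by move=> x _; rewrite derive1E; apply: derive_val.
Qed.

(* The base point [- 1] makes [prim f] differentiable at [0] as well. *)
Definition prim f t := cint (- 1) t f - cint (- 1) 0 f.

Lemma prim0 f : prim f 0 = 0. Proof. by rewrite /prim subrr. Qed.

Lemma primE f t : continuous f -> 0 <= t -> prim f t = cint 0 t f.
Proof. by move=> cf t0; rewrite /prim (@cint_cat (-1) 0 t)//; lra. Qed.

Lemma is_derive_prim f t : continuous f -> 0 <= t -> is_derive t 1 (prim f) (f t).
Proof.
move=> cf t0.
have [||||d1 d2] := @continuous_FTC1_closed R f (-1) t (t + 1).
- lra.
- exact: cont_integrable.
- lra.
- exact: cf.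
have h : is_derive t 1 (fun x => cint (-1) x f) (f t).
  by rewrite cint.unlock; apply: DeriveDef; [exact: d1|rewrite -d2 derive1E].
by apply: (is_derive_eq (is_deriveB h (is_derive_cst (cint (-1) 0 f) t 1))); rewrite subr0.
Qed.

Lemma is_derive_cont f df t : is_derive t 1 f df -> {for t, continuous f}.
Proof. by move=> d; apply/differentiable_continuous/derivable1_diffP; case: d. Qed.

Lemma prim_cont f t : continuous f -> 0 <= t -> {for t, continuous (prim f)}.
Proof. by move=> cf t0; apply: is_derive_cont (is_derive_prim cf t0). Qed.

Lemma dD (f g : R -> R) (t df dg : R) : is_derive t 1 f df -> is_derive t 1 g dg ->
  is_derive t 1 (fun x => f x + g x) (df + dg).
Proof. by move=> h1 h2; exact: is_deriveD. Qed.

Lemma dB (f g : R -> R) (t df dg : R) : is_derive t 1 f df -> is_derive t 1 g dg ->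
  is_derive t 1 (fun x => f x - g x) (df - dg).
Proof. by move=> h1 h2; exact: is_deriveB. Qed.

Lemma dM (f g : R -> R) (t df dg : R) : is_derive t 1 f df -> is_derive t 1 g dg ->
  is_derive t 1 (fun x => f x * g x) (df * g t + f t * dg).
Proof.
move=> h1 h2; apply: (is_derive_eq (is_deriveM h1 h2)).
by rewrite /GRing.scale/=; ring.
Qed.

Lemma dZ (c : R) (f : R -> R) (t df : R) : is_derive t 1 f df ->
  is_derive t 1 (fun x => c * f x) (c * df).
Proof. by move=> h1; exact: is_deriveZ. Qed.

Lemma dC (c t : R) : is_derive t 1 (fun _ : R => c) 0.
Proof. exact: is_derive_cst. Qed.

Lemma dsum n (F : 'I_n -> R -> R) (t : R) (dF : 'I_n -> R) :
  (forall i, is_derive t 1 (F i) (dF i)) ->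
  is_derive t 1 (fun x => \sum_(i < n) F i x) (\sum_(i < n) dF i).
Proof.
move=> h; have -> : (fun x => \sum_(i < n) F i x) = \sum_(i < n) F i.
  by apply: funext => x; rewrite fct_sumE.
exact: is_derive_sum.
Qed.

Lemma d_comp (f g : R -> R) (t df dg : R) : is_derive (g t) 1 f df -> is_derive t 1 g dg ->
  is_derive t 1 (fun x => f (g x)) (df * dg).
Proof.
by move=> h1 h2; apply: (is_derive_eq (is_derive1_comp h1 h2)).
Qed.

Lemma dexp (f : R -> R) (t df : R) : is_derive t 1 f df ->
  is_derive t 1 (fun x => expR (f x)) (df * expR (f t)).
Proof.
move=> h; apply: (is_derive_eq (is_derive1_comp (is_derive_expR _) h)).
by rewrite mulrC.
Qed.

Lemma primD f g t : continuous f -> continuous g ->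
  prim (fun x => f x + g x) t = prim f t + prim g t.
Proof. by move=> cf cg; rewrite /prim !cintD//; lra. Qed.

Lemma primZ c f t : continuous f -> prim (fun x => c * f x) t = c * prim f t.
Proof. by move=> cf; rewrite /prim !cintZ//; lra. Qed.

Lemma le_prim f g t : 0 <= t -> continuous f -> continuous g ->
  (forall x, 0 <= x <= t -> f x <= g x) -> prim f t <= prim g t.
Proof. by move=> t0 cf cg fg; rewrite !primE//; exact: le_cint. Qed.

Lemma prim_ge0 f t : 0 <= t -> continuous f -> (forall x, 0 <= f x) -> 0 <= prim f t.
Proof. by move=> t0 cf h; rewrite primE//; exact: cint_ge0. Qed.

Lemma prim_cst c t : 0 <= t -> prim (fun=> c) t = c * t.
Proof. by move=> t0; rewrite primE ?cint_cst ?subr0//; exact: cst_continuous. Qed.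

Lemma le_prim_t f s t : 0 <= s -> s <= t -> continuous f -> (forall x, 0 <= f x) ->
  prim f s <= prim f t.
Proof.
move=> s0 st cf f0; rewrite !primE//; last exact: le_trans st.
by rewrite (@cint_cat 0 s t)// lerDl cint_ge0.
Qed.

Lemma within_of_for f a b : (forall s : R, a <= s <= b -> {for s, continuous f}) ->
  {within `[a, b], continuous f}.
Proof.
move=> cf; apply: continuous_in_subspaceT => s; rewrite inE/= in_itv/= => h.
exact: cf.
Qed.

(** Derivatives are asked for on the open interval and continuity on the closed one because the
    primitives of [s^(- c)], [0 < c < 1], to which it is applied, have no derivative at 0. The mean
    value theorem is used for [g - f]. *)
Lemma le_of_derive_le f g (df dg : R -> R) a b : a <= b ->
  (forall s : R, a < s < b -> is_derive s 1 f (df s)) ->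
  (forall s : R, a < s < b -> is_derive s 1 g (dg s)) ->
  (forall s : R, a <= s <= b -> {for s, continuous f}) ->
  (forall s : R, a <= s <= b -> {for s, continuous g}) ->
  (forall s : R, a < s < b -> df s <= dg s) ->
  f b - f a <= g b - g a.
Proof.
rewrite le_eqVlt => /predU1P[->|ab]; first by rewrite !subrr.
move=> Hf Hg cf cg le.
have [c cab E] := @MVT R (fun s => g s - f s) (fun s => dg s - df s) a b ab
  (fun x (hx : x \in `]a, b[%R) => is_deriveB (Hg x hx) (Hf x hx))
  (within_of_for (fun s hs => continuousB (cg s hs) (cf s hs))).
have : 0 <= (dg c - df c) * (b - a).
  by rewrite mulr_ge0 ?subr_ge0 ?(ltW ab)//; exact: le.
by rewrite -E; lra.
Qed.

(* Gronwall for [y' <= A' y + B'], via [(y e^{-A} - B)' <= 0]. *)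
Lemma gronwall y (A B : R -> R) (dy dA dB : R -> R) t : 0 <= t ->
  (forall s : R, 0 < s < t -> is_derive s 1 y (dy s)) ->
  (forall s : R, 0 < s < t -> is_derive s 1 A (dA s)) ->
  (forall s : R, 0 < s < t -> is_derive s 1 B (dB s)) ->
  (forall s : R, 0 <= s <= t -> {for s, continuous y}) ->
  (forall s : R, 0 <= s <= t -> {for s, continuous A}) ->
  (forall s : R, 0 <= s <= t -> {for s, continuous B}) ->
  (forall s : R, 0 <= s <= t -> 0 <= A s) -> A 0 = 0 ->
  (forall s : R, 0 < s < t -> 0 <= dB s) -> B 0 = 0 ->
  (forall s : R, 0 < s < t -> dy s <= dA s * y s + dB s) ->
  y t <= expR (A t) * (y 0 + B t).
Proof.
move=> t0 Hy HA HB cy cA cB A0 A00 B0 B00 H.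
have expA s : 0 < s < t -> is_derive s 1 (fun s => expR (- A s)) (- dA s * expR (- A s)).
  move=> hs; apply: (is_derive_eq (is_derive1_comp (is_derive_expR _) (is_deriveN (HA s hs)))).
  by rewrite mulrC.
have h : y t * expR (- A t) - y 0 * expR (- A 0) <= B t - B 0.
apply: (@le_of_derive_le (fun s => y s * expR (- A s)) B
  (fun s => y s * (- dA s * expR (- A s)) + expR (- A s) * dy s) dB 0 t t0).
- by move=> s hs; apply: is_derive_eq; first exact: (is_deriveM (Hy s hs) (expA s hs)).
- move=> s hs; apply: continuousM; first exact: cy.
  apply: continuous_comp; first by apply: continuousN; exact: cA.
  exact: continuous_expR.
- exact: cB.
- move=> s hs.
  have e1 : expR (- A s) <= 1.
    by rewrite -expR0 ler_expR oppr_le0 A0// !ltW//; case/andP: hs.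
  have := H s hs; have := B0 s hs => b0 Hs.
  have : expR (- A s) * dy s <= expR (- A s) * (dA s * y s + dB s).
    by rewrite ler_pM2l ?expR_gt0.
  have : expR (- A s) * dB s <= dB s by rewrite ler_piMl.
  lra.
move: h; rewrite A00 oppr0 expR0 mulr1 B00 subr0 => h.
have {h} : expR (A t) * (y t * expR (- A t)) <= expR (A t) * (y 0 + B t).
  by rewrite ler_pM2l ?expR_gt0//; lra.
by rewrite mulrCA -expRD subrr expR0 mulr1.
Qed.

End calculus.

Section continuity_bits.
Context {R : realType} {T : topologicalType}.
Implicit Types f g : T -> R.
Lemma contM f g : continuous f -> continuous g -> continuous (fun x => f x * g x).
Proof. by move=> cf cg x; apply: continuousM; [exact: cf|exact: cg]. Qed.
Lemma contD f g : continuous f -> continuous g -> continuous (fun x => f x + g x).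
Proof. by move=> cf cg x; apply: continuousD; [exact: cf|exact: cg]. Qed.
Lemma contN f : continuous f -> continuous (fun x => - f x).
Proof. by move=> cf x; apply: continuousN; exact: cf. Qed.
Lemma contB f g : continuous f -> continuous g -> continuous (fun x => f x - g x).
Proof. by move=> cf cg; apply: contD => //; exact: contN. Qed.
Lemma contC (c : R) : continuous (fun _ : T => c).
Proof. by move=> x; exact: cvg_cst. Qed.
Lemma contX f n : continuous f -> continuous (fun x => f x ^+ n).
Proof.
move=> cf; elim: n => [|n IH]; first by under eq_fun do rewrite expr0; exact: contC.
by under eq_fun do rewrite exprS; exact: contM.
Qed.
Lemma cont_norm f : continuous f -> continuous (fun x => `|f x|).
Proof. by move=> cf x; apply: (cvg_norm (cf x)). Qed.
Lemma cont_comp (h : R -> R) f : continuous h -> continuous f -> continuous (fun x => h (f x)).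
Proof. by move=> ch cf x; apply: continuous_comp; [exact: cf|exact: ch]. Qed.
Lemma cont_sum (I : Type) (r : seq I) (F : I -> T -> R) :
  (forall i, continuous (F i)) -> continuous (fun x => \sum_(i <- r) F i x).
Proof.
move=> cF; elim: r => [|i r IH].
  under eq_fun do rewrite big_nil. exact: contC.
under eq_fun do rewrite big_cons.
exact: contD.
Qed.
End continuity_bits.

Create HintDb contdb.
Ltac cont1 := lazymatch goal with
  | |- continuous (fun _ => ?c) => apply: contC
  | |- continuous (fun x => GRing.mul (@?f x) (@?g x)) => apply: (contM (f := f) (g := g)); cbv beta
  | |- continuous (fun x => GRing.add (@?f x) (@?g x)) => apply: (contD (f := f) (g := g)); cbv beta
  | |- continuous (fun x => GRing.opp (@?f x)) => apply: (contN (f := f)); cbv beta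
  | |- continuous (fun x => GRing.exp (@?f x) ?n) => apply: (contX (f := f) (n := n)); cbv beta
  | |- continuous (fun x => Num.norm (@?f x)) => apply: (cont_norm (f := f)); cbv beta
  | |- continuous (fun x => x) => (move=> ?; exact: cvg_id)
  | |- continuous (fun x => expR (@?f x)) => apply: (cont_comp (h := expR) (f := f)); [exact: continuous_expR|cbv beta]
  | |- _ => solve [eauto with contdb]
  end.
Ltac cont := repeat cont1.

(** * Cauchy-Schwarz and Agmon inequalities on the unit interval *)

Section unit_interval.
Context {R : realType}.
Implicit Types f g h : R -> R.
Local Notation I01i := (@cint R 0 1).

Lemma cint_sum (I : Type) (r : seq I) (F : I -> R -> R) (a b : R) :
  (forall i, continuous (F i)) ->
  cint a b (fun x => \sum_(i <- r) F i x) = \sum_(i <- r) cint a b (F i).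
Proof.
move=> cF; elim: r => [|i r IH].
  rewrite big_nil -[RHS](mul0r (cint a b (fun=> 1))) -cintZ; last exact: contC.
  by apply: eq_cint => x _; rewrite big_nil mul0r.
rewrite big_cons -IH -cintD//; last exact: cont_sum.
by apply: eq_cint => x _; rewrite big_cons.
Qed.

Lemma cintN a b f : continuous f -> cint a b (fun x => - f x) = - cint a b f.
Proof.
move=> cf; rewrite -mulN1r -cintZ//.
by apply: eq_cint => x _; rewrite mulN1r.
Qed.

Definition l2 f := Num.sqrt (I01i (fun z => f z ^+ 2)).

Lemma I_sq_ge0 f : 0 <= I01i (fun z => f z ^+ 2).
Proof. by apply: cint_ge0 => x; rewrite sqr_ge0. Qed.

Lemma l2_ge0 f : 0 <= l2 f. Proof. exact: sqrtr_ge0. Qed.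

Lemma l2_sq f : l2 f ^+ 2 = I01i (fun z => f z ^+ 2).
Proof. by rewrite sqr_sqrtr// I_sq_ge0. Qed.

Lemma I_CS f g : continuous f -> continuous g ->
  `|I01i (fun z => f z * g z)| <= l2 f * l2 g.
Proof.
move=> cf cg.
set A := I01i (fun z => f z ^+ 2); set B := I01i (fun z => g z ^+ 2).
set C := I01i _.
have Q (t s : R) : 0 <= t ^+ 2 * A + 2 * t * s * C + s ^+ 2 * B.
  have <- : I01i (fun z => (t * f z + s * g z) ^+ 2) = t ^+ 2 * A + 2 * t * s * C + s ^+ 2 * B.
    rewrite -!cintZ; try by cont.
    rewrite -!cintD; try by cont.
    by apply: eq_cint => x _; ring.
  by apply: cint_ge0 => x; rewrite sqr_ge0.
have A0 : 0 <= A by exact: I_sq_ge0.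
have B0 : 0 <= B by exact: I_sq_ge0.
rewrite -(ler_pXn2r (_ : (0 < 2)%N))// ?nnegrE ?mulr_ge0 ?l2_ge0//.
rewrite exprMn !l2_sq -/A -/B real_normK ?num_real//.
(* If [A = 0], the nonnegative form takes the value [- (B + 2) C^2] at [(B + 1, - C)], which forces
   [C = 0]. Otherwise its value at [(- C, A)] is [A (A B - C^2)]. *)
have [A00|Ane] := eqVneq A 0.
  have h1 := Q (B + 1) (- C); have h2 := Q (- (B+1)) (- C).
  have h3 := Q ((B + 1)) (- C).
  rewrite A00 in h1 *.
  nra.
have := Q (- C) A => h.
have Ap : 0 < A by rewrite lt_def Ane.
have : 0 <= A * (A * B - C ^+ 2) by move: h; rewrite le_eqVlt => /orP[|]; nra.
by rewrite pmulr_rge0// subr_ge0.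
Qed.

Lemma I_CS3 f g h n : continuous f -> continuous g -> continuous h ->
  (forall z, 0 <= z <= 1 -> `|h z| <= n) ->
  `|I01i (fun z => f z * g z * h z)| <= n * l2 f * l2 g.
Proof.
move=> cf cg ch hn.
have n0 : 0 <= n.
  have : 0 <= (0 : R) <= 1 by lra.
  by move=> /hn; apply: le_trans.
have -> : I01i (fun z => f z * g z * h z) = I01i (fun z => (f z * h z) * g z).
  by apply: eq_cint => x _; ring.
apply: le_trans (I_CS _ _) _; try by cont.
apply: ler_wpM2r; first exact: l2_ge0.
rewrite -(ler_pXn2r (_ : (0 < 2)%N))// ?nnegrE ?mulr_ge0 ?l2_ge0//.
rewrite exprMn !l2_sq -cintZ; try by cont.
apply: le_cint; try by cont.
move=> x hx; rewrite exprMn mulrC ler_wpM2r ?sqr_ge0//.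
by rewrite -[leLHS]real_normK ?num_real// ler_pXn2r ?nnegrE// hn.
Qed.

(** [f^2] oscillates by at most [2 int |f g|], and averaging over the base point [y] replaces the
    unknown value [f y ^+ 2] by the squared [L^2] norm. Endpoint values do not enter, so sine and
    cosine polynomials are served alike. *)
Lemma sup_sq_le f g z : (forall x : R, is_derive x 1 f (g x)) -> continuous g ->
  0 <= z <= 1 -> f z ^+ 2 <= l2 f ^+ 2 + 2 * l2 f * l2 g.
Proof.
move=> df cg /andP[z0 z1].
have cf : continuous f by move=> x; exact: is_derive_cont (df x).
pose k := fun z => 2 * (`|f z| * `|g z|).
have ck : continuous k by rewrite /k; cont.
have k0 x : 0 <= k x by rewrite /k !mulr_ge0.
have kle : prim k 1 <= 2 * l2 f * l2 g.
  rewrite primE// /k cintZ; last by cont.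
  rewrite -mulrA ler_wpM2l//.
  have <- : l2 (fun z => `|f z|) = l2 f.
    by rewrite /l2; congr Num.sqrt; apply: eq_cint => x _; rewrite real_normK ?num_real.
  have <- : l2 (fun z => `|g z|) = l2 g.
    by rewrite /l2; congr Num.sqrt; apply: eq_cint => x _; rewrite real_normK ?num_real.
  by apply: le_trans (I_CS _ _); [exact: ler_norm|cont|cont].
(* The sign [(-1) ^+ s] treats increase and decrease of [f^2] together, for base points on either
   side of [z]. *)
have osc x y (s : bool) : 0 <= x -> x <= y -> y <= 1 ->
    (-1) ^+ s * f y ^+ 2 - (-1) ^+ s * f x ^+ 2 <= 2 * l2 f * l2 g.
  move=> x0 xy y1.
  apply: le_trans kle.
  have : (-1) ^+ s * (f y * f y) - (-1) ^+ s * (f x * f x) <= prim k y - prim k x.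
    apply: (@le_of_derive_le _ (fun x => (-1) ^+ s * (f x * f x)) (prim k) (fun x => (-1) ^+ s * (2 * f x * g x)) k x y xy).
    - move=> t ht; apply: is_derive_eq.
      by rewrite /GRing.scale/=; ring.
    - by move=> t /andP[ht _]; apply: is_derive_prim => //; lra.
    - have cc : continuous (fun x => (-1) ^+ s * (f x * f x)) by cont.
      by move=> t _; exact: cc.
    - by move=> t /andP[ht _]; apply: prim_cont => //; lra.
    - move=> t _; apply: le_trans (ler_norm _) _.
      by rewrite normrM normrX normrN1 expr1n mul1r !normrM ger0_norm// /k mulrA.
  have := prim_ge0 x0 ck k0.
  have := le_prim_t (le_trans x0 xy) y1 ck k0.
  by rewrite !expr2; lra.
have pt y : 0 <= y <= 1 -> f z ^+ 2 <= f y ^+ 2 + 2 * l2 f * l2 g.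
  move=> /andP[y0 y1]; have [zy|yz] := leP z y.
    by have := osc z y true z0 zy y1; rewrite expr1; lra.
  by have := osc y z false y0 (ltW yz) z1; rewrite expr0; lra.
have : I01i (fun=> f z ^+ 2) <= I01i (fun y => f y ^+ 2 + 2 * l2 f * l2 g).
  by apply: le_cint => //; cont.
rewrite cint_cst// cintD; [|by cont|by cont].
by rewrite cint_cst// l2_sq subr0 !mulr1.
Qed.

Lemma ip_I f g : continuous f -> continuous g -> ip f g = I01i (fun z => f z * g z).
Proof.
move=> cf cg; rewrite /ip /I01 cint.unlock.
have c : continuous (fun z => f z * g z) by cont.
have := cont_integrable 0 1 c => i.
have i2 : lebesgue_measure.-integrable `]0, 1] (EFin \o (fun z => f z * g z)).
  by apply: integrableS i => //; move=> x /=; rewrite !in_itv/= => /andP[/ltW-> ->].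
have i1 : lebesgue_measure.-integrable `]0, 1[ (EFin \o (fun z => f z * g z)).
  by apply: integrableS i => //; move=> x /=; rewrite !in_itv/= => /andP[/ltW-> /ltW->].
by rewrite Rintegral_itv_bndo_bndc// Rintegral_itv_obnd_cbnd.
Qed.

End unit_interval.

(** * Trigonometric polynomials and the Burgers form *)

HB.lock Definition dot {R : realType} {M : nat} (a b : 'rV[R]_M) : R :=
  \sum_(i < M) a ord0 i * b ord0 i.
HB.lock Definition nrm {R : realType} {M : nat} (a : 'rV[R]_M) : R := Num.sqrt (dot a a).
(** The Fourier multiplier with symbol [w]. Powers of [- A] and the heat semigroup are all of this
    form, hence symmetric and commuting. *)
HB.lock Definition dgm {R : realType} {M : nat} (w : nat -> R) (a : 'rV[R]_M) : 'rV[R]_M :=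
  \row_i (w i * a ord0 i).

Section vectors.
Context {R : realType} {M : nat}.
Implicit Types (a b c : 'rV[R]_M) (w v : nat -> R).

Lemma dotE a b : dot a b = \sum_(i < M) a ord0 i * b ord0 i.
Proof. by rewrite dot.unlock. Qed.
Lemma nrmE a : nrm a = Num.sqrt (dot a a).
Proof. by rewrite nrm.unlock. Qed.
Lemma dgmE w a i : dgm w a ord0 i = w i * a ord0 i.
Proof. by rewrite dgm.unlock mxE. Qed.

Lemma dotC a b : dot a b = dot b a.
Proof. by rewrite !dotE; apply: eq_bigr => i _; rewrite mulrC. Qed.
Lemma dotDl a b c : dot (a + b) c = dot a c + dot b c.
Proof. by rewrite !dotE -big_split/=; apply: eq_bigr => i _; rewrite mxE mulrDl. Qed.
Lemma dotDr a b c : dot c (a + b) = dot c a + dot c b.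
Proof. by rewrite dotC dotDl !(dotC c). Qed.
Lemma dotZl k a b : dot (k *: a) b = k * dot a b.
Proof. by rewrite !dotE mulr_sumr; apply: eq_bigr => i _; rewrite mxE mulrA. Qed.
Lemma dotZr k a b : dot a (k *: b) = k * dot a b.
Proof. by rewrite dotC dotZl dotC. Qed.
Lemma dotNl a b : dot (- a) b = - dot a b.
Proof. by rewrite -scaleN1r dotZl mulN1r. Qed.
Lemma dotNr a b : dot a (- b) = - dot a b.
Proof. by rewrite dotC dotNl dotC. Qed.
Lemma dotBl a b c : dot (a - b) c = dot a c - dot b c.
Proof. by rewrite dotDl dotNl. Qed.
Lemma dotBr a b c : dot c (a - b) = dot c a - dot c b.
Proof. by rewrite dotDr dotNr. Qed.
Lemma dot0l a : dot 0 a = 0. Proof. by rewrite -(scale0r (0 : 'rV[R]_M)) dotZl mul0r. Qed.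
Lemma dot0r a : dot a 0 = 0. Proof. by rewrite dotC dot0l. Qed.
Lemma dot_ge0 a : 0 <= dot a a.
Proof. by rewrite dotE; apply: sumr_ge0 => i _; rewrite -expr2 sqr_ge0. Qed.
Lemma nrm_ge0 a : 0 <= nrm a. Proof. by rewrite nrmE sqrtr_ge0. Qed.
Lemma nrm_sq a : nrm a ^+ 2 = dot a a. Proof. by rewrite nrmE sqr_sqrtr// dot_ge0. Qed.
Lemma coord_sq_le a i : a ord0 i ^+ 2 <= dot a a.
Proof.
rewrite dotE (bigD1 i)//= -expr2 lerDl; apply: sumr_ge0 => j _.
by rewrite -expr2 sqr_ge0.
Qed.
Lemma coord_le a i : `|a ord0 i| <= nrm a.
Proof. by rewrite nrmE -sqrtr_sqr ler_wsqrtr// coord_sq_le. Qed.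
Lemma nrm_eq0 a : nrm a = 0 -> a = 0.
Proof.
move=> a0; apply/rowP => i; rewrite mxE; apply/eqP; rewrite -normr_le0.
by rewrite -a0 coord_le.
Qed.
Lemma nrm0 : nrm (0 : 'rV[R]_M) = 0. Proof. by rewrite !nrmE dot0l sqrtr0. Qed.
Lemma nrmZ k a : nrm (k *: a) = `|k| * nrm a.
Proof.
by rewrite !nrmE dotZl dotZr mulrA -expr2 sqrtrM ?sqr_ge0// sqrtr_sqr.
Qed.
Lemma nrmN a : nrm (- a) = nrm a.
Proof. by rewrite !nrmE dotNl dotNr opprK. Qed.
Lemma le_of_sq (x y : R) : 0 <= y -> x ^+ 2 <= y ^+ 2 -> x <= y.
Proof.
move=> y0 h; apply: le_trans (ler_norm _) _.
by rewrite -(ler_pXn2r (_ : (0 < 2)%N))// ?nnegrE// real_normK ?num_real.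
Qed.
Lemma dot_CS a b : `|dot a b| <= nrm a * nrm b.
Proof.
have [/eqP a0|a0] := eqVneq (nrm a) 0.
  by rewrite (nrm_eq0 (eqP a0)) dot0l normr0 mulr_ge0 ?nrm_ge0.
have [/eqP b0|b0] := eqVneq (nrm b) 0.
  by rewrite (nrm_eq0 (eqP b0)) dot0r normr0 mulr_ge0 ?nrm_ge0.
have ap : 0 < nrm a by rewrite lt_def a0 nrm_ge0.
have bp : 0 < nrm b by rewrite lt_def b0 nrm_ge0.
have ab := mulr_gt0 ap bp.
have := dot_ge0 (nrm b *: a - nrm a *: b).
have := dot_ge0 (nrm b *: a + nrm a *: b).
rewrite dotBl !dotBr dotDl !dotDr !dotZl !dotZr (dotC b a) -!nrm_sq => h1 h2.
rewrite ler_norml; apply/andP; split.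
  by rewrite -(ler_pM2l ab); nra.
by rewrite -(ler_pM2l ab); nra.
Qed.
Lemma dot_CS1 a b : dot a b <= nrm a * nrm b.
Proof. exact: le_trans (ler_norm _) (dot_CS _ _). Qed.
Lemma nrmD a b : nrm (a + b) <= nrm a + nrm b.
Proof.
apply: le_of_sq; first by rewrite addr_ge0 ?nrm_ge0.
rewrite nrm_sq dotDl !dotDr (dotC b a) -!nrm_sq sqrrD.
have := dot_CS1 a b; rewrite mulr2n; lra.
Qed.
Lemma nrmB a b : nrm (a - b) <= nrm a + nrm b.
Proof. by rewrite -(nrmN b); exact: nrmD. Qed.
Lemma nrm_sum (I : Type) (r : seq I) (F : I -> 'rV[R]_M) :
  nrm (\sum_(i <- r) F i) <= \sum_(i <- r) nrm (F i).
Proof.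
elim: r => [|i r IH]; first by rewrite !big_nil nrm0.
by rewrite !big_cons; apply: le_trans (nrmD _ _) _; rewrite lerD2l.
Qed.
Lemma dot_dgm w a b : dot (dgm w a) b = dot a (dgm w b).
Proof. by rewrite !dotE; apply: eq_bigr => i _; rewrite !dgmE mulrCA mulrA. Qed.
Lemma dgm_dgm w v a : dgm w (dgm v a) = dgm (fun i => w i * v i) a.
Proof. by apply/rowP => i; rewrite !(dgmE, mxE) mulrA. Qed.
Lemma dgmD w a b : dgm w (a + b) = dgm w a + dgm w b.
Proof. by apply/rowP => i; rewrite !(dgmE, mxE) mulrDr. Qed.
Lemma dgmZ w k a : dgm w (k *: a) = k *: dgm w a.
Proof. by apply/rowP => i; rewrite !(dgmE, mxE) mulrCA. Qed.
Lemma dgmN w a : dgm w (- a) = - dgm w a.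
Proof. by apply/rowP => i; rewrite !(dgmE, mxE) mulrN. Qed.
Lemma dgmB w a b : dgm w (a - b) = dgm w a - dgm w b.
Proof. by rewrite dgmD dgmN. Qed.
Lemma dgm1 w a : (forall i, w i = 1) -> dgm w a = a.
Proof. by move=> w1; apply/rowP => i; rewrite !(dgmE, mxE) w1 mul1r. Qed.
Lemma eq_dgm w v a : (forall i, w i = v i) -> dgm w a = dgm v a.
Proof. by move=> wv; apply/rowP => i; rewrite !(dgmE, mxE) wv. Qed.
Lemma nrm_dgm_le w v a : (forall i : 'I_M, `|w i| <= v i) -> nrm (dgm w a) <= nrm (dgm v a).
Proof.
move=> wv; rewrite !nrmE; apply: ler_wsqrtr; rewrite !dotE; apply: ler_sum => i _; rewrite !(dgmE, mxE) -!expr2 !exprMn.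
rewrite ler_wpM2r ?sqr_ge0// -[leLHS]real_normK ?num_real//.
by rewrite ler_pXn2r ?nnegrE//; exact: le_trans (wv i).
Qed.
Lemma nrm_dgm_leZ w v (k : R) a : 0 <= k -> (forall i : 'I_M, `|w i| <= k * v i) ->
  nrm (dgm w a) <= k * nrm (dgm v a).
Proof.
move=> k0 wv; rewrite -[X in _ <= X * _](ger0_norm k0) -nrmZ.
have -> : k *: dgm v a = dgm (fun i => k * v i) a.
  by apply/rowP => i; rewrite !(dgmE, mxE) mulrA.
exact: nrm_dgm_le.
Qed.
End vectors.

Definition cosm {R : realType} (i : nat) : R -> R := fun z => Num.sqrt 2 * cos (i.+1%:R * pi * z).

(* [Sf c] and [Cf c] are the sine and cosine polynomials of [c], so [(Sf c)' = Cf (Lam c)] with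
   [Lam = (- A)^(1/2)], [Lai = (- A)^(-1/2)]; [Bq] is the polarised [B_M]. *)
HB.lock Definition Sf {R : realType} {M : nat} (c : 'rV[R]_M) : R -> R := embM c.

HB.lock Definition Cf {R : realType} {M : nat} (c : 'rV[R]_M) : R -> R :=
  fun z => \sum_(i < M) c ord0 i * cosm i z.

HB.lock Definition Bq {R : realType} {M : nat} (a b : 'rV[R]_M) : 'rV[R]_M :=
  coordPM M (Bform (Sf a) (Sf b)).

Lemma SfE {R : realType} {M : nat} (c : 'rV[R]_M) (z : R) :
  Sf c z = \sum_(i < M) c ord0 i * hk i.+1 z.
Proof. by rewrite Sf.unlock. Qed.
Lemma CfE {R : realType} {M : nat} (c : 'rV[R]_M) (z : R) :
  Cf c z = \sum_(i < M) c ord0 i * cosm i z.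
Proof. by rewrite Cf.unlock. Qed.

Section sine_polynomials.
Context {R : realType} {M : nat}.
Implicit Types (a b c d v w s : 'rV[R]_M).
Local Notation I01i := (@cint R 0 1).

Definition kp (i : nat) : R := pi * i.+1%:R.
Definition Lam c := dgm kp c.
Definition Lai c := dgm (fun i => (kp i)^-1) c.

(* Abstracting the values first keeps [ring] from unfolding the trigonometric sums. *)
Ltac gring := cbv beta; repeat match goal with
  | |- context [Sf ?c ?z] => generalize (Sf c z) => ?
  | |- context [Cf ?c ?z] => generalize (Cf c z) => ?
  | |- context [hk ?c ?z] => generalize (hk c z) => ?
  | |- context [cosm ?c ?z] => generalize (cosm c z) => ?
  end; ring.

Lemma kp_ge1 i : 1 <= kp i.
Proof.
rewrite /kp; have := @pi_ge2 R; have : 1 <= i.+1%:R :> R by rewrite ler1n.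
nra.
Qed.
Lemma kp_gt0 i : 0 < kp i. Proof. by apply: lt_le_trans (kp_ge1 i). Qed.

Lemma is_derive_hk i (z : R) : is_derive z 1 (hk i.+1) (kp i * cosm i z).
Proof.
rewrite /hk /kp /cosm; apply: is_derive_eq.
rewrite /GRing.scale/= mulr1; ring.
Qed.
Lemma is_derive_cosm i (z : R) : is_derive z 1 (cosm i) (- (kp i * hk i.+1 z)).
Proof.
rewrite /hk /kp /cosm; apply: is_derive_eq.
rewrite /GRing.scale/= mulr1; ring.
Qed.
Lemma cont_hk i : continuous (hk (R:=R) i.+1).
Proof. by move=> x; exact: is_derive_cont (is_derive_hk i x). Qed.
Lemma cont_cosm i : continuous (cosm (R:=R) i).
Proof. by move=> x; exact: is_derive_cont (is_derive_cosm i x). Qed.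
Hint Resolve cont_hk cont_cosm : contdb.

Lemma is_derive_Sf c (z : R) : is_derive z 1 (Sf c) (Cf (Lam c) z).
Proof.
rewrite Sf.unlock; have := dsum (fun i : 'I_M => dZ (c ord0 i) (is_derive_hk i z)).
congr is_derive; rewrite CfE; apply: eq_bigr => i _; rewrite dgmE; ring.
Qed.
Lemma is_derive_Cf c (z : R) : is_derive z 1 (Cf c) (- Sf (Lam c) z).
Proof.
rewrite Cf.unlock; have := dsum (fun i : 'I_M => dZ (c ord0 i) (is_derive_cosm i z)).
congr is_derive; rewrite SfE -sumrN; apply: eq_bigr => i _; rewrite dgmE; ring.
Qed.
Lemma cont_Sf c : continuous (Sf c).
Proof. by move=> x; exact: is_derive_cont (is_derive_Sf c x). Qed.
Arguments cont_Sf : clear implicits.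
Lemma cont_Cf c : continuous (Cf c).
Proof. by move=> x; exact: is_derive_cont (is_derive_Cf c x). Qed.
Arguments cont_Cf : clear implicits.
Hint Resolve cont_Sf cont_Cf : contdb.

Lemma sin_npi (n : nat) : sin (n%:R * pi) = 0 :> R.
Proof.
elim: n => [|n IH]; first by rewrite mul0r sin0.
by rewrite -natr1 mulrDl mul1r sinDpi IH oppr0.
Qed.
Lemma hk_0 i : hk (R:=R) i.+1 0 = 0. Proof. by rewrite /hk mulr0 sin0 mulr0. Qed.
Lemma hk_1 i : hk (R:=R) i.+1 1 = 0. Proof. by rewrite /hk mulr1 sin_npi mulr0. Qed.
Lemma Sf_0 c : Sf c 0 = 0.
Proof. by rewrite SfE big1// => i _; rewrite hk_0 mulr0. Qed.
Lemma Sf_1 c : Sf c 1 = 0.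
Proof. by rewrite SfE big1// => i _; rewrite hk_1 mulr0. Qed.

Lemma FTC01 (F f : R -> R) : (forall z : R, is_derive z 1 F (f z)) -> continuous f ->
  F 0 = F 1 -> I01i f = 0.
Proof. by move=> dF cf E; rewrite (cint_FTC ltr01 cf dF) E subrr. Qed.

Lemma kp_inj (i j : nat) : i != j -> kp i ^+ 2 - kp j ^+ 2 != 0.
Proof.
move=> ij; rewrite /kp !exprMn -mulrBr mulf_neq0//.
  by rewrite expf_neq0// gt_eqF// pi_gt0.
by rewrite subr_eq0 eqrXn2// eqr_nat eqSS.
Qed.

(** The integrals add up to 2 because [sin^2 + cos^2 = 1]. They coincide because [kp i] times their
    difference is the integral of the derivative of [hk i.+1 * cosm i], which vanishes at both
    ends. *)
Lemma ortho_sin_cos (i : nat) :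
  I01i (fun z => hk i.+1 z ^+ 2) = 1 /\ I01i (fun z => cosm i z ^+ 2) = 1.
Proof.
have h1 : I01i (fun z => hk i.+1 z ^+ 2) + I01i (fun z => cosm i z ^+ 2) = 2.
  rewrite -cintD; [|by cont|by cont].
  rewrite (@eq_cint _ _ _ _ (fun=> 2)) ?cint_cst// ?subr0 ?mulr1//.
  move=> z _; rewrite /hk /cosm !exprMn sqr_sqrtr// -mulrDr addrC cos2Dsin2 mulr1//.
have h2 : kp i * I01i (fun z => cosm i z ^+ 2) - kp i * I01i (fun z => hk i.+1 z ^+ 2) = 0.
  rewrite -mulrBr -cintN; last by cont.
  rewrite -cintD; [|by cont|by cont]; rewrite -cintZ; last by cont.
  apply: (@FTC01 (fun z => hk i.+1 z * cosm i z)).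
  - move=> z; apply: (is_derive_eq (dM (is_derive_hk i z) (is_derive_cosm i z))).
    gring.
  - cont.
  - by rewrite hk_0 hk_1 !mul0r.
have k0 := kp_gt0 i.
have : I01i (fun z => cosm i z ^+ 2) = I01i (fun z => hk i.+1 z ^+ 2).
  by apply: (mulfI (lt0r_neq0 k0)); lra.
by move=> E; split; lra.
Qed.

(** Sturm-Liouville: [(kp i^2 - kp j^2) h_i h_j] is the derivative of the Wronskian of the two
    modes, which vanishes at 0 and 1. *)
Lemma ortho_hk (i j : nat) : I01i (fun z => hk i.+1 z * hk j.+1 z) = (i == j)%:R.
Proof.
case: eqVneq => [->|ij]; first by rewrite -[RHS]/1 -[RHS](ortho_sin_cos j).1; apply: eq_cint => z _; rewrite expr2.
apply: (mulfI (kp_inj ij)); rewrite mulr0 -cintZ; last by cont.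
apply: (@FTC01 (fun z => kp j * (hk i.+1 z * cosm j z) - kp i * (cosm i z * hk j.+1 z))).
- move=> z; apply: (is_derive_eq (dB (dZ _ (dM (is_derive_hk i z) (is_derive_cosm j z))) (dZ _ (dM (is_derive_cosm i z) (is_derive_hk j z))))).
  gring.
- cont.
- by rewrite !hk_0 !hk_1 !(mul0r, mulr0).
Qed.

Lemma ortho_cosm (i j : nat) : I01i (fun z => cosm i z * cosm j z) = (i == j)%:R.
Proof.
case: eqVneq => [->|ij]; first by rewrite -[RHS]/1 -[RHS](ortho_sin_cos j).2; apply: eq_cint => z _; rewrite expr2.
apply: (mulfI (kp_inj ij)); rewrite mulr0 -cintZ; last by cont.
apply: (@FTC01 (fun z => kp i * (hk i.+1 z * cosm j z) - kp j * (cosm i z * hk j.+1 z))).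
- move=> z; apply: (is_derive_eq (dB (dZ _ (dM (is_derive_hk i z) (is_derive_cosm j z))) (dZ _ (dM (is_derive_cosm i z) (is_derive_hk j z))))).
  gring.
- cont.
- by rewrite !hk_0 !hk_1 !(mul0r, mulr0).
Qed.

Lemma I_ortho (h : nat -> R -> R) a b : (forall i, continuous (h i)) ->
  (forall i j, I01i (fun z => h i z * h j z) = (i == j)%:R) ->
  I01i (fun z => (\sum_(i < M) a ord0 i * h i z) * (\sum_(i < M) b ord0 i * h i z)) = dot a b.
Proof.
move=> ch oh.
rewrite (@eq_cint _ _ _ _ (fun z => \sum_(i < M) \sum_(j < M) a ord0 i * b ord0 j * (h i z * h j z))); last first.
  move=> z _; rewrite mulr_suml; apply: eq_bigr => i _; rewrite mulr_sumr; apply: eq_bigr => j _; gring.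
rewrite dotE cint_sum; last first.
  by move=> i; apply: cont_sum => j; cont.
apply: eq_bigr => i _; rewrite cint_sum; last by move=> j; cont.
rewrite (bigD1 i)//= cintZ; last by cont.
rewrite oh eqxx mulr1 big1 ?addr0// => j ji.
rewrite cintZ; last by cont.
have ij : (nat_of_ord i == nat_of_ord j) = false by rewrite val_eqE eq_sym; exact: negbTE.
by rewrite oh ij mulr0.
Qed.

Lemma I_SS a b : I01i (fun z => Sf a z * Sf b z) = dot a b.
Proof. by rewrite -(I_ortho a b cont_hk ortho_hk); apply: eq_cint => z _; rewrite !SfE. Qed.
Lemma I_CC a b : I01i (fun z => Cf a z * Cf b z) = dot a b.
Proof. by rewrite -(I_ortho a b cont_cosm ortho_cosm); apply: eq_cint => z _; rewrite !CfE. Qed.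
Lemma l2_Sf a : l2 (Sf a) = nrm a.
Proof. by rewrite /l2 nrmE -I_SS; congr Num.sqrt; apply: eq_cint => z _; rewrite expr2. Qed.
Lemma l2_Cf a : l2 (Cf a) = nrm a.
Proof. by rewrite /l2 nrmE -I_CC; congr Num.sqrt; apply: eq_cint => z _; rewrite expr2. Qed.
Lemma l2_N (f : R -> R) : l2 (fun z => - f z) = l2 f.
Proof. by rewrite /l2; congr Num.sqrt; apply: eq_cint => z _; rewrite sqrrN. Qed.

Lemma nrm_Lam_ge a : nrm a <= nrm (Lam a).
Proof.
rewrite -{1}[a](@dgm1 _ _ (fun=> 1))//; apply: nrm_dgm_le => i.
by rewrite normr1 kp_ge1.
Qed.

Lemma dot_Lam a b : dot (Lam a) b = dot a (Lam b).
Proof. exact: dot_dgm. Qed.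
Lemma Lam_Lai a : Lam (Lai a) = a.
Proof. by rewrite /Lai /Lam dgm_dgm dgm1// => i; rewrite mulfV// gt_eqF// kp_gt0. Qed.

(** All frequencies are at least 1, so [|a| <= |Lam a|] and the two terms of [sup_sq_le] merge with
    the constant [1 + 2]. *)
Lemma sup_Sf a (z : R) : 0 <= z <= 1 -> Sf a z ^+ 2 <= 3 * nrm a * nrm (Lam a).
Proof.
move=> z01; have := sup_sq_le (is_derive_Sf a) (cont_Cf _) z01.
rewrite l2_Sf l2_Cf; have := nrm_Lam_ge a; have := nrm_ge0 a; nra.
Qed.
Lemma sup_Cf a (z : R) : 0 <= z <= 1 -> Cf a z ^+ 2 <= 3 * nrm a * nrm (Lam a).
Proof.
have cN : continuous (fun z => - Sf (Lam a) z) by cont.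
move=> z01; have := sup_sq_le (is_derive_Cf a) cN z01.
rewrite l2_N l2_Sf l2_Cf; have := nrm_Lam_ge a; have := nrm_ge0 a; nra.
Qed.

Lemma BformE a b (z : R) : Bform (Sf a) (Sf b) z = Sf a z * Cf (Lam b) z + Sf b z * Cf (Lam a) z.
Proof.
rewrite /Bform !derive1E.
by rewrite (@derive_val _ _ _ _ _ _ _ (is_derive_Sf a z)) (@derive_val _ _ _ _ _ _ _ (is_derive_Sf b z)).
Qed.

Lemma BqE a b i : Bq a b ord0 i =
  I01i (fun z => (Sf a z * Cf (Lam b) z + Sf b z * Cf (Lam a) z) * hk i.+1 z).
Proof.
rewrite Bq.unlock mxE; have -> : Bform (Sf a) (Sf b) = fun z => Sf a z * Cf (Lam b) z + Sf b z * Cf (Lam a) z.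
  by apply: funext => z; exact: BformE.
by rewrite ip_I//; cont.
Qed.

Lemma dot_Bq0 a b y : dot (Bq a b) y =
  I01i (fun z => (Sf a z * Cf (Lam b) z + Sf b z * Cf (Lam a) z) * Sf y z).
Proof.
rewrite dotE (@eq_cint _ _ _ _ (fun z => \sum_(i < M) y ord0 i * ((Sf a z * Cf (Lam b) z + Sf b z * Cf (Lam a) z) * hk i.+1 z))); last first.
  by move=> z _; rewrite [Sf y _]SfE mulr_sumr; apply: eq_bigr => i _; gring.
rewrite cint_sum; last by move=> i; cont.
apply: eq_bigr => i _; rewrite cintZ ?BqE 1?mulrC//; cont.
Qed.

(** [B] is the derivative of a product, here moved onto the test function; sine polynomials vanish
    at both ends. *)
Lemma dot_Bq a b y : dot (Bq a b) y = - I01i (fun z => Sf a z * Sf b z * Cf (Lam y) z).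
Proof.
rewrite dot_Bq0; apply/eqP; rewrite -addr_eq0 -cintD; [|by cont|by cont]; apply/eqP.
apply: (@FTC01 (fun z => Sf a z * Sf b z * Sf y z)).
- move=> z; apply: (is_derive_eq (dM (dM (is_derive_Sf a z) (is_derive_Sf b z)) (is_derive_Sf y z))).
  gring.
- cont.
- by rewrite !Sf_0 !Sf_1 !mulr0.
Qed.

Lemma BqC a b : Bq a b = Bq b a.
Proof. apply/rowP => i; rewrite !BqE; apply: eq_cint => z _.
by rewrite addrC. Qed.
Lemma SfD a b (z : R) : Sf (a + b) z = Sf a z + Sf b z.
Proof. by rewrite !SfE -big_split/=; apply: eq_bigr => i _; rewrite mxE mulrDl. Qed.
Lemma SfZ k a (z : R) : Sf (k *: a) z = k * Sf a z.
Proof. by rewrite !SfE mulr_sumr; apply: eq_bigr => i _; rewrite mxE mulrA. Qed.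
Lemma CfD a b (z : R) : Cf (a + b) z = Cf a z + Cf b z.
Proof. by rewrite !CfE -big_split/=; apply: eq_bigr => i _; rewrite mxE mulrDl. Qed.
Lemma CfZ k a (z : R) : Cf (k *: a) z = k * Cf a z.
Proof. by rewrite !CfE mulr_sumr; apply: eq_bigr => i _; rewrite mxE mulrA. Qed.
Lemma BqDl a b c : Bq (a + b) c = Bq a c + Bq b c.
Proof.
apply/rowP => i; rewrite [RHS]mxE !BqE -cintD; [|by cont|by cont].
by apply: eq_cint => z _; rewrite /Lam dgmD SfD CfD; gring.
Qed.
Lemma BqDr a b c : Bq c (a + b) = Bq c a + Bq c b.
Proof. by rewrite BqC BqDl !(BqC c). Qed.
Lemma BqZl k a b : Bq (k *: a) b = k *: Bq a b.
Proof.
apply/rowP => i; rewrite [RHS]mxE !BqE -cintZ; [|by cont].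
by apply: eq_cint => z _; rewrite /Lam dgmZ SfZ CfZ; gring.
Qed.
Lemma BqZr k a b : Bq a (k *: b) = k *: Bq a b.
Proof. by rewrite BqC BqZl BqC. Qed.
Lemma BqNl a b : Bq (- a) b = - Bq a b.
Proof. by rewrite -scaleN1r BqZl scaleN1r. Qed.
Lemma BqNr a b : Bq a (- b) = - Bq a b.
Proof. by rewrite BqC BqNl BqC. Qed.
Lemma BqBl a b c : Bq (a - b) c = Bq a c - Bq b c. Proof. by rewrite BqDl BqNl. Qed.
Lemma BqBr a b c : Bq c (a - b) = Bq c a - Bq c b. Proof. by rewrite BqDr BqNr. Qed.

Lemma coord_embM c (i : 'I_M) : ip (embM c) (hk i.+1) = c ord0 i.
Proof.
have cE : continuous (embM c) by have := cont_Sf c; rewrite Sf.unlock.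
rewrite ip_I; [|exact: cE|exact: cont_hk].
pose dl : 'rV[R]_M := \row_j (j == i)%:R.
have -> : c ord0 i = dot c dl.
  rewrite dotE (bigD1 i)//= mxE eqxx mulr1 big1 ?addr0// => j ji.
  by rewrite mxE (negbTE ji) mulr0.
rewrite -I_SS Sf.unlock; apply: eq_cint => z _; congr (_ * _).
rewrite /embM (bigD1 i)//= mxE eqxx mul1r big1 ?addr0// => j ji.
by rewrite mxE (negbTE ji) mul0r.
Qed.

Lemma driftE c : drift c = - dgm (fun i => kp i ^+ 2) c + Bq c c.
Proof.
apply/rowP => i; rewrite /drift mxE [RHS]mxE; congr (_ + _); last by rewrite Bq.unlock Sf.unlock.
by rewrite !(dgmE, mxE) mulNr coord_embM.
Qed.

Lemma l2norm_Sf c : l2norm (embM c) = nrm c.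
Proof. by have := cont_Sf c; rewrite /l2norm Sf.unlock => cS; rewrite ip_I// nrmE -I_SS Sf.unlock. Qed.

(* [s <d', d> ... = 1/2 <s', d^2>]: the transport term only costs [|s'|], to a subquadratic power. *)
Lemma tri_S s d : 2 * dot (Bq s d) d = I01i (fun z => Cf (Lam s) z * Sf d z * Sf d z).
Proof.
rewrite dot_Bq.
have : I01i (fun z => Cf (Lam s) z * Sf d z * Sf d z + 2 * (Sf s z * Sf d z * Cf (Lam d) z)) = 0.
  apply: (@FTC01 (fun z => Sf s z * Sf d z * Sf d z)).
  - move=> z; apply: (is_derive_eq (dM (dM (is_derive_Sf s z) (is_derive_Sf d z)) (is_derive_Sf d z))).
    gring.
  - cont.
  - by rewrite !Sf_0 !Sf_1 !mulr0.
rewrite cintD; [|by cont|by cont]; rewrite cintZ; last by cont.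
lra.
Qed.

(** The [H^-1] counterpart of [tri_S]: for [d = Lam e], pairing with [Lam^-2 d = Lai e] makes the
    sine polynomial of [d] the derivative, up to sign, of the cosine polynomial of [e], and
    integration by parts again leaves only [s']. Cosines do not vanish at the ends, but [s] does. *)
Lemma tri_C s e : 2 * dot (Bq s (Lam e)) (Lai e) = - I01i (fun z => Cf (Lam s) z * Cf e z * Cf e z).
Proof.
rewrite dot_Bq Lam_Lai.
have : I01i (fun z => Cf (Lam s) z * Cf e z * Cf e z + (- 2) * (Sf s z * Sf (Lam e) z * Cf e z)) = 0.
  apply: (@FTC01 (fun z => Sf s z * Cf e z * Cf e z)).
  - move=> z; apply: (is_derive_eq (dM (dM (is_derive_Sf s z) (is_derive_Cf e z)) (is_derive_Cf e z))).
    gring.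
  - cont.
  - by rewrite !Sf_0 !Sf_1 !mul0r.
rewrite cintD; [|by cont|by cont]; rewrite cintZ; last by cont.
lra.
Qed.

(** Pairing with [Lam^2 v] is the [H^1] energy of [v]. The part of [x x'] containing [v'] is again a
    transport term costing one derivative of [x]; the part containing [w'] is kept as it stands, to
    be paid for by the dissipation of [v]. *)
Lemma tri_V x v w : x = v + w ->
  dot (Bq x x) (Lam (Lam v)) = I01i (fun z => Cf (Lam x) z * Cf (Lam v) z * Cf (Lam v) z)
    + 2 * I01i (fun z => Cf (Lam w) z * Sf (Lam (Lam v)) z * Sf x z).
Proof.
move=> xE; rewrite dot_Bq0.
have : I01i (fun z => Cf (Lam x) z * Cf (Lam v) z * Cf (Lam v) z + (- 2) * (Sf x z * Sf (Lam (Lam v)) z * Cf (Lam v) z)) = 0.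
  apply: (@FTC01 (fun z => Sf x z * Cf (Lam v) z * Cf (Lam v) z)).
  - move=> z; apply: (is_derive_eq (dM (dM (is_derive_Sf x z) (is_derive_Cf (Lam v) z)) (is_derive_Cf (Lam v) z))).
    gring.
  - cont.
  - by rewrite !Sf_0 !Sf_1 !mul0r.
rewrite cintD; [|by cont|by cont]; rewrite cintZ; last by cont.
have -> : I01i (fun z => (Sf x z * Cf (Lam x) z + Sf x z * Cf (Lam x) z) * Sf (Lam (Lam v)) z) =
  2 * I01i (fun z => Sf x z * Sf (Lam (Lam v)) z * Cf (Lam v) z) + 2 * I01i (fun z => Cf (Lam w) z * Sf (Lam (Lam v)) z * Sf x z).
  rewrite -!cintZ; [|by cont|by cont]; rewrite -cintD; [|by cont|by cont].
  have -> : Lam x = Lam v + Lam w by rewrite xE /Lam dgmD.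
  by apply: eq_cint => z _; rewrite CfD; gring.
lra.
Qed.

Lemma Bq_self0 v : dot (Bq v v) v = 0.
Proof.
have := tri_S v v; rewrite dot_Bq.
rewrite (@eq_cint _ _ _ (fun z => Cf (Lam v) z * Sf v z * Sf v z) (fun z => Sf v z * Sf v z * Cf (Lam v) z)); last by move=> z _; gring.
lra.
Qed.

(** Young twice: [2 u a k <= e u^2 a^2 + k^2 / e], then [k^2 / e = 3 a b / e <= b^2 + (9/4) a^2 /
    e^2]. The factor [k], a supremum norm, interpolates between [a] and [b]; so the cost in [u] is
    subquadratic and the coefficient [e] of [u^2] may be as small as desired. *)
Lemma absorb (u a b k e : R) : 0 <= u -> 0 <= a -> 0 <= b -> 0 < e -> 0 <= k -> k ^+ 2 = 3 * a * b ->
  2 * (u * a * k) <= b ^+ 2 + (e * u ^+ 2 + 3 / e ^+ 2) * a ^+ 2.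
Proof.
move=> u0 a0 b0 e0 k0 kE.
have h1 : 2 * (u * a * k) <= e * (u * a) ^+ 2 + e^-1 * k ^+ 2.
  have := sqr_ge0 (e * (u * a) - k); rewrite sqrrB => h.
  by rewrite -(ler_pM2l e0) mulrDr mulVKf ?gt_eqF//; rewrite mulr2n in h; nra.
have : e^-1 * (3 * a * b) <= b ^+ 2 + 3 / e ^+ 2 * a ^+ 2.
  have := sqr_ge0 (3 / 2 * (e^-1 * a) - b); rewrite sqrrB -exprVn => h2.
  have : 0 <= (e^-1 * a) ^+ 2 by exact: sqr_ge0.
  rewrite exprMn; nra.
rewrite -kE; rewrite exprMn in h1; nra.
Qed.

(** The common part of the three transport estimates below: [f] is a sine or cosine polynomial, [a]
    its [L^2] norm and [b] that of its derivative. *)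
Lemma tri_bound s d e (f g : R -> R) (a b : R) : 0 < e -> 0 <= a -> 0 <= b -> continuous f ->
  l2 f = a -> (forall z, 0 <= z <= 1 -> f z ^+ 2 <= 3 * a * b) ->
  2 * `|I01i (fun z => Cf (Lam s) z * f z * f z)| <= b ^+ 2 + (e * nrm (Lam s) ^+ 2 + 3 / e ^+ 2) * a ^+ 2.
Proof.
move=> e0 a0 b0 cf fa fs.
have k2 : 0 <= 3 * a * b by rewrite !mulr_ge0.
apply: le_trans (absorb (nrm_ge0 _) a0 b0 e0 (sqrtr_ge0 (3 * a * b)) (sqr_sqrtr k2)).
rewrite ler_wpM2l//.
apply: le_trans (@I_CS3 _ _ _ f (Num.sqrt (3 * a * b)) _ _ _ _) _; try by cont.
  by move=> z hz; rewrite -sqrtr_sqr ler_wsqrtr// fs.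
by rewrite l2_Cf fa -mulrA mulrC.
Qed.

Lemma est_S1 s d (e : R) : 0 < e ->
  2 * dot (Bq s d) d <= nrm (Lam d) ^+ 2 + (e * nrm (Lam s) ^+ 2 + 3 / e ^+ 2) * nrm d ^+ 2.
Proof.
move=> e0; rewrite tri_S.
have := @tri_bound s d e (Sf d) (Sf d) (nrm d) (nrm (Lam d)) e0 (nrm_ge0 _) (nrm_ge0 _) (cont_Sf _) (l2_Sf _) (sup_Sf d).
set J := I01i _; have := ler_norm J; have := normr_ge0 J; lra.
Qed.

Lemma est_S2 s d (e : R) : 0 < e ->
  2 * dot (Bq s d) (Lai (Lai d)) <= nrm d ^+ 2 + (e * nrm (Lam s) ^+ 2 + 3 / e ^+ 2) * nrm (Lai d) ^+ 2.
Proof.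
move=> e0; have := tri_C s (Lai d); rewrite Lam_Lai => ->.
have := @tri_bound s d e (Cf (Lai d)) (Sf d) (nrm (Lai d)) (nrm (Lam (Lai d))) e0 (nrm_ge0 _) (nrm_ge0 _) (cont_Cf _) (l2_Cf _) (sup_Cf _).
rewrite Lam_Lai.
set J := I01i _; have := ler_norm (- J); rewrite normrN; have := normr_ge0 J; lra.
Qed.

(** The dissipation [2 |Lam^2 v|^2] of the [H^1] energy is used up entirely: one half by the
    transport term, the other by the term with [Lam w]. There [12] is [4 * 3], with the 3 of
    [sup_Sf]. *)
Lemma est_V x v w (e : R) : 0 < e -> x = v + w ->
  2 * dot (Bq x x) (Lam (Lam v)) <= 2 * nrm (Lam (Lam v)) ^+ 2
    + (e * nrm (Lam x) ^+ 2 + 3 / e ^+ 2) * nrm (Lam v) ^+ 2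
    + 12 * (nrm x * nrm (Lam x) * nrm (Lam w) ^+ 2).
Proof.
move=> e0 xE; rewrite (tri_V xE).
have := @tri_bound x v e (Cf (Lam v)) (Sf v) (nrm (Lam v)) (nrm (Lam (Lam v))) e0 (nrm_ge0 _) (nrm_ge0 _) (cont_Cf _) (l2_Cf _) (sup_Cf _).
set J := I01i _; have := ler_norm J => h1 h2.
have k2 : 0 <= 3 * nrm x * nrm (Lam x) by rewrite !mulr_ge0 ?nrm_ge0.
have h5 (z : R) : 0 <= z <= 1 -> `|Sf x z| <= Num.sqrt (3 * nrm x * nrm (Lam x)).
  by move=> hz; rewrite -sqrtr_sqr ler_wsqrtr// sup_Sf.
have := @I_CS3 _ (Cf (Lam w)) (Sf (Lam (Lam v))) (Sf x) _ (cont_Cf _) (cont_Sf _) (cont_Sf _) h5.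
rewrite l2_Cf l2_Sf.
set J2 := I01i _; have := ler_norm J2 => h3 h4.
have := sqr_ge0 (2 * (Num.sqrt (3 * nrm x * nrm (Lam x)) * nrm (Lam w)) - nrm (Lam (Lam v))).
rewrite sqrrB !exprMn (sqr_sqrtr k2); lra.
Qed.

Lemma est_S3 s w y (n : R) : (forall z, 0 <= z <= 1 -> `|Sf s z| <= n) ->
  `|dot (Bq s w) y| <= n * nrm w * nrm (Lam y).
Proof.
move=> hn; rewrite dot_Bq normrN.
rewrite (@eq_cint _ _ _ _ (fun z => Sf w z * Cf (Lam y) z * Sf s z)); last by move=> z _; gring.
apply: le_trans (@I_CS3 _ _ _ (Sf s) n _ _ _ hn) _; try by cont.
by rewrite l2_Sf l2_Cf.
Qed.

(** The derivative and the supremum norm are both put on the test function, so that only [L^2] norms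
    of [a] and [b] remain. This is the kind of bound that [mild_estimate] asks of a forcing. *)
Lemma est_S5 a b y : `|dot (Bq a b) y| <=
  Num.sqrt (3 * nrm (Lam y) * nrm (Lam (Lam y))) * nrm a * nrm b.
Proof.
rewrite dot_Bq normrN.
apply: le_trans (@I_CS3 _ _ _ (Cf (Lam y)) (Num.sqrt (3 * nrm (Lam y) * nrm (Lam (Lam y)))) _ _ _ _) _; try by cont.
  by move=> z hz; rewrite -sqrtr_sqr ler_wsqrtr// sup_Cf.
by rewrite !l2_Sf.
Qed.

Lemma nrm_Lam_le a : nrm (Lam a) <= kp M * nrm a.
Proof.
rewrite -{2}[a](@dgm1 _ _ (fun=> 1))//; apply: nrm_dgm_leZ; first exact: ltW (kp_gt0 _).
move=> i; rewrite ger0_norm ?(ltW (kp_gt0 _))// mulr1 /kp ler_wpM2l ?pi_ge0// ler_nat ltnS.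
exact: ltnW.
Qed.

(** Duality with [y = Bq a b] itself. The constant grows with [M], so the bound serves qualitative
    statements only: Lipschitz continuity of the drift on balls and third differences. *)
Lemma nrm_Bq_le a b : nrm (Bq a b) <= 3 * kp M ^+ 2 * nrm a * nrm b.
Proof.
set y := Bq a b; have [y0|yn] := eqVneq (nrm y) 0.
  have K0 : 0 <= 3 * kp M ^+ 2 :> R by rewrite mulr_ge0// exprn_ge0// ltW// kp_gt0.
  by rewrite y0 mulr_ge0 ?nrm_ge0// mulr_ge0 ?nrm_ge0.
have yp : 0 < nrm y by rewrite lt_def yn nrm_ge0.
rewrite -(ler_pM2r yp) -expr2 nrm_sq.
apply: le_trans (ler_norm _) _; apply: le_trans (est_S5 a b y) _.
have k1 := kp_ge1 M; have L1 := nrm_Lam_le y; have L2 := nrm_Lam_le (Lam y).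
have : Num.sqrt (3 * nrm (Lam y) * nrm (Lam (Lam y))) <= 3 * kp M ^+ 2 * nrm y.
  have K0 : 0 <= 3 * kp M ^+ 2 :> R by rewrite mulr_ge0// exprn_ge0// ltW// kp_gt0.
  apply: le_of_sq; first by rewrite mulr_ge0 ?nrm_ge0.
  rewrite sqr_sqrtr ?mulr_ge0 ?nrm_ge0//.
  have a1 : nrm (Lam y) * nrm (Lam (Lam y)) <= (kp M * nrm y) * (kp M * (kp M * nrm y)).
    apply: ler_pM; rewrite ?nrm_ge0//; apply: le_trans L2 _.
    by rewrite ler_wpM2l// (le_trans _ k1).
  have a2 : kp M ^+ 3 <= kp M ^+ 4 :> R.
    by rewrite [leRHS]exprS ler_peMl// exprn_ge0// (le_trans _ k1).
  have := ler_wpM2r (sqr_ge0 (nrm y)) a2.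
  have : 0 <= kp M ^+ 4 * nrm y ^+ 2 by rewrite mulr_ge0 ?sqr_ge0// exprn_ge0// (le_trans _ k1).
  have {}a1 : nrm (Lam y) * nrm (Lam (Lam y)) <= kp M ^+ 3 * nrm y ^+ 2.
    by rewrite (_ : _ * nrm y ^+ 2 = kp M * nrm y * (kp M * (kp M * nrm y))) //; ring.
  have -> : (3 * kp M ^+ 2 * nrm y) ^+ 2 = 9 * (kp M ^+ 4 * nrm y ^+ 2) by ring.
  rewrite -mulrA; lra.
move=> /(ler_wpM2r (mulr_ge0 (nrm_ge0 a) (nrm_ge0 b))); lra.
Qed.

End sine_polynomials.
#[export] Hint Resolve cont_hk cont_cosm cont_Sf cont_Cf : contdb.

(** * Paths and the heat semigroup *)

Section time_weights.
Context {R : realType}.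
Implicit Types (f g : R -> R) (s t : R).

Lemma is_derive_near_pos f g s df : 0 < s -> (forall u, 0 < u -> f u = g u) ->
  is_derive s 1 f df -> is_derive s 1 g df.
Proof.
move=> s0 fg; apply: near_eq_is_derive.
near=> u; apply: fg; near: u; exact: lt_nbhsr.
Unshelve. all: by end_near. Qed.

(* Paths on [0, +oo[ are extended to negative times by their value at [0]. *)
Definition clamp f s := f (Num.max s 0).

Lemma clampE f s : 0 <= s -> clamp f s = f s.
Proof. by move=> s0; rewrite /clamp max_l. Qed.

Lemma clamp_cont f : (forall s, 0 <= s -> {for s, continuous f}) -> continuous (clamp f).
Proof.
move=> cf s; apply: continuous_comp; last by apply: cf; rewrite le_max lexx orbT.
by apply: (@continuous_max _ R (fun x => x) (fun=> 0)); [exact: cvg_id|exact: cvg_cst].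
Qed.

Lemma is_derive_clamp f s df : 0 < s -> is_derive s 1 f df -> is_derive s 1 (clamp f) df.
Proof. by move=> s0; apply: is_derive_near_pos => // u u0; rewrite clampE// ltW. Qed.

(** The primitive of [s^(- c)] vanishing at 0, for [c < 1], extended by 0 to negative times so that
    it is continuous on the line. *)
Definition pint (c : R) s := (Num.max s 0) `^ (1 - c) / (1 - c).

Lemma pintE c s : 0 <= s -> pint c s = s `^ (1 - c) / (1 - c).
Proof. by move=> s0; rewrite /pint max_l. Qed.

Lemma pint0 c : c < 1 -> pint c 0 = 0.
Proof. by move=> c1; rewrite pintE// powR0 ?mul0r// subr_eq0 gt_eqF. Qed.

Lemma pint_ge0 c s : c < 1 -> 0 <= pint c s.
Proof. by move=> c1; rewrite /pint divr_ge0 ?powR_ge0// subr_ge0 ltW. Qed.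

Lemma is_derive_pint c s : c < 1 -> 0 < s -> is_derive s 1 (pint c) (s `^ (- c)).
Proof.
move=> c1 s0.
have c10 : 1 - c != 0 by rewrite subr_eq0 gt_eqF.
have h := dZ (1 - c)^-1 (is_derive1_powR (1 - c) s0).
apply: (@is_derive_near_pos (fun x => (1 - c)^-1 * x `^ (1 - c))) => //.
  by move=> u u0; rewrite pintE ?ltW// mulrC.
apply: (is_derive_eq h); rewrite mulrA mulVf// mul1r; congr (_ `^ _); ring.
Qed.

Lemma pint_cont c : c < 1 -> continuous (pint c).
Proof.
move=> c1 s; have [s0|s0|<-] := ltgtP 0 s.
- exact: is_derive_cont (is_derive_pint c1 s0).
- apply: (@is_derive_cont _ _ 0); apply: (near_eq_is_derive _ (dC 0 s)).
  near=> u; rewrite /pint max_r; last by apply: ltW; near: u; exact: lt_nbhsl.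
  by rewrite powR0 ?mul0r// subr_eq0 gt_eqF.
- apply/left_right_continuousP; rewrite (pint0 c1); split.
  + apply: cvg_near_cst; near=> u.
    have u0 : u <= 0 by apply: ltW; near: u; exact: nbhs_left_lt.
    by rewrite /pint max_r// powR0 ?mul0r// subr_eq0 gt_eqF.
  + have h : (fun x : R => x `^ (1 - c) / (1 - c)) @ 0^'+ --> (0 / (1 - c)).
      by apply: cvgMl; apply: powR_cvg0; lra.
    rewrite mul0r in h; apply: cvg_trans h; apply: near_eq_cvg.
    by near=> u; rewrite /= pintE// ltW.
Unshelve. all: by end_near. Qed.

(** From [e^y >= 1 + y] and [y^al <= 1 + y]; the latter is why [al] stops at 1. *)
Lemma exp_le_pow (l t al : R) : 0 < l -> 0 < t -> 0 <= al <= 1 ->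
  expR (- (l * t)) <= l `^ (- al) * t `^ (- al).
Proof.
move=> l0 t0 /andP[a0 a1].
have -> : l `^ (- al) * t `^ (- al) = ((l * t) `^ al)^-1 by rewrite -powRM ?ltW// powRN.
rewrite expRN lef_pV2 ?posrE ?expR_gt0 ?powR_gt0 ?mulr_gt0//.
apply: le_trans (expR_ge1Dx _).
have lt0 : 0 < l * t by rewrite mulr_gt0.
have [h|h] := leP (l * t) 1.
  have : (l * t) `^ al <= 1 `^ al by rewrite ge0_ler_powR// nnegrE ltW.
  by rewrite powR1; lra.
have : (l * t) `^ al <= (l * t) `^ 1 by rewrite ler_powR// ltW.
rewrite powRr1; [lra|exact: ltW].
Qed.

Lemma pow_ge0_le (t T g : R) : 0 <= t <= T -> 0 <= g <= 1 -> t `^ g <= 1 + T.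
Proof.
move=> /andP[t0 tT] /andP[g0 g1].
have [h|h] := leP t 1.
  have : t `^ g <= 1 `^ g by rewrite ge0_ler_powR ?nnegrE.
  by rewrite powR1; lra.
have : t `^ g <= t `^ 1 by rewrite ler_powR// ltW.
by rewrite powRr1//; lra.
Qed.

End time_weights.

Section curves.
Context {R : realType} {M : nat}.
Implicit Types (c d F G r w S : R -> 'rV[R]_M) (s t : R) (v : nat -> R).

Definition ccont c := forall i, continuous (fun s => c s ord0 i).
(** The equation is imposed at positive times: a path frozen before 0 has in general a corner at
    0. *)
Definition curve c F := ccont c /\
  forall i s, 0 < s -> is_derive s 1 (fun u => c u ord0 i) (F s ord0 i).

Lemma curve_eq c F G : (forall s, 0 < s -> F s = G s) -> curve c F -> curve c G.
Proof. by move=> FG [cc dc]; split=> // i s s0; rewrite -FG//; exact: dc. Qed.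

Lemma ccontD c d : ccont c -> ccont d -> ccont (fun s => c s + d s).
Proof. by move=> cc cd i; under eq_fun do rewrite mxE; apply: contD; [exact: cc|exact: cd]. Qed.
Lemma ccont_cst (a : 'rV[R]_M) : ccont (fun=> a).
Proof. by move=> i; exact: contC. Qed.
Lemma ccont_dgm v c : ccont c -> ccont (fun s => dgm v (c s)).
Proof. by move=> cc i; under eq_fun do rewrite dgmE; apply: contM; [exact: contC|exact: cc]. Qed.
Lemma ccontZ k c : ccont c -> ccont (fun s => k *: c s).
Proof. by move=> cc i; under eq_fun do rewrite mxE; apply: contM; [exact: contC|exact: cc]. Qed.
Lemma ccontN c : ccont c -> ccont (fun s => - c s).
Proof. by move=> cc i; under eq_fun do rewrite mxE; apply: contN; exact: cc. Qed.
Lemma ccontB c d : ccont c -> ccont d -> ccont (fun s => c s - d s).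
Proof. by move=> cc cd; apply: ccontD => //; exact: ccontN. Qed.

Lemma cont_dot c d : ccont c -> ccont d -> continuous (fun s => dot (c s) (d s)).
Proof. by move=> cc cd; under eq_fun do rewrite dotE; apply: cont_sum => i; apply: contM; [exact: cc|exact: cd]. Qed.

Lemma cont_nrm c : ccont c -> continuous (fun s => nrm (c s)).
Proof.
by move=> cc; under eq_fun do rewrite nrmE; apply: (cont_comp (h := Num.sqrt)); [exact: sqrt_continuous|exact: cont_dot].
Qed.

Lemma curveD c F d G : curve c F -> curve d G -> curve (fun s => c s + d s) (fun s => F s + G s).
Proof.
move=> [cc dc] [cd dd]; split; first exact: ccontD.
move=> i s s0; under eq_fun do rewrite mxE; rewrite mxE.
by apply: dD; [exact: dc|exact: dd].
Qed.
Lemma curveZ k c F : curve c F -> curve (fun s => k *: c s) (fun s => k *: F s).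
Proof.
move=> [cc dc]; split; first exact: ccontZ.
by move=> i s s0; under eq_fun do rewrite mxE; rewrite mxE; apply: dZ; exact: dc.
Qed.
Lemma curveB c F d G : curve c F -> curve d G -> curve (fun s => c s - d s) (fun s => F s - G s).
Proof.
move=> hc /(curveZ (-1)) hd; have := curveD hc hd.
rewrite (_ : (fun s => c s + -1 *: d s) = (fun s => c s - d s)); last by apply: funext => s; rewrite scaleN1r.
by apply: curve_eq => s _; rewrite scaleN1r.
Qed.

Lemma derive_dot c F d G s : curve c F -> curve d G -> 0 < s ->
  is_derive s 1 (fun u => dot (c u) (d u)) (dot (F s) (d s) + dot (c s) (G s)).
Proof.
move=> [_ dc] [_ dd] s0; under eq_fun do rewrite dotE; rewrite !dotE.
have := dsum (fun i => dM (dc i s s0) (dd i s s0)).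
by congr is_derive; rewrite big_split.
Qed.

Lemma derive_energy v c F s : curve c F -> 0 < s ->
  is_derive s 1 (fun u => nrm (dgm v (c u)) ^+ 2) (2 * dot (F s) (dgm v (dgm v (c s)))).
Proof.
move=> hc s0.
have hd : curve (fun s => dgm v (c s)) (fun s => dgm v (F s)).
  case: hc => cc dc; split; first exact: ccont_dgm.
  by move=> i u u0; under eq_fun do rewrite dgmE; rewrite dgmE; apply: dZ; exact: dc.
under eq_fun do rewrite nrm_sq.
apply: (is_derive_eq (derive_dot hd hd s0)).
rewrite (dotC _ (dgm v (F s))) dot_dgm; ring.
Qed.

Lemma derive_energy1 c F s : curve c F -> 0 < s ->
  is_derive s 1 (fun u => nrm (c u) ^+ 2) (2 * dot (F s) (c s)).
Proof.
move=> hc s0; under eq_fun do rewrite nrm_sq.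
apply: (is_derive_eq (derive_dot hc hc s0)); rewrite (dotC (c s)); ring.
Qed.

(* The heat semigroup [e^(tA)]. *)
Definition sg t (x : 'rV[R]_M) := dgm (fun i => expR (- (kp i ^+ 2 * t))) x.

Lemma Lam_sg t x : Lam (sg t x) = sg t (Lam x).
Proof. by rewrite /Lam /sg !dgm_dgm; apply: eq_dgm => i; rewrite mulrC. Qed.

Lemma curve_sg x : curve (fun s => sg s x) (fun s => - Lam (Lam (sg s x))).
Proof.
have H i (s : R) : is_derive s 1 (fun u => sg u x ord0 i) ((- Lam (Lam (sg s x))) ord0 i).
  under eq_fun do rewrite dgmE mulrC; rewrite !(dgmE, mxE).
  apply: (is_derive_eq (dZ (x ord0 i) (dexp (is_deriveN (dZ (kp i ^+ 2) (is_derive_id s 1)))))).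
  by rewrite /=; ring.
split; last by move=> i s _; exact: H.
by move=> i s; exact: is_derive_cont (H i s).
Qed.

Lemma sg0 x : sg 0 x = x.
Proof. by rewrite /sg dgm1// => i; rewrite mulr0 oppr0 expR0. Qed.

(** Gaining [a - b] derivatives costs [t^(- (a - b) / 2)], by [exp_le_pow] at each squared
    frequency; its range of exponents limits the gain to two derivatives. *)
Lemma nrm_sg_smooth t x (a b : R) : 0 < t -> 0 <= a - b <= 2 ->
  nrm (sg t (dgm (fun i => kp i `^ a) x)) <= t `^ (- ((a - b) / 2)) * nrm (dgm (fun i => kp i `^ b) x).
Proof.
move=> t0 ab; rewrite /sg dgm_dgm; apply: nrm_dgm_leZ; first exact: powR_ge0.
move=> i; rewrite ger0_norm; last by rewrite mulr_ge0 ?expR_ge0 ?powR_ge0.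
have k0 := @kp_gt0 R i.
have := @exp_le_pow R (kp i ^+ 2) t ((a - b) / 2).
move=> /(_ _ t0) h; apply: (@le_trans _ _ ((kp i ^+ 2) `^ (- ((a - b) / 2)) * t `^ (- ((a - b) / 2)) * kp i `^ a)).
  by rewrite ler_wpM2r ?powR_ge0// h ?exprn_gt0//; lra.
rewrite -powR_mulrn; last exact: ltW.
rewrite -powRrM mulrAC mulrC -powRD.
  by have -> : 2 * - ((a - b) / 2) + a = b by lra.
by apply/implyP => _; rewrite gt_eqF.
Qed.

Lemma Lam_pow (x : 'rV[R]_M) : Lam x = dgm (fun i => kp i `^ (1 : R)) x.
Proof. by apply: eq_dgm => i; rewrite powRr1 ?ltW ?kp_gt0. Qed.
Lemma id_pow (x : 'rV[R]_M) : x = dgm (fun i => kp i `^ (0 : R)) x.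
Proof. by rewrite dgm1// => i; rewrite powRr0. Qed.
Lemma Lam2_pow (x : 'rV[R]_M) : Lam (Lam x) = dgm (fun i => kp i `^ (2 : R)) x.
Proof.
rewrite /Lam dgm_dgm; apply: eq_dgm => i.
by rewrite powR_mulrn ?ltW ?kp_gt0// expr2.
Qed.

(* Variation of constants: [w] is read off coordinatewise, since [A] is diagonal. *)
Lemma duhamel F : ccont F ->
  {w | curve w (fun s => - Lam (Lam (w s)) + F s) & w 0 = 0}.
Proof.
move=> cF.
pose g (i : 'I_M) := fun u => expR (kp i ^+ 2 * u) * F u ord0 i.
have cg i : continuous (g i).
  apply: contM; last exact: cF.
  by cont.
pose w0 (i : 'I_M) := fun u => expR (- (kp i ^+ 2 * u)) * prim (g i) u.
have dw i s : 0 <= s -> is_derive s 1 (w0 i) (- (kp i ^+ 2 * w0 i s) + F s ord0 i).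
  move=> s0.
  apply: (is_derive_eq (dM (dexp (is_deriveN (dZ (kp i ^+ 2) (is_derive_id s 1)))) (is_derive_prim (cg i) s0))).
  rewrite /w0 /g mulrA -expRD addNr expR0 mul1r /=; ring.
exists (fun s => \row_i clamp (w0 i) s).
  split.
    move=> i; under eq_fun do rewrite mxE.
    by apply: clamp_cont => s s0; exact: is_derive_cont (dw i s s0).
  move=> i s s0; under eq_fun do rewrite mxE; rewrite !(dgmE, mxE).
  have d := dw i s (ltW s0).
  apply: (is_derive_clamp s0); apply: (is_derive_eq d).
  by rewrite (clampE _ (ltW s0)) expr2 mulrA.
by apply/rowP => i; rewrite !mxE clampE// /w0 prim0 mulr0.
Qed.

End curves.

(* Abstracting the atoms first keeps [lra] from comparing them up to conversion. *)
Ltac gen_atoms := repeat match goal with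
  | |- context [dot ?a ?b] => generalize (dot a b); intro
  | |- context [nrm ?a] => generalize (nrm a); intro
  | |- context [expR ?a] => generalize (expR a); intro
  | |- context [powR ?a ?b] => generalize (powR a b); intro
  | |- context [prim ?f ?t] => generalize (prim f t); intro
  | |- context [clamp ?f ?t] => generalize (clamp f t); intro
  | |- context [?f ?s] => is_var f; generalize (f s); intro
  end.
Ltac glra := gen_atoms; clear; repeat match goal with x := _ |- _ => clearbody x end; intros; lra.

(** * The linear equation of differences: energy estimates in [H^-1] and [L^2] *)

Section remainder.
Context {R : realType} {M : nat}.
Implicit Types (r w S : R -> 'rV[R]_M).

Lemma gronwall_prim (y a B dy dB : R -> R) t : 0 <= t -> continuous y -> continuous a ->
  (forall s, 0 <= a s) ->
  (forall s : R, 0 < s < t -> is_derive s 1 y (dy s)) ->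
  (forall s : R, 0 < s < t -> is_derive s 1 B (dB s)) ->
  (forall s : R, 0 <= s <= t -> {for s, continuous B}) ->
  (forall s : R, 0 < s < t -> 0 <= dB s) -> B 0 = 0 ->
  (forall s : R, 0 < s < t -> dy s <= a s * y s + dB s) ->
  y t <= expR (prim a t) * (y 0 + B t).
Proof.
move=> t0 cy ca a0 Hy HB cB B0 B00 H.
apply: (@gronwall _ y (prim a) B dy a dB t t0 Hy _ HB _ _ cB _ (prim0 a) B0 B00 H).
- by move=> s /andP[s0 _]; apply: is_derive_prim => //; exact: ltW.
- by move=> s _; exact: cy.
- by move=> s /andP[s0 _]; exact: prim_cont.
- by move=> s /andP[s0 _]; exact: prim_ge0.
Qed.

(* Energy estimate in [H^-1], with the supremum of [|r|_{-1}] absorbed, then a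
   time-weighted energy estimate in [L^2]. *)
Lemma remainder_estimate S r w (n G dG : R -> R) (t T e K lam g : R) :
  0 < t <= T -> 0 < e -> 0 <= K -> 0 < lam -> 0 <= g < 1 ->
  ccont S -> curve r (fun s => - Lam (Lam (r s)) + (Bq (S s) (r s) + Bq (S s) (w s))) -> r 0 = 0 ->
  (forall s z : R, 0 < s < t -> 0 <= z <= 1 -> `|Sf (S s) z| <= n s) ->
  (forall s : R, 0 < s < t -> nrm (w s) <= K * s `^ (- g)) ->
  (forall s : R, 0 < s < t -> is_derive s 1 G (dG s)) ->
  (forall s : R, 0 <= s <= t -> {for s, continuous G}) -> G 0 = 0 ->
  (forall s : R, 0 < s < t -> (n s / lam) ^+ 2 * s `^ (- g) <= dG s) ->
  nrm (r t) <= 2 * (1 + T) * K * lam * t `^ (- g)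
     * expR (2 * prim (fun s => e * nrm (Lam (S s)) ^+ 2 + 3 / e ^+ 2) t) * (G t + (1 - g)^-1).
Proof.
move=> /andP[t0 tT] e0 K0 lam0 /andP[g0 g1] cS cr r0 Hn Hw HG cG G0 HdG.
set a := fun s => e * nrm (Lam (S s)) ^+ 2 + 3 / e ^+ 2.
set A := prim a t.
have ca : continuous a.
  have h : continuous (fun s => nrm (Lam (S s))) by apply: cont_nrm; exact: ccont_dgm.
  by rewrite /a; cont.
have a0 (s : R) : 0 <= a s.
  by rewrite /a addr_ge0// mulr_ge0 ?sqr_ge0 ?invr_ge0 ?sqr_ge0// ltW.
have A0 : 0 <= A by apply: prim_ge0 => //; exact: ltW.
have g10 : 0 < 1 - g by lra.
(* Young with weight [sg] splits [n s^-g] into [(n / lam)^2 s^-g], integrated by [G], and [s^-g],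
   integrated by [pint g]. With this power of [t] both contribute the same power at the final time,
   as [BtE] shows. *)
set sg := t `^ ((1 - g) / 2).
have sgp : 0 < sg by apply: powR_gt0.
have sg2 : sg ^+ 2 = t `^ (1 - g).
  rewrite /sg -powR_mulrn ?powR_ge0// -powRrM; congr (_ `^ _); lra.
have dG0 (s : R) : 0 < s < t -> 0 <= dG s.
  by move=> hs; apply: le_trans (HdG s hs); rewrite mulr_ge0 ?sqr_ge0 ?powR_ge0.
pose B := fun s => 2^-1 * K * lam * (sg * G s + sg^-1 * pint g s).
pose dB := fun s => 2^-1 * K * lam * (sg * dG s + sg^-1 * s `^ (- g)).
have KL : 0 <= 2^-1 * K * lam by rewrite !mulr_ge0 // ltW.
have HB (s : R) : 0 < s < t -> is_derive s 1 B (dB s).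
  move=> hs; case/andP: (hs) => s0 _.
  exact: (dZ _ (dD (dZ _ (HG s hs)) (dZ _ (is_derive_pint g1 s0)))).
have cB (s : R) : 0 <= s <= t -> {for s, continuous B}.
  move=> hs; apply: continuousM; first exact: cst_continuous.
  apply: continuousD; (apply: continuousM; first exact: cst_continuous); first exact: cG.
  exact: pint_cont.
have B0 : B 0 = 0 by rewrite /B G0 pint0// !mulr0 addr0 mulr0.
have dB0 (s : R) : 0 < s < t -> 0 <= dB s.
  move=> hs; rewrite /dB mulr_ge0// addr_ge0// mulr_ge0 ?(ltW sgp) ?dG0 ?invr_ge0 ?powR_ge0//.
have nB (s : R) : 0 < s < t -> n s * nrm (w s) <= dB s.
  move=> hs; have n0 : 0 <= n s.
    by apply: le_trans (Hn s 0 hs _); rewrite ?lexx ?ler01.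
  apply: (@le_trans _ _ (n s * (K * s `^ (- g)))); first by rewrite ler_wpM2l// Hw.
  have h : 0 <= (sg * (n s / lam) - 1) ^+ 2 by exact: sqr_ge0.
  have p0 := powR_ge0 s (- g).
  apply: (@le_trans _ _ (2^-1 * K * lam * (sg * ((n s / lam) ^+ 2 * s `^ (- g)) + sg^-1 * s `^ (- g)))); last first.
    by rewrite /dB ler_wpM2l// lerD2r ler_pM2l// HdG.
  rewrite -subr_ge0.
  have -> : 2^-1 * K * lam * (sg * ((n s / lam) ^+ 2 * s `^ (- g)) + sg^-1 * s `^ (- g)) - n s * (K * s `^ (- g)) =
    2^-1 * K * lam * s `^ (- g) / sg * (sg * (n s / lam) - 1) ^+ 2.
    by field; rewrite !gt_eqF.
  by rewrite mulr_ge0// mulr_ge0 ?invr_ge0 ?(ltW sgp)// mulr_ge0.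
have BtE : B t = 2^-1 * K * lam * (sg * (G t + (1 - g)^-1)).
  rewrite /B pintE ?(ltW t0)// -sg2; congr (_ * _); field.
  by rewrite !gt_eqF.
have Gt0 : 0 <= G t.
  have := @le_of_derive_le _ (fun=> 0) G (fun=> 0) dG 0 t (ltW t0) (fun s _ => dC 0 s) HG (fun s _ => @cst_continuous _ _ _ _) cG dG0.
  by rewrite G0; lra.
have Bt0 : 0 <= B t.
  by rewrite BtE mulr_ge0// mulr_ge0 ?(ltW sgp)// addr_ge0// invr_ge0 ltW.
pose y1 := fun s => nrm (Lai (r s)) ^+ 2.
have cLai : continuous (fun s => nrm (Lai (r s))) by apply: cont_nrm; apply: ccont_dgm; exact: cr.1.
have cy1 : continuous y1 by rewrite /y1; cont.
have dy1 (s : R) : 0 < s -> is_derive s 1 y1 (2 * dot (- Lam (Lam (r s)) + (Bq (S s) (r s) + Bq (S s) (w s))) (Lai (Lai (r s)))).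
  by move=> s0; exact: (derive_energy (fun i => (kp i)^-1) cr s0).
(* Half of the dissipation [2 |r|^2] absorbs the transport term; the other half is kept and later
   bounds [q], the integral of [|r|^2]. *)
have e1 (s : R) : 0 < s < t -> 2 * dot (- Lam (Lam (r s)) + (Bq (S s) (r s) + Bq (S s) (w s))) (Lai (Lai (r s)))
    <= - nrm (r s) ^+ 2 + a s * y1 s + 2 * dB s * nrm (Lai (r s)).
  move=> hs; rewrite !dotDl dotNl.
  have -> : dot (Lam (Lam (r s))) (Lai (Lai (r s))) = nrm (r s) ^+ 2.
    by rewrite !dot_Lam !Lam_Lai nrm_sq.
  have h1 := est_S2 (S s) (r s) e0.
  have h2 := @est_S3 _ _ (S s) (w s) (Lai (Lai (r s))) (n s) (fun z => Hn s z hs).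
  rewrite Lam_Lai in h2.
  have h3 := le_trans (ler_norm _) h2.
  have h4 := ler_wpM2r (nrm_ge0 (Lai (r s))) (nB s hs).
  rewrite -/(a s) -/(y1 s) in h1.
  by move: h1 h3 h4; glra.
(* The forcing is linear in [|r|_(-1)]. Replacing this norm by its maximum [N] gives
   [N^2 <= 2 N e^A B(t)] at a point of maximum, and dividing by [N] bounds [N]. *)
have [m mI mP] : exists2 m, m \in `[0, t]%R & forall s, s \in `[0, t]%R -> nrm (Lai (r s)) <= nrm (Lai (r m)).
  by apply: EVT_max; [exact: ltW|exact: continuous_subspaceT].
move: mI; rewrite in_itv/= => /andP[m0 mt].
set N := nrm (Lai (r m)).
have N0 : 0 <= N by exact: nrm_ge0.
have dle (s : R) : 0 <= s <= t -> nrm (Lai (r s)) <= N by move=> h; apply: mP; rewrite in_itv.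
have gB (y dy : R -> R) (u : R) : 0 <= u <= t -> continuous y -> y 0 = 0 ->
    (forall s : R, 0 < s < u -> is_derive s 1 y (dy s)) ->
    (forall s, 0 < s < u -> dy s <= a s * y s + 2 * N * dB s) ->
    y u <= expR (prim a u) * (2 * N * B u).
  move=> /andP[u0 ut] cy y00 hy hdy.
  have := @gronwall_prim y a (fun s => 2 * N * B s) dy (fun s => 2 * N * dB s) u u0 cy ca a0 hy.
  rewrite y00 add0r => H; apply: H.
  - by move=> s /andP[s1 s2]; apply: dZ; apply: HB; rewrite s1 (lt_le_trans s2).
  - move=> s /andP[s1 s2]; apply: continuousM; first exact: cst_continuous.
    by apply: cB; rewrite s1 (le_trans s2).
  - move=> s /andP[s1 s2]; apply: mulr_ge0; first exact: mulr_ge0.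
    by apply: dB0; rewrite s1 (lt_le_trans s2).
  - by rewrite B0 mulr0.
  - exact: hdy.
have Bmono u : 0 <= u <= t -> B u <= B t.
  move=> /andP[u0 ut].
  have := @le_of_derive_le _ (fun=> 0) B (fun=> 0) dB u t ut (fun s _ => dC 0 s) _ (fun s _ => @cst_continuous _ _ _ _) _ _.
  rewrite subrr subr_ge0; apply.
  - by move=> s /andP[s1 s2]; apply: HB; rewrite s2 (le_lt_trans u0).
  - by move=> s /andP[s1 s2]; apply: cB; rewrite s2 (le_trans u0).
  - by move=> s /andP[s1 s2]; apply: dB0; rewrite s2 (le_lt_trans u0).
have Bge0 u : 0 <= u <= t -> 0 <= B u.
  move=> /andP[m0' mt'].
  have := @le_of_derive_le _ (fun=> 0) B (fun=> 0) dB 0 u m0' (fun s _ => dC 0 s) _ (fun s _ => @cst_continuous _ _ _ _) _ _.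
  rewrite B0 subrr subr0; apply.
  - by move=> s /andP[s1 s2]; apply: HB; rewrite s1 (lt_le_trans s2).
  - by move=> s /andP[s1 s2]; apply: cB; rewrite s1 (le_trans s2).
  - by move=> s /andP[s1 s2]; apply: dB0; rewrite s1 (lt_le_trans s2).
have y10 : y1 0 = 0 by rewrite /y1 r0 /Lai (_ : dgm _ 0 = 0) ?nrm0 ?expr0n//; apply/rowP => i; rewrite !(dgmE, mxE) mulr0.
have eA : 1 <= expR A by rewrite -expR0 ler_expR.
have NB : N <= 2 * expR A * B t.
  have h := gB y1 _ m _ cy1 y10 (fun s hs => dy1 s (proj1 (andP hs))).
  have {}h : y1 m <= expR (prim a m) * (2 * N * B m).
    apply: h; first by rewrite m0.
    move=> s /andP[s1 s2]; have st : s < t := lt_le_trans s2 mt.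
    have hs : 0 < s < t by rewrite s1.
    apply: le_trans (e1 s hs) _.
    have h1 : dB s * nrm (Lai (r s)) <= dB s * N by rewrite ler_wpM2l ?dB0// dle// !ltW.
    by move: (sqr_ge0 (nrm (r s))) h1; glra.
  have [N00|Nn] := eqVneq N 0; first by rewrite N00 mulr_ge0// mulr_ge0// ?expR_ge0.
  have Np : 0 < N by rewrite lt_def Nn.
  rewrite -(ler_pM2r Np) -expr2; apply: (le_trans h).
  have h1 : B m <= B t by apply: Bmono; rewrite m0.
  have h2 : expR (prim a m) <= expR A by rewrite ler_expR; exact: le_prim_t.
  apply: (@le_trans _ _ (expR A * (2 * N * B t))); last by rewrite le_eqVlt; apply/orP; left; apply/eqP; ring.
  apply: ler_pM; [exact: expR_ge0| |exact: h2|by rewrite ler_wpM2l// mulr_ge0].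
  by apply: mulr_ge0; [exact: mulr_ge0|apply: Bge0; rewrite m0].
have cnr : continuous (fun s => nrm (r s) ^+ 2).
  by have h := cont_nrm cr.1; cont.
pose q := clamp (prim (fun s => nrm (r s) ^+ 2)).
have cq : continuous q by apply: clamp_cont => s s0; exact: prim_cont.
have dq (s : R) : 0 < s -> is_derive s 1 q (nrm (r s) ^+ 2).
  by move=> s0; apply: is_derive_clamp => //; apply: is_derive_prim => //; exact: ltW.
have q0 (s : R) : 0 <= q s by rewrite /q /clamp prim_ge0 ?le_max ?lexx ?orbT// => x; rewrite sqr_ge0.
have q00 : q 0 = 0 by rewrite /q clampE// prim0.
have y1q0 (s : R) : 0 <= y1 s by exact: sqr_ge0.
have qB : q t <= 4 * expR A ^+ 2 * B t ^+ 2.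
  have h : y1 t + q t <= expR A * (2 * N * B t).
    apply: (gB (fun s => y1 s + q s) _ t _ _ _ (fun s hs => dD (dy1 s (proj1 (andP hs))) (dq s (proj1 (andP hs))))).
    - by rewrite lexx ltW.
    - exact: contD.
    - by rewrite y10 q00 addr0.
    - move=> s hs; have h1 : dB s * nrm (Lai (r s)) <= dB s * N.
        by rewrite ler_wpM2l ?dB0// dle//; case/andP: hs => *; rewrite !ltW.
      by move: (mulr_ge0 (a0 s) (q0 s)) (e1 s hs) h1; glra.
  have h2 : N * B t <= 2 * expR A * B t * B t by rewrite ler_wpM2r.
  by move: h (ler_wpM2l (expR_ge0 A) h2) (y1q0 t); rewrite !expr2; glra.
have cid : continuous (fun s : R => s) by move=> ?; exact: cvg_id.
have KL2 : 0 <= K ^+ 2 * lam ^+ 2 * sg ^+ 2.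
  by apply: mulr_ge0; [apply: mulr_ge0|]; exact: sqr_ge0.
have cnr1 := cont_nrm cr.1.
(* The weight [s] tames the initial singularity: its derivative contributes [|r|^2], whose integral
   [q] is known, and the forcing contributes [s (n s^-g)^2 = s^(1-g) n^2 s^-g], at most
   [sg^2 n^2 s^-g], up to the factor [K^2]. *)
have fin : t * nrm (r t) ^+ 2 <= expR A * (0 * nrm (r 0) ^+ 2 + (q t + K ^+ 2 * lam ^+ 2 * sg ^+ 2 * G t)).
  apply: (@gronwall_prim (fun s => s * nrm (r s) ^+ 2) a (fun s => q s + K ^+ 2 * lam ^+ 2 * sg ^+ 2 * G s)
    (fun s => 1 * nrm (r s) ^+ 2 + s * (2 * dot (- Lam (Lam (r s)) + (Bq (S s) (r s) + Bq (S s) (w s))) (r s)))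
    (fun s => nrm (r s) ^+ 2 + K ^+ 2 * lam ^+ 2 * sg ^+ 2 * dG s) t (ltW t0)) => //.
  - by cont.
  - move=> s /andP[s0 _]; exact: (dM (is_derive_id s 1) (derive_energy1 cr s0)).
  - by move=> s hs; apply: dD; [apply: dq; case/andP: hs|apply: dZ; exact: HG].
  - move=> s hs; apply: continuousD; first exact: cq.
    by apply: continuousM; [exact: cst_continuous|exact: cG].
  - by move=> s hs; rewrite addr_ge0 ?sqr_ge0// mulr_ge0// dG0.
  - by rewrite q00 G0 mulr0 addr0.
  - move=> s hs; case/andP: (hs) => s0 st.
    have h1 := est_S1 (S s) (r s) e0.
    have h2 := @est_S3 _ _ (S s) (w s) (r s) (n s) (fun z => Hn s z hs).
    have h3 := le_trans (ler_norm _) h2.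
    have n0 : 0 <= n s by apply: le_trans (Hn s 0 hs _); rewrite ?lexx ?ler01.
    have h4 : n s * nrm (w s) <= n s * (K * s `^ (- g)) by rewrite ler_wpM2l// Hw.
    have h5 : 2 * (n s * nrm (w s) * nrm (Lam (r s))) <= nrm (Lam (r s)) ^+ 2 + (n s * nrm (w s)) ^+ 2.
      by have := sqr_ge0 (nrm (Lam (r s)) - n s * nrm (w s)); rewrite sqrrB; glra.
    have h6 : (n s * nrm (w s)) ^+ 2 <= (n s * (K * s `^ (- g))) ^+ 2.
      by rewrite ler_pXn2r// nnegrE ?mulr_ge0 ?nrm_ge0 ?powR_ge0.
    have h7 : s * (n s * (K * s `^ (- g))) ^+ 2 <= K ^+ 2 * lam ^+ 2 * sg ^+ 2 * dG s.
      have -> : s * (n s * (K * s `^ (- g))) ^+ 2 = K ^+ 2 * lam ^+ 2 * ((s * s `^ (- g)) * ((n s / lam) ^+ 2 * s `^ (- g))).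
        by field; rewrite gt_eqF.
      rewrite -(mulrA (K ^+ 2 * lam ^+ 2)); apply: ler_wpM2l.
        by apply: mulr_ge0; exact: sqr_ge0.
      rewrite sg2.
      have -> : s * s `^ (- g) = s `^ (1 - g).
        by rewrite powRD ?powRr1 ?(ltW s0)//; apply/implyP => _; rewrite gt_eqF.
      apply: ler_pM; [exact: powR_ge0|by apply: mulr_ge0; [exact: sqr_ge0|exact: powR_ge0]| |exact: HdG].
      by apply: ge0_ler_powR; rewrite ?nnegrE ?(ltW s0) ?(ltW t0)// ltW.
    have E : dot (Lam (Lam (r s))) (r s) = nrm (Lam (r s)) ^+ 2 by rewrite nrm_sq dot_Lam.
    rewrite !dotDl dotNl E.
    have h8 : 2 * (- nrm (Lam (r s)) ^+ 2 + (dot (Bq (S s) (r s)) (r s) + dot (Bq (S s) (w s)) (r s))) <= a s * nrm (r s) ^+ 2 + (n s * (K * s `^ (- g))) ^+ 2.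
      by rewrite -/(a s) in h1; move: h1 h3 h5 h6; glra.
    by move: (ler_wpM2l (ltW s0) h8) h7; glra.
rewrite mul0r add0r in fin.
set c := G t + (1 - g)^-1 in BtE *.
have c1 : 1 <= (1 - g)^-1 by rewrite invf_ge1//; lra.
have Gc : G t <= c ^+ 2 by rewrite /c; nra.
have c0 : 0 <= c by rewrite /c; lra.
have h1 : t * nrm (r t) ^+ 2 <= 2 * (K ^+ 2 * lam ^+ 2 * sg ^+ 2) * (expR A ^+ 3 * c ^+ 2).
  apply: le_trans fin _.
  have h2 : q t <= K ^+ 2 * lam ^+ 2 * sg ^+ 2 * (expR A ^+ 2 * c ^+ 2).
    by apply: le_trans qB _; rewrite BtE le_eqVlt; apply/orP; left; apply/eqP; field.
  have h3 : G t <= expR A ^+ 2 * c ^+ 2.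
    apply: le_trans Gc _; rewrite ler_peMl ?sqr_ge0//; exact: exprn_ege1.
  have h4 := ler_wpM2l KL2 h3.
  have h5 : q t + K ^+ 2 * lam ^+ 2 * sg ^+ 2 * G t <= 2 * (K ^+ 2 * lam ^+ 2 * sg ^+ 2) * (expR A ^+ 2 * c ^+ 2).
    by move: h2 h4; glra.
  apply: le_trans (ler_wpM2l (expR_ge0 A) h5) _; rewrite le_eqVlt; apply/orP; left; apply/eqP; ring.
have T1 : 1 <= 1 + T by lra.
apply: le_of_sq.
  by rewrite mulr_ge0// mulr_ge0 ?expR_ge0// mulr_ge0 ?powR_ge0// mulr_ge0 ?(ltW lam0)// mulr_ge0//; lra.
rewrite -(ler_pM2l t0); apply: le_trans h1 _.
(* Trades [sg^2 = t^(1-g)] for [t] times the square of the announced rate [t^-g]; the excess [t^g]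
   is bounded through [T]. *)
have tg : sg ^+ 2 <= t * (t `^ (- g)) ^+ 2 * (1 + T) ^+ 2.
  have -> : sg ^+ 2 = t * (t `^ (- g)) ^+ 2 * t `^ g.
    rewrite sg2 powRD; last by apply/implyP => _; rewrite gt_eqF.
    rewrite powRr1 ?(ltW t0)// powRN; field.
    by rewrite gt_eqF// powR_gt0.
  apply: ler_wpM2l; first by rewrite mulr_ge0 ?sqr_ge0 ?(ltW t0).
  apply: (@le_trans _ _ (1 + T)); last by rewrite expr2 ler_peMr//; lra.
  by apply: pow_ge0_le; rewrite ?(ltW t0)// g0 ltW.
have E4 : expR A ^+ 3 <= expR A ^+ 4 by rewrite [leRHS]exprS ler_peMl// exprn_ge0// expR_ge0.
have -> : expR (2 * A) = expR A ^+ 2 by rewrite (_ : 2 * A = A + A) ?expRD ?expr2//; ring.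
have KL3 : 0 <= K ^+ 2 * lam ^+ 2 * c ^+ 2.
  by apply: mulr_ge0; [apply: mulr_ge0|]; exact: sqr_ge0.
have h6 := ler_pM (sqr_ge0 _) (exprn_ge0 3 (expR_ge0 A)) tg E4.
have := ler_wpM2l KL3 h6.
have : 0 <= K ^+ 2 * lam ^+ 2 * c ^+ 2 * (t * (t `^ (- g)) ^+ 2 * (1 + T) ^+ 2 * expR A ^+ 4).
  apply: mulr_ge0 => //; apply: mulr_ge0; last by apply: exprn_ge0; exact: expR_ge0.
  by apply: mulr_ge0; [apply: mulr_ge0; [exact: ltW|exact: sqr_ge0]|exact: sqr_ge0].
by move: (expR A) (sg ^+ 2) (t `^ (- g)) => E s2 p; clear; lra.
Qed.

End remainder.

(** * Variation of constants and the nonlinear part of a solution *)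

Section mild.
Context {R : realType} {M : nat}.
Implicit Types (w F S V Z X : R -> 'rV[R]_M).

(* Duality: pair [w(t)] with itself and transport the test vector by the semigroup. *)
Lemma mild_estimate w F (t T K g : R) : 0 < t <= T -> 0 <= K -> 0 <= g < 1 ->
  curve w (fun s => - Lam (Lam (w s)) + F s) -> w 0 = 0 ->
  (forall (s : R) y, 0 < s < t -> `|dot (F s) y| <=
     K * s `^ (- g) * Num.sqrt (nrm (Lam y) * nrm (Lam (Lam y)))) ->
  nrm (w t) <= (2 / (1 - g) + 8) * (1 + T) * K * t `^ (- g).
Proof.
move=> /andP[t0 tT] K0 /andP[g0 g1] cw w0 HF.
have g10 : 0 < 1 - g by lra.
set y := w t; have Ny := nrm_ge0 y.
pose tau := fun s => t - s.
(* [E] solves the backward heat equation with final value [y], so the Laplacians cancel in the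
   derivative of [<w, E>] and only [<F, E>] remains; the pairing runs from 0 to [|y|^2]. *)
pose E := fun s => dgm (fun i => expR (- (kp i ^+ 2 * (t - s)))) y.
have cE : curve E (fun s => Lam (Lam (E s))).
  have H i (s : R) : is_derive s 1 (fun u => E u ord0 i) ((Lam (Lam (E s))) ord0 i).
    under eq_fun do rewrite dgmE mulrC; rewrite !dgmE.
    apply: (is_derive_eq (dZ (y ord0 i) (dexp (is_deriveN (dZ (kp i ^+ 2) (dB (dC t s) (is_derive_id s 1))))))).
    by rewrite /=; ring.
  by split; [move=> i s; exact: is_derive_cont (H i s)|move=> i s _; exact: H].
pose dphi := fun s => dot (F s) (E s).
have dph (s : R) : 0 < s < t -> is_derive s 1 (fun u => dot (w u) (E u)) (dphi s).
  move=> /andP[s0 _]; apply: (is_derive_eq (derive_dot cw cE s0)).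
  rewrite dotDl dotNl !dot_Lam /dphi; ring.
have t2 : 0 < t / 2 by lra.
(* A majorant of the Beta integral of [s^-g (t - s)^(-3/4)]: on each half of [[0, t]] the
   nonsingular factor is replaced by its value at [t / 2]. The exponent [3/4] is the mean of the
   smoothing rates [1/2] of [|Lam E|] and [1] of [|Lam^2 E|]. *)
pose Psi := fun s => (t / 2) `^ (- (3 / 4)) * pint g s - (t / 2) `^ (- g) * pint (3 / 4) (t - s).
pose dPsi := fun s => (t / 2) `^ (- (3 / 4)) * s `^ (- g) + (t / 2) `^ (- g) * (t - s) `^ (- (3 / 4)).
have q1 : (3 / 4 : R) < 1 by lra.
have dPs (s : R) : 0 < s < t -> is_derive s 1 Psi (dPsi s).
  move=> /andP[s0 st].
  have ts : 0 < t - s by lra.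
  have h : is_derive s 1 (fun u => pint (3 / 4) (t - u)) (- (t - s) `^ (- (3 / 4))).
    have h0 : is_derive s 1 (fun u : R => t - u) (0 - 1) := dB (dC t s) (is_derive_id s 1).
    have h1 := is_derive_pint q1 ts.
    have h2 := @d_comp R (pint (3 / 4)) (fun u => t - u) s _ _ h1 h0.
    by rewrite sub0r mulrN1 in h2.
  apply: (is_derive_eq (dB (dZ ((t / 2) `^ (- (3 / 4))) (is_derive_pint g1 s0)) (dZ ((t / 2) `^ (- g)) h))).
  by rewrite /dPsi mulrN opprK.
have cPsi : continuous Psi.
  apply: contB; apply: contM; try exact: contC; first exact: pint_cont.
  by apply: cont_comp; [exact: pint_cont|cont].
have bound (s : R) : 0 < s < t -> dphi s <= K * nrm y * dPsi s.
  move=> hs; case/andP: (hs) => s0 st.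
  have ts : 0 < t - s by lra.
  apply: le_trans (ler_norm _) _; apply: le_trans (HF s (E s) hs) _.
  have e1 : nrm (Lam (E s)) <= (t - s) `^ (- (1 / 2)) * nrm y.
    have := @nrm_sg_smooth R M (t - s) y 1 0 ts; rewrite subr0 -Lam_pow -id_pow -Lam_sg.
    by apply; lra.
  have e2 : nrm (Lam (Lam (E s))) <= (t - s) `^ (- 1) * nrm y.
    have := @nrm_sg_smooth R M (t - s) y 2 0 ts; rewrite subr0 -Lam2_pow -id_pow -!Lam_sg.
    rewrite divff//; apply; lra.
  have e3 : Num.sqrt (nrm (Lam (E s)) * nrm (Lam (Lam (E s)))) <= (t - s) `^ (- (3 / 4)) * nrm y.
    apply: le_of_sq; first by rewrite mulr_ge0// powR_ge0.
    rewrite sqr_sqrtr ?mulr_ge0 ?nrm_ge0//.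
    have -> : ((t - s) `^ (- (3 / 4)) * nrm y) ^+ 2 = ((t - s) `^ (- (1 / 2)) * nrm y) * ((t - s) `^ (- 1) * nrm y).
      rewrite exprMn -powR_mulrn ?powR_ge0// -powRrM.
      have -> : - (3 / 4) * 2%:R = - (1 / 2) + - 1 :> R by lra.
      rewrite powRD; last by apply/implyP => _; rewrite gt_eqF.
      ring.
    by apply: ler_pM; rewrite ?nrm_ge0.
  have e4 : s `^ (- g) * (t - s) `^ (- (3 / 4)) <= dPsi s.
    have p1 := powR_ge0 s (- g); have p2 := powR_ge0 (t - s) (- (3 / 4)).
    have p3 := powR_ge0 (t / 2) (- g); have p4 := powR_ge0 (t / 2) (- (3 / 4)).
    have mono (u v c : R) : 0 < u -> u <= v -> 0 <= c -> v `^ (- c) <= u `^ (- c).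
      move=> u0 uv c0; have v0 : 0 < v by lra.
      rewrite !powRN lef_pV2 ?posrE ?powR_gt0//.
      by apply: ge0_ler_powR; rewrite ?nnegrE// ltW.
    rewrite /dPsi; have [h|h] := leP s (t / 2).
      have : (t - s) `^ (- (3 / 4)) <= (t / 2) `^ (- (3 / 4)) by apply: mono => //; lra.
      nra.
    have : s `^ (- g) <= (t / 2) `^ (- g) by apply: mono => //; lra.
    nra.
  apply: le_trans (ler_wpM2l (mulr_ge0 K0 (powR_ge0 _ _)) e3) _.
  have := ler_wpM2l (mulr_ge0 K0 Ny) e4; glra.
have ph0 : dot (w 0) (E 0) = 0 by rewrite w0 dot0l.
have pht : dot (w t) (E t) = nrm y ^+ 2.
  by rewrite nrm_sq /E dgm1// => i; rewrite subrr mulr0 oppr0 expR0.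
have main : nrm y ^+ 2 <= K * nrm y * (Psi t - Psi 0).
  have := @le_of_derive_le _ (fun s => dot (w s) (E s)) (fun s => K * nrm y * Psi s) dphi (fun s => K * nrm y * dPsi s) 0 t (ltW t0) dph.
  rewrite ph0 pht subr0 -mulrBr; apply.
  - by move=> s hs; apply: dZ; exact: dPs.
  - by move=> s _; apply: cont_dot; [exact: cw.1|exact: cE.1].
  - by move=> s _; apply: contM; [exact: contC|exact: cPsi].
  - exact: bound.
have Psit : Psi t - Psi 0 <= (2 / (1 - g) + 8) * (1 + T) * t `^ (- g).
  rewrite /Psi subrr !pint0// subr0 mulr0 mulr0 !pintE ?(ltW t0)//.
  have -> : 1 - 3 / 4 = 1 / 4 :> R by lra.
  have tq : t `^ (1 / 4) <= 1 + T by apply: pow_ge0_le; lra.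
  have half (c : R) : 0 <= c <= 1 -> (t / 2) `^ (- c) <= 2 * t `^ (- c).
    move=> /andP[c0 c1]; rewrite powRM ?invr_ge0 ?(ltW t0)// mulrC ler_wpM2r ?powR_ge0//.
    have h : 2^-1 <= 2^-1 `^ c :> R.
      rewrite -[leLHS]powRr1 ?invr_ge0//; apply: ger_powR => //.
      by rewrite invr_gt0 ltr0n invf_le1// ler1n.
    by rewrite powRN -[leRHS]invrK lef_pV2 ?posrE ?powR_gt0 ?invr_gt0.
  have a1 : (t / 2) `^ (- (3 / 4)) * (t `^ (1 - g) / (1 - g)) <= 2 / (1 - g) * (t `^ (1 / 4) * t `^ (- g)).
    have -> : t `^ (1 / 4) * t `^ (- g) = t `^ (- (3 / 4)) * t `^ (1 - g).
      rewrite -!powRD; first by congr (_ `^ _); lra.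
      by apply/implyP => _; rewrite gt_eqF.
      by apply/implyP => _; rewrite gt_eqF.
    have h : (t / 2) `^ (- (3 / 4)) <= 2 * t `^ (- (3 / 4)) by apply: half; lra.
    have p : 0 <= t `^ (1 - g) / (1 - g) by rewrite divr_ge0 ?powR_ge0// ltW.
    apply: le_trans (ler_wpM2r p h) _.
    by rewrite le_eqVlt; apply/orP; left; apply/eqP; ring.
  have a2 : (t / 2) `^ (- g) * (t `^ (1 / 4) / (1 / 4)) <= 8 * (t `^ (1 / 4) * t `^ (- g)).
    have h : (t / 2) `^ (- g) <= 2 * t `^ (- g) by apply: half; lra.
    have p : 0 <= t `^ (1 / 4) / (1 / 4) by rewrite divr_ge0 ?powR_ge0.
    apply: le_trans (ler_wpM2r p h) _.
    by rewrite le_eqVlt; apply/orP; left; apply/eqP; field.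
  have a3 : t `^ (1 / 4) * t `^ (- g) <= (1 + T) * t `^ (- g) by rewrite ler_wpM2r ?powR_ge0.
  have c0 : 0 <= 2 / (1 - g) + 8 by rewrite addr_ge0// divr_ge0// ltW.
  have := ler_wpM2l c0 a3.
  move: a1 a2; rewrite sub0r opprK.
  move: (2 / (1 - g)) => c; gen_atoms; clear; intros; lra.
have [y0|yn] := eqVneq (nrm y) 0.
  by rewrite y0 mulr_ge0 ?powR_ge0// mulr_ge0// mulr_ge0//; [rewrite addr_ge0// divr_ge0// ltW|lra].
have yp : 0 < nrm y by rewrite lt_def yn.
rewrite -(ler_pM2r yp) -expr2; apply: (le_trans main).
have := ler_wpM2l (mulr_ge0 K0 Ny) Psit.
move: (2 / (1 - g)) (Psi t - Psi 0) => c d; gen_atoms; clear; intros; lra.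
Qed.

(* [H^1] bound of the nonlinear part [V]; the linear part [W] enters through [|W|_1^2]. *)
Lemma nonlinear_part_estimate X V (W : R -> 'rV[R]_M) (B dB : R -> R) (e t : R) : 0 < t -> 0 < e ->
  ccont X -> curve V (fun s => - Lam (Lam (V s)) + Bq (X s) (X s)) -> V 0 = 0 ->
  (forall s, X s = V s + W s) ->
  (forall s : R, 0 < s < t -> is_derive s 1 B (dB s)) ->
  (forall s : R, 0 <= s <= t -> {for s, continuous B}) -> B 0 = 0 ->
  (forall s : R, 0 < s < t -> 12 * (nrm (X s) * nrm (Lam (X s)) * nrm (Lam (W s)) ^+ 2) <= dB s) ->
  nrm (Lam (V t)) ^+ 2 <= expR (prim (fun s => e * nrm (Lam (X s)) ^+ 2 + 3 / e ^+ 2) t) * B t.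
Proof.
move=> t0 e0 cX cV V0 XE HB cB B0 HdB.
set a := fun s => e * nrm (Lam (X s)) ^+ 2 + 3 / e ^+ 2.
have ca : continuous a.
  have h : continuous (fun s => nrm (Lam (X s))) by apply: cont_nrm; exact: ccont_dgm.
  by rewrite /a; cont.
have a0 (s : R) : 0 <= a s.
  by rewrite /a addr_ge0// mulr_ge0 ?sqr_ge0 ?invr_ge0 ?sqr_ge0// ltW.
have h := @gronwall_prim R (fun s => nrm (Lam (V s)) ^+ 2) a B
  (fun s => 2 * dot (- Lam (Lam (V s)) + Bq (X s) (X s)) (Lam (Lam (V s)))) dB t (ltW t0).
have cLV : continuous (fun s => nrm (Lam (V s))) by apply: cont_nrm; apply: ccont_dgm; exact: cV.1.
have : nrm (Lam (V t)) ^+ 2 <= expR (prim a t) * (nrm (Lam (V 0)) ^+ 2 + B t).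
  apply: h => //.
  - by cont.
  - by move=> s /andP[s0 _]; exact: (derive_energy kp cV s0).
  - move=> s hs; apply: le_trans (HdB s hs); rewrite mulr_ge0// mulr_ge0 ?sqr_ge0//.
    by rewrite mulr_ge0 ?nrm_ge0.
  - move=> s hs; rewrite dotDl dotNl -nrm_sq.
    have := est_V e0 (XE s); rewrite -/(a s).
    have := HdB s hs; glra.
rewrite V0 (_ : Lam 0 = 0) ?nrm0 ?expr0n ?add0r//.
by apply/rowP => i; rewrite !(dgmE, mxE) mulr0.
Qed.

End mild.

Section young.
Context {R : realType}.

(* Splits off an integrable power of time at the price of a high power of [u]. *)
Lemma young_time (g : R) : 0 <= g < 1 -> exists2 p : nat, (1 <= p)%N &
  forall u s : R, 1 <= u -> 0 < s -> u * s `^ (- g) <= 2 * u ^+ p + s `^ (- ((1 + g) / 2)).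
Proof.
move=> /andP[g0 g1].
(* The threshold for [u] is [s^(- (1 - g) / 2)]: below it the product is at most
   [s^(- (1 + g) / 2)]; above it [s^-g <= u^k], since the [k]-th power of the threshold is
   [s^-g]. *)
set k := 2 * g / (1 - g).
have k0 : 0 <= k by rewrite /k divr_ge0//; lra.
have [m km] : exists m : nat, k <= m%:R.
  by exists (Num.bound k); apply: ltW; have := archi_boundP k0.
exists m.+1 => // u s u1 s0.
have u0 : 0 < u by lra.
have g' : 0 < (1 - g) / 2 by lra.
have pos1 := powR_ge0 s (- ((1 + g) / 2)).
have um : 1 <= u ^+ m by exact: exprn_ege1.
have [s1|s1] := leP 1 s.
  have : s `^ (- g) <= 1.
    rewrite powRN invf_le1 ?powR_gt0//.
    have : s `^ 0 <= s `^ g by rewrite ler_powR.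
    by rewrite powRr0.
  move=> h; have : u * s `^ (- g) <= u * 1 by rewrite ler_wpM2l// ltW.
  have : u <= u ^+ m.+1 by rewrite exprS ler_peMr// ltW.
  lra.
have [h|h] := leP u (s `^ (- ((1 - g) / 2))).
  have : u * s `^ (- g) <= s `^ (- ((1 - g) / 2)) * s `^ (- g) by rewrite ler_wpM2r ?powR_ge0.
  rewrite -powRD; last by apply/implyP => _; rewrite gt_eqF.
  have -> : - ((1 - g) / 2) + - g = - ((1 + g) / 2) :> R by lra.
  have : 0 <= u ^+ m.+1 by rewrite exprn_ge0// ltW.
  lra.
have : s `^ (- g) <= u ^+ m.
  apply: (@le_trans _ _ (u `^ k)); last first.
    by rewrite -powR_mulrn ?(ltW u0)// ler_powR.
  have -> : s `^ (- g) = (s `^ (- ((1 - g) / 2))) `^ k.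
    rewrite -powRrM; congr (_ `^ _); rewrite /k; field.
    by rewrite gt_eqF//; lra.
  by apply: ge0_ler_powR => //; rewrite ?nnegrE ?powR_ge0 ?ltW.
move=> h2; have : u * s `^ (- g) <= u * u ^+ m by rewrite ler_wpM2l// ltW.
rewrite exprS; have : 0 <= u * u ^+ m by rewrite mulr_ge0 ?ltW// (lt_le_trans _ um).
lra.
Qed.

(* Jensen, from the tangent line of [u ^+ k.+1] at the mean. *)
Lemma tangent_power (k : nat) (u c : R) : 0 <= u -> 0 <= c ->
  k.+1%:R * u * c ^+ k - k%:R * c ^+ k.+1 <= u ^+ k.+1.
Proof.
move=> u0 c0; elim: k => [|k IH]; first by rewrite mul1r expr0 mulr1 mul0r subr0 expr1.
rewrite (exprS u).
have h1 := ler_wpM2l u0 IH.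
have h2 : 0 <= k.+1%:R * (u - c) ^+ 2 * c ^+ k by rewrite mulr_ge0 ?exprn_ge0// mulr_ge0 ?sqr_ge0.
apply: le_trans h1; rewrite -subr_ge0 (_ : _ - _ = k.+1%:R * (u - c) ^+ 2 * c ^+ k)//.
rewrite !exprS -!natr1; ring.
Qed.

Lemma jensen_prim (f : R -> R) (T : R) (k : nat) : 0 < T -> continuous f -> (forall s, 0 <= f s) ->
  prim f T ^+ k.+1 <= T ^+ k * prim (fun s => f s ^+ k.+1) T.
Proof.
move=> T0 cf f0.
set c := prim f T / T.
have P0 : 0 <= prim f T by apply: prim_ge0 => //; exact: ltW.
have c0 : 0 <= c by rewrite divr_ge0// ltW.
have : prim (fun s => k.+1%:R * c ^+ k * f s + (- (k%:R * c ^+ k.+1))) T <= prim (fun s => f s ^+ k.+1) T.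
  apply: le_prim; [exact: ltW|by cont|by cont|move=> s _].
  have := tangent_power k (f0 s) c0; lra.
rewrite primD; [|by cont|by cont]; rewrite primZ// prim_cst ?(ltW T0)// => h.
have PE : prim f T = T * c by rewrite /c mulrC divfK// gt_eqF.
rewrite {1}PE in h; rewrite PE exprMn exprSr -mulrA.
apply: ler_wpM2l; first by rewrite exprn_ge0// ltW.
apply: le_trans h; rewrite le_eqVlt; apply/orP; left; apply/eqP.
rewrite !exprS -!natr1; ring.
Qed.

End young.

(** * Pathwise bounds for Galerkin solutions and their differences *)

Section embedding.
Context {R : realType} {M : nat}.
Implicit Types (a b c x : 'rV[R]_M) (X Y Z V : R -> 'rV[R]_M).

Definition delta (i : 'I_M) : 'rV[R]_M := \row_j (j == i)%:R.

Lemma deltaE c : c = \sum_(i < M) c ord0 i *: delta i.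
Proof.
apply/rowP => j; rewrite summxE (bigD1 j)//= !mxE eqxx mulr1 big1 ?addr0// => i ij.
by rewrite !mxE eq_sym (negbTE ij) mulr0.
Qed.

Lemma dot_delta c i : dot c (delta i) = c ord0 i.
Proof.
rewrite dotE (bigD1 i)//= mxE eqxx mulr1 big1 ?addr0// => j ji.
by rewrite mxE (negbTE ji) mulr0.
Qed.

Lemma Bq_suml (I : Type) (r : seq I) (F : I -> 'rV[R]_M) b :
  Bq (\sum_(i <- r) F i) b = \sum_(i <- r) Bq (F i) b.
Proof.
elim: r => [|i r IH]; last by rewrite !big_cons BqDl IH.
by rewrite !big_nil; have := BqZl 0 0 b; rewrite !scale0r.
Qed.
Lemma Bq_sumr (I : Type) (r : seq I) (F : I -> 'rV[R]_M) b :
  Bq b (\sum_(i <- r) F i) = \sum_(i <- r) Bq b (F i).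
Proof. by rewrite BqC Bq_suml; apply: eq_bigr => i _; rewrite BqC. Qed.

Lemma ccont_Bq X Y : ccont X -> ccont Y -> ccont (fun s => Bq (X s) (Y s)).
Proof.
move=> cX cY i.
have -> : (fun s => Bq (X s) (Y s) ord0 i) =
  (fun s => \sum_(j < M) \sum_(k < M) X s ord0 j * (Y s ord0 k * Bq (delta j) (delta k) ord0 i)).
  apply: funext => s; rewrite {1}(deltaE (X s)) Bq_suml summxE; apply: eq_bigr => j _.
  rewrite BqZl mxE {1}(deltaE (Y s)) Bq_sumr summxE mulr_sumr; apply: eq_bigr => k _.
  by rewrite BqZr mxE.
apply: cont_sum => j; apply: cont_sum => k.
by apply: contM; [exact: cX|apply: contM; [exact: cY|exact: contC]].
Qed.

Lemma ccont_drift X : ccont X -> ccont (fun s => drift (X s)).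
Proof.
move=> cX i; under eq_fun do rewrite driftE.
move: i; apply: ccontD; last exact: ccont_Bq.
by apply: ccontN; exact: ccont_dgm.
Qed.

Lemma driftB a b : drift a - drift b = - Lam (Lam (a - b)) + Bq (a + b) (a - b).
Proof.
rewrite !driftE BqBr !BqDl (BqC b a) /Lam dgm_dgm dgmB.
rewrite (@eq_dgm _ _ _ (fun i => kp i ^+ 2) a); last by move=> i; rewrite expr2.
rewrite (@eq_dgm _ _ _ (fun i => kp i ^+ 2) b); last by move=> i; rewrite expr2.
apply/rowP => i; rewrite !mxE; ring.
Qed.

Lemma pow_step (p r s : R) : 0 < p -> p <= r -> 0 < s ->
  (r - p) * r `^ (- (1 + s)) <= p `^ (- s) / s - r `^ (- s) / s.
Proof.
move=> p0 pr s0.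
have H (v : R) : 0 < v -> is_derive v 1 (fun v => (- s^-1) * v `^ (- s)) (v `^ (- (1 + s))).
  move=> v0; apply: (is_derive_eq (dZ (- s^-1) (is_derive1_powR (- s) v0))).
  rewrite mulrA mulrNN mulVf ?gt_eqF// mul1r; congr (_ `^ _); lra.
have c1 : continuous (fun v : R => r `^ (- (1 + s)) * v) by cont.
have := @le_of_derive_le R (fun v => r `^ (- (1 + s)) * v) (fun v => (- s^-1) * v `^ (- s))
    (fun v => r `^ (- (1 + s)) * 1) (fun v => v `^ (- (1 + s))) p r pr.
move=> /(_ _ _ _ _ _) K.
have {}K : r `^ (- (1 + s)) * r - r `^ (- (1 + s)) * p <= (- s^-1) * r `^ (- s) - (- s^-1) * p `^ (- s).
  apply: K.
  - by move=> v /andP[x1 _]; apply: H; exact: lt_trans x1.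
  - by move=> v _; exact: c1.
  - by move=> v /andP[x1 _]; apply: is_derive_cont (H v _); exact: lt_le_trans x1.
  - move=> v /andP[x1 x2]; have x0 : 0 < v := lt_trans p0 x1.
    rewrite mulr1 !powRN lef_pV2 ?posrE ?powR_gt0//; last exact: lt_le_trans pr.
    by apply: ge0_ler_powR; rewrite ?nnegrE; lra.
lra.
Qed.

(** Comparison with the integral of [v^(- (1 + s))]; the subtracted tail makes the induction
    telescope. *)
Lemma sum_pow_le (m : nat) (s : R) : 0 < s ->
  \sum_(i < m.+1) (i.+1%:R : R) `^ (- (1 + s)) <= 1 + s^-1 - (m.+1%:R) `^ (- s) / s.
Proof.
move=> s0; elim: m => [|m IH].
  rewrite big_ord_recr big_ord0/= add0r !powR1; lra.
rewrite big_ord_recr/=.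
have m0 : 0 < m.+1%:R :> R by rewrite ltr0n.
have m1 : m.+1%:R <= m.+2%:R :> R by rewrite ler_nat.
have := pow_step m0 m1 s0.
have -> : (m.+2%:R : R) - m.+1%:R = 1 by rewrite -(natr1 m.+1); lra.
by rewrite mul1r; move: IH; lra.
Qed.

(* Sobolev embedding [H^sigma] in [L^oo] for [sigma > 1/2]. *)
Lemma sup_Sf_pow (x : 'rV[R]_M) (sigma z : R) : 1 < 2 * sigma ->
  `|Sf x z| <= Num.sqrt (2 * (1 + (2 * sigma - 1)^-1)) * nrm (dgm (fun i => kp i `^ sigma) x).
Proof.
move=> hs; set b := 2 * sigma - 1; have b0 : 0 < b by rewrite /b; lra.
set y := dgm _ x.
pose c : 'rV[R]_M := \row_i (hk i.+1 z * kp i `^ (- sigma)).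
have -> : Sf x z = dot y c.
  rewrite SfE dotE; apply: eq_bigr => i _; rewrite dgmE mxE.
  have k0 := kp_gt0 (R := R) i.
  have -> : kp i `^ sigma * x ord0 i * (hk i.+1 z * kp i `^ (- sigma)) =
    (kp i `^ sigma * kp i `^ (- sigma)) * (x ord0 i * hk i.+1 z) by ring.
  rewrite -powRD; last by apply/implyP => _; rewrite gt_eqF.
  by rewrite subrr powRr0 mul1r.
apply: le_trans (dot_CS _ _) _; rewrite mulrC ler_wpM2r ?nrm_ge0//.
rewrite nrmE ler_wsqrtr// dotE.
have h1 (i : 'I_M) : c ord0 i * c ord0 i <= 2 * i.+1%:R `^ (- (1 + b)).
  rewrite mxE -expr2 exprMn; apply: ler_pM; rewrite ?sqr_ge0//.
    rewrite /hk exprMn sqr_sqrtr// ler_piMr//.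
  rewrite -powR_mulrn ?powR_ge0// -powRrM.
  have -> : - sigma * 2%:R = - (1 + b) :> R by rewrite /b; lra.
  rewrite !powRN lef_pV2 ?posrE ?powR_gt0 ?kp_gt0 ?ltr0n//.
  apply: ge0_ler_powR; rewrite ?nnegrE ?(ltW (kp_gt0 _))//; first by lra.
  rewrite /kp ler_peMl//; have := @pi_ge2 R; lra.
apply: le_trans (ler_sum _ (fun i _ => h1 i)) _.
rewrite -mulr_sumr ler_wpM2l//.
have bi : 0 < b^-1 by rewrite invr_gt0.
have : \sum_(i < M) (i.+1%:R : R) `^ (- (1 + b)) <= \sum_(i < M.+1) (i.+1%:R : R) `^ (- (1 + b)).
  by rewrite big_ord_recr/= lerDl powR_ge0.
have := sum_pow_le M b0.
have : 0 <= (M.+1%:R : R) `^ (- b) / b by rewrite divr_ge0 ?powR_ge0// ltW.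
lra.
Qed.

End embedding.

Section path_bounds.
Context {R : realType} {M : nat}.
Implicit Types (x : 'rV[R]_M) (X Y Z V W : R -> 'rV[R]_M).

(* [X] is a Galerkin path from [x], split as nonlinear part + [e^{tA} x] + stochastic convolution [Z]. *)
Definition mild_path x X Z := ccont X /\ ccont Z /\
  exists2 V, curve V (fun s => - Lam (Lam (V s)) + Bq (X s) (X s)) &
    V 0 = 0 /\ forall s, X s = V s + (sg s x + Z s).

(* The norm of [(- A)^(sigma / 2) x]. *)
Definition nsig (sigma : R) x := nrm (dgm (fun i => kp i `^ sigma) x).
Definition diss (T : R) X := prim (fun s => nrm (Lam (X s)) ^+ 2) T.
(** The summand 1 makes it at least 1, so that lower powers are dominated by higher ones. *)
Definition moms (T : R) (q : nat) X Z := 1 + diss T X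
  + prim (fun s => (1 + nrm (X s) ^+ 2) ^+ q) T
  + prim (fun s => (1 + nrm (Lam (Z s)) ^+ 2) ^+ q) T.

Lemma cont_nrmL X : ccont X -> continuous (fun s => nrm (Lam (X s))).
Proof. by move=> cX; apply: cont_nrm; exact: ccont_dgm. Qed.

Lemma diss_ge0 T X : 0 <= T -> ccont X -> 0 <= diss T X.
Proof.
move=> T0 cX; apply: prim_ge0 => //; last by move=> s; exact: sqr_ge0.
by have h := cont_nrmL cX; cont.
Qed.

Lemma moms_ge T q X Z : 0 <= T -> ccont X -> ccont Z ->
  [/\ 1 <= moms T q X Z, diss T X <= moms T q X Z,
   prim (fun s => (1 + nrm (X s) ^+ 2) ^+ q) T <= moms T q X Z &
   prim (fun s => (1 + nrm (Lam (Z s)) ^+ 2) ^+ q) T <= moms T q X Z].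
Proof.
move=> T0 cX cZ; have := diss_ge0 T0 cX.
have h1 := cont_nrm cX; have h2 := cont_nrmL cZ.
have : 0 <= prim (fun s => (1 + nrm (X s) ^+ 2) ^+ q) T.
  by apply: prim_ge0 => //; [cont|move=> s; rewrite exprn_ge0// addr_ge0 ?sqr_ge0].
have : 0 <= prim (fun s => (1 + nrm (Lam (Z s)) ^+ 2) ^+ q) T.
  by apply: prim_ge0 => //; [cont|move=> s; rewrite exprn_ge0// addr_ge0 ?sqr_ge0].
rewrite /moms; move: (prim _ _) (prim _ _) (diss _ _) => a b c; clear; intros; split; lra.
Qed.

Lemma prim_expB (e : R) X t : 0 <= t -> ccont X ->
  prim (fun s => e * nrm (Lam (X s)) ^+ 2 + 3 / e ^+ 2) t = e * diss t X + 3 / e ^+ 2 * t.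
Proof.
move=> t0 cX; have h := cont_nrmL cX.
by rewrite primD; [|by cont|by cont]; rewrite primZ; [rewrite prim_cst|cont].
Qed.

Lemma nrm_Lam_sg_le (t sigma : R) x : 0 < t -> 0 <= 1 - sigma <= 2 ->
  nrm (Lam (sg t x)) <= t `^ (- ((1 - sigma) / 2)) * nsig sigma x.
Proof.
move=> t0 hs; have := @nrm_sg_smooth R M t x 1 sigma t0 hs.
by rewrite -Lam_pow -Lam_sg.
Qed.

(** Young, pointwise in time, for the forcing [12 |X| |X|_1 |W|_1^2]: [a = |X|], [b = |X|_1], [w] is
    the squared blow-up rate of [|e^(sA) x|_1] and [z = |Z|_1^2]. The result is a sum of terms with
    known time integrals: the dissipation, high powers, and an integrable power [y] of time. *)
Lemma forcing_le (a b z w l u v up uq vq y : R) : 0 <= a -> 0 <= b -> 0 <= z -> 0 <= w ->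
  1 <= l -> u = 1 + a ^+ 2 -> v = 1 + z -> u ^+ 2 <= uq -> up <= uq -> v ^+ 4 <= vq ->
  u * w ^+ 2 <= 2 * up + y -> 0 <= y ->
  12 * (a * b * (2 * (l * w) + 2 * z)) <= l * (24 * b ^+ 2 + (36 * uq + (12 * vq + 12 * y))).
Proof.
move=> a0 b0 z0 w0 l1 uE vE h1 h2 h3 h4 y0.
have a1 : a * b * w <= 2^-1 * b ^+ 2 + up + 2^-1 * y.
  have := sqr_ge0 (b - a * w); have := sqr_ge0 w; nra.
have a2 : a * b * z <= 2^-1 * b ^+ 2 + 4^-1 * (uq + vq).
  have k1 := sqr_ge0 (b - a * z); have k2 := sqr_ge0 (u - v ^+ 2).
  have k3 : a ^+ 2 * z ^+ 2 <= u * v ^+ 2.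
    by apply: ler_pM; rewrite ?sqr_ge0// ?ler_pXn2r ?nnegrE//; nra.
  have k4 : v ^+ 4 = (v ^+ 2) ^+ 2 by rewrite -exprM.
  nra.
have l0 : 0 <= l by lra.
have b1 := ler_wpM2l l0 a1.
have b2 : 2^-1 * b ^+ 2 + 4^-1 * (uq + vq) <= l * (2^-1 * b ^+ 2 + 4^-1 * (uq + vq)).
  rewrite ler_peMl//; have := sqr_ge0 b; have := sqr_ge0 u.
  have : 0 <= v ^+ 4 by rewrite exprn_even_ge0.
  lra.
have b3 := ler_wpM2l l0 h2.
have b4 : 0 <= l * vq by rewrite mulr_ge0// (le_trans _ h3)// exprn_even_ge0.
have b5 : 0 <= l * uq by rewrite mulr_ge0// (le_trans _ h1)// sqr_ge0.
lra.
Qed.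

Lemma lin_le (s : R) x Z (sigma lam a b : R) : 0 <= 1 - sigma <= 2 -> 1 + nsig sigma x <= lam -> 0 < s ->
  0 <= a -> 0 <= b ->
  12 * (a * b * nrm (Lam (sg s x + Z s)) ^+ 2) <=
  12 * (a * b * (2 * (lam ^+ 2 * (s `^ (- ((1 - sigma) / 2))) ^+ 2) + 2 * nrm (Lam (Z s)) ^+ 2)).
Proof.
move=> hs hl s0 a0 b0; rewrite ler_wpM2l// ler_wpM2l ?mulr_ge0//.
have h1 := nrm_Lam_sg_le x s0 hs.
have p0 := powR_ge0 s (- ((1 - sigma) / 2)).
have h2 : s `^ (- ((1 - sigma) / 2)) * nsig sigma x <= s `^ (- ((1 - sigma) / 2)) * lam.
  by rewrite ler_wpM2l//; lra.
have n0 : 0 <= nsig sigma x by exact: nrm_ge0.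
have h3 : nrm (Lam (sg s x + Z s)) <= nrm (Lam (sg s x)) + nrm (Lam (Z s)).
  by rewrite {1}/Lam dgmD; exact: nrmD.
rewrite -exprMn (mulrC lam).
have h4 : 0 <= s `^ (- ((1 - sigma) / 2)) * lam by rewrite mulr_ge0//; lra.
move: (nrm_ge0 (Lam (sg s x + Z s))) (nrm_ge0 (Lam (Z s))) (le_trans h1 h2) h3 h4.
move: (_ * lam) (nrm _) (nrm _) (nrm _) => c d e f; clear; intros.
have : f ^+ 2 <= (c + e) ^+ 2 by rewrite ler_pXn2r ?nnegrE//; lra.
have := sqr_ge0 (c - e); rewrite sqrrB sqrrD; lra.
Qed.

End path_bounds.

Section uniform.
Context {R : realType}.

(** [H^1] bound of the nonlinear part, quadratic in [lam] because [|e^(sA) x|_1^2] is. The exponent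
    [q] may be any sufficiently large one, so that estimates with different thresholds can share one
    [moms]. *)
Lemma V_bound (sigma T e : R) : 0 < T -> 0 < e -> 1 / 2 < sigma <= 1 ->
  exists2 q0 : nat, (0 < q0)%N & forall q : nat, (q0 <= q)%N -> exists2 C : R, 1 <= C &
  forall (M : nat) (x : 'rV[R]_M) (X Z V : R -> 'rV[R]_M) (lam t : R), 0 < t <= T -> 1 + nsig sigma x <= lam ->
    ccont X -> ccont Z -> curve V (fun s => - Lam (Lam (V s)) + Bq (X s) (X s)) -> V 0 = 0 ->
    (forall s, X s = V s + (sg s x + Z s)) ->
    nrm (Lam (V t)) ^+ 2 <= lam ^+ 2 * C * expR (e * diss T X) * moms T q X Z.
Proof.
move=> T0 e0 /andP[s1 s2].
(* After Young the rate of [|e^(sA) x|_1] enters to the fourth power, [s^(-2 (1 - sigma))], which is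
   integrable exactly when [sigma > 1/2]. *)
set g := 2 * (1 - sigma); have hg : 0 <= g < 1 by rewrite /g; lra.
have [p p1 hp] := young_time hg.
set g' := (1 + g) / 2; have g'1 : g' < 1 by rewrite /g'; lra.
exists (maxn p 4); first by rewrite (leq_trans p1)// leq_maxl.
move=> q; rewrite geq_max => /andP[pq q4].
set c := pint g' T; have c0 : 0 <= c by apply: pint_ge0.
exists (expR (3 / e ^+ 2 * T) * (100 + 12 * c)).
  have : 1 <= expR (3 / e ^+ 2 * T).
    by rewrite -expR0 ler_expR mulr_ge0 ?(ltW T0)// divr_ge0// sqr_ge0.
  by move: (expR _) => E; nra.
move=> M x X Z V lam t /andP[t0 tT] hlam cX cZ cV V0 XE.
have hs2 : 0 <= 1 - sigma <= 2 by lra.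
have gE : g = 2 * (1 - sigma) by [].
have lam1 : 1 <= lam by have := nrm_ge0 (dgm (fun i => kp i `^ sigma) x); rewrite /nsig in hlam; lra.
have cnX := cont_nrm cX; have cLX := cont_nrmL cX; have cLZ := cont_nrmL cZ.
pose A := clamp (prim (fun s => nrm (Lam (X s)) ^+ 2)).
pose U := clamp (prim (fun s => (1 + nrm (X s) ^+ 2) ^+ q)).
pose W := clamp (prim (fun s => (1 + nrm (Lam (Z s)) ^+ 2) ^+ q)).
have cA : continuous (fun s => nrm (Lam (X s)) ^+ 2) by cont.
have cU : continuous (fun s => (1 + nrm (X s) ^+ 2) ^+ q) by cont.
have cW : continuous (fun s => (1 + nrm (Lam (Z s)) ^+ 2) ^+ q) by cont.
pose B := fun s => lam ^+ 2 * (24 * A s + (36 * U s + (12 * W s + 12 * pint g' s))).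
pose dB := fun s => lam ^+ 2 * (24 * nrm (Lam (X s)) ^+ 2 + (36 * (1 + nrm (X s) ^+ 2) ^+ q + (12 * (1 + nrm (Lam (Z s)) ^+ 2) ^+ q + 12 * s `^ (- g')))).
have dcl (f : R -> R) (s : R) : continuous f -> 0 < s -> is_derive s 1 (clamp (prim f)) (f s).
  by move=> cf s0; apply: is_derive_clamp => //; apply: is_derive_prim => //; exact: ltW.
have ccl (f : R -> R) : continuous f -> continuous (clamp (prim f)).
  by move=> cf; apply: clamp_cont => s s0; exact: prim_cont.
have HB (s : R) : 0 < s < t -> is_derive s 1 B (dB s).
  move=> /andP[s0 _]; apply: dZ; apply: dD; first by apply: dZ; exact: dcl.
  apply: dD; first by apply: dZ; exact: dcl.
  by apply: dD; apply: dZ; [exact: dcl|exact: is_derive_pint].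
have cB : continuous B.
  have h1 := ccl _ cA; have h2 := ccl _ cU; have h3 := ccl _ cW; have h4 := pint_cont g'1.
  rewrite /B; apply: contM; first exact: contC.
  by apply: contD; [apply: contM; [exact: contC|exact: h1]|apply: contD; [apply: contM; [exact: contC|exact: h2]|
     apply: contD; (apply: contM; [exact: contC|])]].
have B0 : B 0 = 0 by rewrite /B /A /U /W !clampE// !prim0 pint0// !mulr0 !addr0 mulr0.
have main := @nonlinear_part_estimate R M X V (fun s => sg s x + Z s) B dB e t t0 e0 cX cV V0 XE HB (fun s _ => cB s) B0.
have {}main : nrm (Lam (V t)) ^+ 2 <= expR (prim (fun s => e * nrm (Lam (X s)) ^+ 2 + 3 / e ^+ 2) t) * B t.
  apply: main => s /andP[s0 st].
  have NX := nrm_ge0 (X s); have NLX := nrm_ge0 (Lam (X s)).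
  apply: le_trans (lin_le Z hs2 hlam s0 NX NLX) _.
  set u := 1 + nrm (X s) ^+ 2; set v := 1 + nrm (Lam (Z s)) ^+ 2.
  have u1 : 1 <= u by rewrite /u lerDl sqr_ge0.
  have v1 : 1 <= v by rewrite /v lerDl sqr_ge0.
  apply: (@forcing_le R _ _ _ _ _ u v (u ^+ p)) => //; try exact: sqr_ge0.
  - exact: exprn_ege1.
  - by apply: ler_weXn2l => //; rewrite (leq_trans _ q4).
  - exact: ler_weXn2l.
  - exact: ler_weXn2l.
  - rewrite -exprM -powR_mulrn ?powR_ge0// -powRrM.
    have -> : - ((1 - sigma) / 2) * (2 * 2)%N%:R = - g by rewrite natrM gE; field.
    exact: hp.
  - exact: powR_ge0.
have [m1 mA mU mW] := moms_ge q (ltW T0) cX cZ.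
have Bt : B t <= lam ^+ 2 * ((100 + 12 * c) * moms T q X Z).
  rewrite /B ler_wpM2l ?sqr_ge0//.
  have pm (f : R -> R) : continuous f -> (forall s, 0 <= f s) -> clamp (prim f) t <= prim f T.
    by move=> cf f0; rewrite clampE ?(ltW t0)//; apply: le_prim_t => //; exact: ltW.
  have h1 : A t <= moms T q X Z by apply: le_trans (pm _ cA _) mA => s; exact: sqr_ge0.
  have h2 : U t <= moms T q X Z.
    by apply: le_trans (pm _ cU _) mU => s; rewrite exprn_ge0// addr_ge0 ?sqr_ge0.
  have h3 : W t <= moms T q X Z.
    by apply: le_trans (pm _ cW _) mW => s; rewrite exprn_ge0// addr_ge0 ?sqr_ge0.
  have h4 : pint g' t <= c.
    rewrite /c !pintE ?(ltW T0) ?(ltW t0)// ler_wpM2r ?invr_ge0 ?subr_ge0 ?(ltW g'1)//.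
    by apply: ge0_ler_powR; rewrite ?nnegrE ?(ltW T0) ?(ltW t0)// subr_ge0 ltW.
  have h5 : c <= c * moms T q X Z by rewrite ler_peMr.
  move: h1 h2 h3 h4 h5 m1; clear; move: (A t) (U t) (W t) (pint g' t) (moms _ _ _ _) => *; lra.
have Bt0 : 0 <= B t.
  have := @le_of_derive_le _ (fun=> 0) B (fun=> 0) dB 0 t (ltW t0) (fun s _ => dC 0 s) HB (fun s _ => @cst_continuous _ _ _ _) (fun s _ => cB s).
  rewrite B0 subrr subr0; apply => s hs.
  rewrite mulr_ge0 ?sqr_ge0// !addr_ge0// mulr_ge0// ?sqr_ge0 ?powR_ge0 ?exprn_ge0// addr_ge0 ?sqr_ge0//.
apply: (le_trans main).
rewrite prim_expB ?(ltW t0)//.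
have hE : expR (e * diss t X + 3 / e ^+ 2 * t) <= expR (e * diss T X) * expR (3 / e ^+ 2 * T).
  rewrite -expRD ler_expR; apply: lerD.
    apply: ler_wpM2l; first exact: ltW.
    by apply: le_prim_t => //; [exact: ltW|move=> s; exact: sqr_ge0].
  by apply: ler_wpM2l => //; apply: divr_ge0 => //; exact: sqr_ge0.
apply: le_trans (ler_pM (expR_ge0 _) Bt0 hE Bt) _.
rewrite le_eqVlt; apply/orP; left; apply/eqP; ring.
Qed.

End uniform.

Section sup_est.
Context {R : realType} {M : nat}.
Implicit Types (x h : 'rV[R]_M) (X Y Z V W S : R -> 'rV[R]_M).

Lemma sup_Sf2 (a : 'rV[R]_M) (z : R) : 0 <= z <= 1 -> `|Sf a z| <= 2 * nrm (Lam a).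
Proof.
move=> hz; apply: le_of_sq; first by rewrite mulr_ge0 ?nrm_ge0.
rewrite real_normK ?num_real//; apply: le_trans (sup_Sf a hz) _.
have := nrm_Lam_ge a; have := nrm_ge0 a; move: (nrm a) (nrm _) => u v; nra.
Qed.

Lemma nsig_sg (s sigma : R) x : 0 <= s -> nsig sigma (sg s x) <= nsig sigma x.
Proof.
move=> s0; rewrite /nsig /sg dgm_dgm; apply: nrm_dgm_le => i.
rewrite ger0_norm ?mulr_ge0 ?powR_ge0 ?expR_ge0// ler_piMr ?powR_ge0//.
by rewrite expR_le1 oppr_le0 mulr_ge0// sqr_ge0.
Qed.

End sup_est.

Section path_estimates.
Context {R : realType}.

(** In [X = V + e^(sA) x + Z] the outer summands are controlled by their [H^1] norms, the middle one
    only by the embedding of [H^sigma] in [L^oo]. The bound is linear in [lam], hence so is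
    [theta]. *)
Lemma sup_bound (sigma T e : R) : 0 < T -> 0 < e -> 1 / 2 < sigma <= 1 ->
  exists2 q0 : nat, (0 < q0)%N & forall q : nat, (q0 <= q)%N -> exists2 C : R, 1 <= C &
  forall (M : nat) (x : 'rV[R]_M) (X Z : R -> 'rV[R]_M) (lam s z : R), 0 < s <= T -> 0 <= z <= 1 -> 1 + nsig sigma x <= lam ->
    mild_path x X Z ->
    `|Sf (X s) z| <= lam * (C * expR (e * diss T X) * moms T q X Z) * (1 + nrm (Lam (Z s)) ^+ 2).
Proof.
move=> T0 e0 hs; have [q0 q00 H] := V_bound T0 e0 hs.
exists q0 => // q qq; have [C C1 HC] := H q qq.
set K := Num.sqrt (2 * (1 + (2 * sigma - 1)^-1)).
have K0 : 0 <= K by exact: sqrtr_ge0.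
exists (2 * C + K + 2); first by lra.
move=> M x X Z lam s z hsT hz hlam [cX [cZ [V cV [V0 XE]]]].
have [s0 sT] := andP hsT.
have := HC M x X Z V lam s hsT hlam cX cZ cV V0 XE.
have [Q1 _ _ _] := moms_ge q (ltW T0) cX cZ.
have E1 : 1 <= expR (e * diss T X).
  by rewrite -expR0 ler_expR mulr_ge0 ?(ltW e0)// diss_ge0// ltW.
have ns : 0 <= nsig sigma x by exact: nrm_ge0.
have v1 : 1 <= 1 + nrm (Lam (Z s)) ^+ 2 by rewrite lerDl sqr_ge0.
rewrite XE SfD SfD => hV.
have b1 := sup_Sf2 (V s) hz; have b3 := sup_Sf2 (Z s) hz.
have b2 : `|Sf (sg s x) z| <= K * nsig sigma (sg s x).
  by apply: sup_Sf_pow; case/andP: hs => h1 h2; lra.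
have b4 := ler_wpM2l K0 (nsig_sg sigma x (ltW s0)).
have b5 : 2 * nrm (Lam (Z s)) <= 1 + nrm (Lam (Z s)) ^+ 2.
  by have := sqr_ge0 (nrm (Lam (Z s)) - 1); rewrite sqrrB; move: (nrm _) => w; lra.
have b6 : nrm (Lam (V s)) <= lam * (C * expR (e * diss T X) * moms T q X Z).
  apply: le_of_sq; first by rewrite !mulr_ge0//; lra.
  apply: (le_trans hV); rewrite exprMn.
  have -> : lam ^+ 2 * C * expR (e * diss T X) * moms T q X Z = lam ^+ 2 * (C * expR (e * diss T X) * moms T q X Z).
    by rewrite !mulrA.
  have p1 : 1 <= C * expR (e * diss T X) * moms T q X Z.
    by apply: mulr_ege1 => //; exact: mulr_ege1.
  apply: ler_wpM2l; first exact: sqr_ge0.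
  by rewrite expr2 ler_peMl//; exact: le_trans p1.
apply: le_trans (ler_normD _ _) _.
have b7 := ler_normD (Sf (sg s x) z) (Sf (Z s) z).
pose P := expR (e * diss T X) * moms T q X Z.
have P1 : 1 <= P by exact: mulr_ege1.
have PE (c : R) : c * expR (e * diss T X) * moms T q X Z = c * P by rewrite -mulrA.
rewrite PE in b6 *.
set v := 1 + _ in v1 b5 *.
have l1 : 1 <= lam by lra.
clearbody P v K.
have C0 : 0 <= C by exact: le_trans C1.
have P0 : 0 <= P by exact: le_trans P1.
have l0 : 0 <= lam by exact: le_trans l1.
have c1 : lam * (C * P) <= lam * (C * P) * v.
  by rewrite ler_peMr//; apply: mulr_ge0 => //; exact: mulr_ge0.
have c2 : K * lam <= lam * (K * P) * v.
  rewrite [leLHS]mulrC -mulrA; apply: ler_wpM2l => //; rewrite -mulrA ler_peMr//.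
  exact: mulr_ege1.
have c3 : v <= lam * P * v.
  by rewrite ler_peMl//; [exact: le_trans v1|exact: mulr_ege1].
have c4 : K * nsig sigma x <= K * lam.
  by apply: ler_wpM2l => //; apply: le_trans hlam; rewrite lerDr.
rewrite PE.
have -> : lam * ((2 * C + K + 2) * P) * v = 2 * (lam * (C * P) * v) + lam * (K * P) * v + 2 * (lam * P * v).
  by ring.
move: v1 b1 b2 b3 b4 b5 b6 b7 c1 c2 c3 c4; clear.
move: (nrm (Lam (V s))) (nrm (Lam (Z s))) (K * nsig sigma (sg s x)) (K * nsig sigma x) => n1 n2 n3 n4.
move: (K * lam) (lam * (C * P)) (lam * (K * P) * v) (lam * P * v) => n5 n6 n7 n8.
move: (`|_|) (`|_|) (`|_|) (`|_|) (n6 * v) => m1 m2 m3 m4 m5.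
move: n1 n2 n3 n4 n5 n6 n7 n8 m1 m2 m3 m4 m5 => /= n1 n2 n3 n4 n5 n6 n7 n8 m1 m2 m3 m4 m5 *.
lra.
Qed.

Lemma sum4_sq (a : 'I_4 -> R) : (\sum_i a i) ^+ 2 <= 4 * \sum_i a i ^+ 2.
Proof.
rewrite !big_ord_recl !big_ord0 !addr0.
move: (a _) (a _) (a _) (a _) => p q r s.
have := sqr_ge0 (p - q); have := sqr_ge0 (p - r); have := sqr_ge0 (p - s).
have := sqr_ge0 (q - r); have := sqr_ge0 (q - s); have := sqr_ge0 (r - s).
nra.
Qed.

Definition tdiss {M : nat} {I : finType} (T : R) (Xs : I -> R -> 'rV[R]_M) := \sum_i diss T (Xs i).
Definition tmoms {M : nat} {I : finType} (T : R) q (Xs Zs : I -> R -> 'rV[R]_M) := \sum_i moms T q (Xs i) (Zs i).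
(* The random Lipschitz constant of the flow on the bounded set measured by [lam]. *)
Definition theta {M : nat} {I : finType} (T e : R) q (lam : R) (Xs Zs : I -> R -> 'rV[R]_M) :=
  lam * expR (10 * e * tdiss T Xs) * tmoms T q Xs Zs ^+ 3.

(** [S] is any path dominated by four Galerkin paths, which covers the sum of two and the
    combination in [pair_drift]. Exponents of [theta], with [E = e^(e A)]: Gronwall gives [E^8],
    since the square of a sum of four terms is at most four times the sum of squares and the
    exponent is doubled; the squared supremum bound gives [E^2 Q^2]; one more [Q] comes from the
    time integral of powers of [Z]. *)
Lemma remainder_core (sigma T e g : R) : 0 < T -> 0 < e -> 1 / 2 < sigma <= 1 -> 0 <= g < 1 ->
  exists2 q0 : nat, (0 < q0)%N & forall q : nat, (q0 <= q)%N -> exists2 C : R, 1 <= C &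
  forall (M : nat) (xs : 'I_4 -> 'rV[R]_M) (Xs Zs : 'I_4 -> R -> 'rV[R]_M) (S r w : R -> 'rV[R]_M) (lam t K : R),
    0 < t <= T -> (forall i, 1 + nsig sigma (xs i) <= lam) -> (forall i, mild_path (xs i) (Xs i) (Zs i)) ->
    ccont S -> (forall s z, `|Sf (S s) z| <= \sum_i `|Sf (Xs i s) z|) ->
    (forall s, nrm (Lam (S s)) <= \sum_i nrm (Lam (Xs i s))) ->
    0 <= K -> curve r (fun s => - Lam (Lam (r s)) + (Bq (S s) (r s) + Bq (S s) (w s))) -> r 0 = 0 ->
    (forall s : R, 0 < s < t -> nrm (w s) <= K * s `^ (- g)) ->
    nrm (r t) <= C * K * t `^ (- g) * theta T e q lam Xs Zs.
Proof.
move=> T0 e0 hs hg; have [q1 q10 H] := sup_bound T0 e0 hs.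
have [p p1 hp] := young_time hg; have [g0 g1] := andP hg.
set g' := (1 + g) / 2; have g'1 : g' < 1 by rewrite /g'; lra.
(* [2 * p] because [young_time] is applied with [u = v^2]. *)
exists (maxn q1 (2 * p)); first by rewrite (leq_trans q10)// leq_maxl.
move=> q; rewrite geq_max => /andP[qq pq]; have [C C1 HC] := H q qq.
set c := pint g' T; have c0 : 0 <= c by apply: pint_ge0.
have g10 : 0 <= (1 - g)^-1 by rewrite invr_ge0; lra.
set F := expR (6 / e ^+ 2 * T).
have F1 : 1 <= F.
  by rewrite -expR0 ler_expR mulr_ge0 ?(ltW T0)// divr_ge0// sqr_ge0.
set H0 := 4 * C ^+ 2 * (2 + 4 * c).
have H00 : 0 <= H0 by rewrite mulr_ge0 ?mulr_ge0 ?sqr_ge0//; lra.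
exists (2 * (1 + T) * F * (H0 + (1 - g)^-1 + 1)).
  have a1 : 1 <= H0 + (1 - g)^-1 + 1 by lra.
  have a2 : 1 <= 2 * (1 + T) by lra.
  by apply: mulr_ege1 => //; apply: mulr_ege1.
move=> M xs Xs Zs S r w lam t K htT hlam hX cS supS LS K0 cr r0 Hw.
have [t0 tT] := andP htT.
have cX i : ccont (Xs i) by case: (hX i).
have cZ i : ccont (Zs i) by case: (hX i) => _ [].
set A := tdiss T Xs; set Q := tmoms T q Xs Zs.
have A0i i : 0 <= diss T (Xs i) by apply: diss_ge0 => //; exact: ltW.
have Ai i : diss T (Xs i) <= A.
  by rewrite /A /tdiss (bigD1 i)//= lerDl; apply: sumr_ge0 => j _; exact: A0i.
have A0 : 0 <= A by apply: sumr_ge0 => i _; exact: A0i.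
have Q1i i : 1 <= moms T q (Xs i) (Zs i) by have [] := moms_ge q (ltW T0) (cX i) (cZ i).
have Qi i : moms T q (Xs i) (Zs i) <= Q.
  by rewrite /Q /tmoms (bigD1 i)//= lerDl; apply: sumr_ge0 => j _; exact: le_trans (Q1i j).
have Q1 : 1 <= Q by apply: le_trans (Q1i ord0) (Qi ord0).
set E := expR (e * A).
have E1 : 1 <= E by rewrite -expR0 ler_expR mulr_ge0// ltW.
have lam1 : 1 <= lam.
  have := hlam ord0; have : 0 <= nsig sigma (xs ord0) by exact: nrm_ge0.
  by move: (nsig _ _) => a; clear; lra.
pose v i s := 1 + nrm (Lam (Zs i s)) ^+ 2.
have v1 i s : 1 <= v i s by rewrite /v lerDl sqr_ge0.
pose n s := lam * (C * E * Q) * \sum_i v i s.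
have Hn (s z : R) : 0 < s < t -> 0 <= z <= 1 -> `|Sf (S s) z| <= n s.
  move=> /andP[s0 st] hz; apply: le_trans (supS s z) _.
  rewrite /n mulr_sumr; apply: ler_sum => i _.
  have hsT : 0 < s <= T by rewrite s0/=; exact: ltW (lt_le_trans st tT).
  apply: le_trans (HC _ _ _ _ lam s z hsT hz (hlam i) (hX i)) _.
  apply: ler_wpM2r; first exact: le_trans (v1 i s).
  apply: ler_wpM2l; first exact: le_trans lam1.
  have b1 : expR (e * diss T (Xs i)) <= E by rewrite ler_expR ler_wpM2l// ltW.
  apply: ler_pM; [| |apply: ler_wpM2l => //|exact: Qi].
  - by apply: mulr_ge0; [exact: le_trans C1|exact: expR_ge0].
  - exact: le_trans (Q1i i).
  - exact: le_trans C1.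
have cv i : continuous (fun s => v i s ^+ q).
  by have hh := cont_nrmL (cZ i); rewrite /v; cont.
pose P i := clamp (prim (fun s => v i s ^+ q)).
set k := 4 * (C * E * Q) ^+ 2.
have k0 : 0 <= k by rewrite mulr_ge0// sqr_ge0.
pose G s := k * \sum_i (2 * P i s + pint g' s).
pose dG s := k * \sum_i (2 * v i s ^+ q + s `^ (- g')).
have HG (s : R) : 0 < s < t -> is_derive s 1 G (dG s).
  move=> /andP[s0 _]; apply: dZ; apply: dsum => i; apply: dD; last exact: is_derive_pint.
  apply: dZ; apply: is_derive_clamp => //; apply: is_derive_prim; [exact: cv|exact: ltW].
have cG : continuous G.
  apply: contM; first exact: contC.
  apply: cont_sum => i; apply: contD; last exact: pint_cont.
  apply: contM; first exact: contC.
  by apply: clamp_cont => s s0; apply: prim_cont => //; exact: cv.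
have G0 : G 0 = 0.
  by rewrite /G big1 ?mulr0// => i _; rewrite /P clampE// prim0 mulr0 pint0// addr0.
have HdG (s : R) : 0 < s < t -> (n s / lam) ^+ 2 * s `^ (- g) <= dG s.
  move=> /andP[s0 st].
  have -> : (n s / lam) ^+ 2 = (C * E * Q) ^+ 2 * (\sum_i v i s) ^+ 2.
    rewrite /n -exprMn; congr (_ ^+ 2).
    have : lam != 0 by rewrite gt_eqF//; lra.
    by move=> l0; rewrite -!mulrA mulrC -!mulrA mulVf// mulr1; ring.
  have b1 := sum4_sq (fun i => v i s).
  have b2 : (\sum_i v i s ^+ 2) * s `^ (- g) <= \sum_i (2 * v i s ^+ q + s `^ (- g')).
    rewrite mulr_suml; apply: ler_sum => i _.
    apply: le_trans (hp _ s (exprn_ege1 2 (v1 i s)) s0) _.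
    rewrite -/g' lerD2r ler_wpM2l// -exprM; exact: ler_weXn2l.
  have b3 := ler_wpM2r (powR_ge0 s (- g)) b1.
  have b4 := ler_wpM2l (sqr_ge0 (C * E * Q)) b3.
  have b5 := ler_wpM2l k0 b2.
  rewrite -mulrA; apply: (le_trans b4); apply: le_trans b5.
  by rewrite /k le_eqVlt; apply/orP; left; apply/eqP; ring.
have l0 : 0 < lam by lra.
have := @remainder_estimate R M S r w n G dG t T e K lam g htT e0 K0 l0 hg cS cr r0 Hn Hw HG (fun s _ => cG s) G0 HdG.
set B := prim _ t.
have HB : 2 * B <= 8 * e * A + 6 / e ^+ 2 * T.
  have cL := cont_nrmL cS.
  have cLi i := cont_nrmL (cX i).
  have : B <= prim (fun s => 4 * e * (\sum_i nrm (Lam (Xs i s)) ^+ 2) + 3 / e ^+ 2) t.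
    apply: le_prim; [exact: ltW|by cont| |].
      apply: contD; last exact: contC.
      by apply: contM; [exact: contC|apply: cont_sum => i; apply: contX; exact: cLi].
    move=> s _; rewrite lerD2r (mulrC 4) -mulrA; apply: ler_wpM2l; first exact: ltW.
    apply: le_trans (sum4_sq _); rewrite ler_pXn2r ?nnegrE ?nrm_ge0//.
    by apply: sumr_ge0 => i _; exact: nrm_ge0.
  have cs : continuous (fun s => \sum_i nrm (Lam (Xs i s)) ^+ 2).
    by apply: cont_sum => i; apply: contX; exact: cLi.
  rewrite primD; [|by cont|by cont]; rewrite primZ// prim_cst ?(ltW t0)//.
  have -> : prim (fun s => \sum_i nrm (Lam (Xs i s)) ^+ 2) t = \sum_i diss t (Xs i).
    rewrite primE ?(ltW t0)// cint_sum; last by move=> i; apply: contX; exact: cLi.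
    by apply: eq_bigr => i _; rewrite /diss primE ?(ltW t0)//; apply: contX; exact: cLi.
  have b1 : \sum_i diss t (Xs i) <= A.
    apply: ler_sum => i _; apply: le_prim_t => //; [exact: ltW|by apply: contX; exact: cLi|by move=> s; exact: sqr_ge0].
  have b2 := ler_wpM2l (ltW e0) b1.
  have e20 : 0 <= 3 / e ^+ 2 by rewrite divr_ge0// sqr_ge0.
  have b3 := ler_wpM2l e20 tT.
  have -> : 6 / e ^+ 2 * T = 2 * (3 / e ^+ 2 * T) by lra.
  move: b2 b3; move: (\sum_i _) (3 / e ^+ 2 * T) (3 / e ^+ 2 * t) => a b d; clear; intros; lra.
have HE : expR (2 * B) <= F * E ^+ 8.
  apply: (@le_trans _ _ (expR (8 * e * A + 6 / e ^+ 2 * T))); first by rewrite ler_expR.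
  rewrite expRD mulrC; apply: ler_wpM2l; first exact: expR_ge0.
  by rewrite /E -expRM_natl mulrA.
have HGt : G t <= H0 * (E ^+ 2 * Q ^+ 3).
  have b1 i : 2 * P i t + pint g' t <= 2 * moms T q (Xs i) (Zs i) + c.
    have [_ _ _ mW] := moms_ge q (ltW T0) (cX i) (cZ i).
    apply: lerD.
      rewrite ler_wpM2l// /P clampE ?(ltW t0)//; apply: le_trans mW.
      have := @le_prim_t R (fun s => v i s ^+ q) t T (ltW t0) tT (cv i); apply.
      by move=> s; apply: exprn_ge0; exact: le_trans (v1 i s).
    rewrite /c !pintE ?(ltW T0) ?(ltW t0)// ler_wpM2r ?invr_ge0 ?subr_ge0 ?(ltW g'1)//.
    by apply: ge0_ler_powR; rewrite ?nnegrE ?(ltW T0) ?(ltW t0)// subr_ge0 ltW.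
  have b2 : \sum_i (2 * P i t + pint g' t) <= (2 + 4 * c) * Q.
    apply: le_trans (ler_sum _ (fun i _ => b1 i)) _.
    rewrite big_split/= -mulr_sumr -/(tmoms T q Xs Zs) -/Q sumr_const card_ord -mulr_natl.
    have : c <= c * Q by rewrite ler_peMr.
    clear; lra.
  have := ler_wpM2l k0 b2; rewrite -/(G t) => /le_trans; apply.
  by rewrite /k /H0 le_eqVlt; apply/orP; left; apply/eqP; ring.
move=> main; apply: (le_trans main).
have Gt0 : 0 <= G t.
  have := @le_of_derive_le _ (fun=> 0) G (fun=> 0) dG 0 t (ltW t0) (fun s _ => dC 0 s) HG (fun s _ => @cst_continuous _ _ _ _) (fun s _ => cG s).
  rewrite G0 subrr subr0; apply => s hs'; apply: le_trans (HdG s hs').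
  by rewrite mulr_ge0 ?sqr_ge0 ?powR_ge0.
have X0 : 0 <= 2 * (1 + T) * K * lam * t `^ (- g).
  by rewrite mulr_ge0 ?powR_ge0// mulr_ge0 ?(ltW l0)// mulr_ge0//; lra.
have EQ1 : 1 <= E ^+ 2 * Q ^+ 3 by apply: mulr_ege1; exact: exprn_ege1.
have HG2 : G t + (1 - g)^-1 <= (H0 + (1 - g)^-1 + 1) * (E ^+ 2 * Q ^+ 3).
  have : (1 - g)^-1 <= (1 - g)^-1 * (E ^+ 2 * Q ^+ 3) by rewrite ler_peMr.
  by move: HGt EQ1; move: (G t) (E ^+ 2 * _) ((1 - g)^-1) => a b d; clear; lra.
have G20 : 0 <= G t + (1 - g)^-1 by rewrite addr_ge0.
have HEX : 2 * (1 + T) * K * lam * t `^ (- g) * expR (2 * B) <= 2 * (1 + T) * K * lam * t `^ (- g) * (F * E ^+ 8).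
  by rewrite ler_wpM2l.
have X1 : 0 <= 2 * (1 + T) * K * lam * t `^ (- g) * expR (2 * B) by rewrite mulr_ge0 ?expR_ge0.
apply: le_trans (ler_pM X1 G20 HEX HG2) _.
rewrite /theta -/A -/Q.
have -> : expR (10 * e * A) = E ^+ 8 * E ^+ 2 by rewrite -exprD /E -expRM_natl mulrA.
by rewrite le_eqVlt; apply/orP; left; apply/eqP; ring.
Qed.

End path_estimates.

Section differences.
Context {R : realType}.

Lemma theta_ge1 (M : nat) (T e sigma lam : R) q (xs : 'I_4 -> 'rV[R]_M) Xs Zs : 0 <= T -> 0 <= e ->
  (forall i, 1 + nsig sigma (xs i) <= lam) -> (forall i, mild_path (xs i) (Xs i) (Zs i)) ->
  1 <= theta T e q lam Xs Zs.
Proof.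
move=> T0 e0 hlam hX.
have cX i : ccont (Xs i) by case: (hX i).
have cZ i : ccont (Zs i) by case: (hX i) => _ [].
have l1 : 1 <= lam by apply: le_trans (hlam ord0); rewrite lerDl; exact: nrm_ge0.
have A0 : 0 <= tdiss T Xs by apply: sumr_ge0 => i _; exact: diss_ge0.
have Q1 : 1 <= tmoms T q Xs Zs.
  have Q1i i : 1 <= moms T q (Xs i) (Zs i) by have [] := moms_ge q T0 (cX i) (cZ i).
  rewrite /tmoms (bigD1 ord0)//=; apply: le_trans (Q1i ord0) _; rewrite lerDl.
  by apply: sumr_ge0 => i _; exact: le_trans (Q1i i).
apply: mulr_ege1; last exact: exprn_ege1.
apply: mulr_ege1 => //; rewrite -expR0 ler_expR; apply: mulr_ge0 => //; exact: mulr_ge0.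
Qed.

Lemma sum_pair_le (f : 'I_4 -> R) i j : i != j -> (forall k, 0 <= f k) -> f i + f j <= \sum_k f k.
Proof.
move=> ij f0; rewrite (bigD1 i)//= lerD2l (bigD1 j)/= 1?eq_sym// lerDl.
by apply: sumr_ge0 => k _.
Qed.

(** Subtracting the heat flow of the initial difference [h] leaves a remainder that starts at 0 and
    is forced by [B(S, e^(sA) h)], with [|e^(sA) h| <= s^-al |(- A)^-al h|]. The family has four
    members throughout, so that one [theta] serves first and second differences. *)
Lemma first_difference (sigma T e al : R) : 0 < T -> 0 < e -> 1 / 2 < sigma <= 1 -> 0 <= al < 1 ->
  exists2 q0 : nat, (0 < q0)%N & forall q : nat, (q0 <= q)%N -> exists2 C : R, 1 <= C &
  forall (M : nat) (xs : 'I_4 -> 'rV[R]_M) (Xs Zs : 'I_4 -> R -> 'rV[R]_M) (i j : 'I_4) (lam t : R),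
    i != j -> 0 < t <= T -> (forall k, 1 + nsig sigma (xs k) <= lam) ->
    (forall k, mild_path (xs k) (Xs k) (Zs k)) -> Xs i 0 - Xs j 0 = xs i - xs j ->
    curve (fun s => Xs i s - Xs j s) (fun s => drift (Xs i s) - drift (Xs j s)) ->
    nrm (Xs i t - Xs j t) <= C * t `^ (- al) * nsig (- (2 * al)) (xs i - xs j) * theta T e q lam Xs Zs.
Proof.
move=> T0 e0 hs hal; have [q0 q00 H] := remainder_core T0 e0 hs hal.
exists q0 => // q qq; have [C C1 HC] := H q qq.
exists (1 + C); first by lra.
move=> M xs Xs Zs i j lam t ij htT hlam hX D0 cD.
have [t0 tT] := andP htT; have [a0 a1] := andP hal.
have cX k : ccont (Xs k) by case: (hX k).
set h := xs i - xs j; set K := nsig (- (2 * al)) h.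
have K0 : 0 <= K by exact: nrm_ge0.
have Hw (s : R) : 0 < s -> nrm (sg s h) <= K * s `^ (- al).
  move=> s0; have := @nrm_sg_smooth R M s h 0 (- (2 * al)) s0.
  rewrite -id_pow (_ : (0 - - (2 * al)) / 2 = al); last by field.
  by move=> hh; rewrite [leRHS]mulrC; apply: hh; lra.
pose S s := Xs i s + Xs j s.
pose r s := (Xs i s - Xs j s) - sg s h.
have cr : curve r (fun s => - Lam (Lam (r s)) + (Bq (S s) (r s) + Bq (S s) (sg s h))).
  apply: curve_eq (curveB cD (curve_sg h)) => s _.
  rewrite driftB -BqDr /r subrK /Lam [in RHS]dgmB [in RHS]dgmB.
  by rewrite opprD !opprK -!addrA; congr (_ + _); rewrite addrC.
have r0 : r 0 = 0 by rewrite /r sg0 D0 subrr.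
have rt := HC M xs Xs Zs S r (fun s => sg s h) lam t K htT hlam hX.
have {}rt : nrm (r t) <= C * K * t `^ (- al) * theta T e q lam Xs Zs.
  apply: rt => //.
  - exact: ccontD.
  - move=> s z; rewrite SfD; apply: le_trans (ler_normD _ _) _.
    exact: (@sum_pair_le (fun k => `|Sf (Xs k s) z|)).
  - move=> s; rewrite /Lam dgmD; apply: le_trans (nrmD _ _) _.
    by apply: (@sum_pair_le (fun k => nrm (dgm kp (Xs k s)))) => // k; exact: nrm_ge0.
  - by move=> s /andP[s0 _]; exact: Hw.
have th1 := theta_ge1 q (ltW T0) (ltW e0) hlam hX.
have -> : Xs i t - Xs j t = r t + sg t h by rewrite /r subrK.
apply: le_trans (nrmD _ _) _.
have h1 := Hw t t0.
have h2 : K * t `^ (- al) <= K * t `^ (- al) * theta T e q lam Xs Zs.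
  by rewrite ler_peMr// mulr_ge0// powR_ge0.
move: rt h1 h2; move: (theta _ _ _ _ _ _) (t `^ _) => th p; clear.
have -> : (1 + C) * p * K * th = K * p * th + C * K * p * th by ring.
move: (K * p * th) (K * p) (C * K * p * th) (nrm _) (nrm _) => *; lra.
Qed.

Lemma SfB (M : nat) (a b : 'rV[R]_M) (z : R) : Sf (a - b) z = Sf a z - Sf b z.
Proof. by rewrite -scaleN1r SfD SfZ mulN1r. Qed.

Lemma pow_addN (s a b : R) : 0 < s -> s `^ (- (a + b)) = s `^ (- a) * s `^ (- b).
Proof. by move=> s0; rewrite opprD powRD//; apply/implyP => _; rewrite gt_eqF. Qed.

(** The quadratic term is arranged so that the second difference is transported by a combination of
    the four paths, while the source is the product of the two first differences from the common
    base point [d]. *)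
Lemma pair_drift (M : nat) (a b c d : 'rV[R]_M) :
  (drift a - drift b) - (drift c - drift d) =
  - Lam (Lam ((a - b) - (c - d))) + (Bq (a + b + c - d) ((a - b) - (c - d)) + 2 *: Bq (b - d) (c - d)).
Proof.
rewrite !driftE /Lam !dgm_dgm (@eq_dgm _ _ _ (fun i => kp i ^+ 2)); last by move=> i; rewrite expr2.
rewrite [in RHS]dgmB [in RHS]dgmB [in RHS]dgmB.
have -> : Bq (a + b + c - d) (a - b - (c - d)) + 2 *: Bq (b - d) (c - d) =
    Bq a a - Bq b b - Bq c c + Bq d d.
  rewrite !(BqDl, BqNl) !(BqDr, BqNr) (BqC b a) (BqC c a) (BqC d a) (BqC c b) (BqC d b) (BqC d c).
  move: (Bq a a) (Bq b b) (Bq c c) (Bq d d) (Bq a b) (Bq a c) (Bq a d) (Bq b c) (Bq b d) (Bq c d) => *.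
  by apply/rowP => i; rewrite !mxE; ring.
move: (dgm _ a) (dgm _ b) (dgm _ c) (dgm _ d) (Bq a a) (Bq b b) (Bq c c) (Bq d d) => *.
by apply/rowP => i; rewrite !mxE; ring.
Qed.

(** The source [2 B(Dg, Dh)], of size [theta^2 s^-(al + be)], is first absorbed by the solution [w]
    of the linear heat equation, through the mild estimate. What is left is a remainder equation
    forced by [B(S, w)], which costs the third [theta]. *)
Lemma second_difference (sigma T e al be : R) : 0 < T -> 0 < e -> 1 / 2 < sigma <= 1 ->
  0 <= al < 1 -> 0 <= be < 1 -> al + be < 1 ->
  exists2 q0 : nat, (0 < q0)%N & forall q : nat, (q0 <= q)%N -> exists2 C : R, 1 <= C &
  forall (M : nat) (xs : 'I_4 -> 'rV[R]_M) (Xs Zs : 'I_4 -> R -> 'rV[R]_M) (i j k l : 'I_4) (lam t : R),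
    uniq [:: i; j; k; l] -> 0 < t <= T -> (forall k, 1 + nsig sigma (xs k) <= lam) ->
    (forall k, mild_path (xs k) (Xs k) (Zs k)) ->
    (forall a b, Xs a 0 - Xs b 0 = xs a - xs b) -> xs i - xs j = xs k - xs l ->
    (forall a b, curve (fun s => Xs a s - Xs b s) (fun s => drift (Xs a s) - drift (Xs b s))) ->
    nrm ((Xs i t - Xs j t) - (Xs k t - Xs l t)) <= C * t `^ (- (al + be)) *
      nsig (- (2 * al)) (xs j - xs l) * nsig (- (2 * be)) (xs k - xs l) * theta T e q lam Xs Zs ^+ 3.
Proof.
move=> T0 e0 hs hal hbe hab.
have hg : 0 <= al + be < 1 by rewrite hab andbT addr_ge0//; [case/andP: hal|case/andP: hbe].
have [q1 q10 H1] := first_difference T0 e0 hs hal.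
have [q2 q20 H2] := first_difference T0 e0 hs hbe.
have [q3 q30 H3] := remainder_core T0 e0 hs hg.
exists (q1 + q2 + q3)%N; first by rewrite addn_gt0 q30 orbT.
move=> q qq; have [C1 C11 HC1] := H1 q (leq_trans (leq_trans (leq_addr _ _) (leq_addr _ _)) qq).
have [C2 C21 HC2] := H2 q (leq_trans (leq_trans (leq_addl _ _) (leq_addr _ _)) qq).
have [C3 C31 HC3] := H3 q (leq_trans (leq_addl _ _) qq).
set c := (2 / (1 - (al + be)) + 8) * (1 + T).
have c0 : 1 <= c.
  have : 0 <= 2 / (1 - (al + be)) by rewrite divr_ge0// ltW// subr_gt0.
  move=> h; apply: mulr_ege1; [by move: h; move: (2 / _) => u; clear; lra|by lra].
set C4 := c * (4 * C1 * C2).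
have C41 : 1 <= C4.
  apply: mulr_ege1 => //; apply: mulr_ege1 => //; apply: mulr_ege1 => //; lra.
exists (C4 + C3 * C4); first by rewrite ler_wpDr// mulr_ge0//; [exact: le_trans C31|exact: le_trans C41].
move=> M xs Xs Zs i j k l lam t un htT hlam hX X0 xE cX2.
have [t0 tT] := andP htT.
move: un; rewrite /= !inE !negb_or andbT => /andP[/and3P[ij ik il] /andP[/andP[jk jl] kl]].
have cX a : ccont (Xs a) by case: (hX a).
set th := theta T e q lam Xs Zs.
have th1 : 1 <= th := theta_ge1 q (ltW T0) (ltW e0) hlam hX.
set Ng := nsig _ _; set Nh := nsig _ _.
have Ng0 : 0 <= Ng by exact: nrm_ge0.
have Nh0 : 0 <= Nh by exact: nrm_ge0.
pose Dg s := Xs j s - Xs l s; pose Dh s := Xs k s - Xs l s.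
have cDg : ccont Dg by exact: ccontB.
have cDh : ccont Dh by exact: ccontB.
pose F s := 2 *: Bq (Dg s) (Dh s).
have cF : ccont F by apply: ccontZ; exact: ccont_Bq.
have [w cw w0] := duhamel cF.
have th0 : 0 <= th by exact: le_trans th1.
have K0 : 0 <= 4 * C1 * C2 * (Ng * Nh * th ^+ 2).
  apply: mulr_ge0; last by rewrite mulr_ge0 ?sqr_ge0// mulr_ge0.
  by apply: mulr_ge0; [apply: mulr_ge0 => //|]; [exact: le_trans C11|exact: le_trans C21].
have Hw (s : R) : 0 < s <= t -> nrm (w s) <= C4 * (Ng * Nh * th ^+ 2) * s `^ (- (al + be)).
  move=> /andP[s0 st].
  have hsT : 0 < s <= T by rewrite s0/=; exact: le_trans tT.
  have := @mild_estimate R M w F s T (4 * C1 * C2 * (Ng * Nh * th ^+ 2)) (al + be) hsT K0 hg cw w0.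
  rewrite -/c /C4 => h.
  have -> : c * (4 * C1 * C2) * (Ng * Nh * th ^+ 2) = c * (4 * C1 * C2 * (Ng * Nh * th ^+ 2)) by rewrite !mulrA.
  apply: h => u y /andP[u0 us].
  have huT : 0 < u <= T by rewrite u0/=; exact: ltW (lt_le_trans us (le_trans st tT)).
  rewrite dotZl normrM ger0_norm//.
  have b1 := est_S5 (Dg u) (Dh u) y.
  have b2 := HC1 M xs Xs Zs j l lam u jl huT hlam hX (X0 _ _) (cX2 _ _).
  have b3 := HC2 M xs Xs Zs k l lam u kl huT hlam hX (X0 _ _) (cX2 _ _).
  rewrite -/Ng -/th -/(Dg u) in b2; rewrite -/Nh -/th -/(Dh u) in b3.
  have b4 : Num.sqrt (3 * nrm (Lam y) * nrm (Lam (Lam y))) <= 2 * Num.sqrt (nrm (Lam y) * nrm (Lam (Lam y))).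
    rewrite -mulrA sqrtrM//; apply: ler_wpM2r; first exact: sqrtr_ge0.
    by apply: le_of_sq => //; rewrite sqr_sqrtr//; lra.
  have b5 := ler_pM (nrm_ge0 _) (nrm_ge0 _) b2 b3.
  have p0 : 0 <= nrm (Dg u) * nrm (Dh u) by rewrite mulr_ge0 ?nrm_ge0.
  have b6 := ler_pM (sqrtr_ge0 _) p0 b4 b5.
  rewrite -mulrA in b1; have b7 := le_trans b1 b6.
  have b8 : 2 * `|dot (Bq (Dg u) (Dh u)) y| <= 2 * (2 * Num.sqrt (nrm (Lam y) * nrm (Lam (Lam y))) *
       (C1 * u `^ (- al) * Ng * th * (C2 * u `^ (- be) * Nh * th))) by rewrite ler_wpM2l.
  apply: (le_trans b8).
  rewrite pow_addN//; move: (u `^ _) (u `^ _) (Num.sqrt _) => pa pb sq.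
  by rewrite le_eqVlt; apply/orP; left; apply/eqP; ring.
pose E s := (Xs i s - Xs j s) - (Xs k s - Xs l s).
pose S s := Xs i s + Xs j s + Xs k s - Xs l s.
have cE : curve E (fun s => - Lam (Lam (E s)) + (Bq (S s) (E s) + F s)).
  apply: curve_eq (curveB (cX2 i j) (cX2 k l)) => s _; exact: pair_drift.
pose r s := E s - w s.
have cr : curve r (fun s => - Lam (Lam (r s)) + (Bq (S s) (r s) + Bq (S s) (w s))).
  apply: curve_eq (curveB cE cw) => s _.
  rewrite -BqDr /r subrK /Lam [in RHS]dgmB [in RHS]dgmB.
  move: (dgm _ _) (dgm _ (dgm _ (w s))) (F s) (Bq _ _) => p u f b.
  by apply/rowP => a; rewrite !mxE; ring.
have r0 : r 0 = 0 by rewrite /r w0 /E !X0 xE subrr subr0.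
have sum4 (f : 'I_4 -> R) : f i + f j + f k + f l = \sum_a f a.
  have e4 : perm_eq [:: i; j; k; l] (index_enum 'I_4).
    apply: uniq_perm; [|exact: index_enum_uniq|].
      by rewrite /= !inE !negb_or ij ik il jk jl kl.
    have := @uniq_min_size _ [:: i; j; k; l] (index_enum 'I_4).
    case=> //; [by rewrite /= !inE !negb_or ij ik il jk jl kl|by move=> a; rewrite mem_index_enum|].
    by rewrite /index_enum -enumT size_enum_ord.
  by rewrite -(perm_big _ e4)/= !big_cons big_nil addr0 !addrA.
have rt := HC3 M xs Xs Zs S r w lam t (C4 * (Ng * Nh * th ^+ 2)) htT hlam hX.
have {}rt : nrm (r t) <= C3 * (C4 * (Ng * Nh * th ^+ 2)) * t `^ (- (al + be)) * th.
  apply: rt => //.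
  - by apply: ccontB => //; apply: ccontD => //; exact: ccontD.
  - move=> s z; rewrite SfB !SfD -(sum4 (fun a => `|Sf (Xs a s) z|)).
    apply: le_trans (ler_normB _ _) _; rewrite lerD2r.
    by apply: le_trans (ler_normD _ _) _; rewrite lerD2r ler_normD.
  - move=> s; rewrite -(sum4 (fun a => nrm (Lam (Xs a s)))) /Lam dgmB !dgmD.
    apply: le_trans (nrmB _ _) _; rewrite lerD2r.
    by apply: le_trans (nrmD _ _) _; rewrite lerD2r nrmD.
  - by apply: mulr_ge0; [exact: le_trans C41|rewrite mulr_ge0 ?sqr_ge0// mulr_ge0].
  - by move=> s /andP[s0 /ltW st]; apply: Hw; rewrite s0.
have wt : nrm (w t) <= C4 * (Ng * Nh * th ^+ 2) * t `^ (- (al + be)).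
  by apply: Hw; rewrite t0 lexx.
have -> : Xs i t - Xs j t - (Xs k t - Xs l t) = r t + w t by rewrite /r subrK.
apply: le_trans (nrmD _ _) _.
have h2 : C4 * (Ng * Nh * th ^+ 2) * t `^ (- (al + be)) <= C4 * (Ng * Nh * th ^+ 2) * t `^ (- (al + be)) * th.
  rewrite ler_peMr//; apply: mulr_ge0; last exact: powR_ge0.
  by apply: mulr_ge0; [exact: le_trans C41|rewrite mulr_ge0 ?sqr_ge0// mulr_ge0].
have -> : (C4 + C3 * C4) * t `^ (- (al + be)) * Ng * Nh * th ^+ 3 =
  C3 * (C4 * (Ng * Nh * th ^+ 2)) * t `^ (- (al + be)) * th + C4 * (Ng * Nh * th ^+ 2) * t `^ (- (al + be)) * th.
  by clearbody C4 th Ng Nh; move: (t `^ _) => p; ring.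
by apply: lerD => //; exact: le_trans h2.
Qed.

End differences.

(** * Exponential moments of Gaussian Euler schemes *)

Section uniform_continuity.
Context {R : realType}.

Lemma unif_cont (f : R -> R) (T eps : R) : continuous f -> 0 < eps ->
  exists2 del : R, 0 < del & forall s t, 0 <= s <= T -> `|t - s| < del -> `|f t - f s| < eps.
Proof.
move=> cf e0; have cK := @segment_compact R 0 T.
move/compact_near_coveringP: cK => /(_ R (0^'+) (fun del s => forall t, `|t - s| < del -> `|f t - f s| < eps)) H.
have {}H : \forall del \near 0^'+, `[0, T] `<=` (fun s => forall t, `|t - s| < del -> `|f t - f s| < eps).
  apply: H => s0 _.
  have /cvgrPdist_lt/(_ (eps / 2)) := cf s0.
  rewrite divr_gt0// => /(_ isT) [d /= d0 Hd].
  have d20 : 0 < d / 2 by rewrite divr_gt0.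
  exists ([set s | `|s0 - s| < d / 2], [set del | 0 < del /\ del < d / 2]) => /=.
    split; first by exists (d / 2).
    by apply: filterI; [exact: nbhs_right_gt|exact: nbhs_right_lt].
  move=> [s del] /= [h1 [h2 h3]] t h4.
  have a1 : `|f s0 - f s| < eps / 2 by apply: Hd => /=; lra.
  have a2 : `|f s0 - f t| < eps / 2.
    apply: Hd => /=; have := ler_normB (s0 - s) (t - s).
    by rewrite (_ : s0 - s - (t - s) = s0 - t); [lra|ring].
  have := ler_normB (f s0 - f s) (f s0 - f t).
  by rewrite (_ : f s0 - f s - (f s0 - f t) = f t - f s); [lra|ring].
near (0 : R)^'+ => del; exists del => [|s t hs hst]; first by near: del; exact: nbhs_right_gt.
have H2 : `[0, T] `<=` (fun s => forall t, `|t - s| < del -> `|f t - f s| < eps) by near: del.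
by apply: (H2 s) => //=; rewrite in_itv.
Unshelve. all: by end_near. Qed.

Lemma increment_defect (g dg : R -> R) (s h eps : R) : 0 <= h ->
  (forall u : R, s < u < s + h -> is_derive u 1 g (dg u)) ->
  (forall u : R, s <= u <= s + h -> {for u, continuous g}) ->
  (forall u, s < u < s + h -> `|dg u - dg s| <= eps) ->
  `|g (s + h) - g s - h * dg s| <= h * eps.
Proof.
move=> h0 Hd cg He; have sh : s <= s + h by rewrite lerDl.
have lin (c : R) (u : R) : is_derive u 1 (fun v : R => c * v) (c * 1) by apply: dZ; exact: is_derive_id.
have cl (c : R) (u : R) : {for u, continuous (fun v : R => c * v)} by apply: is_derive_cont (lin c u).
have := @le_of_derive_le R g (fun v => (dg s + eps) * v) dg (fun=> (dg s + eps) * 1) s (s + h) sh Hd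
  (fun u _ => lin _ u) cg (fun u _ => cl _ u).
have := @le_of_derive_le R (fun v => (dg s - eps) * v) g (fun=> (dg s - eps) * 1) dg s (s + h) sh
  (fun u _ => lin _ u) Hd (fun u _ => cl _ u) cg.
move=> h1 h2.
have b1 : (dg s - eps) * (s + h) - (dg s - eps) * s <= g (s + h) - g s.
  by apply: h1 => u hu; have := He u hu; rewrite ler_norml; lra.
have b2 : g (s + h) - g s <= (dg s + eps) * (s + h) - (dg s + eps) * s.
  by apply: h2 => u hu; have := He u hu; rewrite ler_norml; lra.
rewrite ler_norml; lra.
Qed.

Lemma riemann_sum (f : R -> R) (T : R) : 0 <= T -> continuous f ->
  (fun m => T / m.+1%:R * \sum_(j < m.+1) f (j%:R * (T / m.+1%:R))) @ \oo --> prim f T.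
Proof.
move=> T0 cf; apply/cvgrPdist_le => eps e0.
have e1 : 0 < eps / (T + 1) by rewrite divr_gt0//; lra.
have [del d0 Hd] := unif_cont T cf e1.
near=> m; set h := T / m.+1%:R.
have hdel : h < del.
  rewrite /h ltr_pdivrMr ?ltr0n// mulrC -ltr_pdivrMr//.
  apply: lt_trans (_ : m%:R < _); last by rewrite ltr_nat.
  by near: m; exact: nbhs_infty_gtr.
have h0 : 0 <= h by rewrite divr_ge0.
have Th : T = m.+1%:R * h by rewrite /h mulrC divfK// gt_eqF.
have -> : prim f T = \sum_(j < m.+1) (prim f (j%:R * h + h) - prim f (j%:R * h)).
  have H n : prim f (n%:R * h) = \sum_(j < n) (prim f (j%:R * h + h) - prim f (j%:R * h)).
    elim: n => [|n IH]; first by rewrite big_ord0 mul0r prim0.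
    rewrite big_ord_recr/= -IH -natr1 mulrDl mul1r; ring.
  by rewrite {1}Th H.
rewrite mulr_sumr -sumrB; apply: le_trans (ler_norm_sum _ _ _) _.
apply: (@le_trans _ _ (\sum_(j < m.+1) h * (eps / (T + 1)))).
  apply: ler_sum => j _.
  have j0 : 0 <= j%:R * h by rewrite mulr_ge0.
  apply: (@increment_defect (prim f) f (j%:R * h) h (eps / (T + 1)) h0).
  - by move=> u /andP[u0 _]; apply: is_derive_prim => //; lra.
  - by move=> u /andP[u0 _]; apply: prim_cont => //; lra.
  - move=> u /andP[u1 u2]; apply: ltW; apply: Hd.
      rewrite j0/= Th ler_wpM2r// ler_nat; exact: ltnW.
    rewrite gtr0_norm; lra.
rewrite sumr_const card_ord -mulr_natl mulrA -Th mulrCA ler_piMr ?(ltW e0)//.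
by rewrite ler_pdivrMr; lra.
Unshelve. all: by end_near. Qed.

End uniform_continuity.

(** * Upper expectations *)

Section upper_expectation.
Context {R : realType} d (Om : measurableType d) (P : probability Om R).
Implicit Types (f g : Om -> R) (C : R).

(* Upper expectation bound, so that measurability of the path functionals is never needed. *)
Definition Ele f C := exists G : Om -> \bar R, [/\ measurable_fun setT G, (forall w, 0 <= G w)%E,
  {ae P, forall w, ((f w)%:E <= G w)%E} & (\int[P]_w G w <= C%:E)%E].

Lemma Ele_le f g C D : {ae P, forall w, f w <= g w} -> C <= D -> Ele g C -> Ele f D.
Proof.
move=> fg CD [G [mG G0 gG IG]]; exists G; split => //.
  by apply: filterS2 fg gG => w /= a b; apply: le_trans b; rewrite lee_fin.
by apply: le_trans IG _; rewrite lee_fin.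
Qed.

Lemma Ele_meas f C : measurable_fun setT f -> (forall w, 0 <= f w) ->
  (\int[P]_w (f w)%:E <= C%:E)%E -> Ele f C.
Proof.
move=> mf f0 fC; exists (EFin \o f); split => //=; first exact/measurable_EFinP.
exact: nearW.
Qed.

Lemma EleD f g C D : Ele f C -> Ele g D -> Ele (fun w => f w + g w) (C + D).
Proof.
move=> [F [mF F0 fF IF]] [G [mG G0 gG IG]]; exists (fun w => F w + G w)%E; split.
- exact: emeasurable_funD.
- by move=> w; rewrite adde_ge0.
- by apply: filterS2 fF gG => w a b; rewrite EFinD leeD.
- by rewrite ge0_integralD// EFinD leeD.
Qed.

Lemma EleZ k f C : 0 <= k -> Ele f C -> Ele (fun w => k * f w) (k * C).
Proof.
move=> k0 [F [mF F0 fF IF]]; exists (fun w => k%:E * F w)%E; split.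
- exact: measurable_funeM.
- by move=> w; rewrite mule_ge0.
- by apply: filterS fF => w a; rewrite EFinM lee_wpmul2l.
- by rewrite ge0_integralZl// EFinM lee_wpmul2l.
Qed.

Lemma Ele_cst C : 0 <= C -> Ele (fun=> C) C.
Proof.
move=> C0; apply: Ele_meas => //.
rewrite integral_cst// -[leRHS]mule1 lee_wpmul2l//; exact: probability_le1.
Qed.

Lemma Ele_sum (I : Type) (r : seq I) (f : I -> Om -> R) (C : I -> R) :
  (forall i, Ele (f i) (C i)) -> Ele (fun w => \sum_(i <- r) f i w) (\sum_(i <- r) C i).
Proof.
move=> H; elim: r => [|i r IH].
  by under eq_fun do rewrite big_nil; rewrite big_nil; exact: Ele_cst.
by under eq_fun do rewrite big_cons; rewrite big_cons; exact: EleD.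
Qed.

(** The limit is majorized by the lower limit of the majorants, whose integral Fatou bounds; [f]
    itself may be nonmeasurable. *)
Lemma Ele_fatou (f_ : nat -> Om -> R) f C : (forall n, Ele (f_ n) C) ->
  {ae P, forall w, (fun n => f_ n w) @ \oo --> f w} -> Ele f C.
Proof.
move=> /choice[G HG] cvf.
have mG n : measurable_fun setT (G n) by case: (HG n).
have G0 n w : (0 <= G n w)%E by case: (HG n).
have GC n : (\int[P]_w G n w <= C%:E)%E by case: (HG n).
have fG : {ae P, forall w, forall n, ((f_ n w)%:E <= G n w)%E}.
  by apply/ae_foralln => n; case: (HG n).
exists (fun w => limn_einf (fun n => G n w)); split.
- rewrite /limn_einf; apply/measurableT_comp => //.
  apply: (@measurable_fun_limn_esup _ _ _ _ (fun n w => (- G n w)%E)) => n.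
  exact: measurableT_comp.
- move=> w; rewrite limn_einf_lim; apply: lime_ge; first exact: is_cvg_einfs.
  by apply: nearW => n; apply: le_ereal_inf_tmp => _ [m /= nm <-].
- apply: filterS2 cvf fG => w cw fw.
  have cE : (fun n => (f_ n w)%:E) @ \oo --> (f w)%:E by apply: cvg_EFin; [exact: nearW|exact: cw].
  have [h _] := cvg_limn_einf_sup cE.
  rewrite -h !limn_einf_lim; apply: lee_lim; [exact: is_cvg_einfs|exact: is_cvg_einfs|].
  apply: nearW => n; apply: le_ereal_inf_tmp => _ [m /= nm <-].
  by apply: ge_ereal_inf; exists (f_ m w)%:E => //; exists m.
- apply: le_trans (fatou P measurableT mG (fun n w _ => G0 n w)) _.
  rewrite limn_einf_lim; apply: lime_le; first exact: is_cvg_einfs.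
  apply: nearW => n; apply: le_trans (GC n).
  by apply: ge_ereal_inf => /=; exists (\int[P]_w G n w)%E => //; exists n => /=.
Qed.

(** In place of Tonelli, which would require joint measurability in time and chance: Riemann sums
    and [Ele_fatou]. *)
Lemma Ele_prim (f : Om -> R -> R) (T C : R) : 0 <= T -> {ae P, forall w, continuous (f w)} ->
  (forall s, 0 <= s <= T -> Ele (fun w => f w s) C) -> Ele (fun w => prim (f w) T) (T * C).
Proof.
move=> T0 cf H.
apply: (@Ele_fatou (fun m w => T / m.+1%:R * \sum_(j < m.+1) f w (j%:R * (T / m.+1%:R)))).
  move=> m.
  have h0 : 0 <= T / m.+1%:R by rewrite divr_ge0.
  have -> : T * C = T / m.+1%:R * \sum_(j < m.+1) C.
    by rewrite sumr_const card_ord -[C *+ _]mulr_natl mulrA divfK// gt_eqF.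
  apply: EleZ => //; apply: (Ele_sum (index_enum 'I_m.+1) (f := fun j w => f w (j%:R * (T / m.+1%:R)))) => j; apply: H.
  rewrite mulr_ge0//=.
  have {2}-> : T = m.+1%:R * (T / m.+1%:R) by rewrite mulrC divfK// gt_eqF.
  by rewrite ler_wpM2r// ler_nat ltnW.
by apply: filterS cf => w cw; exact: riemann_sum.
Qed.

Lemma Ele_int f C : measurable_fun setT f -> (forall w, 0 <= f w) -> Ele f C ->
  (\int[P]_w (f w)%:E <= C%:E)%E.
Proof.
move=> mf f0 [G [mG G0 fG IG]]; apply: le_trans IG.
apply: ae_ge0_le_integral => //.
- by move=> w _; rewrite lee_fin.
- exact/measurable_EFinP.
- by apply: filterS fG => w h _.
Qed.

End upper_expectation.

(** * Gaussian exponential integrals and independent innovations *)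

Section gaussian.
Context {R : realType}.
Local Notation mu := (@lebesgue_measure R).

Section density.
Context dT (T : measurableType dT).
Variables (g : T -> R) (mu nu : {measure set T -> \bar R}).
Hypotheses (mg : measurable_fun setT g) (g0 : forall x, 0 <= g x)
  (nuE : forall A, measurable A -> nu A = (\int[mu]_(x in A) (g x)%:E)%E).

Let mgE : measurable_fun setT (EFin \o g).
Proof. exact/measurable_EFinP. Qed.

Let density_indic E : measurable E ->
  (\int[nu]_x (\1_E x)%:E = \int[mu]_x ((\1_E x)%:E * (g x)%:E))%E.
Proof.
move=> mE; rewrite integral_indic//= setIT nuE// [LHS]integral_mkcond.
apply: eq_integral => x _; rewrite patchE indicE.
by case: (x \in E); rewrite ?mul1e ?mul0e.
Qed.

Import HBNNSimple.

Let density_nnsfun (f : {nnsfun T >-> R}) :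
  (\int[nu]_x (f x)%:E = \int[mu]_x ((f x)%:E * (g x)%:E))%E.
Proof.
under [LHS]eq_integral do rewrite fimfunE -fsumEFin//.
rewrite [LHS]ge0_integral_fsum//; last 2 first.
  - by move=> r; exact/measurable_EFinP/measurableT_comp.
  - by move=> n x _; rewrite EFinM nnfun_muleindic_ge0.
under [RHS]eq_integral.
  move=> x xD; rewrite fimfunE -fsumEFin// muleC ge0_mule_fsumr; last first.
    by move=> r; rewrite EFinM nnfun_muleindic_ge0.
  over.
rewrite [RHS]ge0_integral_fsum//; last 2 first.
  - move=> r; apply: emeasurable_funM => //.
    by apply/measurable_EFinP; exact/measurableT_comp.
  - by move=> n x _; apply: mule_ge0; [rewrite lee_fin|rewrite EFinM nnfun_muleindic_ge0].
apply: eq_fsbigr => r _.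
under [RHS]eq_integral do rewrite EFinM muleCA.
have [r0|r0] := leP 0 r.
  rewrite [LHS]integralZl_indic_nnsfun//= density_indic// [RHS]ge0_integralZl//.
  - by congr (_ * _)%E; apply: eq_integral => x _; rewrite muleC.
  - by apply: emeasurable_funM => //; exact/measurable_EFinP.
  - by move=> x _; rewrite mule_ge0 ?lee_fin.
have E0 : f @^-1` [set r] = set0.
  apply/seteqP; split=> x //= fx.
  have : (0%R <= r%:E * (\1_(f @^-1` [set r]) x)%:E)%E by exact: nnfun_muleindic_ge0.
  by rewrite indicE mem_set// mule1 lee_fin leNgt r0.
by rewrite E0 !integral0_eq// => x _; rewrite indic0 /= ?mule0 ?mulr0.
Qed.

Lemma integral_density (f : T -> \bar R) : measurable_fun setT f -> (forall x, 0 <= f x)%E ->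
  (\int[nu]_x f x = \int[mu]_x (f x * (g x)%:E))%E.
Proof.
move=> mf f0.
pose f_ := nnsfun_approx measurableT mf.
transitivity (lim (\int[nu]_x (f_ n x)%:E @[n --> \oo])%E).
  rewrite -monotone_convergence//=.
  - apply: eq_integral => ? /[!inE] xD; apply/esym/cvg_lim => //=.
    exact: cvg_nnsfun_approx.
  - by move=> n; exact/measurable_EFinP/measurable_funTS.
  - by move=> n ? _; rewrite lee_fin.
  - by move=> ? _ ? ? mn; rewrite lee_fin; exact/lefP/nd_nnsfun_approx.
transitivity (lim (\int[mu]_x ((f_ n x)%:E * (g x)%:E) @[n --> \oo])%E); last first.
  rewrite -monotone_convergence//=.
  - apply: eq_integral => x _; apply/cvg_lim => //.
    apply: cvgeMr => //; exact: cvg_nnsfun_approx.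
  - by move=> n; apply: emeasurable_funM => //; exact/measurable_EFinP/measurable_funTS.
  - by move=> n ? _; rewrite mule_ge0 ?lee_fin.
  - by move=> x _ a b ab; apply: lee_wpmul2r; rewrite lee_fin//; exact/lefP/nd_nnsfun_approx.
by apply: congr_lim; apply/funext => n /=; exact: density_nnsfun.
Qed.

End density.

Lemma inv_le_exp (z : R) : 0 <= z <= 1 / 2 -> (1 - z)^-1 <= expR (2 * z).
Proof.
move=> /andP[z0 z1]; have z2 : 0 < 1 - z by lra.
rewrite -[leLHS]mul1r ler_pdivrMr//.
have := expR_ge1Dx (2 * z); move: (expR _) => E h; nra.
Qed.

Lemma measurable_exp_quadratic (p c : R) : measurable_fun setT (fun r => (expR (p * r + c * r ^+ 2))%:E).
Proof.
apply/measurable_EFinP; apply: measurableT_comp => //.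
apply: measurable_funD; apply: measurable_funM => //; exact: measurable_funX.
Qed.

(** Completing the square turns the integrand into a multiple of the normal density of variance
    [tau / k] and mean [p tau / k], with [k = 1 - 2 c tau]. The multiple is
    [k^(-1/2) e^(p^2 tau / (2 k))], and [4 c tau <= 1] yields [k >= 1/2] and
    [k^(-1/2) <= e^(2 c tau)]. *)
Lemma gauss_exp (tau p c : R) : 0 < tau -> 0 <= c -> 4 * (c * tau) <= 1 ->
  (\int[normal_prob 0 (Num.sqrt tau)]_r (expR (p * r + c * r ^+ 2))%:E
    <= (expR (2 * (c * tau) + p ^+ 2 * tau))%:E)%E.
Proof.
move=> t0 c0 ct; have s0 : Num.sqrt tau != 0 by rewrite sqrtr_eq0 -ltNge.
have mf := measurable_exp_quadratic p c.
have H := @integral_density _ (measurableTypeR R) (normal_pdf 0 (Num.sqrt tau)) mu (normal_prob 0 (Num.sqrt tau))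
  (@measurable_normal_pdf _ _ _) (@normal_pdf_ge0 _ _ _) (fun _ _ => erefl) (fun r => (expR (p * r + c * r ^+ 2))%:E) mf.
rewrite [leLHS]H; last by move=> r; rewrite lee_fin expR_ge0.
set k := 1 - 2 * (c * tau); have k0 : 0 < k by rewrite /k; lra.
set s2 := Num.sqrt (tau / k).
have s2p : 0 < tau / k by rewrite divr_gt0.
have s20 : s2 != 0 by rewrite sqrtr_eq0 -ltNge.
set m := p * (tau / k).
have E r : ((expR (p * r + c * r ^+ 2))%:E * (normal_pdf 0 (Num.sqrt tau) r)%:E)%E =
   ((Num.sqrt k^-1 * expR (p ^+ 2 * (tau / k) / 2))%:E * (normal_pdf m s2 r)%:E)%E.
  rewrite -!EFinM; congr (_%:E); rewrite !normal_pdfE// /normal_fun /normal_peak.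
  rewrite /s2 !sqr_sqrtr ?(ltW t0) ?(ltW s2p)// subr0.
  have -> : Num.sqrt (tau * pi *+ 2) = Num.sqrt k * Num.sqrt (tau / k * pi *+ 2).
    rewrite -sqrtrM ?(ltW k0)//; congr Num.sqrt.
    rewrite -[X in _ = k * X]mulr_natr -[LHS]mulr_natr; field; exact: lt0r_neq0.
  rewrite sqrtrV ?(ltW k0)// invfM.
  set A := (Num.sqrt k)^-1; set B := (Num.sqrt _)^-1.
  have -> : expR (p * r + c * r ^+ 2) * (A * B * expR (- r ^+ 2 / (tau *+ 2))) =
    A * B * (expR (p * r + c * r ^+ 2) * expR (- r ^+ 2 / (tau *+ 2))) by ring.
  have -> : A * expR (p ^+ 2 * (tau / k) / 2) * (B * expR (- (r - m) ^+ 2 / (tau / k *+ 2))) =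
    A * B * (expR (p ^+ 2 * (tau / k) / 2) * expR (- (r - m) ^+ 2 / (tau / k *+ 2))) by ring.
  congr (_ * _); rewrite -!expRD; congr expR.
  rewrite -[tau *+ 2]mulr_natr -[tau / k *+ 2]mulr_natr /m /k; field.
  by rewrite -/k !lt0r_neq0.
under eq_integral do rewrite E.
have mpdf : measurable_fun setT (fun x => (normal_pdf m s2 x)%:E).
  by apply/measurable_EFinP; exact: measurable_normal_pdf.
rewrite ge0_integralZl//; last by move=> x _; rewrite lee_fin normal_pdf_ge0.
rewrite [X in (_ * X)%E](@integral_normal_pdf R m s2) mule1 lee_fin expRD.
apply: ler_pM; rewrite ?sqrtr_ge0 ?expR_ge0//.
  apply: le_of_sq; first exact: expR_ge0.
  rewrite sqr_sqrtr ?invr_ge0 ?(ltW k0)//.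
  have h : (1 - 2 * (c * tau))^-1 <= expR (2 * (2 * (c * tau))).
    by apply: inv_le_exp; rewrite mulr_ge0 ?mulr_ge0 ?(ltW t0)//=; lra.
  by apply: (le_trans h); rewrite -expRM_natl.
have k2 : k^-1 <= 2 by rewrite -[leLHS]mul1r ler_pdivrMr// /k; lra.
rewrite ler_expR -[leLHS]mulrA; apply: ler_wpM2l; first exact: sqr_ge0.
by rewrite -mulrA ler_piMr ?(ltW t0)//; lra.
Qed.

End gaussian.

Section joint.
Context {R : realType} dO d1 d2 (Om : measurableType dO) (P : probability Om R)
  (T1 : measurableType d1) (T2 : measurableType d2).
Variables (X : Om -> T1) (Y : Om -> T2).
Hypotheses (mX : measurable_fun setT X) (mY : measurable_fun setT Y).

(** The hypothesis identifies the joint law with a product measure on rectangles, hence everywhere;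
    Tonelli does the rest. *)
Lemma joint_integral (nu : probability T2 R) :
  (forall A B, measurable A -> measurable B -> P (X @^-1` A `&` Y @^-1` B) = P (X @^-1` A) * nu B)%E ->
  forall f : T1 * T2 -> \bar R, measurable_fun setT f -> (forall z, 0 <= f z)%E ->
  (\int[P]_w f (X w, Y w) = \int[P]_w \int[nu]_r f (X w, r))%E.
Proof.
move=> H f mf f0.
have mphi : measurable_fun setT (fun w => (X w, Y w)) by apply: measurable_fun_pair.
pose XX : {mfun Om >-> T1} := HB.pack X (isMeasurableFun.Build _ _ _ _ X mX).
pose ZZ : {mfun Om >-> (T1 * T2)%type} := HB.pack (fun w => (X w, Y w)) (isMeasurableFun.Build _ _ _ _ _ mphi).
have -> : (\int[P]_w f (X w, Y w) = \int[distribution P ZZ]_z f z)%E.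
  by rewrite /distribution ge0_integral_pushforward// => y _.
transitivity (\int[(distribution P XX \x nu)%E]_z f z)%E.
  apply: eq_measure_integral => A mA _; apply/esym; exact: product_measure_unique.
rewrite fubini_tonelli1// /distribution ge0_integral_pushforward//.
- exact: measurable_fun_fubini_tonelli_F.
- by move=> y _; apply: integral_ge0.
Qed.

End joint.

Section innovations.
Context {R : realType} d (Om : measurableType d) (P : probability Om R).
Variables (xi : nat -> Om -> R) (nu : probability (measurableTypeR R) R) (N : nat).
Hypothesis mxi : forall i, measurable_fun setT (xi i).
Hypothesis indep : forall n, (n <= N)%N -> forall A : nat -> set R, (forall i, measurable (A i)) ->
  P [set w | forall i, (i < n)%N -> A i (xi i w)] = (\prod_(i < n) nu (A i))%E.

(* A pi-system of the events determined by the first [n] innovations. *)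
Definition history n : set (set Om) := [set E | exists2 A : nat -> set R,
  (forall i, measurable (A i)) & E = [set w | forall i, (i < n)%N -> A i (xi i w)]].
(** [Om] with the sigma-algebra of the first [n] innovations: measurability on this type is
    adaptedness. *)
Definition past n := g_sigma_algebraType (history n).

Lemma history_measurable n : history n `<=` measurable.
Proof.
move=> _ [A mA ->].
rewrite (_ : [set w | _] = \bigcap_(i in [set i | (i < n)%N]) (xi i @^-1` A i))//.
apply: fin_bigcap_measurable; first exact: finite_II.
by move=> i _; rewrite -[_ @^-1` _]setTI; exact: mxi.
Qed.

Lemma past_sub n (E : set Om) : measurable (E : set (past n)) -> measurable E.
Proof.
by apply: smallest_sub; [exact: sigma_algebra_measurable|exact: history_measurable].
Qed.

Lemma past_id n : measurable_fun setT (id : Om -> past n).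
Proof. by move=> _ E mE; rewrite setTI preimage_id; have := @past_sub n E mE. Qed.

Lemma xi_past i n : (i < n)%N -> measurable_fun setT (xi i : past n -> R).
Proof.
move=> hi _ B mB; rewrite setTI; apply: sub_sigma_algebra.
exists (fun j => if j == i then B else setT); first by move=> j; case: ifP.
apply/seteqP; split => w /= h; first by move=> j _; case: eqP => // ->.
by have := h i hi; rewrite eqxx.
Qed.

(** Uniqueness of measures on the pi-system [history n]: both sides are finite measures in [E], and
    on a cylinder the product formula for [n + 1] innovations applies. *)
Lemma past_indep n (E : set Om) B : (n < N)%N -> measurable (E : set (past n)) -> measurable B ->
  P (E `&` xi n @^-1` B) = (P E * nu B)%E.
Proof.
move=> nN mE mB.
have mX : measurable (xi n @^-1` B) by rewrite -[_ @^-1` _]setTI; exact: mxi.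
have nuB : nu B = (fine (nu B))%:E by rewrite fineK// fin_num_measure.
have k0 : 0 <= fine (nu B) by rewrite fine_ge0.
have -> : P (E `&` xi n @^-1` B) = mrestr P mX E by [].
have -> : (P E * nu B)%E = mscale (NngNum k0) P E by rewrite /mscale/= -nuB muleC.
apply: (@g_sigma_algebra_measure_unique _ R Om (history n) (@history_measurable n) (fun=> setT)) => //.
- by move=> i; exists (fun=> setT) => //; apply/seteqP; split.
- by apply/seteqP; split => // w _; exists 0%N.
- move=> _ _ [A mA ->] [A' mA' ->]; exists (fun i => A i `&` A' i).
    by move=> i; exact: measurableI.
  apply/seteqP; split => w /=; first by move=> [h h'] i hi; split; [exact: h|exact: h'].
  by move=> h; split => i /h[].
- move=> _ [A mA ->].
  rewrite /= /mrestr /mscale.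
  pose A' i := if i == n then B else A i.
  have mA' i : measurable (A' i) by rewrite /A'; case: ifP.
  have -> : [set w | forall i, (i < n)%N -> A i (xi i w)] `&` xi n @^-1` B =
     [set w | forall i, (i < n.+1)%N -> A' i (xi i w)].
    apply/seteqP; split => w /= h.
      move=> i; rewrite ltnS leq_eqVlt /A'; case: eqP => /= [-> _|_ hi]; first exact: h.2.
      exact: h.1.
    split; last by have := h n (ltnSn n); rewrite /A' eqxx.
    by move=> i hi; have := h i (ltnW hi); rewrite /A' (ltn_eqF hi).
  apply: (etrans (indep nN mA')); rewrite big_ord_recr/= {2}/A' eqxx muleC.
  apply: (etrans _ (esym (congr1 (fun z => (fine (nu B))%:E * z)%E (indep (ltnW nN) mA)))).
  rewrite -nuB; congr (_ * _)%E.
  by apply: eq_bigr => i _; rewrite /A' (ltn_eqF (ltn_ord i)).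
- by move=> _; rewrite /= /mrestr setTI; apply: (le_lt_trans (probability_le1 P mX)); rewrite ltry.
Qed.

Lemma innovation_integral n (f : past n * measurableTypeR R -> \bar R) : (n < N)%N -> measurable_fun setT f ->
  (forall z, 0 <= f z)%E ->
  (\int[P]_w f (w, xi n w) = \int[P]_w \int[nu]_r f (w, r))%E.
Proof.
move=> nN mf f0.
apply: (@joint_integral _ _ _ _ Om P (past n) (measurableTypeR R) id (xi n) (@past_id n) (mxi n) nu _ f mf f0).
by move=> A B mA mB; exact: past_indep.
Qed.

End innovations.

Section gaussian_step.
Context {R : realType} d (Om : measurableType d) (P : probability Om R).
Variables (xi : nat -> Om -> R) (tau : R) (N : nat).
Hypothesis tau0 : 0 < tau.
Hypothesis mxi : forall i, measurable_fun setT (xi i).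
Hypothesis indep : forall n, (n <= N)%N -> forall A : nat -> set R, (forall i, measurable (A i)) ->
  P [set w | forall i, (i < n)%N -> A i (xi i w)] = (\prod_(i < n) normal_prob 0 (Num.sqrt tau) (A i))%E.

(** Conditionally on the past, [gauss_exp] applies with [p = 2 s <y, b>] and [c = s |b|^2]. By
    Cauchy-Schwarz the term [p^2 tau] is again a multiple of [|y|^2], so one innovation only
    inflates the coefficient [s]; [U] carries what has accumulated before. *)
Lemma gauss_step (M n : nat) (U : Om -> R) (y : Om -> 'rV[R]_M) (b : 'rV[R]_M) (s : R) : (n < N)%N ->
  measurable_fun setT (U : past xi n -> R) ->
  (forall i, measurable_fun setT ((fun w => y w ord0 i) : past xi n -> R)) ->
  0 <= s -> 4 * (s * (nrm b ^+ 2 * tau)) <= 1 ->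
  (\int[P]_w (expR (U w + s * nrm (y w + xi n w *: b) ^+ 2))%:E <=
   (expR (2 * (s * (nrm b ^+ 2 * tau))))%:E *
   \int[P]_w (expR (U w + s * (1 + 4 * (s * (nrm b ^+ 2 * tau))) * nrm (y w) ^+ 2))%:E)%E.
Proof.
move=> nN mU my s0 sb.
pose nu : probability (measurableTypeR R) R := normal_prob 0 (Num.sqrt tau).
pose q (w : Om) (r : R) := U w + s * (dot (y w) (y w) + (2 * r * dot (y w) b + r * r * dot b b)).
have qE w r : U w + s * nrm (y w + r *: b) ^+ 2 = q w r.
  by rewrite nrm_sq dotDl !dotDr !dotZl !dotZr (dotC b) /q; ring.
pose f (z : past xi n * measurableTypeR R) := (expR (q z.1 z.2))%:E.
have m2 : measurable_fun setT (fun z : past xi n * measurableTypeR R => z.2 : R) by exact: measurable_snd.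
have m1 (g : Om -> R) : measurable_fun setT (g : past xi n -> R) ->
    measurable_fun setT (fun z : past xi n * measurableTypeR R => g z.1).
  by move=> mg; apply: (measurableT_comp mg); exact: measurable_fst.
have mdot (c : Om -> 'rV[R]_M) : (forall i, measurable_fun setT ((fun w => c w ord0 i) : past xi n -> R)) ->
    measurable_fun setT ((fun w => dot (y w) (c w)) : past xi n -> R).
  move=> mc; under eq_fun do rewrite dotE; apply: measurable_sum => i; exact: measurable_funM.
have mf : measurable_fun setT f.
  apply/measurable_EFinP; apply: measurableT_comp => //.
  have h1 := m1 _ (mdot y my).
  have h2 : measurable_fun setT (fun z : past xi n * measurableTypeR R => dot (y z.1) b).
    by apply: (m1 (fun w => dot (y w) b)); apply: (mdot (fun=> b)) => i; exact: measurable_cst.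
  apply: measurable_funD; first exact: (m1 U).
  apply: measurable_funM; first exact: measurable_cst.
  apply: measurable_funD; first exact: h1.
  apply: measurable_funD; apply: measurable_funM; try exact: measurable_cst; try exact: h2.
    by apply: measurable_funM; [exact: measurable_cst|exact: m2].
  by apply: measurable_funM; exact: m2.
have -> : (\int[P]_w (expR (U w + s * nrm (y w + xi n w *: b) ^+ 2))%:E = \int[P]_w f (w, xi n w))%E.
  by apply: eq_integral => w _; rewrite qE.
rewrite (@innovation_integral _ _ _ P xi nu N mxi indep n f nN mf); last by move=> z; rewrite lee_fin expR_ge0.
set be := nrm b ^+ 2 * tau.
have be0 : 0 <= be by rewrite mulr_ge0 ?sqr_ge0// ltW.
have mR : measurable_fun setT (fun w => (expR (U w + s * (1 + 4 * (s * be)) * nrm (y w) ^+ 2))%:E).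
  apply/measurable_EFinP; apply: measurableT_comp => //; apply: measurable_funD.
    exact: (measurableT_comp mU (@past_id _ _ _ xi mxi n)).
  apply: measurable_funM; first exact: measurable_cst.
  under eq_fun do rewrite nrm_sq.
  exact: (measurableT_comp (mdot y my) (@past_id _ _ _ xi mxi n)).
rewrite -ge0_integralZl//.
apply: ge0_le_integral => //.
- by move=> w _; apply: integral_ge0 => r _; rewrite lee_fin expR_ge0.
- have f0 z : (0 <= f z)%E by rewrite lee_fin expR_ge0.
  exact: (measurableT_comp (@measurable_fun_fubini_tonelli_F _ _ _ _ _ nu f mf f0) (@past_id _ _ _ xi mxi n)).
- exact: measurable_funeM.
move=> w _; rewrite /f /=.
have -> : (\int[nu]_r (expR (q w r))%:E = \int[nu]_r ((expR (U w + s * dot (y w) (y w)))%:E *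
   (expR ((2 * s * dot (y w) b) * r + (s * dot b b) * r ^+ 2))%:E))%E.
  by apply: eq_integral => r _; rewrite -EFinM -expRD; congr (expR _)%:E; rewrite /q; ring.
rewrite ge0_integralZl//; last exact: (measurable_exp_quadratic (2 * s * dot (y w) b) (s * dot b b)).
have c0 : 0 <= s * dot b b by rewrite mulr_ge0// -nrm_sq sqr_ge0.
have ct : 4 * (s * dot b b * tau) <= 1 by rewrite -nrm_sq -[s * _ * _]mulrA.
apply: le_trans (lee_wpmul2l _ (gauss_exp (2 * s * dot (y w) b) tau0 c0 ct)) _.
  by rewrite lee_fin expR_ge0.
rewrite -!EFinM lee_fin -!expRD ler_expR.
have CS : dot (y w) b ^+ 2 <= nrm (y w) ^+ 2 * nrm b ^+ 2.
  by rewrite -exprMn -[leLHS]real_normK ?num_real// ler_pXn2r ?nnegrE ?dot_CS ?mulr_ge0 ?nrm_ge0.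
have := ler_wpM2l (mulr_ge0 (mulr_ge0 (ler0n _ 4) (sqr_ge0 s)) (ltW tau0)) CS.
rewrite /be -!nrm_sq; move: (nrm _ ^+ 2) (nrm b ^+ 2) (dot _ _) => p r u; clear.
lra.
Qed.

End gaussian_step.

Section scheme.
Context {R : realType}.

Fixpoint euler {M} (Psi : 'rV[R]_M -> 'rV[R]_M) (y0 : 'rV[R]_M) (dN : nat -> 'rV[R]_M) (j : nat) :=
  if j is j'.+1 then Psi (euler Psi y0 dN j') + dN j' else y0.

Definition cmeas {M} d (T : measurableType d) (y : T -> 'rV[R]_M) :=
  forall i, measurable_fun setT (fun w => y w ord0 i).
Definition vmeas {M} (Psi : 'rV[R]_M -> 'rV[R]_M) :=
  forall d (T : measurableType d) (y : T -> 'rV[R]_M), cmeas y -> cmeas (Psi \o y).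
Definition fmeas {M} (g : 'rV[R]_M -> R) :=
  forall d (T : measurableType d) (y : T -> 'rV[R]_M), cmeas y -> measurable_fun setT (g \o y).

Lemma cmeasD {M} d (T : measurableType d) (y z : T -> 'rV[R]_M) :
  cmeas y -> cmeas z -> cmeas (fun w => y w + z w).
Proof. by move=> my mz i; under eq_fun do rewrite mxE; exact: measurable_funD. Qed.
Lemma cmeasZ {M} d (T : measurableType d) (k : T -> R) (y : T -> 'rV[R]_M) :
  measurable_fun setT k -> cmeas y -> cmeas (fun w => k w *: y w).
Proof. by move=> mk my i; under eq_fun do rewrite mxE; exact: measurable_funM. Qed.
Lemma cmeas_cst {M} d (T : measurableType d) (b : 'rV[R]_M) : cmeas (fun _ : T => b).
Proof. by move=> i; exact: measurable_cst. Qed.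
Lemma cmeas_sum {M} d (T : measurableType d) n (y : 'I_n -> T -> 'rV[R]_M) :
  (forall k, cmeas (y k)) -> cmeas (fun w => \sum_k y k w).
Proof. by move=> my i; under eq_fun do rewrite summxE; apply: measurable_sum => k; exact: my. Qed.
Lemma cmeas_dgm {M} d (T : measurableType d) v (y : T -> 'rV[R]_M) : cmeas y -> cmeas (fun w => dgm v (y w)).
Proof. by move=> my i; under eq_fun do rewrite dgmE; apply: measurable_funM => //; exact: my. Qed.
Lemma meas_dot {M} d (T : measurableType d) (y z : T -> 'rV[R]_M) : cmeas y -> cmeas z ->
  measurable_fun setT (fun w => dot (y w) (z w)).
Proof. by move=> my mz; under eq_fun do rewrite dotE; apply: measurable_sum => i; exact: measurable_funM. Qed.
Lemma meas_nrm2 {M} d (T : measurableType d) (y : T -> 'rV[R]_M) : cmeas y ->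
  measurable_fun setT (fun w => nrm (y w) ^+ 2).
Proof. by move=> my; under eq_fun do rewrite nrm_sq; exact: meas_dot. Qed.

Lemma le_int_exp d (Om : measurableType d) (P : probability Om R) (f g : Om -> R) :
  measurable_fun setT f -> measurable_fun setT g -> (forall w, f w <= g w) ->
  (\int[P]_w (expR (f w))%:E <= \int[P]_w (expR (g w))%:E)%E.
Proof.
move=> mf mg fg; apply: ge0_le_integral => //.
- by apply/measurable_EFinP; exact: measurableT_comp.
- by apply/measurable_EFinP; exact: measurableT_comp.
- by move=> w _; rewrite lee_fin ler_expR.
Qed.

Lemma int_exp_shift d (Om : measurableType d) (P : probability Om R) (c : R) (f : Om -> R) :
  measurable_fun setT f ->
  ((expR c)%:E * \int[P]_w (expR (f w))%:E = \int[P]_w (expR (c + f w))%:E)%E.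
Proof.
move=> mf; have mE : measurable_fun setT (fun w => (expR (f w))%:E).
  by apply/measurable_EFinP; exact: measurableT_comp.
rewrite -ge0_integralZl//.
by apply: eq_integral => w _; rewrite expRD EFinM.
Qed.

Section lyapunov.
Context d (Om : measurableType d) (P : probability Om R) (M : nat).
Variables (xi : nat -> Om -> R) (tau : R) (n J : nat).
Hypothesis tau0 : 0 < tau.
Hypothesis mxi : forall i, measurable_fun setT (xi i).
Hypothesis indep : forall i, (i <= J * n)%N -> forall A : nat -> set R, (forall i, measurable (A i)) ->
  P [set w | forall l, (l < i)%N -> A l (xi l w)] = (\prod_(l < i) normal_prob 0 (Num.sqrt tau) (A l))%E.
Variables (b : nat -> 'rV[R]_M) (Psi : 'rV[R]_M -> 'rV[R]_M) (y0 : 'rV[R]_M)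
  (v : nat -> nat -> R) (gam : nat -> 'rV[R]_M -> R) (a kappa B : R).

(** Innovation [j * n + k] belongs to mode [k] in time step [j]: steps and modes are put in one
    linear order, in which the innovations are revealed. *)
Definition noise_inc w j := \sum_(k < n) xi (j * n + k)%N w *: b k.
Let Y j w := euler Psi y0 (noise_inc w) j.
Let be j k := nrm (dgm (v j.+1) (b k)) ^+ 2 * tau.
Let S j := \sum_(i < j) \sum_(k < n) be i k.

Hypotheses (a0 : 0 <= a) (k0 : 0 <= kappa) (mPsi : vmeas Psi) (mgam : forall j, fmeas (gam j))
  (gam0 : forall j y, 0 <= gam j y).
Hypothesis SB : S J <= B.
Hypothesis aB : 4 * (a * B) <= 1.
Hypothesis diss_step : forall j y, (j < J)%N ->
  nrm (dgm (v j.+1) (Psi y)) ^+ 2 + gam j y <= nrm (dgm (v j) y) ^+ 2 + kappa.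

Let be0 j k : 0 <= be j k. Proof. by rewrite mulr_ge0 ?sqr_ge0// ltW. Qed.

Let SS j : S j.+1 = S j + \sum_(k < n) be j k. Proof. by rewrite /S big_ord_recr. Qed.

Let Sle i j : (i <= j)%N -> S i <= S j.
Proof.
elim: j => [|j IH]; first by rewrite leqn0 => /eqP ->.
rewrite leq_eqVlt => /predU1P[->//|/IH h]; apply: (le_trans h).
by rewrite SS lerDl sumr_ge0.
Qed.

Let Y_past j i : (j * n <= i)%N -> cmeas (Y j : past xi i -> 'rV[R]_M).
Proof.
elim: j => [|j IH] ji; first exact: cmeas_cst.
have jn : (j * n <= i)%N by apply: leq_trans ji; rewrite leq_mul2r leqnSn orbT.
rewrite /Y /=; apply: cmeasD; first by apply: mPsi; exact: IH.
apply: cmeas_sum => k; apply: cmeasZ; last exact: cmeas_cst.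
apply: xi_past; apply: leq_trans ji; rewrite mulSn addnC ltn_add2r; exact: ltn_ord.
Qed.

(** Within a time step the modes are added one at a time; the factor [e^(- 4 a sum be)] in the
    coefficient pays for the inflation [1 + 4 s be <= e^(4 a be)] caused by each. *)
Let inner (U : Om -> R) (y : Om -> 'rV[R]_M) (s : R) j : (j < J)%N ->
  (forall i, (j * n <= i)%N -> measurable_fun setT (U : past xi i -> R)) ->
  (forall i, (j * n <= i)%N -> cmeas (y : past xi i -> 'rV[R]_M)) ->
  0 <= s <= a -> forall k, (k <= n)%N ->
  (\int[P]_w (expR (U w + s * expR (- (4 * a * \sum_(l < k) be j l)) *
      nrm (dgm (v j.+1) (y w + \sum_(l < k) xi (j * n + l)%N w *: b l)) ^+ 2))%:E <=
   (expR (2 * a * \sum_(l < k) be j l))%:E * \int[P]_w (expR (U w + s * nrm (dgm (v j.+1) (y w)) ^+ 2))%:E)%E.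
Proof.
move=> jJ mU my /andP[s0 sa]; elim=> [_|k IH kn].
  rewrite big_ord0 !mulr0 oppr0 !expR0 mul1e.
  by rewrite le_eqVlt; apply/orP; left; apply/eqP; apply: eq_integral => w _; rewrite big_ord0 addr0 mulr1.
set z := fun w => dgm (v j.+1) (y w + \sum_(l < k) xi (j * n + l)%N w *: b l).
set s' := s * expR (- (4 * a * \sum_(l < k.+1) be j l)).
have s'0 : 0 <= s' by rewrite mulr_ge0 ?expR_ge0.
have sumS : \sum_(l < k.+1) be j l = \sum_(l < k) be j l + be j k by rewrite big_ord_recr.
have s's : s' <= s.
  rewrite /s' ler_piMr// expR_le1 oppr_le0 mulr_ge0 ?mulr_ge0//.
  by apply: sumr_ge0 => l _.
have bk : be j k <= B.
  apply: le_trans SB; apply: le_trans (Sle jJ).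
  rewrite SS; apply: ler_wpDl; first by apply: sumr_ge0 => i _; apply: sumr_ge0.
  by rewrite (bigD1 (Ordinal kn))//= lerDl sumr_ge0.
have sb : 4 * (s' * be j k) <= 1.
  have : s' * be j k <= a * B by apply: ler_pM => //; exact: le_trans s's sa.
  by move=> h; apply: le_trans aB; rewrite ler_wpM2l.
have jkN : (j * n + k < J * n)%N.
  by apply: (@leq_trans (j.+1 * n)); [rewrite mulSn addnC ltn_add2r|rewrite leq_mul2r jJ orbT].
have mz : cmeas (z : past xi (j * n + k) -> 'rV[R]_M).
  apply: cmeas_dgm; apply: cmeasD; first by apply: my; exact: leq_addr.
  apply: cmeas_sum => l; apply: cmeasZ; last exact: cmeas_cst.
  by apply: xi_past; rewrite ltn_add2l.
have := @gauss_step R d Om P xi tau (J * n) tau0 mxi indep M (j * n + k) U z (dgm (v j.+1) (b k)) s' jkN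
   (mU _ (leq_addr _ _)) mz s'0 sb.
rewrite -/(be j k) => step.
have -> : (\int[P]_w (expR (U w + s' * nrm (dgm (v j.+1) (y w + \sum_(l < k.+1) xi (j * n + l)%N w *: b l)) ^+ 2))%:E
  = \int[P]_w (expR (U w + s' * nrm (z w + xi (j * n + k)%N w *: dgm (v j.+1) (b k)) ^+ 2))%:E)%E.
  by apply: eq_integral => w _; rewrite big_ord_recr/= addrA dgmD dgmZ.
apply: (le_trans step).
have {}IH := IH (ltnW kn).
have EXP : expR (2 * a * \sum_(l < k.+1) be j l) = expR (2 * a * be j k) * expR (2 * a * \sum_(l < k) be j l).
  by rewrite sumS -expRD; congr expR; ring.
rewrite EXP EFinM -[leRHS]muleA.
have mUO : measurable_fun setT U by exact: (measurableT_comp (mU _ (leqnn _)) (@past_id _ _ _ xi mxi _)).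
have mzO : cmeas z by move=> i; exact: (measurableT_comp (mz i) (@past_id _ _ _ xi mxi _)).
have me (c : R) : measurable_fun setT (fun w => U w + c * nrm (z w) ^+ 2).
  by apply: measurable_funD => //; apply: measurable_funM => //; exact: meas_nrm2.
apply: lee_pmul => //.
- by apply: integral_ge0 => w _; rewrite lee_fin expR_ge0.
- rewrite lee_fin ler_expR -mulrA; apply: ler_wpM2l => //; apply: ler_wpM2r; first exact: be0.
  exact: le_trans s's sa.
apply: le_trans IH; apply: le_int_exp; [exact: me|exact: me|].
move=> w; rewrite lerD2l; apply: ler_wpM2r; first exact: sqr_ge0.
rewrite /s' sumS -mulrA; apply: ler_wpM2l => //.
have -> : - (4 * a * \sum_(l < k) be j l) = - (4 * a * (\sum_(l < k) be j l + be j k)) + 4 * (a * be j k) by ring.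
rewrite expRD; apply: ler_wpM2l; first exact: expR_ge0.
apply: le_trans (expR_ge1Dx _); rewrite lerD2l ler_wpM2l//; apply: ler_wpM2r; first exact: be0.
by apply: le_trans sa; rewrite -sumS.
Qed.

(** The coefficient [s j = a e^(- 4 a S j)] decreases with the noise energy spent so far but stays
    above [a e^(- 4 a B)], so the bound is independent of the number of modes. A deterministic step
    may dissipate [gam] and gain [kappa]; the weights [v] let the norm change with [j], as the
    stochastic convolution requires. *)
Lemma lyapunov : (\int[P]_w (expR (a * expR (- (4 * a * B)) *
      (nrm (dgm (v J) (Y J w)) ^+ 2 + \sum_(j < J) gam j (Y j w))))%:E
   <= (expR (a * J%:R * kappa + 2 * a * B + a * nrm (dgm (v 0%N) y0) ^+ 2))%:E)%E.
Proof.
set sJ := a * expR (- (4 * a * B)).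
have sJ0 : 0 <= sJ by rewrite mulr_ge0 ?expR_ge0.
pose s j := a * expR (- (4 * a * S j)).
have S0 j : 0 <= S j by apply: sumr_ge0 => i _; apply: sumr_ge0.
have s0 j : 0 <= s j by rewrite mulr_ge0 ?expR_ge0.
have sa j : s j <= a by rewrite /s ler_piMr// expR_le1 oppr_le0 !mulr_ge0.
have sJs j : (j <= J)%N -> sJ <= s j.
  move=> jJ; apply: ler_wpM2l => //; rewrite ler_expR lerN2; apply: ler_wpM2l; first by rewrite mulr_ge0.
  exact: le_trans (Sle jJ) SB.
pose U j w := sJ * \sum_(i < j) gam i (Y i w).
have mU j i : (j * n <= i)%N -> measurable_fun setT (U j.+1 : past xi i -> R).
  move=> ji; apply: measurable_funM => //; apply: measurable_sum => l; apply: mgam; apply: Y_past.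
  by apply: leq_trans ji; rewrite leq_mul2r -ltnS ltn_ord orbT.
have main j : (j <= J)%N -> (\int[P]_w (expR (U j w + s j * nrm (dgm (v j) (Y j w)) ^+ 2))%:E
   <= (expR (a * j%:R * kappa + 2 * a * S j + a * nrm (dgm (v 0%N) y0) ^+ 2))%:E)%E.
  elim: j => [_|j IH jJ].
    rewrite [X in (X <= _)%E](_ : _ = (expR (a * nrm (dgm (v 0%N) y0) ^+ 2))%:E).
      by rewrite lee_fin /S big_ord0 !mulr0 mul0r !add0r.
    under eq_integral do rewrite /U /s /S !big_ord0 !mulr0 oppr0 expR0 mulr1 add0r.
    transitivity (\int[P]_w cst (expR (a * nrm (dgm (v 0%N) y0) ^+ 2))%:E w)%E; first exact: eq_integral.
    rewrite integral_cst// -[RHS]mule1; congr (_ * _)%E; exact: probability_setT.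
  have := @inner (U j.+1) (fun w => Psi (Y j w)) (s j) j jJ (mU j) _ _ n (leqnn n).
  move=> /(_ _ _)/le_trans H.
  have -> : s j.+1 = s j * expR (- (4 * a * \sum_(l < n) be j l)).
    by rewrite /s SS mulrDr opprD expRD mulrA.
  apply: H.
  - by move=> i ji; apply: mPsi; exact: Y_past.
  - by rewrite s0 sa.
  have -> : expR (a * j.+1%:R * kappa + 2 * a * S j.+1 + a * nrm (dgm (v 0%N) y0) ^+ 2) =
     expR (2 * a * \sum_(l < n) be j l) * (expR (a * kappa) * expR (a * j%:R * kappa + 2 * a * S j + a * nrm (dgm (v 0%N) y0) ^+ 2)).
    by rewrite -!expRD SS -natr1; congr expR; ring.
  rewrite EFinM; apply: lee_wpmul2l; first by rewrite lee_fin expR_ge0.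
  have {}IH := IH (ltnW jJ).
  have mYO i : cmeas (Y i).
    by move=> l; exact: (measurableT_comp (@Y_past i _ (leqnn _) l) (@past_id _ _ _ xi mxi _)).
  have mUO i : measurable_fun setT (U i).
    by apply: measurable_funM => //; apply: measurable_sum => l; apply: mgam; exact: mYO.
  apply: (@le_trans _ _ ((expR (a * kappa))%:E * \int[P]_w (expR (U j w + s j * nrm (dgm (v j) (Y j w)) ^+ 2))%:E)%E); last first.
    by rewrite EFinM; apply: lee_wpmul2l => //; rewrite lee_fin expR_ge0.
  have mR : measurable_fun setT (fun w => U j w + s j * nrm (dgm (v j) (Y j w)) ^+ 2).
    by apply: measurable_funD => //; apply: measurable_funM => //; apply: meas_nrm2; exact: cmeas_dgm.
  rewrite int_exp_shift//; apply: le_int_exp.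
  - apply: measurable_funD => //; apply: measurable_funM => //; apply: meas_nrm2; apply: cmeas_dgm.
    exact: mPsi.
  - exact: measurable_funD.
  move=> w; rewrite /U big_ord_recr/= mulrDr.
  have h1 := ler_wpM2l (s0 j) (diss_step (Y j w) jJ).
  have h2 := ler_wpM2r (gam0 j (Y j w)) (sJs j (ltnW jJ)).
  have h3 := ler_wpM2r k0 (sa j).
  move: h1 h2 h3; rewrite !mulrDr; move: (nrm _ ^+ 2) (nrm _ ^+ 2) (\sum_(i < j) _) (gam j _) => p r u g.
  by move: (sJ * u) (sJ * g) (s j * g) (s j * p) (s j * r) (s j * kappa) (a * kappa) => *; lra.
have {}main := main J (leqnn J).
have mY i : cmeas (Y i).
  by move=> l; exact: (measurableT_comp (@Y_past i _ (leqnn _) l) (@past_id _ _ _ xi mxi _)).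
apply: (@le_trans _ _ (\int[P]_w (expR (U J w + s J * nrm (dgm (v J) (Y J w)) ^+ 2))%:E)%E).
  apply: le_int_exp.
  - apply: measurable_funM => //; apply: measurable_funD; first by apply: meas_nrm2; exact: cmeas_dgm.
    by apply: measurable_sum => j; apply: mgam.
  - apply: measurable_funD; apply: measurable_funM => //.
      by apply: measurable_sum => j; apply: mgam.
    by apply: meas_nrm2; exact: cmeas_dgm.
  - move=> w; rewrite /U mulrDr addrC lerD2l; apply: ler_wpM2r; first exact: sqr_ge0.
    exact: sJs.
apply: (le_trans main); rewrite lee_fin ler_expR; rewrite lerD2r lerD2l; apply: ler_wpM2l => //.
by rewrite mulr_ge0.
Qed.

End lyapunov.

End scheme.

(** * Rational coefficient maps *)

Section regular.
Context {R : realType}.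

(* Common abstraction of "measurable", "continuous" and "convergent": what rational maps preserve. *)
Definition ralg (T : Type) (K : (T -> R) -> Prop) :=
  [/\ forall c, K (fun=> c), forall f g, K f -> K g -> K (fun w => f w + g w),
   forall f g, K f -> K g -> K (fun w => f w * g w) &
   forall f, K f -> (forall w, 1 <= f w) -> K (fun w => (f w)^-1)].

Lemma ralg_sum (T : Type) (K : (T -> R) -> Prop) (I : Type) (r : seq I) (F : I -> T -> R) :
  ralg K -> (forall i, K (F i)) -> K (fun w => \sum_(i <- r) F i w).
Proof.
move=> [kc kD kM kV] KF; elim: r => [|i r IH]; first by under eq_fun do rewrite big_nil; exact: kc.
by under eq_fun do rewrite big_cons; exact: kD.
Qed.

Lemma ralg_meas d (T : measurableType d) : ralg (fun f : T -> R => measurable_fun setT f).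
Proof.
split=> [c|f g|f g|f mf f1]; [exact: measurable_cst|exact: measurable_funD|exact: measurable_funM|].
rewrite (_ : (fun w => (f w)^-1) = (fun w => (f w) `^ (-1))); first exact: measurableT_comp (measurable_powR _) mf.
by apply: funext => w; rewrite powR_inv1// (le_trans _ (f1 w)).
Qed.

(** A sequence together with its limit is one function on [option nat], with the limit at [None];
    convergence then is a property of a single function, as [ralg] requires. *)
Lemma ralg_cvg : ralg (fun u : option nat -> R => (fun n => u (Some n)) @ \oo --> u None).
Proof.
split=> [c|f g|f g|f cf f1]; [exact: cvg_cst|exact: cvgD|exact: cvgM|].
by apply: cvgV => //; rewrite gt_eqF// (lt_le_trans _ (f1 None)).
Qed.

Definition vreg {M} (Psi : 'rV[R]_M -> 'rV[R]_M) := forall T (K : (T -> R) -> Prop), ralg K ->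
  forall y : T -> 'rV[R]_M, (forall i, K (fun w => y w ord0 i)) -> forall i, K (fun w => Psi (y w) ord0 i).
Definition freg {M} (g : 'rV[R]_M -> R) := forall T (K : (T -> R) -> Prop), ralg K ->
  forall y : T -> 'rV[R]_M, (forall i, K (fun w => y w ord0 i)) -> K (fun w => g (y w)).

Context {M : nat}.
Implicit Types (Psi Phi : 'rV[R]_M -> 'rV[R]_M) (g : 'rV[R]_M -> R).

Lemma vreg_meas Psi : vreg Psi -> vmeas Psi.
Proof. by move=> h d T y my i; apply: (h _ _ (ralg_meas T)). Qed.
Lemma freg_meas g : freg g -> fmeas g.
Proof. by move=> h d T y my; apply: (h _ _ (ralg_meas T)). Qed.

Lemma vreg_id : vreg (@id 'rV[R]_M). Proof. by move=> T K kK y. Qed.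
Lemma vregD Psi Phi : vreg Psi -> vreg Phi -> vreg (fun y => Psi y + Phi y).
Proof.
move=> h k T K kK y Ky i; case: (kK) => _ kD _ _; under eq_fun do rewrite mxE.
by apply: kD; [exact: h|exact: k].
Qed.
Lemma vregZ g Psi : freg g -> vreg Psi -> vreg (fun y => g y *: Psi y).
Proof.
move=> h k T K kK y Ky i; case: (kK) => _ _ kM _; under eq_fun do rewrite mxE.
by apply: kM; [exact: h|exact: k].
Qed.
Lemma vreg_dgm v Psi : vreg Psi -> vreg (fun y => dgm v (Psi y)).
Proof.
move=> h T K kK y Ky i; case: (kK) => kc _ kM _; under eq_fun do rewrite dgmE.
by apply: kM; [exact: kc|exact: h].
Qed.
Lemma freg_cst c : freg (fun _ : 'rV[R]_M => c). Proof. by move=> T K [kc _ _ _]. Qed.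
Lemma vreg_Bq : vreg (fun y : 'rV[R]_M => Bq y y).
Proof.
move=> T K kK y Ky i; case: (kK) => kc _ kM _.
have -> : (fun w => Bq (y w) (y w) ord0 i) =
  (fun w => \sum_(j < M) \sum_(k < M) y w ord0 j * (y w ord0 k * Bq (delta j) (delta k) ord0 i)).
  apply: funext => w; rewrite {1}(deltaE (y w)) Bq_suml summxE; apply: eq_bigr => j _.
  rewrite BqZl mxE [X in Bq _ X](deltaE (y w)) Bq_sumr summxE mulr_sumr; apply: eq_bigr => k _.
  by rewrite BqZr mxE.
apply: ralg_sum => // j; apply: ralg_sum => // k.
by apply: (kM); [exact: Ky|apply: kM; [exact: Ky|exact: kc]].
Qed.
Lemma vreg_drift : vreg (@drift R M).
Proof.
have -> : @drift R M = (fun y => (-1) *: dgm (fun i => kp i ^+ 2) (id y) + Bq y y).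
  by apply: funext => y; rewrite driftE scaleN1r.
apply: vregD; last exact: vreg_Bq.
by apply: (vregZ (g := fun=> -1)); [exact: freg_cst|exact: vreg_dgm vreg_id].
Qed.
Lemma freg_dot Psi Phi : vreg Psi -> vreg Phi -> freg (fun y => dot (Psi y) (Phi y)).
Proof.
move=> h k T K kK y Ky; under eq_fun do rewrite dotE; apply: ralg_sum => // i.
by case: (kK) => _ _ kM _; apply: kM; [exact: h|exact: k].
Qed.
Lemma freg_nrm2 Psi : vreg Psi -> freg (fun y => nrm (Psi y) ^+ 2).
Proof. by move=> h; under eq_fun do rewrite nrm_sq; exact: freg_dot. Qed.
Lemma fregD g h : freg g -> freg h -> freg (fun y => g y + h y).
Proof. by move=> rg rh T K kK y Ky; case: (kK) => _ kD _ _; apply: kD; [exact: rg|exact: rh]. Qed.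
Lemma fregM g h : freg g -> freg h -> freg (fun y => g y * h y).
Proof. by move=> rg rh T K kK y Ky; case: (kK) => _ _ kM _; apply: kM; [exact: rg|exact: rh]. Qed.
Lemma fregV g : freg g -> (forall y, 1 <= g y) -> freg (fun y => (g y)^-1).
Proof. by move=> rg g1 T K kK y Ky; case: (kK) => _ _ _ kV; apply: kV => //; exact: rg. Qed.

Lemma freg_cvg g (y : nat -> 'rV[R]_M) (z : 'rV[R]_M) : freg g ->
  (forall i, (fun n => y n ord0 i) @ \oo --> z ord0 i) -> (fun n => g (y n)) @ \oo --> g z.
Proof.
move=> rg yz; pose u (o : option nat) := if o is Some n then y n else z.
exact: (rg _ _ ralg_cvg u).
Qed.
Lemma vreg_cvg Psi (y : nat -> 'rV[R]_M) (z : 'rV[R]_M) : vreg Psi ->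
  (forall i, (fun n => y n ord0 i) @ \oo --> z ord0 i) ->
  forall i, (fun n => Psi (y n) ord0 i) @ \oo --> Psi z ord0 i.
Proof.
move=> rg yz i; pose u (o : option nat) := if o is Some n then y n else z.
exact: (rg _ _ ralg_cvg u).
Qed.

Lemma euler_cvg Psi y0 (dN : nat -> nat -> 'rV[R]_M) (dN' : nat -> 'rV[R]_M) j : vreg Psi ->
  (forall l i, (l < j)%N -> (fun n => dN n l ord0 i) @ \oo --> dN' l ord0 i) ->
  forall i, (fun n => euler Psi y0 (dN n) j ord0 i) @ \oo --> euler Psi y0 dN' j ord0 i.
Proof.
move=> rP; elim: j => [|j IH] H i; first exact: cvg_cst.
rewrite /=; under eq_fun do rewrite mxE; rewrite mxE; apply: cvgD; last exact: H.
by apply: (vreg_cvg rP) => {}i; apply: IH => l k lj; apply: H; exact: ltnW.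
Qed.

End regular.

(** * Convergence of Euler schemes along a continuous driving path *)

Section euler_convergence.
Context {R : realType} {M : nat}.
Implicit Types (Y N : R -> 'rV[R]_M) (d : 'rV[R]_M -> 'rV[R]_M).

Lemma nrm_delta (i : 'I_M) : nrm (delta i : 'rV[R]_M) = 1.
Proof.
by apply/eqP; rewrite -sqrp_eq1 ?nrm_ge0// nrm_sq dot_delta mxE eqxx.
Qed.

Lemma nrm_le_sum (v : 'rV[R]_M) : nrm v <= \sum_(i < M) `|v ord0 i|.
Proof.
rewrite {1}(deltaE v); apply: le_trans (nrm_sum _ _) _.
by apply: ler_sum => i _; rewrite nrmZ nrm_delta mulr1.
Qed.

Lemma sum_share (e : R) : 0 <= e -> \sum_(i < M) e / M.+1%:R <= e.
Proof.
move=> e0; rewrite sumr_const card_ord -[leLHS]mulr_natr mulrAC ler_pdivrMr ?ltr0n// ler_wpM2l// ler_nat.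
exact: leqnSn.
Qed.

Lemma unif_ccont (F : R -> 'rV[R]_M) (T eps : R) : ccont F -> 0 < eps ->
  exists2 del : R, 0 < del & forall s t, 0 <= s <= T -> `|t - s| < del -> nrm (F t - F s) <= eps.
Proof.
move=> cF e0; have M0 : 0 < M.+1%:R :> R by rewrite ltr0n.
have e1 : 0 < eps / M.+1%:R by rewrite divr_gt0.
have /choice[del Hd] : forall i : 'I_M, exists del : R, 0 < del /\ forall s t, 0 <= s <= T -> `|t - s| < del ->
    `|F t ord0 i - F s ord0 i| < eps / M.+1%:R.
  by move=> i; have [del d0 Hd] := unif_cont T (cF i) e1; exists del.
set S := 1 + \sum_i (del i)^-1.
have S0 : 0 < S by rewrite ltr_pwDl// sumr_ge0// => i _; rewrite invr_ge0 ltW//; case: (Hd i).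
exists S^-1; first by rewrite invr_gt0.
move=> s t hs hst; apply: le_trans (nrm_le_sum _) _.
apply: (@le_trans _ _ (\sum_(i < M) eps / M.+1%:R)).
  apply: ler_sum => i _; have [d0 H] := Hd i; rewrite !mxE; apply: ltW; apply: H => //.
  apply: (lt_le_trans hst); rewrite -[leRHS]invrK lef_pV2 ?posrE ?invr_gt0//.
  rewrite /S (bigD1 i)//= addrCA lerDl addr_ge0// sumr_ge0// => j _.
  by rewrite invr_ge0 ltW//; case: (Hd j).
exact: sum_share (ltW e0).
Qed.

Lemma bounded_path (F : R -> 'rV[R]_M) (T : R) : 0 <= T -> ccont F ->
  exists2 rho : R, 0 < rho & forall s, 0 <= s <= T -> nrm (F s) <= rho.
Proof.
move=> T0 cF; have cn := cont_nrm cF.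
have [c _ Hc] := EVT_max T0 (continuous_subspaceT cn).
exists (nrm (F c) + 1); first by rewrite ltr_wpDl ?nrm_ge0.
move=> s hs; apply: (@le_trans _ _ (nrm (F c))); last by rewrite lerDl.
by apply: Hc; rewrite in_itv.
Qed.

Definition loc_lip d := forall rho : R, exists2 L : R, 0 <= L &
  forall a b, nrm a <= rho -> nrm b <= rho -> nrm (d a - d b) <= L * nrm (a - b).
Definition consistent (dt : R -> 'rV[R]_M -> 'rV[R]_M) d := forall rho eps : R, 0 < eps ->
  exists2 tau0 : R, 0 < tau0 & forall tau y, 0 < tau < tau0 -> nrm y <= rho -> nrm (dt tau y - d y) <= eps.

(** The driving path [N] is only continuous, but [Y - N] is differentiable. A step of the scheme
    therefore deviates from the path by a consistency error, a Lipschitz term and the defect of a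
    rectangle rule, which a discrete Gronwall argument sums up. *)
Lemma euler_path_cvg (dt : R -> 'rV[R]_M -> 'rV[R]_M) d Y N (t eps : R) :
  0 < t -> 0 < eps -> loc_lip d -> consistent dt d -> ccont Y -> ccont N -> N 0 = 0 ->
  ccont (fun s => d (Y s)) -> curve (fun s => Y s - N s) (fun s => d (Y s)) ->
  exists m0 : nat, forall m j, (m0 <= m)%N -> (j <= m.+1)%N ->
    let tau := t / m.+1%:R in
    nrm (euler (fun y => y + tau *: dt tau y) (Y 0) (fun l => N (l.+1%:R * tau) - N (l%:R * tau)) j - Y (j%:R * tau)) <= eps.
Proof.
move=> t0 e0 lipd cons cY cN N0 cdY cYN.
have [rho0 rho00 Hrho] := bounded_path (ltW t0) cY.
set rho := rho0 + 1.
have [L L0 HL] := lipd rho.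
(* The cap 1 keeps the scheme in the ball of radius [rho0 + 1], for which [L] and [tau0] are chosen;
   the induction proves this confinement along with the error bound. *)
set eps1 := Num.min eps 1.
have e10 : 0 < eps1 by rewrite lt_min e0 ltr01.
set eta := eps1 / (2 * (t + 1) * expR (L * t)).
have den0 : 0 < 2 * (t + 1) * expR (L * t) by rewrite mulr_gt0 ?expR_gt0//; lra.
have eta0 : 0 < eta by rewrite divr_gt0.
have [tau0 tau00 Hc] := cons rho eta eta0.
have [del del0 Hd] := unif_ccont t cdY eta0.
have eM : 0 < eta / M.+1%:R by rewrite divr_gt0.
have [del' del'0 Hd'] := unif_ccont t cdY eM.
set r := Num.min tau0 del'; have r0 : 0 < r by rewrite lt_min tau00.
exists (Num.bound (t / r)) => m j mm jm; cbv zeta; set tau := t / m.+1%:R.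
have m10 : 0 < m.+1%:R :> R by rewrite ltr0n.
have tau_gt0 : 0 < tau by rewrite divr_gt0.
have taur : tau < r.
  rewrite /tau ltr_pdivrMr// mulrC -ltr_pdivrMr//.
  apply: lt_le_trans (archi_boundP _) _; first by rewrite divr_ge0 ?ltW.
  by rewrite ler_nat; exact: leq_trans (leqnSn _).
have taut : m.+1%:R * tau = t by rewrite /tau mulrC divfK// gt_eqF.
set E := euler _ _ _.
have jt i : (i <= m.+1)%N -> 0 <= i%:R * tau <= t.
  by move=> im; rewrite mulr_ge0 ?(ltW tau_gt0)//= -taut ler_wpM2r ?(ltW tau_gt0)// ler_nat.
suff H : nrm (E j - Y (j%:R * tau)) <= expR (L * (j%:R * tau)) * (2 * eta * (j%:R * tau)).
  apply: (le_trans H); have /andP[j0 jt1] := jt j jm.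
  have h1 : expR (L * (j%:R * tau)) <= expR (L * t) by rewrite ler_expR ler_wpM2l.
  have h2 : 2 * eta * (j%:R * tau) <= 2 * eta * (t + 1).
    apply: ler_wpM2l; first by rewrite mulr_ge0// ltW.
    by apply: (le_trans jt1); rewrite lerDl.
  have h3 : 0 <= 2 * eta * (j%:R * tau) by rewrite mulr_ge0// mulr_ge0// ltW.
  apply: le_trans (ler_pM (expR_ge0 _) h3 h1 h2) _.
  have -> : expR (L * t) * (2 * eta * (t + 1)) = eta * (2 * (t + 1) * expR (L * t)) by ring.
  by rewrite /eta divfK ?gt_eqF// ge_min lexx.
elim: j jm => [_|j IH jm]; first by rewrite /E /= mul0r subrr nrm0 mulr0 mulr0 mulr0.
have {}IH := IH (ltnW jm); have /andP[j0 jt1] := jt j (ltnW jm); have /andP[_ jt2] := jt j.+1 jm.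
set s := j%:R * tau in IH j0 jt1 *.
have sE : j.+1%:R * tau = s + tau by rewrite -natr1 mulrDl mul1r.
rewrite sE in jt2 *.
have Ej : nrm (E j - Y s) <= 1.
  apply: (le_trans IH); have h1 : expR (L * s) <= expR (L * t) by rewrite ler_expR ler_wpM2l.
  have h2 : 2 * eta * s <= 2 * eta * (t + 1).
    apply: ler_wpM2l; first by rewrite mulr_ge0// ltW.
    by apply: (le_trans jt1); rewrite lerDl.
  have h3 : 0 <= 2 * eta * s by rewrite mulr_ge0// mulr_ge0// ltW.
  apply: le_trans (ler_pM (expR_ge0 _) h3 h1 h2) _.
  have -> : expR (L * t) * (2 * eta * (t + 1)) = eta * (2 * (t + 1) * expR (L * t)) by ring.
  by rewrite /eta divfK ?gt_eqF// ge_min lexx orbT.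
have Ys : nrm (Y s) <= rho0 by apply: Hrho; rewrite j0.
have Ejr : nrm (E j) <= rho.
  have -> : E j = (E j - Y s) + Y s by rewrite subrK.
  by apply: le_trans (nrmD _ _) _; rewrite /rho addrC lerD.
set X := N (s + tau) - N s.
have EE : E j.+1 - Y (s + tau) = (E j - Y s) + tau *: (dt tau (E j) - d (E j)) + tau *: (d (E j) - d (Y s))
    - (((Y (s + tau) - N (s + tau)) - (Y s - N s)) - tau *: d (Y s)).
  rewrite /E /= -/E -natr1 mulrDl mul1r -/s.
  move: (E j) (N (s + tau)) (N s) (Y (s + tau)) (d (Y s)) (Y s) => e n1 n2 y1 dy y2.
  move: (dt tau e) (d e) => p q.
  by apply/rowP => i; rewrite !mxE; ring.
have b1 : nrm (dt tau (E j) - d (E j)) <= eta.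
  by apply: Hc => //; rewrite tau_gt0/=; apply: (lt_le_trans taur); rewrite ge_min lexx.
have b2 : nrm (d (E j) - d (Y s)) <= L * nrm (E j - Y s).
  by apply: HL => //; apply: (le_trans Ys); rewrite lerDl.
have b3 : nrm (((Y (s + tau) - N (s + tau)) - (Y s - N s)) - tau *: d (Y s)) <= tau * eta.
  apply: le_trans (nrm_le_sum _) _.
  apply: (@le_trans _ _ (\sum_(i < M) tau * (eta / M.+1%:R))).
    apply: ler_sum => i _; rewrite !mxE.
    have := @increment_defect R (fun u => (Y u - N u) ord0 i) (fun u => d (Y u) ord0 i) s tau (eta / M.+1%:R) (ltW tau_gt0).
    rewrite !mxE; apply.
    - by move=> u /andP[u0 _]; apply: cYN.2; exact: le_lt_trans u0.
    - by move=> u _; apply: cYN.1.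
    - move=> u /andP[u1 u2]; have := coord_le (d (Y u) - d (Y s)) i; rewrite !mxE => h.
      apply: (le_trans h); apply: Hd'; first by rewrite j0.
      rewrite gtr0_norm; last by lra.
      apply: lt_trans (_ : tau < _); first by lra.
      by apply: (lt_le_trans taur); rewrite ge_min lexx orbT.
  rewrite -mulr_sumr; apply: ler_wpM2l; first exact: ltW.
  exact: sum_share (ltW eta0).
rewrite EE; apply: le_trans (nrmB _ _) _; apply: (@le_trans _ _ ((1 + L * tau) * nrm (E j - Y s) + 2 * eta * tau)).
  have h1 := nrmD (E j - Y s + tau *: (dt tau (E j) - d (E j))) (tau *: (d (E j) - d (Y s))).
  have h2 := nrmD (E j - Y s) (tau *: (dt tau (E j) - d (E j))).
  rewrite !nrmZ (gtr0_norm tau_gt0) in h1 h2.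
  have h3 := ler_wpM2l (ltW tau_gt0) b1.
  have h4 := ler_wpM2l (ltW tau_gt0) b2.
  move: h1 h2 h3 h4 b3; move: (nrm _) (nrm (_ + _)) (nrm (_ - tau *: _)) (nrm (_ - d (E j))) (nrm (_ - d (Y s))) (nrm _) => p1 p2 p3 p4 p5 p6; clear.
  by move=> *; lra.
have h1 : (1 + L * tau) * nrm (E j - Y s) <= expR (L * tau) * (expR (L * s) * (2 * eta * s)).
  apply: ler_pM => //; [|exact: nrm_ge0|exact: expR_ge1Dx].
  by rewrite addr_ge0// mulr_ge0// ltW.
have h2 : 2 * eta * tau <= expR (L * (s + tau)) * (2 * eta * tau).
  rewrite ler_peMl//; first by apply: mulr_ge0; [rewrite mulr_ge0// ltW|exact: ltW].
  by rewrite -expR0 ler_expR mulr_ge0// addr_ge0// ltW.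
apply: le_trans (lerD h1 h2) _.
by rewrite mulrA -expRD -mulrDr [tau + s]addrC -mulrDr -mulrDr.
Qed.

End euler_convergence.

(** * Moments of the Galerkin flow *)

Section bessel.
Context {R : realType}.
Local Notation mu := (@lebesgue_measure R).
Local Notation I := (@I01 R).

Let mI : measurable (I : set (measurableTypeR R)). Proof. exact: measurable_itv. Qed.

Lemma cont_integrable_I01 (f : R -> R) : continuous f -> mu.-integrable I (EFin \o f).
Proof.
move=> cf; apply: (integrableS _ _ _ (cont_integrable 0 1 cf)) => //.
by apply: subset_itv; rewrite bnd_simp.
Qed.

Lemma L2fun_cont (f : R -> R) : continuous f -> L2fun f.
Proof.
move=> cf; split; first by apply: measurable_funTS; exact: continuous_measurable_fun.
have c2 : continuous (fun z => f z ^+ 2) by cont.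
have /integrableP[_] := cont_integrable_I01 c2.
by under eq_integral do rewrite /= ger0_norm ?sqr_ge0//.
Qed.

Lemma integrable_add (f g : R -> R) : mu.-integrable I (EFin \o f) -> mu.-integrable I (EFin \o g) ->
  mu.-integrable I (EFin \o (fun z => f z + g z)).
Proof. by move=> hf hg; have := integrableD mI hf hg; congr (_.-integrable _ _); apply: funext. Qed.

Section one.
Variable e : R -> R.
Hypothesis Le : L2fun e.

Lemma L2_sq_integrable : mu.-integrable I (EFin \o (fun z => e z ^+ 2)).
Proof.
case: Le => me fin; apply/integrableP; split.
  by apply/measurable_EFinP; exact: measurable_funX.
by under eq_integral do rewrite /= ger0_norm ?sqr_ge0//.
Qed.

Lemma L2_cont_integrable (f : R -> R) : continuous f -> mu.-integrable I (EFin \o (fun z => e z * f z)).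
Proof.
move=> cf; have c2 : continuous (fun z => f z ^+ 2) by cont.
apply: (le_integrable mI _ _ (integrable_add L2_sq_integrable (cont_integrable_I01 c2))).
  apply/measurable_EFinP; apply: measurable_funM; first by case: Le.
  by apply: measurable_funTS; exact: continuous_measurable_fun.
move=> z _ /=; rewrite lee_fin [leRHS]ger0_norm ?addr_ge0 ?sqr_ge0// normrM.
have := sqr_ge0 (`|e z| - `|f z|); rewrite -(real_normK (num_real (e z))) -(real_normK (num_real (f z))).
have := sqr_ge0 `|e z|; have := sqr_ge0 `|f z|; move: `|e z| `|f z| => a b; nra.
Qed.

Lemma ip_embM (M : nat) (c : 'rV[R]_M) : ip e (Sf c) = \sum_(i < M) c ord0 i * ip e (hk i.+1).
Proof.
have H (r : seq 'I_M) : Rintegral mu I (fun z => e z * \sum_(i <- r) c ord0 i * hk i.+1 z) = \sum_(i <- r) c ord0 i * ip e (hk i.+1).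
  have ch (s : seq 'I_M) : continuous (fun z : R => \sum_(i <- s) c ord0 i * hk i.+1 z).
    by apply: cont_sum => i; apply: contM; [exact: contC|exact: cont_hk].
  elim: r => [|i r IH].
    by rewrite big_nil; under eq_Rintegral do rewrite big_nil mulr0; rewrite Rintegral_cst// mul0r.
  rewrite big_cons -IH /ip.
  have i1 := L2_cont_integrable (@cont_hk R i).
  rewrite -RintegralZl// -RintegralD//; first last.
  - exact: (L2_cont_integrable (ch r)).
  - have := L2_cont_integrable (contM (@contC _ _ (c ord0 i)) (@cont_hk R i)).
    by congr (_.-integrable _ _); apply: funext => z /=; congr (_%:E); ring.
  apply: eq_Rintegral => z _; rewrite big_cons; ring.
by rewrite -H /ip; apply: eq_Rintegral => z _; rewrite SfE.
Qed.

Lemma bessel (M : nat) : nrm (coordPM M e) ^+ 2 <= ip e e.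
Proof.
set c := coordPM M e; have cS := @cont_Sf R M c.
have c2 : continuous (fun z => Sf c z ^+ 2) by cont.
have : 0 <= Rintegral mu I (fun z => (e z - Sf c z) ^+ 2) by apply: Rintegral_ge0 => z _; exact: sqr_ge0.
have -> : Rintegral mu I (fun z => (e z - Sf c z) ^+ 2) =
   Rintegral mu I (fun z => e z ^+ 2) + (Rintegral mu I (fun z => Sf c z ^+ 2) + Rintegral mu I (fun z => -2 * (e z * Sf c z))).
  have i1 := L2_cont_integrable cS.
  have i2 : mu.-integrable I (EFin \o (fun z => -2 * (e z * Sf c z))).
    have := L2_cont_integrable (contM (@contC _ _ (-2)) cS).
    by congr (_.-integrable _ _); apply: funext => z /=; congr (_%:E); ring.
  have i3 := cont_integrable_I01 c2.
  rewrite -[X in _ = _ + X]RintegralD// -RintegralD//; [|exact: L2_sq_integrable|exact: (integrable_add i3 i2)].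
  by apply: eq_Rintegral => z _; ring.
rewrite RintegralZl//; last exact: L2_cont_integrable.
have -> : Rintegral mu I (fun z => e z * Sf c z) = nrm c ^+ 2.
  have := ip_embM c; rewrite /ip => ->; rewrite nrm_sq dotE; apply: eq_bigr => i _.
  by rewrite {2}/c mxE.
have -> : Rintegral mu I (fun z => Sf c z ^+ 2) = nrm c ^+ 2.
  rewrite nrm_sq -I_SS -ip_I// /ip; apply: eq_Rintegral => z _; exact: expr2.
rewrite /ip; under [X in _ -> _ <= X]eq_Rintegral do rewrite -expr2.
lra.
Qed.

End one.
End bessel.

Section noise.
Context {R : realType}.
Variables (e : nat -> R -> R) (q : nat -> R).
Hypothesis Hq : trace_class_eig e q.

(* The noise [P_M W^Q] is [sum_k W^(k) bvec M k]. *)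
Definition bvec M k : 'rV[R]_M := Num.sqrt (q k) *: coordPM M (e k).

(** By Bessel [|P_M e_k| <= 1], so the trace of [Q] bounds the noise energy for all [M]; the added 1
    makes the bound positive. *)
Lemma trace_bound : exists2 trQ : R, 0 < trQ & forall M n, \sum_(k < n) nrm (bvec M k) ^+ 2 <= trQ.
Proof.
have [Le [on [_ [q0 [l Hl]]]]] := Hq.
exists (l + 1).
  have h : 0 <= l.
    rewrite -(cvg_lim _ Hl)//; apply: limr_ge; first by apply/cvg_ex; exists l.
    by apply: nearW => n; apply: sumr_ge0.
  lra.
move=> M n; apply: (@le_trans _ _ (\sum_(k < n) q k)).
  apply: ler_sum => k _; rewrite /bvec nrmZ exprMn ger0_norm ?sqrtr_ge0// sqr_sqrtr//.
  rewrite -[leRHS]mulr1; apply: ler_wpM2l => //.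
  by apply: le_trans (bessel (Le k) M) _; rewrite on eqxx.
apply: (@le_trans _ _ l); last by rewrite lerDl.
rewrite -(cvg_lim _ Hl)//; apply: limr_ge; first by apply/cvg_ex; exists l.
near=> m.
have nm : (n <= m)%N by near: m; exact: nbhs_infty_ge.
rewrite -(subnKC nm) big_split_ord/= lerDl; exact: sumr_ge0.
Unshelve. all: by end_near. Qed.

End noise.

Section brownian_scheme.
Context {R : realType} d (Om : measurableType d) (P : probability Om R).
Variables (W : nat -> R -> Om -> R).
Hypothesis HW : indep_std_BMs P W.

Definition incr (tau : R) n i w :=
  W (i %% n)%N ((i %/ n).+1%:R * tau) w - W (i %% n)%N ((i %/ n)%:R * tau) w.

Lemma prod_block (F : nat -> \bar R) n J :
  (\prod_(k < n) \prod_(j < J) F (j * n + k)%N = \prod_(l < J * n) F l)%E.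
Proof.
rewrite exchange_big/=; elim: J => [|J IH]; first by rewrite big_ord0 mul0n big_ord0.
rewrite big_ord_recr/= IH -!(big_mkord xpredT F) mulSn addnC.
rewrite [RHS](@big_cat_nat _ _ _ (J * n)%N)//= ?leq_addr//; congr (_ * _)%E.
rewrite -{2}[(J * n)%N]add0n big_addn addKn big_mkord.
by apply: eq_bigr => k _; rewrite addnC.
Qed.

(** The independence hypothesis speaks of full rectangles of steps and modes. A prefix of the
    enumeration is reached by imposing the void condition [setT] on the later increments. *)
Lemma incr_indep (tau : R) n J : 0 < tau -> forall i, (i <= J * n)%N -> forall A : nat -> set R,
  (forall i, measurable (A i)) ->
  P [set w | forall l, (l < i)%N -> A l (incr tau n l w)] =
  (\prod_(l < i) normal_prob 0 (Num.sqrt tau) (A l))%E.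
Proof.
move=> tau0 i iJ A mA; have [_ [_ [_ H]]] := HW.
pose A' k j := if (j * n + k < i)%N then A (j * n + k)%N else setT.
have mA' k j : measurable (A' k j) by rewrite /A'; case: ifP.
have := H n J (fun j => j%:R * tau) A' _ _ mA'.
rewrite mul0r lexx => /(_ isT) {}H.
have {}H := H (fun j => _).
have -> : [set w | forall l, (l < i)%N -> A l (incr tau n l w)] =
  [set w | forall k j, (k < n)%N -> (j < J)%N -> A' k j (W k (j.+1%:R * tau) w - W k (j%:R * tau) w)].
  apply/seteqP; split => w /= h.
    move=> k j kn jJ; rewrite /A'; case: ifP => // jk.
    have := h _ jk; rewrite /incr divnMDl ?(leq_ltn_trans _ kn)// divn_small// addn0.
    by rewrite modnMDl modn_small.
  move=> l li; have n0 : (0 < n)%N by have := leq_trans li iJ; case: n {h A' mA' H iJ} => //; rewrite muln0.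
  have lJ : (l %/ n < J)%N by rewrite ltn_divLR// (leq_trans li iJ).
  by have := h (l %% n)%N (l %/ n)%N (ltn_pmod l n0) lJ; rewrite /A' -divn_eq li.
rewrite H; last by move=> j; rewrite -natr1 mulrDl mul1r ltrDl.
transitivity (\prod_(k < n) \prod_(j < J) (fun l => normal_prob 0 (Num.sqrt tau) (if (l < i)%N then A l else setT)) (j * n + k)%N)%E.
  apply: eq_bigr => k _; apply: eq_bigr => j _; rewrite /A'.
  rewrite (_ : j.+1%:R * tau - j%:R * tau = tau); last by rewrite -natr1; ring.
  by case: ifP.
rewrite (prod_block (fun l => normal_prob 0 (Num.sqrt tau) (if (l < i)%N then A l else setT))).
rewrite -(big_mkord xpredT (fun l => normal_prob 0 (Num.sqrt tau) (if (l < i)%N then A l else setT))).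
rewrite -(big_mkord xpredT (fun l => normal_prob 0 (Num.sqrt tau) (A l))).
rewrite [LHS](@big_cat_nat _ _ _ i)//=.
rewrite (_ : (\prod_(i <= l < J * n) _)%E = 1%E) ?mule1; last first.
  rewrite big_nat_cond big1// => l /andP[/andP[il _] _]; rewrite ltnNge il/=.
  exact: (@probability_setT _ _ _ (normal_prob 0 (Num.sqrt tau) : probability (measurableTypeR R) R)).
by apply: eq_big_nat => l /andP[_ ->].
Qed.

Lemma measurable_incr tau n i : measurable_fun setT (incr tau n i).
Proof. by apply: measurable_funB; case: HW. Qed.

(* Letting the number of noise modes tend to infinity in the exponential Lyapunov estimate. *)
Lemma Ele_scheme M (b : nat -> 'rV[R]_M) (N : Om -> R -> 'rV[R]_M) (tau : R) J
  (Psi : 'rV[R]_M -> 'rV[R]_M) y0 (v : nat -> nat -> R) (gam : nat -> 'rV[R]_M -> R) (a kappa B : R) :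
  0 < tau -> 0 <= a -> 0 <= kappa -> vreg Psi -> (forall j, freg (gam j)) -> (forall j y, 0 <= gam j y) ->
  (forall n, \sum_(j < J) \sum_(k < n) nrm (dgm (v j.+1) (b k)) ^+ 2 * tau <= B) -> 4 * (a * B) <= 1 ->
  (forall j y, (j < J)%N -> nrm (dgm (v j.+1) (Psi y)) ^+ 2 + gam j y <= nrm (dgm (v j) y) ^+ 2 + kappa) ->
  (forall s, 0 <= s -> {ae P, forall w, forall i : 'I_M,
     (fun n => \sum_(k < n) W k s w * b k ord0 i) @ \oo --> N w s ord0 i}) ->
  Ele P (fun w => let Y := euler Psi y0 (fun j => N w (j.+1%:R * tau) - N w (j%:R * tau)) in
      expR (a * expR (- (4 * a * B)) * (nrm (dgm (v J) (Y J)) ^+ 2 + \sum_(j < J) gam j (Y j))))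
    (expR (a * J%:R * kappa + 2 * a * B + a * nrm (dgm (v 0%N) y0) ^+ 2)).
Proof.
move=> tau0 a0 k0 rP rg g0 SB aB Hd HN.
pose Yn n w := euler Psi y0 (noise_inc (incr tau n) n b w).
have mYn n j : cmeas (fun w => Yn n w j).
  elim: j => [|j IH]; first exact: cmeas_cst.
  apply: cmeasD; first exact: (vreg_meas rP).
  by apply: cmeas_sum => k; apply: cmeasZ; [exact: measurable_incr|exact: cmeas_cst].
apply: (@Ele_fatou _ _ _ P (fun n w => expR (a * expR (- (4 * a * B)) *
   (nrm (dgm (v J) (Yn n w J)) ^+ 2 + \sum_(j < J) gam j (Yn n w j))))).
  move=> n; apply: Ele_meas.
  - apply: measurableT_comp => //; apply: measurable_funM => //; apply: measurable_funD.
      by apply: meas_nrm2; apply: cmeas_dgm.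
    by apply: measurable_sum => j; apply: (freg_meas (rg j)).
  - by move=> w; exact: expR_ge0.
  - apply: (@lyapunov R d Om P M (incr tau n) tau n J tau0 (@measurable_incr tau n) (@incr_indep tau n J tau0)
      b Psi y0 v gam a kappa B) => //; first exact: vreg_meas.
    by move=> j; exact: freg_meas.
have HN2 : {ae P, forall w, forall j : nat, forall i : 'I_M,
     (fun n => \sum_(k < n) W k (j%:R * tau) w * b k ord0 i) @ \oo --> N w (j%:R * tau) ord0 i}.
  by apply/ae_foralln => j; apply: HN; rewrite mulr_ge0// ltW.
apply: filterS HN2 => w Hw.
have cY j i : (fun n => Yn n w j ord0 i) @ \oo -->
    euler Psi y0 (fun j => N w (j.+1%:R * tau) - N w (j%:R * tau)) j ord0 i.
  have := @euler_cvg R M Psi y0 (fun n => noise_inc (incr tau n) n b w)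
    (fun j => N w (j.+1%:R * tau) - N w (j%:R * tau)) j rP _ i.
  apply => l {}i lj; rewrite !mxE.
  have -> : (fun n => noise_inc (incr tau n) n b w l ord0 i) =
     (fun n => \sum_(k < n) W k (l.+1%:R * tau) w * b k ord0 i - \sum_(k < n) W k (l%:R * tau) w * b k ord0 i).
    apply: funext => n; rewrite -sumrB /noise_inc summxE; apply: eq_bigr => k _.
    have n0 : (0 < n)%N := leq_ltn_trans (leq0n k) (ltn_ord k).
    rewrite mxE /incr divnMDl// divn_small// addn0 modnMDl modn_small//; ring.
  by apply: cvgB; exact: Hw.
cbv zeta; set Y := euler _ _ _ in cY *.
set F := _ * (_ + _).
suff cv : (fun n => a * expR (- (4 * a * B)) *
    (nrm (dgm (v J) (Yn n w J)) ^+ 2 + \sum_(j < J) gam j (Yn n w j))) @ \oo --> F.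
  by apply: (cvg_comp _ _ cv); exact: continuous_expR.
apply: cvgM; first exact: cvg_cst.
apply: cvgD.
  exact: (freg_cvg (freg_nrm2 (vreg_dgm (v J) (@vreg_id _ _)))).
pose u (j : 'I_J) (o : option nat) := if o is Some n then gam j (Yn n w j) else gam j (Y j).
by apply: (ralg_sum (F := u) (index_enum 'I_J) ralg_cvg) => j; exact: (freg_cvg (rg j)).
Qed.

End brownian_scheme.

Section euler_limits.
Context {R : realType} {M : nat}.
Implicit Types (Y N : R -> 'rV[R]_M) (d : 'rV[R]_M -> 'rV[R]_M).

Lemma euler_end_cvg dt d Y N (t : R) :
  0 < t -> loc_lip d -> consistent dt d -> ccont Y -> ccont N -> N 0 = 0 ->
  ccont (fun s => d (Y s)) -> curve (fun s => Y s - N s) (fun s => d (Y s)) ->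
  forall i, (fun m : nat => let tau := t / m.+1%:R in
    euler (fun y => y + tau *: dt tau y) (Y 0) (fun l => N (l.+1%:R * tau) - N (l%:R * tau)) m.+1 ord0 i)
    @ \oo --> Y t ord0 i.
Proof.
move=> t0 ld cs cY cN N0 cdY cYN i; apply/cvgrPdist_le => eps e0.
have [m0 H] := euler_path_cvg t0 e0 ld cs cY cN N0 cdY cYN.
near=> m; have mm : (m0 <= m)%N by near: m; exact: nbhs_infty_ge.
have := H m m.+1 mm (leqnn _); cbv zeta.
rewrite [m.+1%:R * _]mulrC divfK ?pnatr_eq0//; apply: le_trans.
set E := euler _ _ _ _; have := coord_le (E - Y t) i.
by rewrite !mxE distrC.
Unshelve. all: by end_near. Qed.

Lemma euler_sum_cvg dt d Y N (t : R) (G : R -> 'rV[R]_M -> R) (g : 'rV[R]_M -> R) :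
  0 < t -> loc_lip d -> consistent dt d -> ccont Y -> ccont N -> N 0 = 0 ->
  ccont (fun s => d (Y s)) -> curve (fun s => Y s - N s) (fun s => d (Y s)) ->
  continuous (fun s => g (Y s)) ->
  (forall rho eps : R, 0 < eps -> exists2 eta : R, 0 < eta & forall tau y z, 0 < tau < eta ->
     nrm y <= rho -> nrm z <= rho -> nrm (y - z) <= eta -> `|G tau y - g z| <= eps) ->
  (fun m : nat => let tau := t / m.+1%:R in \sum_(j < m.+1) tau *
    G tau (euler (fun y => y + tau *: dt tau y) (Y 0) (fun l => N (l.+1%:R * tau) - N (l%:R * tau)) j))
    @ \oo --> prim (fun s => g (Y s)) t.
Proof.
move=> t0 ld cs cY cN N0 cdY cYN cg HG; apply/cvgrPdist_le => eps e0.
have e2 : 0 < eps / 2 by rewrite divr_gt0.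
have e3 : 0 < eps / 2 / t by rewrite divr_gt0.
have [rho r0 Hrho] := bounded_path (ltW t0) cY.
have [eta eta0 Heta] := HG (rho + 1) _ e3.
have eta1 : 0 < Num.min eta 1 by rewrite lt_min eta0 ltr01.
have [m0 H] := euler_path_cvg t0 eta1 ld cs cY cN N0 cdY cYN.
have /cvgrPdist_le/(_ _ e2) HR := riemann_sum (ltW t0) cg.
near=> m; have mm : (m0 <= m)%N by near: m; exact: nbhs_infty_ge.
have HR2 : `|prim (fun s => g (Y s)) t - t / m.+1%:R * \sum_(j < m.+1) g (Y (j%:R * (t / m.+1%:R)))| <= eps / 2 by near: m.
cbv zeta; set tau := t / m.+1%:R in HR2 *.
have tau0 : 0 < tau by rewrite divr_gt0// ltr0n.
have taueta : tau < eta.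
  rewrite /tau ltr_pdivrMr ?ltr0n// mulrC -ltr_pdivrMr//.
  by apply: lt_trans (_ : m%:R < _); [near: m; exact: nbhs_infty_gtr|rewrite ltr_nat].
have taut : m.+1%:R * tau = t by rewrite /tau mulrC divfK// gt_eqF// ltr0n.
set E := euler _ _ _ in H *.
have HE j : (j <= m.+1)%N -> nrm (E j - Y (j%:R * tau)) <= Num.min eta 1 by move=> jm; exact: H.
have jt j : (j <= m.+1)%N -> 0 <= j%:R * tau <= t.
  by move=> jm; rewrite mulr_ge0 ?(ltW tau0)//= -taut ler_wpM2r ?(ltW tau0)// ler_nat.
have D : `|tau * \sum_(j < m.+1) g (Y (j%:R * tau)) - \sum_(j < m.+1) tau * G tau (E j)| <= eps / 2.
  rewrite mulr_sumr -sumrB; apply: le_trans (ler_norm_sum _ _ _) _.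
  apply: (@le_trans _ _ (\sum_(j < m.+1) tau * (eps / 2 / t))).
    apply: ler_sum => j _; rewrite -mulrBr normrM gtr0_norm//; apply: ler_wpM2l; first exact: ltW.
    have jm : (j <= m.+1)%N := ltnW (ltn_ord j).
    have hY : nrm (Y (j%:R * tau)) <= rho by apply: Hrho; exact: jt.
    rewrite distrC; apply: Heta; first by rewrite tau0.
    - have -> : E j = (E j - Y (j%:R * tau)) + Y (j%:R * tau) by rewrite subrK.
      apply: le_trans (nrmD _ _) _; rewrite addrC; apply: lerD => //.
      by apply: le_trans (HE j jm) _; rewrite ge_min lexx orbT.
    - by apply: (le_trans hY); rewrite lerDl.
    - by apply: le_trans (HE j jm) _; rewrite ge_min lexx.
  by rewrite sumr_const card_ord -[leLHS]mulr_natl mulrA taut mulrC divfK ?gt_eqF.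
have := ler_normD (prim (fun s => g (Y s)) t - tau * \sum_(j < m.+1) g (Y (j%:R * tau)))
  (tau * \sum_(j < m.+1) g (Y (j%:R * tau)) - \sum_(j < m.+1) tau * G tau (E j)).
rewrite addrA subrK => h; apply: (le_trans h); apply: le_trans (lerD HR2 D) _.
by rewrite -splitr.
Unshelve. all: by end_near. Qed.

End euler_limits.

(** * The drift and its tamed version *)

Section coefficients.
Context {R : realType} {M : nat}.
Implicit Types (a b y z : 'rV[R]_M).

Let k2 : R := kp M ^+ 2.
Let k20 : 0 <= k2. Proof. exact: sqr_ge0. Qed.

Lemma nrm_Lam2_le a : nrm (Lam (Lam a)) <= k2 * nrm a.
Proof.
apply: le_trans (nrm_Lam_le _) _; rewrite /k2 expr2 -mulrA; apply: ler_wpM2l; last exact: nrm_Lam_le.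
exact: ltW (kp_gt0 _).
Qed.

Lemma drift_lip : loc_lip (@drift R M).
Proof.
move=> rho; exists (k2 + 3 * k2 * `|2 * rho|); first by rewrite addr_ge0// mulr_ge0// mulr_ge0.
move=> a b ha hb; rewrite driftB; apply: le_trans (nrmD _ _) _; rewrite nrmN mulrDl; apply: lerD.
  exact: nrm_Lam2_le.
apply: le_trans (nrm_Bq_le _ _) _; rewrite -/k2; apply: ler_wpM2r; first exact: nrm_ge0.
apply: ler_wpM2l; first by rewrite mulr_ge0.
apply: le_trans (nrmD _ _) _; apply: le_trans (ler_norm _); lra.
Qed.

Lemma drift_bound (rho : R) : exists2 K : R, 0 <= K & forall y, nrm y <= rho -> nrm (drift y) <= K.
Proof.
have [L L0 HL] := drift_lip `|rho|.
exists (L * `|rho|); first by rewrite mulr_ge0.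
move=> y hy; have y0 : nrm (0 : 'rV[R]_M) <= `|rho| by rewrite nrm0.
have := HL y 0 (le_trans hy (ler_norm _)) y0; rewrite subr0.
have -> : drift 0 = 0 :> 'rV[R]_M.
  rewrite driftE (_ : dgm _ 0 = 0); last by apply/rowP => i; rewrite !(dgmE, mxE) mulr0.
  by rewrite oppr0 add0r; have := BqZl 0 (0 : 'rV[R]_M) 0; rewrite !scale0r.
rewrite subr0 => h; apply: (le_trans h); apply: ler_wpM2l => //; exact: le_trans hy (ler_norm _).
Qed.

Lemma dot_drift y : dot (drift y) y = - nrm (Lam y) ^+ 2.
Proof. by rewrite driftE dotDl Bq_self0 addr0 dotNl nrm_sq -dot_Lam /Lam dgm_dgm; congr (- dot _ _); apply: eq_dgm => i; rewrite expr2. Qed.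

(* Taming makes [tau |tamed tau y|^2 <= sqrt tau], so that the explicit Euler step keeps the
   exponential Lyapunov estimate of the continuous flow up to a vanishing error. *)
Definition damp (tau : R) y := (1 + Num.sqrt tau * nrm (drift y) ^+ 2)^-1.
Definition tamed tau y := damp tau y *: drift y.

Lemma damp_bounds tau y : 0 < damp tau y <= 1.
Proof.
have h : 1 <= 1 + Num.sqrt tau * nrm (drift y) ^+ 2 by rewrite lerDl mulr_ge0 ?sqr_ge0 ?sqrtr_ge0.
by rewrite /damp invr_gt0 (lt_le_trans _ h)//= invf_le1// (lt_le_trans _ h).
Qed.

Lemma damp_near tau y : 1 - damp tau y <= Num.sqrt tau * nrm (drift y) ^+ 2.
Proof.
set u := Num.sqrt tau * _; have u0 : 0 <= u by rewrite mulr_ge0 ?sqr_ge0 ?sqrtr_ge0.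
have h : 0 < 1 + u by rewrite ltr_wpDr.
rewrite /damp -/u -(@ler_pM2r _ (1 + u))// mulrBl mulVf ?gt_eqF//; nra.
Qed.

Lemma freg_damp tau : freg (damp tau).
Proof.
apply: fregV.
  apply: fregD; first exact: freg_cst.
  by apply: fregM; [exact: freg_cst|exact: freg_nrm2 vreg_drift].
by move=> y; rewrite lerDl mulr_ge0 ?sqr_ge0 ?sqrtr_ge0.
Qed.

Lemma vreg_tamed tau : vreg (tamed tau).
Proof. exact: vregZ (freg_damp tau) vreg_drift. Qed.

Lemma small_sqrt (K eps : R) : 0 <= K -> 0 < eps -> exists2 tau0 : R, 0 < tau0 &
  forall tau, 0 < tau < tau0 -> Num.sqrt tau * K <= eps.
Proof.
move=> K0 e0; have K1 : 0 < K + 1 by rewrite ltr_wpDl.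
exists ((eps / (K + 1)) ^+ 2); first by rewrite exprn_gt0// divr_gt0.
move=> tau /andP[t0 tt]; apply: (@le_trans _ _ (eps / (K + 1) * K)).
  have h0 : 0 <= eps / (K + 1) by rewrite divr_ge0// ltW.
  apply: ler_wpM2r => //; rewrite -[leRHS]ger0_norm// -sqrtr_sqr; apply: ler_wsqrtr; exact: ltW.
by rewrite -mulrA ler_piMr ?ltW// mulrC ltr_pdivrMr//; lra.
Qed.

Lemma tamed_consistent : consistent tamed (@drift R M).
Proof.
move=> rho eps e0; have [K K0 HK] := drift_bound rho.
have [tau0 t0 H] := small_sqrt (exprn_ge0 3 K0) e0.
exists tau0 => // tau y ht hy.
have -> : tamed tau y - drift y = (damp tau y - 1) *: drift y by rewrite scalerBl scale1r.
have /andP[d0 d1] := damp_bounds tau y.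
rewrite nrmZ distrC ger0_norm ?subr_ge0//.
have h := damp_near tau y; have hd := HK y hy; have nd := nrm_ge0 (drift y).
apply: le_trans (H tau ht).
apply: (@le_trans _ _ (Num.sqrt tau * nrm (drift y) ^+ 2 * nrm (drift y))).
  exact: ler_wpM2r.
rewrite -mulrA -exprSr; apply: ler_wpM2l; first exact: sqrtr_ge0.
by rewrite ler_pXn2r.
Qed.

(** The nonlinearity is orthogonal to [y], so the mixed term is pure dissipation. The quadratic term
    is at most [tau^(3/2)], since [damp] times [sqrt tau |drift|^2] is at most 1. *)
Lemma tamed_dissipation (tau : R) y : 0 < tau ->
  nrm (y + tau *: tamed tau y) ^+ 2 + tau * (2 * (nrm (Lam y) ^+ 2 * damp tau y)) <= nrm y ^+ 2 + tau * Num.sqrt tau.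
Proof.
move=> t0; have /andP[d0 d1] := damp_bounds tau y.
have dE : damp tau y * (1 + Num.sqrt tau * nrm (drift y) ^+ 2) = 1.
  rewrite /damp mulVf// gt_eqF// ltr_wpDr// mulr_ge0 ?sqr_ge0 ?sqrtr_ge0//.
have sE : Num.sqrt tau ^+ 2 = tau by rewrite sqr_sqrtr// ltW.
have s0 := sqrtr_ge0 tau; have D0 := sqr_ge0 (nrm (drift y)).
have -> : nrm (y + tau *: tamed tau y) ^+ 2 = nrm y ^+ 2 + 2 * tau * damp tau y * dot (drift y) y +
   tau ^+ 2 * damp tau y ^+ 2 * nrm (drift y) ^+ 2.
  rewrite /tamed scalerA; clear; move: (damp tau y) (drift y) => u D.
  by rewrite !nrm_sq !dotDl !dotDr !dotZl !dotZr (dotC y); ring.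
rewrite dot_drift.
have h : tau ^+ 2 * damp tau y ^+ 2 * nrm (drift y) ^+ 2 <= tau * Num.sqrt tau.
  have -> : tau ^+ 2 * damp tau y ^+ 2 * nrm (drift y) ^+ 2 =
    tau * Num.sqrt tau * (damp tau y * (damp tau y * (Num.sqrt tau * nrm (drift y) ^+ 2))).
    by move: (damp tau y) (nrm _) (Num.sqrt tau) sE => u p s <-; ring.
  rewrite ler_piMr//; first by rewrite mulr_ge0// ltW.
  have h1 : damp tau y * (Num.sqrt tau * nrm (drift y) ^+ 2) <= 1.
    by move: dE d0; rewrite mulrDr mulr1; move: (damp tau y * (_ * _)) => u; lra.
  rewrite mulr_ile1// ?(ltW d0)// mulr_ge0 ?(ltW d0)// mulr_ge0//.
apply: le_trans (_ : nrm y ^+ 2 + tau ^+ 2 * damp tau y ^+ 2 * nrm (drift y) ^+ 2 <= _); last by rewrite lerD2l.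
by rewrite le_eqVlt; apply/orP; left; apply/eqP; ring.
Qed.

(** Supplies [euler_sum_cvg] with the local consistency of the damped dissipation. *)
Lemma dissipation_consistent (rho eps : R) : 0 < eps -> exists2 eta : R, 0 < eta &
  forall tau y z, 0 < tau < eta -> nrm y <= rho -> nrm z <= rho -> nrm (y - z) <= eta ->
  `|2 * (nrm (Lam y) ^+ 2 * damp tau y) - 2 * nrm (Lam z) ^+ 2| <= eps.
Proof.
move=> e0; have [K K0 HK] := drift_bound rho.
set r := `|rho|; set A := 2 * (k2 * r ^+ 2) * K ^+ 2.
have A0 : 0 <= A by rewrite mulr_ge0 ?sqr_ge0// mulr_ge0// mulr_ge0 ?sqr_ge0.
have e2 : 0 < eps / 2 by rewrite divr_gt0.
have [tau0 t0 H] := small_sqrt A0 e2.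
set B := 2 * (k2 * (2 * r)) + 1; have B0 : 0 < B.
  by rewrite /B /r; apply: ltr_wpDl => //; do ?[apply: mulr_ge0 => //].
exists (Num.min tau0 (eps / 2 / B)); first by rewrite lt_min t0 divr_gt0.
move=> tau y z /andP[ta]; rewrite lt_min => /andP[tb _] hy hz; rewrite le_min => /andP[_ hyz].
have /andP[d0 d1] := damp_bounds tau y.
have ry : nrm y <= r := le_trans hy (ler_norm _); have rz : nrm z <= r := le_trans hz (ler_norm _).
have sqL (c : 'rV[R]_M) : nrm (Lam c) ^+ 2 <= k2 * nrm c ^+ 2.
  rewrite /k2 -exprMn ler_pXn2r ?nnegrE ?nrm_ge0//; first exact: nrm_Lam_le.
  by rewrite mulr_ge0 ?nrm_ge0 ?(ltW (kp_gt0 _)).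
have h1 : nrm (Lam y) ^+ 2 * (1 - damp tau y) <= k2 * r ^+ 2 * (Num.sqrt tau * K ^+ 2).
  apply: ler_pM; [exact: sqr_ge0|by rewrite subr_ge0| |].
    apply: le_trans (sqL y) _; apply: ler_wpM2l => //; rewrite ler_pXn2r ?nnegrE ?nrm_ge0//; exact: normr_ge0.
  apply: le_trans (damp_near _ _) _; apply: ler_wpM2l; first exact: sqrtr_ge0.
  by rewrite ler_pXn2r ?nnegrE ?nrm_ge0//; exact: HK.
have h2 : `|nrm (Lam y) ^+ 2 - nrm (Lam z) ^+ 2| <= k2 * (2 * r) * nrm (y - z).
  have -> : nrm (Lam y) ^+ 2 - nrm (Lam z) ^+ 2 = dot (Lam (y - z)) (Lam (y + z)).
    rewrite !nrm_sq /Lam dgmB dgmD dotDl !dotDr dotNl (dotC (dgm _ z)) !dotNl; ring.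
  apply: le_trans (dot_CS _ _) _.
  have b1 := nrm_Lam_le (y - z); have b2 := nrm_Lam_le (y + z).
  have b3 : nrm (y + z) <= 2 * r by apply: le_trans (nrmD _ _) _; lra.
  have kp0 : 0 <= kp M :> R := ltW (kp_gt0 _).
  apply: le_trans (ler_pM (nrm_ge0 _) (nrm_ge0 _) b1 b2) _.
  have -> : kp M * nrm (y - z) * (kp M * nrm (y + z)) = k2 * nrm (y + z) * nrm (y - z) by rewrite /k2; ring.
  by apply: ler_wpM2r; [exact: nrm_ge0|exact: ler_wpM2l].
have h3 := H tau (introT andP (conj ta tb)).
have h4 : 2 * (k2 * (2 * r)) * nrm (y - z) <= eps / 2.
  apply: (@le_trans _ _ (B * nrm (y - z))); first by apply: ler_wpM2r; [exact: nrm_ge0|rewrite /B lerDl].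
  by rewrite mulrC -ler_pdivlMr.
have h5 : 0 <= nrm (Lam y) ^+ 2 * (1 - damp tau y) by rewrite mulr_ge0 ?sqr_ge0// subr_ge0.
move: h1 h2 h3 h4 h5; rewrite /A mulrBr mulr1 !ler_norml.
move: (nrm (Lam y) ^+ 2 * damp tau y) (nrm (Lam y) ^+ 2) (nrm (Lam z) ^+ 2) => p q u.
have -> : Num.sqrt tau * (2 * (k2 * r ^+ 2) * K ^+ 2) = 2 * (k2 * r ^+ 2 * (Num.sqrt tau * K ^+ 2)) by ring.
rewrite -!(mulrA 2).
move: (k2 * r ^+ 2 * _) (k2 * (2 * r) * _) => v w h1 /andP[h2 h2'] h3 h4 h5.
by apply/andP; split; lra.
Qed.

End coefficients.

(** Discrete form, with [x = k^2 tau], of the bound on [int_0^t k^2 e^(- 2 k^2 (t - s)) ds]. It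
    makes the [H^1] energy of the stochastic convolution at most a multiple of the trace of [Q],
    uniformly in the frequency [k]. *)
Lemma geometric_sum {R : realType} (x : R) J : 0 <= x -> \sum_(j < J) (1 + x)^-1 ^+ 2 ^+ (J.-1 - j) * x <= 1 + x.
Proof.
move=> x0; have -> : \sum_(j < J) (1 + x)^-1 ^+ 2 ^+ (J.-1 - j) * x = \sum_(j < J) (1 + x)^-1 ^+ 2 ^+ j * x.
  by case: J => [|J]; [rewrite !big_ord0|rewrite [RHS](reindex_inj rev_ord_inj)/=; apply: eq_bigr => j _; rewrite subSS].
elim: J => [|J IH]; first by rewrite big_ord0; lra.
rewrite big_ord_recl/= expr0 mul1r.
have -> : \sum_(i < J) (1 + x)^-1 ^+ 2 ^+ bump 0 i * x = (1 + x)^-1 ^+ 2 * \sum_(j < J) (1 + x)^-1 ^+ 2 ^+ j * x.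
  by rewrite mulr_sumr; apply: eq_bigr => j _; rewrite /bump/= add1n exprS mulrA.
have x1 : 0 < 1 + x by lra.
rewrite addrC lerD2r; apply: (@le_trans _ _ ((1 + x)^-1 ^+ 2 * (1 + x))); first by apply: ler_wpM2l => //; exact: sqr_ge0.
by rewrite expr2 -mulrA mulVf ?gt_eqF// mulr1 invf_le1//; lra.
Qed.

(** * Exponential moments of the solution and of the stochastic convolution *)

Section moments.
Context {R : realType} d (Om : measurableType d) (P : probability Om R).
Variables (W : nat -> R -> Om -> R) (e : nat -> R -> R) (q : nat -> R) (T : R).
Hypotheses (HW : indep_std_BMs P W) (Hq : trace_class_eig e q) (T0 : 0 < T).

Definition driven M (N : Om -> R -> 'rV[R]_M) := forall s, 0 <= s ->
  {ae P, forall w, forall i : 'I_M, (fun n => \sum_(k < n) W k s w * bvec e q M k ord0 i) @ \oo --> N w s ord0 i}.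

Definition sol_path M (x : 'rV[R]_M) X N := [/\ ccont X, ccont N, N 0 = 0, X 0 = x &
  curve (fun s => X s - N s) (fun s => drift (X s))].
Definition conv_path M (Z N : R -> 'rV[R]_M) := [/\ ccont Z, ccont N, N 0 = 0, Z 0 = 0 &
  curve (fun s => Z s - N s) (fun s => - Lam (Lam (Z s)))].

Lemma solution_moment (eps : R) : 0 < eps -> exists2 a : R, 0 < a & exists2 C : R, 1 <= C &
  forall M (x : 'rV[R]_M) (X N : Om -> R -> 'rV[R]_M) t, 0 <= t <= T -> driven N ->
   {ae P, forall w, sol_path x (X w) (N w)} ->
   Ele P (fun w => expR (a * (nrm (X w t) ^+ 2 + 2 * diss t (X w)))) (C * expR (eps * nrm x ^+ 2)).
Proof.
move=> e0; have [trQ t0 HQ] := trace_bound Hq.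
(* [B] bounds the noise energy up to time [T]. The second entry of the minimum is the smallness
   [4 a B <= 1] of the Lyapunov estimate, the first gives [a |x|^2 <= eps |x|^2]. *)
pose a := Num.min eps (1 / (4 * (T * trQ))); pose B := T * trQ.
have B0 : 0 < B by rewrite mulr_gt0.
have a0 : 0 < a by rewrite lt_min e0 divr_gt0// mulr_gt0.
have aB : 4 * (a * B) <= 1.
  have : a <= 1 / (4 * B) by rewrite ge_min lexx orbT.
  by rewrite ler_pdivlMr ?mulr_gt0//; lra.
exists (a * expR (- (4 * a * B))); first by rewrite mulr_gt0// expR_gt0.
have E1 : 0 <= a * T * Num.sqrt T + 2 * a * B.
  by apply: addr_ge0; [apply: mulr_ge0; [apply: mulr_ge0; exact: ltW|exact: sqrtr_ge0]|apply: mulr_ge0; [apply: mulr_ge0 => //; exact: ltW|exact: ltW]].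
exists (expR (a * T * Num.sqrt T + 2 * a * B)); first by rewrite -[leLHS]expR0 ler_expR.
move=> M x X N t /andP[tt0 tT] HN HX.
have ex : a * nrm x ^+ 2 <= eps * nrm x ^+ 2 by apply: ler_wpM2r; [exact: sqr_ge0|rewrite ge_min lexx].
rewrite -expRD.
(* At [t = 0] there is no positive step size, but the path is still at [x]. *)
move: tt0; rewrite le_eqVlt => /orP[/eqP <-|tpos].
  apply: Ele_le (Ele_cst P (expR_ge0 (a * expR (- (4 * a * B)) * nrm x ^+ 2))).
    by apply: filterS HX => w [_ _ _ X0 _]; rewrite X0 /diss prim0 mulr0 addr0.
  rewrite ler_expR; apply: (@le_trans _ _ (a * nrm x ^+ 2)); last by lra.
  apply: ler_wpM2r; first exact: sqr_ge0.
  rewrite ler_piMr ?(ltW a0)// -[leRHS]expR0 ler_expR oppr_le0 -mulrA; apply: mulr_ge0 => //; apply: mulr_ge0; exact: ltW.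
pose tau m := t / m.+1%:R.
have tau0 m : 0 < tau m by rewrite divr_gt0// ltr0n.
have tauT m : tau m <= T by apply: le_trans tT; rewrite ler_pdivrMr ?ltr0n// ler_peMr ?(ltW tpos)// ler1n.
have taut m : m.+1%:R * tau m = t by rewrite /tau mulrC divfK// gt_eqF// ltr0n.
pose Y w m := euler (fun y => y + tau m *: tamed (tau m) y) x (fun j => N w (j.+1%:R * tau m) - N w (j%:R * tau m)).
pose gam (m : nat) (j : nat) (y : 'rV[R]_M) := tau m * (2 * (nrm (Lam y) ^+ 2 * damp (tau m) y)).
apply: (@Ele_fatou _ _ _ P (fun m w => expR (a * expR (- (4 * a * B)) *
   (nrm (dgm (fun=> 1) (Y w m m.+1)) ^+ 2 + \sum_(j < m.+1) gam m j (Y w m j))))).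
  move=> m; apply: (@Ele_le _ _ _ _ _ _ (expR (a * m.+1%:R * (tau m * Num.sqrt (tau m)) + 2 * a * B + a * nrm (dgm (fun=> 1) x) ^+ 2))).
  - by apply: nearW => w; exact: lexx.
  (* The [m + 1] gains [tau sqrt tau] add up to [t sqrt tau <= T sqrt T]. *)
  - rewrite ler_expR dgm1//; apply: lerD => //; rewrite lerD2r -mulrA (mulrA _ (tau m)) taut -mulrA; apply: ler_wpM2l; first exact: ltW.
    by apply: ler_pM; rewrite ?(ltW tpos)// ?sqrtr_ge0// ler_wsqrtr.
  - apply: (@Ele_scheme R d Om P W HW M (bvec e q M) N (tau m) m.+1 _ x (fun _ _ => 1) (gam m) a) => //.
    + exact: ltW.
    + by rewrite mulr_ge0// ?sqrtr_ge0// ltW.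
    + by apply: vregD; [exact: vreg_id|apply: vregZ; [exact: freg_cst|exact: vreg_tamed]].
    + move=> j; apply: fregM; first exact: freg_cst.
      apply: fregM; first exact: freg_cst.
      apply: fregM; first exact: freg_nrm2 (vreg_dgm _ (@vreg_id _ _)).
      exact: freg_damp.
    + move=> j y; have /andP[/ltW d0 _] := damp_bounds (tau m) y.
      by apply: mulr_ge0; [exact: ltW|apply: mulr_ge0 => //; apply: mulr_ge0 => //; exact: sqr_ge0].
    + move=> n; apply: (@le_trans _ _ (\sum_(j < m.+1) tau m * trQ)).
        apply: ler_sum => j _; rewrite -mulr_suml mulrC; apply: ler_wpM2l; first exact: ltW.
        by under eq_bigr do rewrite dgm1//; exact: HQ.
      rewrite sumr_const card_ord -mulr_natl mulrA taut; apply: ler_wpM2r => //; exact: ltW.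
    + by move=> j y _; rewrite !dgm1//; exact: tamed_dissipation.
apply: filterS HX => w [cX cN N0 X0 cXN]; set F := _ * (_ + _).
suff cv : (fun m => a * expR (- (4 * a * B)) *
    (nrm (dgm (fun=> 1) (Y w m m.+1)) ^+ 2 + \sum_(j < m.+1) gam m j (Y w m j))) @ \oo --> F.
  by apply: (cvg_comp _ _ cv); exact: continuous_expR.
have cd : ccont (fun s => drift (X w s)) by exact: ccont_drift.
apply: cvgM; first exact: cvg_cst.
apply: cvgD.
  under eq_fun do rewrite dgm1//.
  apply: (freg_cvg (freg_nrm2 (@vreg_id _ _))) => i.
  by rewrite /Y /tau -X0; exact: (euler_end_cvg tpos (@drift_lip R M) (@tamed_consistent R M) cX cN N0 cd cXN).
rewrite /diss -primZ; last by apply: contX; exact: cont_nrmL.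
rewrite /Y /tau -X0 /gam.
apply: (euler_sum_cvg (G := fun tau y => 2 * (nrm (Lam y) ^+ 2 * damp tau y)) (g := fun y => 2 * nrm (Lam y) ^+ 2)
  tpos (@drift_lip R M) (@tamed_consistent R M) cX cN N0 cd cXN).
  by apply: contM; [exact: contC|apply: contX; exact: cont_nrmL].
exact: dissipation_consistent.
Qed.

(** The scheme is implicit Euler for the linear equation, measured in the final [H^1] norm
    propagated backwards in time. In these norms the deterministic step is an isometry, so
    [kappa = 0], and the smoothing shows up in the noise energy, which [geometric_sum] adds up. *)
Lemma convolution_moment : exists2 a : R, 0 < a & exists2 C : R, 1 <= C &
  forall M (Z N : Om -> R -> 'rV[R]_M) t, 0 <= t <= T -> driven N ->
   {ae P, forall w, conv_path (Z w) (N w)} ->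
   Ele P (fun w => expR (a * nrm (Lam (Z w t)) ^+ 2)) C.
Proof.
have [trQ t0 HQ] := trace_bound Hq.
pose B := 2 * trQ; have B0 : 0 < B by rewrite mulr_gt0.
pose a := 1 / (4 * B); have a0 : 0 < a by rewrite divr_gt0// mulr_gt0.
have aB : 4 * (a * B) <= 1 by rewrite /a div1r mulrCA mulVf// gt_eqF// mulr_gt0.
exists (a * expR (- (4 * a * B))); first by rewrite mulr_gt0// expR_gt0.
exists (expR (2 * a * B)).
  by rewrite -[leLHS]expR0 ler_expR mulr_ge0 ?(ltW B0)// mulr_ge0// ltW.
move=> M Z N t /andP[tt0 tT] HN HZ.
move: tt0; rewrite le_eqVlt => /orP[/eqP <-|tpos].
  have L0 : Lam 0 = 0 :> 'rV[R]_M by apply/rowP => i; rewrite !(dgmE, mxE) mulr0.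
  apply: Ele_le (Ele_cst P ler01).
    by apply: filterS HZ => w [_ _ _ Z0 _]; rewrite Z0 L0 nrm0 expr0n/= mulr0 expR0.
  by rewrite -[leLHS]expR0 ler_expR mulr_ge0 ?(ltW B0)// mulr_ge0// ltW.
pose tau m := t / m.+1%:R.
have tau0 m : 0 < tau m by rewrite divr_gt0// ltr0n.
have taut m : m.+1%:R * tau m = t by rewrite /tau mulrC divfK// gt_eqF// ltr0n.
(* With this increment one step divides the [i]-th coordinate by [1 + kp i^2 tau]: implicit Euler in
   explicit form. *)
pose dt (s : R) (y : 'rV[R]_M) := - dgm (fun i => kp i ^+ 2 * (1 + kp i ^+ 2 * s)^-1) y.
pose dd (y : 'rV[R]_M) := - Lam (Lam y).
have dE y : dd y = - dgm (fun i => kp i ^+ 2) y by rewrite /dd /Lam dgm_dgm; congr (- _); apply: eq_dgm => i; rewrite expr2.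
pose Y w m := euler (fun y => y + tau m *: dt (tau m) y) 0 (fun j => N w (j.+1%:R * tau m) - N w (j%:R * tau m)).
have ks (i : nat) (s : R) : 0 < s -> 0 < 1 + kp i ^+ 2 * s by move=> s0; rewrite ltr_wpDr// mulr_ge0 ?sqr_ge0// ltW.
have kM (i : 'I_M) : kp i ^+ 2 <= kp M ^+ 2 :> R.
  rewrite ler_pXn2r ?nnegrE ?(ltW (kp_gt0 _))// /kp; apply: ler_wpM2l; first exact: pi_ge0.
  by rewrite ler_nat ltnS ltnW.
have ld : loc_lip dd.
  move=> rho; exists (kp M ^+ 2); first exact: sqr_ge0.
  move=> y z _ _; have := nrm_Lam2_le (y - z); rewrite -[in leLHS]nrmN -/(dd _) !dE.
  by rewrite dgmB opprD.
have cs : consistent dt dd.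
  move=> rho eps e0; pose K : R := kp M ^+ 4 * `|rho| + 1.
  have K0 : 0 < K by rewrite /K; apply: ltr_wpDl => //; apply: mulr_ge0 => //; exact: exprn_ge0 (ltW (kp_gt0 _)).
  exists (eps / K); first by rewrite divr_gt0.
  move=> s y /andP[s0 sK] hy; rewrite dE /dt opprK addrC.
  have -> : dgm (fun i => kp i ^+ 2) y - dgm (fun i => kp i ^+ 2 * (1 + kp i ^+ 2 * s)^-1) y =
      dgm (fun i => kp i ^+ 2 * (1 - (1 + kp i ^+ 2 * s)^-1)) y.
    by apply/rowP => i; rewrite !(dgmE, mxE); ring.
  apply: (@le_trans _ _ (s * kp M ^+ 4 * nrm y)); last first.
    apply: (@le_trans _ _ (s * K)); last by rewrite -ler_pdivlMr// ltW.
    rewrite -mulrA; apply: ler_wpM2l; first exact: ltW.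
    apply: (@le_trans _ _ (kp M ^+ 4 * `|rho|)); last by rewrite lerDl.
    by apply: ler_wpM2l; [exact: exprn_ge0 (ltW (kp_gt0 _))|exact: le_trans hy (ler_norm _)].
  rewrite -[in leRHS](@dgm1 _ _ (fun=> 1) y)//; apply: nrm_dgm_leZ.
    by apply: mulr_ge0; [exact: ltW|exact: exprn_ge0 (ltW (kp_gt0 _))].
  move=> i; rewrite mulr1; have x0 := ks i s s0.
  have -> : kp i ^+ 2 * (1 - (1 + kp i ^+ 2 * s)^-1) = (s * kp i ^+ 2 ^+ 2) * (1 + kp i ^+ 2 * s)^-1.
    by field; rewrite gt_eqF.
  have h0 : 0 <= s * kp i ^+ 2 ^+ 2 by rewrite mulr_ge0 ?sqr_ge0// ltW.
  rewrite normrM ger0_norm// ger0_norm ?invr_ge0 ?(ltW x0)//.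
  apply: (@le_trans _ _ (s * kp i ^+ 2 ^+ 2)).
    by rewrite ler_piMr// invf_le1// lerDl mulr_ge0 ?sqr_ge0// ltW.
  apply: ler_wpM2l; first exact: ltW.
  by rewrite (exprM _ 2 2) ler_pXn2r ?nnegrE ?sqr_ge0.
pose v m j i : R := kp i * ((1 + kp i ^+ 2 * tau m)^-1) ^+ (m.+1 - j).
(* From the index [m0] on, [kp i^2 tau <= 1], so that [geometric_sum] is at most 2, the factor in
   [B]; the sequence is shifted accordingly. *)
have [m0 Hm0] : exists m0 : nat, kp M ^+ 2 * t <= m0.+1%:R.
  exists (Num.bound (kp M ^+ 2 * t)); apply: ltW; apply: lt_trans (archi_boundP _) _; last by rewrite ltr_nat.
  by rewrite mulr_ge0 ?sqr_ge0// ltW.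
have cv w : conv_path (Z w) (N w) -> (fun m => expR (a * expR (- (4 * a * B)) * (nrm (dgm (v m m.+1) (Y w m m.+1)) ^+ 2 + \sum_(j < m.+1) 0))) @ \oo -->
    expR (a * expR (- (4 * a * B)) * nrm (Lam (Z w t)) ^+ 2).
  move=> [cZ cN N0 Z0 cZN]; suff h : (fun m => a * expR (- (4 * a * B)) *
    (nrm (dgm (v m m.+1) (Y w m m.+1)) ^+ 2 + \sum_(j < m.+1) 0)) @ \oo --> a * expR (- (4 * a * B)) * nrm (Lam (Z w t)) ^+ 2.
    by apply: (cvg_comp _ _ h); exact: continuous_expR.
  apply: cvgM; first exact: cvg_cst.
  have -> : (fun m => nrm (dgm (v m m.+1) (Y w m m.+1)) ^+ 2 + \sum_(j < m.+1) 0) = (fun m => nrm (Lam (Y w m m.+1)) ^+ 2).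
    apply: funext => m; rewrite big1// addr0 /Lam; congr (nrm _ ^+ 2); apply: eq_dgm => i.
    by rewrite /v subnn expr0 mulr1.
  apply: (freg_cvg (freg_nrm2 (vreg_dgm _ (@vreg_id _ _)))) => i.
  rewrite /Y /tau -Z0; apply: (euler_end_cvg tpos ld cs cZ cN N0 _ cZN).
  by apply: ccontN; apply: ccont_dgm; apply: ccont_dgm.
apply: (@Ele_fatou _ _ _ P (fun n w => let m := (n + m0)%N in
  expR (a * expR (- (4 * a * B)) * (nrm (dgm (v m m.+1) (Y w m m.+1)) ^+ 2 + \sum_(j < m.+1) 0)))); last first.
  by apply: filterS HZ => w hw; have := cv w hw; rewrite -(cvg_shiftn m0).
move=> n; cbv zeta; set m := (n + m0)%N.
apply: (@Ele_le _ _ _ _ _ _ (expR (a * m.+1%:R * 0 + 2 * a * B + a * nrm (dgm (v m 0%N) (0 : 'rV[R]_M)) ^+ 2))).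
- by apply: nearW => w; exact: lexx.
- rewrite ler_expR mulr0 add0r (_ : dgm _ 0 = 0) ?nrm0 ?expr0n/= ?mulr0 ?addr0//.
  by apply/rowP => i; rewrite !(dgmE, mxE) mulr0.
- apply: (@Ele_scheme R d Om P W HW M (bvec e q M) N (tau m) m.+1 _ 0 (v m) (fun _ _ => 0) a) => //.
  + exact: ltW.
  + apply: vregD; first exact: vreg_id.
    apply: vregZ; first exact: freg_cst.
    have -> : dt (tau m) = (fun y => dgm (fun i => - (kp i ^+ 2 * (1 + kp i ^+ 2 * tau m)^-1)) y).
      by apply: funext => y; apply/rowP => i; rewrite !(dgmE, mxE) mulNr.
    exact: vreg_dgm (@vreg_id _ _).
  + by move=> j; exact: freg_cst.
  + move=> n'; rewrite exchange_big/=.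
    apply: (@le_trans _ _ (\sum_(k < n') 2 * nrm (bvec e q M k) ^+ 2)); last first.
      by rewrite -mulr_sumr; apply: ler_wpM2l => //; exact: HQ.
    apply: ler_sum => k _; move: (bvec e q M k) => b.
    rewrite !nrm_sq dotE mulr_sumr.
    under eq_bigr do rewrite nrm_sq dotE mulr_suml.
    rewrite exchange_big/=; apply: ler_sum => i _.
    have x0 : 0 <= kp i ^+ 2 * tau m by rewrite mulr_ge0 ?sqr_ge0// ltW.
    have x1 : kp i ^+ 2 * tau m <= 1.
      rewrite /tau mulrA ler_pdivrMr ?ltr0n// mul1r.
      apply: (@le_trans _ _ (kp M ^+ 2 * t)); first by apply: ler_wpM2r => //; exact: ltW.
      by apply: (le_trans Hm0); rewrite ler_nat ltnS /m leq_addl.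
    have := geometric_sum m.+1 x0; move: x1; set x := kp i ^+ 2 * tau m => x1 G.
    apply: (@le_trans _ _ ((\sum_(j < m.+1) (1 + x)^-1 ^+ 2 ^+ (m.+1.-1 - j) * x) * (b ord0 i * b ord0 i))).
      rewrite mulr_suml; apply: ler_sum => j _; rewrite !dgmE /v subSS -/x exprAC /= le_eqVlt; apply/orP; left; apply/eqP.
      by rewrite /x; ring.
    apply: ler_wpM2r; first by rewrite -expr2 sqr_ge0.
    by apply: (le_trans G); lra.
  + move=> j y jm; rewrite !addr0 (_ : dgm (v m j.+1) _ = dgm (v m j) y)//.
    apply/rowP => i; rewrite !(dgmE, mxE) /v; have := ks i _ (tau0 m); set x := 1 + _ => x0.
    have -> : (m.+1 - j)%N = (m.+1 - j.+1).+1 by rewrite subnSK.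
    rewrite [_^-1 ^+ _.+1]exprS (_ : kp i ^+ 2 = (x - 1) / tau m); last by rewrite /x; field; rewrite gt_eqF.
    by field; rewrite !gt_eqF.
Unshelve. all: by end_near. Qed.

End moments.

Section path_construction.
Context {R : realType}.

Lemma max0_cont : continuous (fun s : R => Num.max s 0).
Proof. by move=> s; apply: (@continuous_max _ R (fun x => x) (fun=> 0)); [exact: cvg_id|exact: cvg_cst]. Qed.

Lemma within_clamp (T : topologicalType) (f : R -> T) : {within `[(0:R), +oo[, continuous f} ->
  continuous (fun s : R => f (Num.max s 0)).
Proof.
move=> /subspace_continuousP cf s.
have m0 : `[(0:R), +oo[%classic (Num.max s 0) by rewrite /= in_itv/= andbT le_max lexx orbT.
apply: (@cvg_comp _ _ _ (fun s => Num.max s 0) f _ (within `[(0:R), +oo[ (nbhs (Num.max s 0)))); last exact: cf.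
move=> U hU; have h : nbhs (Num.max s 0) (fun y => `[(0:R), +oo[%classic y -> U y) := hU.
have h2 : \forall y \near s, `[(0:R), +oo[%classic (Num.max y 0) -> U (Num.max y 0) := @max0_cont s _ h.
apply: filterS h2 => y /=; apply.
by rewrite in_itv/= andbT le_max lexx orbT.
Qed.

Lemma grid_cvg (s : R) : 0 <= s -> (fun m : nat => (Num.truncn (s * m.+1%:R))%:R / m.+1%:R : R) @ \oo --> s.
Proof.
move=> s0; apply/cvgrPdist_le => eps e0; near=> m.
have m0 : (0 : R) < m.+1%:R by rewrite ltr0n.
have h0 : 0 <= s * m.+1%:R by rewrite mulr_ge0.
have /andP[h1 h2] := truncn_itv h0.
have h3 : m.+1%:R^-1 <= eps.
  rewrite -[leRHS]invrK lef_pV2 ?posrE ?invr_gt0//.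
  by apply: ltW; apply: lt_trans (_ : m%:R < _); [near: m; exact: nbhs_infty_gtr|rewrite ltr_nat].
move: h1 h2; rewrite -[X in _ < X]natr1; set k := (Num.truncn _)%:R => h1 h2.
have -> : s - k / m.+1%:R = (s * m.+1%:R - k) / m.+1%:R by rewrite mulrBl mulfK// gt_eqF.
rewrite normrM ger0_norm ?subr_ge0// ger0_norm ?invr_ge0 ?(ltW m0)//.
apply: le_trans h3; rewrite ler_piMl ?invr_ge0 ?(ltW m0)//; lra.
Unshelve. all: by end_near. Qed.

Lemma curve_shift M (c d F : R -> 'rV[R]_M) : curve c F -> ccont d -> (forall s, 0 < s -> c s = d s) -> curve d F.
Proof.
move=> [_ dc] cd cE; split=> // i s s0; apply: (is_derive_near_pos s0 _ (dc i s s0)).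
by move=> u u0; rewrite cE.
Qed.

End path_construction.

(** * From Galerkin solutions to paths *)

Section galerkin_paths.
Context {R : realType} d (Om : measurableType d) (P : probability Om R).
Variables (W : nat -> R -> Om -> R) (e : nat -> R -> R) (q : nat -> R).

(** The noise path is read off from the equation and so is continuous for every [w], whereas the
    noise series is known to converge almost surely only at each fixed time. *)
Lemma galerkin_path M (x : 'rV[R]_M) (X : R -> Om -> 'rV[R]_M) : indep_std_BMs P W -> galerkin_sol P W e q x X ->
  exists2 N, driven P W e q N & {ae P, forall w, sol_path x (fun s => X (Num.max s 0) w) (N w)}.
Proof.
move=> [_ [W0 _]] [cX [_ HX]].
pose Y w s := X (Num.max s 0) w.
have cY w : ccont (Y w).
  move=> i s; apply: (@continuous_comp _ _ _ (Y w) (fun v : 'rV[R]_M => v ord0 i)).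
    exact: (within_clamp (cX w)).
  exact: coord_continuous.
pose I w s : 'rV[R]_M := \row_i clamp (prim (fun u => drift (Y w u) ord0 i)) s.
pose N w s := Y w s - x - I w s.
have IE w s : 0 <= s -> I w s = \row_j Rintegral lebesgue_measure `[(0:R), s] (fun u => drift (X u w) ord0 j).
  move=> s0; apply/rowP => i; rewrite !mxE clampE// primE//; last by apply: ccont_drift; exact: cY.
  rewrite cint.unlock; apply: eq_Rintegral => u; rewrite inE/= in_itv/= => /andP[u0 _].
  by rewrite /Y max_l.
have cI w : ccont (I w).
  move=> i; under eq_fun do rewrite mxE.
  by apply: clamp_cont => s s0; apply: prim_cont => //; apply: ccont_drift; exact: cY.
have dN : driven P W e q N.
  move=> s s0; apply: filterS (HX s s0) => w Hw i.
  have := Hw i; rewrite -IE// /N /Y max_l//.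
  rewrite (_ : (fun n => \sum_(k < n) Num.sqrt (q k) * W k s w * ip (e k) (hk i.+1)) =
    (fun n => \sum_(k < n) W k s w * bvec e q M k ord0 i))//.
  by apply: funext => n; apply: eq_bigr => k _; rewrite !mxE; ring.
exists N => //; apply: filterS (dN 0 (lexx 0)) => w Hw.
have N0 : N w 0 = 0.
  apply/rowP => i; have := Hw i.
  under eq_fun do under eq_bigr do rewrite W0 mul0r.
  under eq_fun do rewrite big1//.
  by move=> h; rewrite [RHS]mxE; exact: cvg_unique h (cvg_cst _).
split => //; first exact: cY.
- by apply: ccontB; [apply: ccontB; [exact: cY|exact: ccont_cst]|exact: cI].
- move/eqP: N0; rewrite /N (_ : I w 0 = 0) ?subr0 ?subr_eq0; first by move/eqP.
  by apply/rowP => i; rewrite !mxE clampE// prim0.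
- have -> : (fun s => X (Num.max s 0) w - N w s) = (fun s => x + I w s).
    by apply: funext => s; rewrite /N /Y; apply/rowP => i; rewrite !mxE; ring.
  split; first by apply: ccontD; [exact: ccont_cst|exact: cI].
  move=> i s s0; under eq_fun do rewrite !mxE.
  have cd : continuous (fun u => drift (Y w u) ord0 i) by apply: ccont_drift; exact: cY.
  have := is_derive_clamp s0 (is_derive_prim cd (ltW s0)).
  by move=> h; apply: (is_derive_eq (dD (dC (x ord0 i) s) h)); rewrite add0r.
Qed.

(** Almost surely the two agree at all nonnegative rational times, as limits of one series, hence at
    all times by continuity. One exceptional set thus suffices for the equation of a difference of
    solutions. *)
Lemma shared_noise M (N N' : Om -> R -> 'rV[R]_M) : driven P W e q N -> driven P W e q N' ->
  {ae P, forall w, ccont (N w)} -> {ae P, forall w, ccont (N' w)} ->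
  {ae P, forall w, forall s, 0 <= s -> N w s = N' w s}.
Proof.
move=> dN dN' cN cN'.
have H : {ae P, forall w, forall m k : nat, N w (k%:R / m.+1%:R) = N' w (k%:R / m.+1%:R)}.
  apply/ae_foralln => m; apply/ae_foralln => k.
  have h0 : (0 : R) <= k%:R / m.+1%:R by rewrite divr_ge0.
  apply: filterS2 (dN _ h0) (dN' _ h0) => w h h'; apply/rowP => i.
  exact: cvg_unique (h i) (h' i).
apply: filterS3 H cN cN' => w Hw cw cw' s s0; apply/rowP => i.
have g := grid_cvg s0.
have h1 := cvg_comp _ _ g (cw i s); have h2 := cvg_comp _ _ g (cw' i s).
rewrite (_ : _ \o _ = (fun s => N' w s ord0 i) \o (fun m : nat => (Num.truncn (s * m.+1%:R))%:R / m.+1%:R)) in h1.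
  exact: cvg_unique h1 h2.
by apply: funext => m /=; rewrite Hw.
Qed.

Lemma difference_path M (x y : 'rV[R]_M) X N Y N' : sol_path x X N -> sol_path y Y N' ->
  (forall s, 0 <= s -> N s = N' s) -> curve (fun s => X s - Y s) (fun s => drift (X s) - drift (Y s)).
Proof.
move=> [cX cN _ _ hX] [cY cN' _ _ hY] NE.
apply: (curve_shift (curveB hX hY)); first exact: ccontB.
by move=> s s0; rewrite (NE s (ltW s0)) opprB addrA subrK.
Qed.

(** The stochastic convolution is obtained path by path, by subtraction rather than as a stochastic
    integral: [X - V - e^(sA) x] solves the linear equation with the same noise. *)
Lemma sol_path_mild M (x : 'rV[R]_M) X N : sol_path x X N -> exists2 Z, mild_path x X Z & conv_path Z N.
Proof.
move=> [cX cN N0 X0 hX].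
have cB : ccont (fun s => Bq (X s) (X s)) by exact: ccont_Bq.
have [V cV V0] := duhamel cB.
have csg : ccont (fun s => sg s x) by case: (curve_sg x).
have cVc : ccont V by case: cV.
pose Z s := X s - V s - sg s x.
have cZ : ccont Z by apply: ccontB => //; exact: ccontB.
exists Z.
  split=> //; split=> //; exists V => //; split => // s.
  by rewrite /Z; apply/rowP => i; rewrite !mxE; ring.
split => //; first by rewrite /Z X0 V0 sg0 subr0 subrr.
have h := curveB (curveB hX cV) (curve_sg x).
have {}h : curve (fun s => Z s - N s) _ := curve_shift h (ccontB cZ cN) _.
apply: curve_eq (h _) => s s0; last by rewrite /Z; apply/rowP => i; rewrite !mxE; ring.
have L a : Lam (Lam a) = dgm (fun i => kp i ^+ 2) a :> 'rV[R]_M by rewrite /Lam dgm_dgm; apply: eq_dgm => i; rewrite expr2.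
rewrite driftE !L /Z !dgmB.
by move: (dgm _ (X s)) (dgm _ (V s)) (dgm _ (sg s x)) (Bq _ _) => a b c f; apply/rowP => i; rewrite !mxE; ring.
Qed.

End galerkin_paths.

Section elementary.
Context {R : realType}.
Implicit Types (a y : R) (n p : nat).

Lemma pow_le_exp a n : 0 < a -> exists2 C : R, 1 <= C & forall y, 0 <= y -> (1 + y) ^+ n <= C * expR (a * y).
Proof.
move=> a0; pose c := 1 + n.+1%:R / a.
have n0 : (0 : R) < n.+1%:R by rewrite ltr0n.
have c1 : 1 <= c by rewrite lerDl divr_ge0// ltW.
exists (c ^+ n.+1); first exact: exprn_ege1.
move=> y y0; have h : 1 + y <= c * expR (a * y / n.+1%:R).
  have z0 : 0 <= a * y / n.+1%:R by rewrite divr_ge0 ?mulr_ge0// ltW.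
  apply: (@le_trans _ _ (c * (1 + a * y / n.+1%:R))); last first.
    by apply: ler_wpM2l; [exact: le_trans c1|exact: expR_ge1Dx].
  rewrite mulrDr mulr1; apply: lerD => //; rewrite /c mulrDl mul1r.
  have -> : n.+1%:R / a * (a * y / n.+1%:R) = y by field; rewrite !gt_eqF.
  by rewrite lerDr.
apply: (@le_trans _ _ ((1 + y) ^+ n.+1)).
  by apply: ler_weXn2l => //; rewrite lerDl.
have y1 : 0 <= 1 + y by rewrite addr_ge0.
apply: (@le_trans _ _ ((c * expR (a * y / n.+1%:R)) ^+ n.+1)).
  by rewrite ler_pXn2r ?nnegrE//; exact: le_trans h.
by rewrite exprMn -expRM_natr divfK// gt_eqF.
Qed.

(** The index of a largest summand. The two lemmas that follow derive from it convexity bounds with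
    a factor [#|I|]. *)
Lemma sum_le_share (I : finType) (i0 : I) (f : I -> R) : exists i, \sum_j f j <= #|I|%:R * f i.
Proof.
have [i _ hi] := @arg_maxP _ _ _ i0 xpredT f isT.
exists i; rewrite mulr_natl -sumr_const; apply: ler_sum => j _; exact: hi.
Qed.

Lemma sum_pow_share (I : finType) (i0 : I) (f : I -> R) p : (forall i, 0 <= f i) ->
  (\sum_j f j) ^+ p <= #|I|%:R ^+ p * \sum_j f j ^+ p.
Proof.
move=> f0; have [i hi] := sum_le_share i0 f.
apply: (@le_trans _ _ ((#|I|%:R * f i) ^+ p)).
  by rewrite lerXn2r ?nnegrE//; [exact: sumr_ge0|exact: mulr_ge0].
rewrite exprMn; apply: ler_wpM2l; first exact: exprn_ge0.
by rewrite (bigD1 i)//= lerDl sumr_ge0// => j _; exact: exprn_ge0.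
Qed.

Lemma exp_sum_share (I : finType) (i0 : I) (f : I -> R) :
  expR (\sum_j f j) <= \sum_j expR (#|I|%:R * f j).
Proof.
have [i hi] := sum_le_share i0 f.
apply: (@le_trans _ _ (expR (#|I|%:R * f i))); first by rewrite ler_expR.
by rewrite (bigD1 i)//= lerDl sumr_ge0// => j _; exact: expR_ge0.
Qed.

Lemma add4_pow p (a b c d : R) : 0 <= a -> 0 <= b -> 0 <= c -> 0 <= d ->
  (a + b + c + d) ^+ p <= 4 ^+ p * (a ^+ p + b ^+ p + c ^+ p + d ^+ p).
Proof.
move=> a0 b0 c0 d0.
have := @sum_pow_share 'I_4 ord0 (fun i => nth 0 [:: a; b; c; d] i) p.
rewrite card_ord !big_ord_recl !big_ord0 /= !addr0 !addrA; apply.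
by case=> [[|[|[|[|]]]]].
Qed.

End elementary.

Section flow_moments.
Context {R : realType} d (Om : measurableType d) (P : probability Om R).
Variables (W : nat -> R -> Om -> R) (e : nat -> R -> R) (q : nat -> R) (T : R).
Hypotheses (HW : indep_std_BMs P W) (Hq : trace_class_eig e q) (T0 : 0 < T).

Definition flow M (x : 'rV[R]_M) X N Z := driven P W e q N /\
  {ae P, forall w, [/\ sol_path x (X w) (N w), mild_path x (X w) (Z w) & conv_path (Z w) (N w)]}.

(** [Z] is chosen separately for each [w], with no claim of measurability; upper expectations
    tolerate this. *)
Lemma sol_flow M (x : 'rV[R]_M) X N : driven P W e q N -> {ae P, forall w, sol_path x (X w) (N w)} ->
  exists Z, flow x X N Z.
Proof.
move=> dN HX.
have /choice[Z HZ] : forall w, exists Z, sol_path x (X w) (N w) -> mild_path x (X w) Z /\ conv_path Z (N w).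
  move=> w; have [h|h] := pselect (sol_path x (X w) (N w)); last by exists (fun=> 0).
  by have [Z h1 h2] := sol_path_mild h; exists Z.
by exists Z; split => //; apply: filterS HX => w h; have [? ?] := HZ w h; split.
Qed.

(** [a] is fixed before the powers [r] and [p]: polynomial moments of every order follow from the
    same exponential moments, by Jensen in time. *)
Lemma path_moment (eps : R) : 0 < eps -> exists2 a : R, 0 < a & forall r p : nat, exists2 C : R, 1 <= C &
  forall M (x : 'rV[R]_M) X N Z, flow x X N Z ->
    Ele P (fun w => expR (2 * a * diss T (X w))) (C * expR (eps * nrm x ^+ 2)) /\
    Ele P (fun w => moms T r (X w) (Z w) ^+ p.+1) (C * expR (eps * nrm x ^+ 2)).
Proof.
move=> e0; have [a a0 [C1 C11 H1]] := solution_moment HW Hq T0 e0.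
have [b b0 [C2 C21 H2]] := convolution_moment T HW Hq.
exists a => // r p.
have a20 : 0 < 2 * a by rewrite mulr_gt0.
have [D1 D11 HD1] := pow_le_exp p.+1 a20.
have [D2 D21 HD2] := pow_le_exp (r * p.+1) a0.
have [D3 D31 HD3] := pow_le_exp (r * p.+1) b0.
have Tp0 : 0 <= T ^+ p by exact: exprn_ge0 (ltW T0).
have T00 := ltW T0.
pose B := 4 ^+ p.+1 * (1 + D1 * C1 + T ^+ p * (T * (D2 * C1)) + T ^+ p * (T * (D3 * C2))).
have p1 : 0 <= D1 * C1 by rewrite mulr_ge0//; [exact: le_trans D11|exact: le_trans C11].
have p2 : 0 <= T ^+ p * (T * (D2 * C1)).
  by apply: mulr_ge0 => //; apply: mulr_ge0 => //; apply: mulr_ge0; [exact: le_trans D21|exact: le_trans C11].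
have p3 : 0 <= T ^+ p * (T * (D3 * C2)).
  by apply: mulr_ge0 => //; apply: mulr_ge0 => //; apply: mulr_ge0; [exact: le_trans D31|exact: le_trans C21].
have B0 : 0 <= B by apply: mulr_ge0 => //; rewrite !addr_ge0.
exists (C1 + B); first by rewrite ler_wpDr.
move=> M x X N Z [dN HF].
set E := expR (eps * nrm x ^+ 2); have E1 : 1 <= E by rewrite -[leLHS]expR0 ler_expR mulr_ge0 ?sqr_ge0// ltW.
have E0 : 0 <= E by exact: le_trans E1.
have hX : {ae P, forall w, sol_path x (X w) (N w)} by apply: filterS HF => w [].
have hZ : {ae P, forall w, conv_path (Z w) (N w)} by apply: filterS HF => w [].
have mX s : 0 <= s <= T -> Ele P (fun w => expR (a * (nrm (X w s) ^+ 2 + 2 * diss s (X w)))) (C1 * E) by move=> hs; exact: (H1 _ _ _ N).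
have mA : Ele P (fun w => expR (2 * a * diss T (X w))) (C1 * E).
  apply: Ele_le (mX T _); rewrite ?lexx ?T00//; apply: filterS hX => w [cX _ _ _ _].
  have := mulr_ge0 (ltW a0) (sqr_ge0 (nrm (X w T))).
  rewrite ler_expR; move: (diss T (X w)) (nrm _ ^+ 2) => D n; rewrite mulrDr.
  have -> : a * (2 * D) = 2 * a * D by ring.
  by rewrite lerDr.
split; first by apply: Ele_le mA; [exact: nearW|rewrite ler_wpM2r// lerDl].
have mU : Ele P (fun w => prim (fun s => D2 * expR (a * nrm (X w s) ^+ 2)) T) (T * (D2 * (C1 * E))).
  apply: Ele_prim => //.
    apply: filterS hX => w [cX _ _ _ _]; apply: contM; first exact: contC.
    by apply: (cont_comp (@continuous_expR R)); apply: contM; [exact: contC|apply: contX; exact: cont_nrm].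
  move=> s hs; apply: EleZ; first exact: le_trans D21.
  apply: Ele_le (mX s hs); rewrite ?lexx//; apply: filterS hX => w [cX _ _ _ _].
  have /andP[s0 _] := hs.
  by rewrite ler_expR; apply: ler_wpM2l; [exact: ltW|rewrite lerDl mulr_ge0// diss_ge0].
have mV : Ele P (fun w => prim (fun s => D3 * expR (b * nrm (Lam (Z w s)) ^+ 2)) T) (T * (D3 * C2)).
  apply: Ele_prim => //.
    apply: filterS hZ => w [cZ _ _ _ _]; apply: contM; first exact: contC.
    by apply: (cont_comp (@continuous_expR R)); apply: contM; [exact: contC|apply: contX; exact: cont_nrmL].
  by move=> s hs; apply: EleZ; [exact: le_trans D31|exact: (H2 _ _ N)].
apply: (@Ele_le _ _ _ P _ (fun w => 4 ^+ p.+1 * (1 + D1 * expR (2 * a * diss T (X w))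
    + T ^+ p * prim (fun s => D2 * expR (a * nrm (X w s) ^+ 2)) T
    + T ^+ p * prim (fun s => D3 * expR (b * nrm (Lam (Z w s)) ^+ 2)) T)) (4 ^+ p.+1 * (1 + D1 * (C1 * E)
    + T ^+ p * (T * (D2 * (C1 * E))) + T ^+ p * (T * (D3 * C2))))).
- apply: filterS2 hX hZ => w [cX _ _ _ _] [cZ _ _ _ _].
  have dX := diss_ge0 T00 cX.
  have cu : continuous (fun s => 1 + nrm (X w s) ^+ 2) by apply: contD; [exact: contC|apply: contX; exact: cont_nrm].
  have cv : continuous (fun s => 1 + nrm (Lam (Z w s)) ^+ 2) by apply: contD; [exact: contC|apply: contX; exact: cont_nrmL].
  have u0 s : 0 <= 1 + nrm (X w s) ^+ 2 by rewrite addr_ge0 ?sqr_ge0.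
  have v0 s : 0 <= 1 + nrm (Lam (Z w s)) ^+ 2 by rewrite addr_ge0 ?sqr_ge0.
  have h1 : 0 <= prim (fun s => (1 + nrm (X w s) ^+ 2) ^+ r) T.
    by apply: prim_ge0 => //; [exact: contX|move=> s; exact: exprn_ge0].
  have h2 : 0 <= prim (fun s => (1 + nrm (Lam (Z w s)) ^+ 2) ^+ r) T.
    by apply: prim_ge0 => //; [exact: contX|move=> s; exact: exprn_ge0].
  apply: le_trans (add4_pow _ ler01 dX h1 h2) _.
  apply: ler_wpM2l => //; rewrite expr1n.
  apply: lerD; [apply: lerD; [apply: lerD => //|]|].
  + apply: le_trans (HD1 _ dX); move: (diss T (X w)) dX => D D0'.
    by rewrite ler_pXn2r ?nnegrE ?addr_ge0// lerDr.
  + apply: le_trans (jensen_prim _ _ _ _) _ => //; [exact: contX|by move=> s; exact: exprn_ge0|].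
    apply: ler_wpM2l => //; apply: le_prim => //.
    * by apply: contX; exact: contX.
    * apply: contM; first exact: contC.
      by apply: (cont_comp (@continuous_expR R)); apply: contM; [exact: contC|apply: contX; exact: cont_nrm].
    * by move=> s _; rewrite -exprM; apply: HD2; exact: sqr_ge0.
  + apply: le_trans (jensen_prim _ _ _ _) _ => //; [exact: contX|by move=> s; exact: exprn_ge0|].
    apply: ler_wpM2l => //; apply: le_prim => //.
    * by apply: contX; exact: contX.
    * apply: contM; first exact: contC.
      by apply: (cont_comp (@continuous_expR R)); apply: contM; [exact: contC|apply: contX; exact: cont_nrmL].
    * by move=> s _; rewrite -exprM; apply: HD3; exact: sqr_ge0.
- apply: (@le_trans _ _ (B * E)); last by rewrite ler_wpM2r// lerDr (le_trans _ C11).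
  rewrite /B -mulrA; apply: ler_wpM2l => //; rewrite !mulrDl mul1r.
  by apply: lerD; [apply: lerD; [apply: lerD; [|rewrite mulrA]|rewrite !mulrA]|rewrite ler_peMr].
- apply: EleZ => //; apply: EleD; [apply: EleD; [apply: EleD|]|].
  + exact: Ele_cst.
  + by apply: EleZ => //; exact: le_trans D11.
  + exact: EleZ.
  + exact: EleZ.
Qed.

Lemma theta_moment (I : finType) (i0 : I) (eps : R) n : 0 < eps -> exists2 e0 : R, 0 < e0 & forall r k, (k <= n)%N ->
  exists2 C : R, 1 <= C & forall M (x : 'rV[R]_M) xs (Xs Ns Zs : I -> Om -> R -> 'rV[R]_M) (lam : R), 0 <= lam ->
    (forall i : I, flow (xs i) (Xs i) (Ns i) (Zs i)) -> (forall i, nrm (xs i) ^+ 2 <= 2 * nrm x ^+ 2 + 2) ->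
    Ele P (fun w => theta T e0 r lam (Xs ^~ w) (Zs ^~ w) ^+ k) (C * lam ^+ k * expR (eps * nrm x ^+ 2)).
Proof.
(* Half of [eps], since the moments start from points with [|xs i|^2 <= 2 |x|^2 + 2]. *)
move=> eps0; have e2 : 0 < eps / 2 by rewrite divr_gt0.
have [a a0 Ha] := path_moment e2.
pose c : R := #|I|%:R; have c0 : 0 <= c by [].
have c1 : 0 < c + 1 by rewrite ltr_wpDl.
have n0 : (0 : R) < n.+1%:R by rewrite ltr0n.
(* The exponential in [theta] is raised to a power [k <= n], squared to separate it from the
   moments, and distributed over [#|I|] paths; this choice keeps the final coefficient
   [20 e0 k #|I|] below [2 a]. *)
exists (a / (10 * n.+1%:R * (c + 1))); first by rewrite divr_gt0// mulr_gt0// mulr_gt0.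
(* The cube of [tmoms], to the power [k], squared. *)
set e0 := a / _; move=> r k kn; pose p := (6 * k)%N.
have [C C1 HC] := Ha r p.
have C0 : 0 <= C := le_trans ler01 C1.
pose D := (c + c ^+ p.+1 * c) * (C * expR eps).
have D0 : 0 <= D by rewrite mulr_ge0// ?addr_ge0// ?mulr_ge0// ?exprn_ge0// ?expR_ge0.
exists (1 + D); first by rewrite lerDl.
move=> M x xs Xs Ns Zs lam l0 HF Hx.
set E := expR (eps * nrm x ^+ 2); have E0 : 0 <= E := expR_ge0 _.
have xE i : expR (eps / 2 * nrm (xs i) ^+ 2) <= expR eps * E.
  rewrite -expRD ler_expR; apply: le_trans (ler_wpM2l (ltW e2) (Hx i)) _.
  rewrite le_eqVlt; apply/orP; left; apply/eqP; by field.
have aeF : {ae P, forall w i, [/\ sol_path (xs i) (Xs i w) (Ns i w), mild_path (xs i) (Xs i w) (Zs i w) & conv_path (Zs i w) (Ns i w)]}.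
  by apply: filter_forall => i; case: (HF i).
have m1 i : Ele P (fun w => expR (2 * a * diss T (Xs i w))) (C * (expR eps * E)).
  have [h _] := HC _ _ _ _ _ (HF i).
  by apply: Ele_le h; [exact: nearW|rewrite ler_wpM2l].
have m2 i : Ele P (fun w => moms T r (Xs i w) (Zs i w) ^+ p.+1) (C * (expR eps * E)).
  have [_ h] := HC _ _ _ _ _ (HF i).
  by apply: Ele_le h; [exact: nearW|rewrite ler_wpM2l].
apply: (@Ele_le _ _ _ P _ (fun w => lam ^+ k * (\sum_i expR (2 * a * diss T (Xs i w)) +
    c ^+ p.+1 * \sum_i moms T r (Xs i w) (Zs i w) ^+ p.+1)) (lam ^+ k * (\sum_(i : I) C * (expR eps * E) +
    c ^+ p.+1 * \sum_(i : I) C * (expR eps * E)))).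
- apply: filterS aeF => w Hw.
  have T00 := ltW T0.
  have hA i : 0 <= diss T (Xs i w) by have [[cX _ _ _ _] _ _] := Hw i; exact: diss_ge0.
  have hQ i : 1 <= moms T r (Xs i w) (Zs i w).
    by have [[cX _ _ _ _] _ [cZ _ _ _ _]] := Hw i; have [] := moms_ge r T00 cX cZ.
  have Q1 : 1 <= tmoms T r (Xs^~ w) (Zs^~ w).
    rewrite /tmoms (bigD1 i0)//=; apply: ler_wpDr; last exact: hQ.
    by apply: sumr_ge0 => j _; exact: le_trans (hQ j).
  rewrite /theta -mulrA exprMn; apply: ler_wpM2l; first exact: exprn_ge0.
  rewrite exprMn -exprM -expRM_natr.
  have h1 : expR (10 * e0 * tdiss T (Xs^~ w) * k%:R) ^+ 2 <= \sum_i expR (2 * a * diss T (Xs i w)).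
    rewrite -expRM_natr /tdiss mulr_sumr !mulr_suml; apply: le_trans (exp_sum_share i0 _) _.
    apply: ler_sum => i _; rewrite ler_expR -/c.
    have -> : c * (10 * e0 * diss T (Xs i w) * k%:R * 2) = (20 * e0 * k%:R * c) * diss T (Xs i w) by ring.
    apply: ler_wpM2r => //.
    have kn' : k%:R <= n.+1%:R :> R by rewrite ler_nat ltnW.
    have h : k%:R * c <= n.+1%:R * (c + 1) by apply: ler_pM => //; lra.
    have -> : 20 * e0 * k%:R * c = 20 * e0 * (k%:R * c) by ring.
    have -> : 2 * a = 20 * e0 * (n.+1%:R * (c + 1)) by rewrite /e0; field; rewrite !gt_eqF.
    by apply: ler_wpM2l => //; rewrite mulr_ge0// /e0 divr_ge0 ?ltW// mulr_gt0// mulr_gt0.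
  have h2 : tmoms T r (Xs^~ w) (Zs^~ w) ^+ (3 * k) ^+ 2 <= c ^+ p.+1 * \sum_i moms T r (Xs i w) (Zs i w) ^+ p.+1.
    apply: le_trans (sum_pow_share i0 _ (fun i => le_trans ler01 (hQ i))).
    by rewrite -exprM; apply: ler_weXn2l => //; rewrite /p mulnAC leqnSn.
  move: h1 h2; move: (expR _) (_ ^+ (3 * k)) (\sum_i _) (c ^+ p.+1 * _) => u v s t h1 h2.
  by have := sqr_ge0 (u - v); have := sqr_ge0 (u + v); nra.
- rewrite sumr_const -(mulr_natl _ #|I|) -/c.
  have lE : 0 <= lam ^+ k * E by rewrite mulr_ge0// exprn_ge0.
  have -> : lam ^+ k * (c * (C * (expR eps * E)) + c ^+ p.+1 * (c * (C * (expR eps * E)))) = D * (lam ^+ k * E).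
    by rewrite /D; ring.
  by rewrite -mulrA; apply: ler_wpM2r => //; rewrite lerDr.
- apply: EleZ; first exact: exprn_ge0.
  apply: EleD; first exact: Ele_sum.
  by apply: EleZ; [exact: exprn_ge0|exact: Ele_sum].
Qed.

End flow_moments.

(** * Differentiability from finite differences *)

Section linear_asymptotics.
Context {R : realType}.

Section one_dimension.
Variables (b : R -> R) (C r : R).
Hypotheses (r0 : 0 < r) (C0 : 0 <= C) (bL : forall s, `|s| < r -> `|b s| <= C * `|s|).
Hypothesis bA : forall eps : R, 0 < eps -> exists2 del : R, 0 < del & forall s t, `|s| < del -> `|t| < del ->
  `|b (s + t) - b s - b t| <= eps * `|t|.

Lemma near_additive_multiple (eps del : R) (s : R) n : 0 <= eps -> 0 < s ->
  (forall s t, `|s| < del -> `|t| < del -> `|b (s + t) - b s - b t| <= eps * `|t|) ->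
  n.+1%:R * s < del -> `|b (n.+1%:R * s) - n.+1%:R * b s| <= eps * (n.+1%:R * s).
Proof.
move=> e0 s0 H; elim: n => [|n IH] hd; first by rewrite !mul1r subrr normr0 mulr_ge0// ltW.
have e1 : n.+2%:R = n.+1%:R + 1 :> R by rewrite -natr1.
have hs : n.+1%:R * s < del by apply: lt_trans hd; rewrite e1 mulrDl mul1r ltrDl.
have n0 : 0 <= n.+1%:R * s by rewrite mulr_ge0// ltW.
have s1 : s < del by apply: le_lt_trans hs; rewrite ler_peMl ?ler1n ?(ltW s0).
have := H (n.+1%:R * s) s; rewrite ger0_norm// gtr0_norm// => /(_ hs s1).
have := IH hs; rewrite e1 !mulrDl !mul1r mulrDr !ler_norml.
by move: (b (_ + _)) (b (_ * _)) (n.+1%:R * b s) (b s) (eps * (_ * _)) (eps * s) => *; lra.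
Qed.

(** The numbers [m b(1/m)] and [n b(1/n)] are both close to [m n b(1/(m n))] by asymptotic
    additivity, so the quotients along reciprocals form a Cauchy sequence. *)
Lemma difference_quotient_limit : exists p : R, forall eps : R, 0 < eps -> exists2 del : R, 0 < del &
  forall s, `|s| < del -> `|b s - p * s| <= eps * `|s|.
Proof.
pose pm (m : nat) := m.+1%:R * b (m.+1%:R^-1).
have m0 (m : nat) : (0 : R) < m.+1%:R by rewrite ltr0n.
have b0 : b 0 = 0.
  by apply/eqP; rewrite -normr_le0; have := @bL 0; rewrite normr0 mulr0; exact.
have close (eps : R) : 0 < eps -> \forall m \near \oo, \forall n \near \oo, `|pm m - pm n| <= eps.
  move=> e0; have e2 : 0 < eps / 2 by rewrite divr_gt0.
  have [del d0 H] := bA e2.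
  have key m n : m.+1%:R^-1 < del -> `|pm m - m.+1%:R * n.+1%:R * b ((m.+1%:R * n.+1%:R)^-1)| <= eps / 2.
    move=> hm; have mn : 0 < (m.+1%:R * n.+1%:R)^-1 :> R by rewrite invr_gt0 mulr_gt0.
    have E : n.+1%:R * (m.+1%:R * n.+1%:R)^-1 = m.+1%:R^-1 :> R by rewrite invfM mulrCA mulfV ?gt_eqF// mulr1.
    have := @near_additive_multiple (eps / 2) del (m.+1%:R * n.+1%:R)^-1 n (ltW e2) mn H.
    rewrite E => /(_ hm) h; rewrite /pm -mulrA -mulrBr normrM gtr0_norm//.
    apply: le_trans (ler_wpM2l (ltW (m0 m)) h) _.
    by rewrite mulrCA mulfV ?mulr1// gt_eqF.
  have small : \forall m \near \oo, (m.+1%:R^-1 : R) < del.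
    near=> m; rewrite -[del]invrK ltf_pV2 ?posrE ?invr_gt0//.
    by apply: lt_trans (_ : m%:R < _); [near: m; exact: nbhs_infty_gtr|rewrite ltr_nat].
  near=> m; near=> n.
  have h1 := key m n; have h2 := key n m; rewrite [n.+1%:R * _]mulrC in h2.
  have hm : m.+1%:R^-1 < del by near: m.
  have hn : n.+1%:R^-1 < del by near: n.
  have := h1 hm; have := h2 hn; rewrite !ler_norml; move: (_ * b _) => z.
  by move: (pm m) (pm n) => u v; lra.
have cp : cvg (pm @ \oo).
  apply/cauchy_cvgP; apply: cauchy_exP => eps e0.
  have e2 : 0 < eps / 2 by rewrite divr_gt0.
  have [N _ HN] := close _ e2; exists (pm N).
  have := HN N (leqnn _); apply: filterS => n /= hn.
  by rewrite /fmap/= /ball/=; apply: le_lt_trans hn _; rewrite ltr_pdivrMr//; lra.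
set p := lim (pm @ \oo).
exists p => eps e0; have e4 : 0 < eps / 4 by rewrite divr_gt0.
have [del d0 H] := bA e4.
exists (Num.min del r); first by rewrite lt_min d0.
have pos s : 0 < s < Num.min del r -> `|b s - p * s| <= 3 / 4 * eps * s.
  move=> /andP[s0]; rewrite lt_min => /andP[sd sr].
  have /cvgrPdist_le/(_ _ e4) hp := cp.
  have K0 : 0 <= eps / 4 + C + `|p| by rewrite !addr_ge0// ltW.
  have [m [h1 h2]] : exists m : nat, `|p - pm m| <= eps / 4 /\ (eps / 4 + C + `|p|) * m.+1%:R^-1 <= eps / 4 * s.
    have h : \forall m \near \oo, `|p - pm m| <= eps / 4 /\ (eps / 4 + C + `|p|) * m.+1%:R^-1 <= eps / 4 * s.
      near=> m; split; first by near: m.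
      rewrite ler_pdivrMr// [leRHS]mulrC -ler_pdivrMr ?mulr_gt0//.
      by apply: ltW; apply: lt_trans (_ : m%:R < _); [near: m; exact: nbhs_infty_gtr|rewrite ltr_nat].
    by have [N _ HN] := h; exists N; apply: HN => /=.
  have sm0 : 0 <= s * m.+1%:R by rewrite mulr_ge0// ltW.
  have /andP[k1] := truncn_itv sm0; rewrite -[X in _ < X]natr1; set k := Num.truncn _ in k1 *; move=> k2.
  (* A general [s] is a multiple [f] of [1 / (m + 1)] plus a rest [g], so small that the crude bound
     [C |g|] suffices for it. *)
  pose f := k%:R / m.+1%:R : R; pose g := s - f.
  have f0 : 0 <= f by rewrite divr_ge0.
  have fs : f <= s by rewrite ler_pdivrMr.
  have g0 : 0 <= g by rewrite subr_ge0.
  have g1 : g <= m.+1%:R^-1.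
    rewrite -(@ler_pM2r _ m.+1%:R)// mulVf ?gt_eqF// /g mulrBl /f divfK ?gt_eqF//; lra.
  have gs : g <= s by rewrite gerBl.
  have b1 : `|b s - b f - b g| <= eps / 4 * g.
    have fg : f + g = s by rewrite /g addrC subrK.
    by have := H f g; rewrite fg (ger0_norm f0) (ger0_norm g0); apply; apply: le_lt_trans sd.
  have b2 : `|b g| <= C * g by have := @bL g; rewrite ger0_norm//; apply; apply: le_lt_trans sr.
  have b3 : `|b f - k%:R * b m.+1%:R^-1| <= eps / 4 * f.
    move: fs; rewrite /f; case: (k) => [|k'] hk; first by rewrite !mul0r b0 subrr normr0 mulr0.
    apply: (near_additive_multiple (ltW e4) _ H); first by rewrite invr_gt0.
    exact: le_lt_trans hk sd.
  have b4 : `|k%:R * b m.+1%:R^-1 - p * f| <= eps / 4 * f.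
    have -> : k%:R * b m.+1%:R^-1 - p * f = f * (pm m - p) by rewrite /f /pm; field; rewrite addrC natr1 gt_eqF.
    by rewrite normrM ger0_norm// mulrC distrC; apply: ler_wpM2r.
  have b5 : `|p * f - p * s| <= `|p| * g by rewrite -mulrBr normrM distrC (ger0_norm g0).
  have b6 : (eps / 4 + C + `|p|) * g <= eps / 4 * s.
    by apply: le_trans h2; apply: ler_wpM2l.
  have b7 : eps / 4 * f <= eps / 4 * s by apply: ler_wpM2l => //; exact: ltW.
  have -> : 3 / 4 * eps * s = eps / 4 * s + eps / 4 * s + eps / 4 * s by field.
  move: b1 b2 b3 b4 b5 b6 b7; rewrite !mulrDl !ler_norml.
  move: (b s) (b f) (b g) (k%:R * _) (p * f) (p * s) (eps / 4 * g) (C * g) (`|p| * g) (eps / 4 * f) (eps / 4 * s).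
  by clear => *; lra.
move=> s; have [->|sn] := eqVneq s 0; first by rewrite normr0 b0 mulr0 subrr normr0 mulr0.
have [s0|s0] := ltP 0 s.
  rewrite gtr0_norm// => hs; have := pos s; rewrite s0 => /(_ hs) h; apply: (le_trans h).
  by rewrite ler_wpM2r ?ltW//; lra.
have {}s0 : s < 0 by rewrite lt_neqAle sn.
rewrite ltr0_norm// => hs; have ns : 0 < - s by rewrite oppr_gt0.
have := pos (- s); rewrite ns => /(_ hs).
move: hs; rewrite lt_min => /andP[sd _].
have := H s (- s); rewrite normrN ltr0_norm// subrr b0 sub0r => /(_ sd sd).
rewrite !ler_norml; move: (b s) (b (- s)) => u v; rewrite !mulrN ?opprK.
have -> : eps / 4 * s = eps * s / 4 by ring.
have -> : 3 / 4 * eps * s = 3 * (eps * s) / 4 by field.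
by move: (eps * s) (p * s) => *; lra.
Unshelve. all: by end_near. Qed.

End one_dimension.

Context {M : nat}.
Implicit Types (h f g x p : 'rV[R]_M) (a u : 'rV[R]_M -> R).

(** On each axis this is [difference_quotient_limit]; the coordinates of [h] are then added one at a
    time, each at the cost of a small multiple of its absolute value. *)
Lemma asymptotically_linear a (C r : R) : 0 < r -> 0 <= C -> (forall h, nrm h < r -> `|a h| <= C * nrm h) ->
  (forall eps : R, 0 < eps -> exists2 del : R, 0 < del & forall f g, nrm f < del -> nrm g < del ->
     `|a (f + g) - a f - a g| <= eps * nrm g) ->
  exists p, forall eps : R, 0 < eps -> exists2 del : R, 0 < del &
    forall h, nrm h < del -> `|a h - dot p h| <= eps * nrm h.
Proof.
move=> r0 C0 aL aA.
have nd (s : R) i : nrm (s *: delta i : 'rV[R]_M) = `|s| by rewrite nrmZ nrm_delta mulr1.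
have /choice[p Hp] : forall i : 'I_M, exists p : R, forall eps : R, 0 < eps -> exists2 del : R, 0 < del &
  forall s, `|s| < del -> `|a (s *: delta i) - p * s| <= eps * `|s|.
  move=> i; apply: (@difference_quotient_limit (fun s => a (s *: delta i)) C r) => //.
    by move=> s hs; rewrite -(nd s i); apply: aL; rewrite nd.
  move=> eps e0; have [del d0 H] := aA _ e0; exists del => // s t hs ht.
  by rewrite scalerDl -(nd t i); apply: H; rewrite nd.
exists (\row_i p i) => eps e0.
have e1 : 0 < eps / 2 / M.+1%:R by rewrite !divr_gt0.
have [del d0 H] := aA _ e1.
have /choice[dl Hdl] : forall i : 'I_M, exists del : R, 0 < del /\ forall s, `|s| < del -> `|a (s *: delta i) - p i * s| <= eps / 2 / M.+1%:R * `|s|.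
  by move=> i; have [dd ? ?] := Hp i _ e1; exists dd.
have [del2 d20 H2] : exists2 del2 : R, 0 < del2 & forall i, del2 <= dl i.
  exists (\big[Num.min/1]_i dl i); last by move=> i; exact: bigmin_le_cond.
  by elim/big_ind : _ => // [y z y0 z0|i _]; [rewrite lt_min y0|case: (Hdl i)].
have sM h : \sum_i `|h ord0 i| <= M%:R * nrm h.
  rewrite mulr_natl -[X in _ *+ X]card_ord -sumr_const; apply: ler_sum => i _; exact: coord_le.
exists (Num.min del2 (del / M.+1%:R)); first by rewrite lt_min d20 divr_gt0.
move=> h; rewrite lt_min ltr_pdivlMr// => /andP[hd2 hd].
have hS : \sum_i `|h ord0 i| < del.
  apply: le_lt_trans (sM h) _; apply: le_lt_trans hd; rewrite mulrC; apply: ler_wpM2l; first exact: nrm_ge0.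
  by rewrite ler_nat.
have a0 : a 0 = 0.
  by apply/eqP; rewrite -normr_le0; have := aL 0; rewrite nrm0 mulr0; apply.
have sub (l : seq 'I_M) : \sum_(i <- l) `|h ord0 i| < del ->
    `|a (\sum_(i <- l) h ord0 i *: delta i) - \sum_(i <- l) a (h ord0 i *: delta i)| <= eps / 2 / M.+1%:R * \sum_(i <- l) `|h ord0 i|.
  elim: l => [|i l IH]; first by rewrite !big_nil a0 subrr normr0 mulr0.
  rewrite !big_cons => hl.
  have hl2 : \sum_(j <- l) `|h ord0 j| < del by apply: le_lt_trans hl; rewrite lerDr.
  have hi : `|h ord0 i| < del by apply: le_lt_trans hl; rewrite lerDl sumr_ge0.
  have hs : nrm (\sum_(j <- l) h ord0 j *: delta j : 'rV[R]_M) < del.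
    by apply: le_lt_trans hl2; apply: le_trans (nrm_sum _ _) _; apply: ler_sum => j _; rewrite nd.
  have := H _ (h ord0 i *: delta i) hs; rewrite nd => /(_ hi); have := IH hl2.
  rewrite [_ + h ord0 i *: _]addrC mulrDr !ler_norml.
  move: (a (_ + _)) (a _) (\sum_(j <- l) a _) (a (_ *: _)) (_ * `|h ord0 i|) (_ * \sum_(j <- l) `|_|) => *; lra.
have hE := deltaE h.
have S1 := sub (index_enum 'I_M) hS; rewrite -hE in S1.
have S2 : `|\sum_i a (h ord0 i *: delta i) - dot (\row_i p i) h| <= eps / 2 / M.+1%:R * \sum_i `|h ord0 i|.
  rewrite dotE -sumrB mulr_sumr; apply: le_trans (ler_norm_sum _ _ _) _; apply: ler_sum => i _.
  rewrite mxE; have [_ hh] := Hdl i; apply: hh; apply: lt_le_trans (H2 i).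
  exact: le_lt_trans (coord_le _ _) hd2.
have S3 : eps / 2 / M.+1%:R * \sum_i `|h ord0 i| <= eps / 2 * nrm h.
  rewrite -mulrA; apply: ler_wpM2l; first by rewrite ltW// divr_gt0.
  rewrite mulrC ler_pdivrMr//; apply: le_trans (sM h) _; rewrite mulrC; apply: ler_wpM2l; first exact: nrm_ge0.
  by rewrite ler_nat.
rewrite -[a h](subrK (\sum_i a (h ord0 i *: delta i))) -addrA.
apply: le_trans (ler_normD _ _) _; apply: le_trans (lerD S1 S2) _.
by apply: le_trans (lerD S3 S3) _; rewrite -mulrDl -splitr.
Qed.

End linear_asymptotics.

HB.instance Definition _ (R : realType) (M : nat) (p : 'rV[R]_M) :=
  @GRing.isLinear.Build R 'rV[R]_M R^o *:%R (dot p) (fun k a b => etrans (dotDr _ _ _) (congr1 (+%R^~ _) (dotZr _ _ _))).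

Section differentiability.
Context {R : realType} {M : nat}.
Implicit Types (h x p : 'rV[R]_M) (u : 'rV[R]_M -> R).

(** The norm of row vectors is the maximum norm, whereas [nrm] is the Euclidean one. *)
Lemma nrm_le_norm h : nrm h <= M.+1%:R * `|h|.
Proof.
apply: le_trans (nrm_le_sum h) _.
apply: (@le_trans _ _ (\sum_(i < M) `|h|)).
  apply: ler_sum => i _; rewrite [leRHS]mx_normrE.
  by apply: le_trans (le_bigmax _ _ (ord0, i)).
by rewrite sumr_const card_ord -[leLHS]mulr_natl ler_wpM2r// ler_nat.
Qed.

Lemma cont_dot_vec p : continuous (dot p : 'rV[R]_M -> R).
Proof.
rewrite (_ : dot p = fun h => \sum_(i < M) p ord0 i * h ord0 i); last by apply: funext => h; rewrite dotE.
apply: cont_sum => i; apply: contM; first exact: contC.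
exact: coord_continuous.
Qed.

Lemma differentiable_dot u x p : (forall eps : R, 0 < eps -> exists2 del : R, 0 < del &
    forall h, nrm h < del -> `|u (x + h) - u x - dot p h| <= eps * nrm h) ->
  differentiable u x /\ forall h, 'd u x h = dot p h.
Proof.
move=> H.
have E : u \o shift x = cst (u x) + (dot p : {linear 'rV[R]_M -> R^o}) +o_ (0 : 'rV[R]_M) id.
  apply/eqaddoP => eps e0.
  have M0 : 0 < M.+1%:R :> R by [].
  have [del d0 Hd] := H _ (divr_gt0 e0 M0).
  have h0 : \forall h \near (0 : 'rV[R]_M), `|h| < del / M.+1%:R by apply: nbhs0_lt; rewrite divr_gt0.
  apply: filterS h0 => h; rewrite ltr_pdivlMr// mulrC => hd.
  have h1 := Hd h (le_lt_trans (nrm_le_norm h) hd).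
  change (`|u (h + x) - (u x + dot p h)| <= eps * `|h|); rewrite opprD addrA (addrC h).
  apply: (le_trans h1); rewrite -mulrA; apply: ler_wpM2l; first exact: ltW.
  by rewrite mulrC ler_pdivrMr// mulrC; exact: nrm_le_norm.
have D : 'd u x = dot p :> ('rV[R]_M -> R) by exact: (diff_unique (@cont_dot_vec p) E).
split; last by move=> h; rewrite D.
by apply/diff_locallyP; rewrite D; split => //; exact: cont_dot_vec.
Qed.

End differentiability.

Section compact_modulus.
Context {R : realType} {M : nat}.
Implicit Types (y z g h : 'rV[R]_M).

Lemma near_nrm y (r : R) : 0 < r -> \forall z \near y, nrm (z - y) < r.
Proof.
move=> r0; have M0 : 0 < M.+1%:R :> R by [].
have h0 : \forall z \near y, `|y - z| < r / M.+1%:R.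
  by apply: (@cvgr_dist_lt _ _ _ (nbhs y) _ id y) => //; rewrite divr_gt0.
apply: filterS h0 => z; rewrite distrC ltr_pdivlMr// mulrC; exact: le_lt_trans (nrm_le_norm _).
Qed.

(** Continuity is uniform on bounded sets by compactness of cubes; this uses the finite dimension of
    [H_M]. *)
Lemma uniform_modulus (D : 'rV[R]_M -> 'rV[R]_M -> 'rV[R]_M -> R) (rho eps : R) : 0 < eps ->
  (forall y (eps : R), 0 < eps -> exists2 del : R, 0 < del & forall z, nrm (z - y) < del ->
     forall g h, `|D z g h - D y g h| <= eps * nrm g * nrm h) ->
  exists2 eta : R, 0 < eta & forall y z, nrm y <= rho -> nrm (z - y) < eta ->
     forall g h, `|D z g h - D y g h| <= eps * nrm g * nrm h.
Proof.
move=> e0 HD.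
have cK : compact [set v : 'rV[R]_M | forall i, `[- rho, rho]%classic (v ord0 i)].
  by apply: (@rV_compact _ _ (fun=> `[- rho, rho]%classic)) => i; exact: segment_compact.
move/compact_near_coveringP: cK => /(_ R (0^'+) (fun del y => forall z, nrm (z - y) < del ->
   forall g h, `|D z g h - D y g h| <= eps * nrm g * nrm h)) H.
have {}H : \forall del \near 0^'+, [set v : 'rV[R]_M | forall i, `[- rho, rho]%classic (v ord0 i)] `<=`
    (fun y => forall z, nrm (z - y) < del -> forall g h, `|D z g h - D y g h| <= eps * nrm g * nrm h).
  apply: H => y0 _.
  have [d d0 Hd] := HD y0 (eps / 2) (divr_gt0 e0 (ltr0Sn _ 1)).
  have d20 : 0 < d / 2 by rewrite divr_gt0.
  exists ([set y | nrm (y - y0) < d / 2], [set del | 0 < del /\ del < d / 2]) => /=.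
    split; first exact: near_nrm.
    by apply: filterI; [exact: nbhs_right_gt|exact: nbhs_right_lt].
  move=> [y del] /= [h1 [h2 h3]] z h4 g h.
  have a1 := Hd y _ g h; have a2 := Hd z _ g h.
  have {}a1 : `|D y g h - D y0 g h| <= eps / 2 * nrm g * nrm h by apply: a1; lra.
  have {}a2 : `|D z g h - D y0 g h| <= eps / 2 * nrm g * nrm h.
    apply: a2; have := nrmD (z - y) (y - y0); rewrite addrA subrK; lra.
  have -> : D z g h - D y g h = (D z g h - D y0 g h) - (D y g h - D y0 g h) by ring.
  apply: le_trans (ler_normB _ _) _; apply: le_trans (lerD a2 a1) _.
  by rewrite le_eqVlt; apply/orP; left; apply/eqP; field.
near (0 : R)^'+ => eta; exists eta => [|y z hy hz g h]; first by near: eta; exact: nbhs_right_gt.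
have H2 : [set v : 'rV[R]_M | forall i, `[- rho, rho]%classic (v ord0 i)] `<=`
    (fun y => forall z, nrm (z - y) < eta -> forall g h, `|D z g h - D y g h| <= eps * nrm g * nrm h) by near: eta.
apply: (H2 y) => //= i; rewrite in_itv/= -ler_norml; exact: le_trans (coord_le _ _) hy.
Unshelve. all: by end_near. Qed.

(* Modulus of continuity, linearised: no smallness of [y] or [z - y] is required. *)
Lemma linear_modulus (D : 'rV[R]_M -> 'rV[R]_M -> 'rV[R]_M -> R) (K eps : R) : 0 < eps -> 0 <= K ->
  (forall y g h, `|D y g h| <= K * nrm g * nrm h) ->
  (forall y (eps : R), 0 < eps -> exists2 del : R, 0 < del & forall z, nrm (z - y) < del ->
     forall g h, `|D z g h - D y g h| <= eps * nrm g * nrm h) ->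
  exists2 L : R, 0 <= L & forall y z g h, `|D z g h - D y g h| <= (eps * (1 + nrm y) + L * nrm (z - y)) * nrm g * nrm h.
Proof.
move=> e0 K0 DK HD; have [eta eta0 H] := uniform_modulus (2 * K / eps) e0 HD.
exists (2 * K / eta); first by rewrite divr_ge0 ?mulr_ge0// ltW.
move=> y z g h; have ny := nrm_ge0 y; have nz := nrm_ge0 (z - y).
have p0 : 0 <= 2 * K / eta * nrm (z - y) by rewrite mulr_ge0// divr_ge0 ?mulr_ge0// ltW.
have e1 : eps <= eps * (1 + nrm y) by rewrite ler_peMr ?(ltW e0)// lerDl.
suff [hh|hh] : `|D z g h - D y g h| <= eps * nrm g * nrm h \/ 2 * K <= eps * (1 + nrm y) + 2 * K / eta * nrm (z - y).
- apply: (le_trans hh); do 2 (apply: ler_wpM2r; first exact: nrm_ge0); lra.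
- apply: (@le_trans _ _ (2 * K * nrm g * nrm h)); last by do 2 (apply: ler_wpM2r; first exact: nrm_ge0).
  apply: le_trans (ler_normB _ _) _; apply: le_trans (lerD (DK z g h) (DK y g h)) _.
  by rewrite -!mulrA (mulrA 2) -mulrDl mulr_natl mulr2n.
have [hy|hy] := leP (nrm y) (2 * K / eps); last first.
  right; move: hy; rewrite ltr_pdivrMr// => hy; move: p0 hy; move: (2 * K / eta * _) => p; nra.
have [hz|hz] := ltP (nrm (z - y)) eta; first by left; exact: H.
right; have : 2 * K <= 2 * K / eta * nrm (z - y).
  by rewrite -mulrA ler_peMr ?mulr_ge0// mulrC ler_pdivlMr// mul1r.
have : 0 <= eps * (1 + nrm y) by rewrite mulr_ge0 ?(ltW e0)// addr_ge0.
lra.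
Qed.

End compact_modulus.

Section increments.
Context {R : realType}.

Lemma is_derive_expansion (F : R -> R) (s dF : R) : (forall eps : R, 0 < eps -> exists2 del : R, 0 < del &
    forall h, `|h| < del -> `|F (s + h) - F s - dF * h| <= eps * `|h|) -> is_derive s 1 F dF.
Proof.
move=> H.
have E : (fun h => h^-1 *: ((F \o shift s) (h *: (1 : R)) - F s)) @ 0^' --> dF.
  apply/cvgrPdist_le => eps e0; have [del d0 Hd] := H _ e0.
  have h0 : \forall h \near (0 : R)^', `|h| < del.
    by apply: dnbhs0_lt.
  near=> h; have hn : h != 0 by near: h; exact: nbhs_dnbhs_neq.
  have hd : `|h| < del by near: h.
  have := Hd h hd; rewrite /= /GRing.scale/= mulr1 (addrC h) => h1.
  have -> : dF - h^-1 * (F (s + h) - F s) = - (F (s + h) - F s - dF * h) / h by field.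
  rewrite mulNr normrN.
  by rewrite normrM normfV ler_pdivrMr ?normr_gt0.
by apply: DeriveDef; [apply/cvg_ex; exists dF|exact: cvg_lim E].
Unshelve. all: by end_near. Qed.

Lemma increment_bound (F : R -> R) (dF : R -> R) (c K : R) : (forall s : R, is_derive s 1 F (dF s)) ->
  (forall s, 0 <= s <= 1 -> `|dF s - c| <= K) -> `|F 1 - F 0 - c| <= K.
Proof.
move=> HF HK.
have dl k (s : R) : is_derive s 1 (fun s => k * s) (k * 1) := dZ k (is_derive_id s 1).
have up : F 1 - F 0 <= (c + K) * 1 - (c + K) * 0.
  apply: (le_of_derive_le ler01 (fun s _ => HF s) (fun s _ => dl (c + K) s)
    (fun s _ => is_derive_cont (HF s)) (fun s _ => is_derive_cont (dl (c + K) s))) => s /andP[s0 s1].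
  by have := HK s; rewrite (ltW s0) (ltW s1) ler_norml => /(_ isT); lra.
have dn : (c - K) * 1 - (c - K) * 0 <= F 1 - F 0.
  apply: (le_of_derive_le ler01 (fun s _ => dl (c - K) s) (fun s _ => HF s)
    (fun s _ => is_derive_cont (dl (c - K) s)) (fun s _ => is_derive_cont (HF s))) => s /andP[s0 s1].
  by have := HK s; rewrite (ltW s0) (ltW s1) ler_norml => /(_ isT); lra.
by rewrite ler_norml; move: up dn; lra.
Qed.

End increments.

Section observable.
Context {R : realType}.
Variable phi : (R -> R) -> R.
Hypothesis Hphi : C2_bounded_L2 phi.

Lemma Sf_L2 M (c : 'rV[R]_M) : L2fun (Sf c).
Proof. by apply: L2fun_cont; exact: cont_Sf. Qed.

Lemma SfDE M (a b : 'rV[R]_M) : (fun z => Sf a z + Sf b z) = Sf (a + b).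
Proof. by apply: funext => z; rewrite SfD. Qed.

Lemma SfZE M k (a : 'rV[R]_M) : (fun z => k * Sf a z + 0 * Sf a z) = Sf (k *: a).
Proof. by apply: funext => z; rewrite SfZ mul0r addr0. Qed.

Lemma l2norm_SfE M (c : 'rV[R]_M) : l2norm (Sf c) = nrm c.
Proof. by rewrite -l2norm_Sf Sf.unlock. Qed.

(** What the later estimates use of [phi]. The constant [K] is uniform in [M] and feeds the
    quantitative bounds, while [L] may depend on [M] and feeds only the qualitative bound on third
    differences. *)
Lemma observable_increments : exists2 K : R, 0 <= K & forall M, exists D2 : 'rV[R]_M -> 'rV[R]_M -> 'rV[R]_M -> R,
  [/\ forall y h : 'rV[R]_M, `|phi (Sf (y + h)) - phi (Sf y)| <= K * nrm h,
   forall y a b : 'rV[R]_M, `|phi (Sf (y + a + b)) - phi (Sf (y + a)) - phi (Sf (y + b)) + phi (Sf y)| <= K * nrm a * nrm b,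
   forall y a b a' b', `|D2 y a b - D2 y a' b'| <= K * (nrm (a - a') * nrm b + nrm a' * nrm (b - b')) &
   forall eps : R, 0 < eps -> exists2 L : R, 0 <= L & forall y z a b : 'rV[R]_M,
     `|phi (Sf (z + a + b)) - phi (Sf (z + a)) - phi (Sf (z + b)) + phi (Sf z) - D2 y a b|
       <= (eps * (1 + nrm y) + L * (nrm (z - y) + nrm a + nrm b)) * nrm a * nrm b].
Proof.
have [Dphi [D2phi [K1 [K2 H]]]] := Hphi.
exists (`|K1| + `|K2|); first by rewrite addr_ge0.
(* In [D2] the direction in which [Dphi] is differentiated comes last, in [D2phi] it comes first. *)
move=> M; pose D1 (y h : 'rV[R]_M) := Dphi (Sf y) (Sf h); pose D2 (y g h : 'rV[R]_M) := D2phi (Sf y) (Sf h) (Sf g).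
have H' (c : 'rV[R]_M) := H (Sf c) (Sf_L2 c).
have D1Z y k h : D1 y (k *: h) = k * D1 y h.
  have [h1 _] := H' y; have := h1 k 0 _ _ (Sf_L2 h) (Sf_L2 h).
  by rewrite SfZE mul0r addr0.
have D1K y h : `|D1 y h| <= `|K1| * nrm h.
  have [_ [h1 _]] := H' y; apply: le_trans (h1 _ (Sf_L2 h)) _; rewrite l2norm_SfE.
  by apply: ler_wpM2r; [exact: nrm_ge0|exact: ler_norm].
have D1d y (eps : R) : 0 < eps -> exists2 del : R, 0 < del & forall h, nrm h < del ->
    `|phi (Sf (y + h)) - phi (Sf y) - D1 y h| <= eps * nrm h.
  move=> e0; have [_ [_ [h1 _]]] := H' y; have [del d0 Hd] := h1 _ e0.
  exists del => // h hd; have := Hd _ (Sf_L2 h); rewrite l2norm_SfE => /(_ hd).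
  by rewrite SfDE.
have D2l y a b h : D2 y h (a - b) = D2 y h a - D2 y h b.
  have [_ [_ [_ [h1 _]]]] := H' y; have [h2 _] := h1 1 (-1) _ _ _ (Sf_L2 a) (Sf_L2 b) (Sf_L2 h).
  move: h2; rewrite mul1r mulN1r /D2 => <-; congr (D2phi _ _ _).
  by apply: funext => z; rewrite SfB mul1r mulN1r.
have D2r y a b h : D2 y (a - b) h = D2 y a h - D2 y b h.
  have [_ [_ [_ [h1 _]]]] := H' y; have [_ h2] := h1 1 (-1) _ _ _ (Sf_L2 a) (Sf_L2 b) (Sf_L2 h).
  move: h2; rewrite mul1r mulN1r /D2 => <-; congr (D2phi _ _ _).
  by apply: funext => z; rewrite SfB mul1r mulN1r.
have D2Z y k a h : D2 y h (k *: a) = k * D2 y h a.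
  have [_ [_ [_ [h1 _]]]] := H' y; have [h2 _] := h1 k 0 _ _ _ (Sf_L2 a) (Sf_L2 a) (Sf_L2 h).
  by move: h2; rewrite SfZE mul0r addr0.
have D2K y g h : `|D2 y g h| <= `|K2| * nrm g * nrm h.
  have [_ [_ [_ [_ [h1 _]]]]] := H' y; apply: le_trans (h1 _ _ (Sf_L2 h) (Sf_L2 g)) _; rewrite !l2norm_SfE.
  rewrite -!mulrA (mulrC (nrm h)); apply: ler_wpM2r; [by rewrite mulr_ge0 ?nrm_ge0|exact: ler_norm].
have D2d y (eps : R) : 0 < eps -> exists2 del : R, 0 < del & forall g, nrm g < del -> forall h,
    `|D1 (y + g) h - D1 y h - D2 y h g| <= eps * nrm g * nrm h.
  move=> e0; have [_ [_ [_ [_ [_ [h1 _]]]]]] := H' y; have [del d0 Hd] := h1 _ e0.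
  exists del => // g hd h; have := Hd _ (Sf_L2 g); rewrite l2norm_SfE => /(_ hd _ (Sf_L2 h)).
  by rewrite SfDE l2norm_SfE.
have D2c y (eps : R) : 0 < eps -> exists2 del : R, 0 < del & forall z, nrm (z - y) < del ->
    forall g h, `|D2 z g h - D2 y g h| <= eps * nrm g * nrm h.
  move=> e0; have [_ [_ [_ [_ [_ [_ h1]]]]]] := H' y; have [del d0 Hd] := h1 _ e0.
  exists del => // z hz g h; have := Hd _ (Sf_L2 (z - y)); rewrite l2norm_SfE => /(_ hz _ _ (Sf_L2 h) (Sf_L2 g)).
  have E : y + (z - y) = z by rewrite addrC subrK.
  by rewrite SfDE E !l2norm_SfE -!mulrA (mulrC (nrm h)).
have line (y h : 'rV[R]_M) (s : R) : is_derive s 1 (fun s => phi (Sf (y + s *: h))) (D1 (y + s *: h) h).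
  apply: is_derive_expansion => eps e0; have n1 : 0 < nrm h + 1 by rewrite ltr_wpDl ?nrm_ge0.
  have [del d0 Hd] := D1d (y + s *: h) _ (divr_gt0 e0 n1).
  exists (del / (nrm h + 1)); first by rewrite divr_gt0.
  move=> t; rewrite ltr_pdivlMr// => ht.
  have nt : nrm (t *: h) <= `|t| * (nrm h + 1) by rewrite nrmZ; apply: ler_wpM2l => //; rewrite lerDl.
  have := Hd (t *: h) (le_lt_trans nt ht); rewrite D1Z scalerDl addrA mulrC => h1; apply: (le_trans h1).
  by rewrite -mulrA; apply: ler_wpM2l; [exact: ltW|rewrite mulrC ler_pdivrMr].
have line2 (y g h : 'rV[R]_M) (s : R) : is_derive s 1 (fun s => D1 (y + s *: g) h) (D2 (y + s *: g) h g).
  apply: is_derive_expansion => eps e0; have n1 : 0 < nrm g * nrm h + 1 by rewrite ltr_wpDl// mulr_ge0 ?nrm_ge0.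
  have [del d0 Hd] := D2d (y + s *: g) _ (divr_gt0 e0 n1).
  have n2 : 0 < nrm g + 1 by rewrite ltr_wpDl ?nrm_ge0.
  exists (del / (nrm g + 1)); first by rewrite divr_gt0.
  move=> t; rewrite ltr_pdivlMr// => ht.
  have nt : nrm (t *: g) <= `|t| * (nrm g + 1) by rewrite nrmZ; apply: ler_wpM2l => //; rewrite lerDl.
  have := Hd (t *: g) (le_lt_trans nt ht) h; rewrite D2Z scalerDl addrA [t * _]mulrC => h1; apply: (le_trans h1).
  rewrite nrmZ -!mulrA; apply: ler_wpM2l; first exact: ltW.
  by rewrite mulrCA ler_piMr// mulrC ler_pdivrMr// mul1r lerDl.
(* The mean value inequality, applied in [s] and then in [t], compares the second difference over a
   parallelogram with the values of [D2] on it. *)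
have square (y a b : 'rV[R]_M) (c K : R) : (forall s t, 0 <= s <= 1 -> 0 <= t <= 1 -> `|D2 (y + s *: a + t *: b) a b - c| <= K) ->
    `|phi (Sf (y + a + b)) - phi (Sf (y + a)) - phi (Sf (y + b)) + phi (Sf y) - c| <= K.
  move=> HK.
  pose F s := phi (Sf (y + b + s *: a)) - phi (Sf (y + s *: a)).
  have dF (s : R) : is_derive s 1 F (D1 (y + b + s *: a) a - D1 (y + s *: a) a) := dB (line _ _ _) (line _ _ _).
  have -> : phi (Sf (y + a + b)) - phi (Sf (y + a)) - phi (Sf (y + b)) + phi (Sf y) - c = F 1 - F 0 - c.
    by rewrite /F !scale1r !scale0r !addr0 (addrAC y b a); ring.
  apply: (increment_bound dF) => s hs.
  have := @increment_bound _ _ _ c K (line2 (y + s *: a) b a).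
  by rewrite scale1r scale0r addr0 (addrAC y _ b); apply => t ht; exact: HK.
exists D2; split.
- move=> y h; have := @increment_bound _ _ _ 0 (`|K1| * nrm h) (line y h).
  rewrite scale1r scale0r addr0 subr0 => h1; apply: le_trans (h1 _) _.
    by move=> s _; rewrite subr0.
  by apply: ler_wpM2r; [exact: nrm_ge0|rewrite lerDl].
- move=> y a b; rewrite -[X in `|X|]subr0; apply: square => s t _ _; rewrite subr0.
  apply: le_trans (D2K _ _ _) _; do 2 (apply: ler_wpM2r; first exact: nrm_ge0); by rewrite lerDr.
- move=> y a b a' b'.
  have -> : D2 y a b - D2 y a' b' = D2 y (a - a') b + D2 y a' (b - b') by rewrite D2l D2r; ring.
  apply: le_trans (ler_normD _ _) _; rewrite mulrDr; apply: lerD.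
    by rewrite mulrA; apply: le_trans (D2K _ _ _) _; do 2 (apply: ler_wpM2r; first exact: nrm_ge0); rewrite lerDr.
  by rewrite mulrA; apply: le_trans (D2K _ _ _) _; do 2 (apply: ler_wpM2r; first exact: nrm_ge0); rewrite lerDr.
- move=> eps e0; have [L L0 HL] := linear_modulus e0 (normr_ge0 K2) D2K D2c.
  exists L => // y z a b; apply: square => s t /andP[s0 s1] /andP[t0 t1].
  apply: le_trans (HL y _ a b) _; do 2 (apply: ler_wpM2r; first exact: nrm_ge0); rewrite lerD2l.
  apply: ler_wpM2l => //.
  have -> : z + s *: a + t *: b - y = (z - y) + s *: a + t *: b by rewrite addrAC (addrAC z).
  apply: le_trans (nrmD _ _) _; apply: lerD; last by rewrite nrmZ ger0_norm// ler_piMl ?nrm_ge0.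
  by apply: le_trans (nrmD _ _) _; apply: lerD => //; rewrite nrmZ ger0_norm// ler_piMl ?nrm_ge0.
Qed.

End observable.

(** * Finite families of paths driven by the same noise *)

Section families.
Context {R : realType} {M : nat}.
Implicit Types (I J : finType).

Lemma nsig0 (x : 'rV[R]_M) : nsig (- (2 * 0)) x = nrm x.
Proof. by rewrite /nsig dgm1// => i; rewrite mulr0 oppr0 powRr0. Qed.

(* Galerkin paths from the points [xs], driven by the same noise. *)
Definition common_noise I (sigma lam : R) (xs : I -> 'rV[R]_M) Xs Zs :=
  [/\ forall k, 1 + nsig sigma (xs k) <= lam, forall k, mild_path (xs k) (Xs k) (Zs k),
   forall a b, Xs a 0 - Xs b 0 = xs a - xs b &
   forall a b, curve (fun s => Xs a s - Xs b s) (fun s => drift (Xs a s) - drift (Xs b s))].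

Lemma family_pull I J (phi : J -> I) sigma lam (xs : I -> 'rV[R]_M) Xs Zs : common_noise sigma lam xs Xs Zs ->
  common_noise sigma lam (xs \o phi) (Xs \o phi) (Zs \o phi).
Proof. by move=> [h1 h2 h3 h4]; split => * /=. Qed.

(** Reduces arbitrary families to the quadruples of the pathwise estimates. A path may occur up to
    four times in a quadruple, whence the factor 4 in the exponent and [64 = 4^3] from the cube of
    the moments. *)
Lemma theta_pull I (phi : 'I_4 -> I) (T e sigma lam : R) q (xs : I -> 'rV[R]_M) Xs Zs : 0 <= T -> 0 <= e ->
  common_noise sigma lam xs Xs Zs -> theta T e q lam (Xs \o phi) (Zs \o phi) <= 64 * theta T (4 * e) q lam Xs Zs.
Proof.
move=> T0 e0 [hl hX _ _].
have d0 i : 0 <= diss T (Xs i) by apply: diss_ge0 => //; case: (hX i).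
have m0 i : 0 <= moms T q (Xs i) (Zs i).
  by have [cX [cZ _]] := hX i; have [h _ _ _] := moms_ge q T0 cX cZ; exact: le_trans h.
have le4 (f : I -> R) : (forall i, 0 <= f i) -> \sum_k f (phi k) <= 4 * \sum_i f i.
  move=> f0; have -> : 4 * \sum_i f i = \sum_(k < 4) \sum_i f i.
    by rewrite sumr_const card_ord mulr_natl.
  apply: ler_sum => k _; rewrite (bigD1 (phi k))//= lerDl; exact: sumr_ge0.
have l0 : 0 <= lam by apply: le_trans (hl (phi ord0)); rewrite addr_ge0// nrm_ge0.
rewrite /theta (_ : 64 * _ = lam * expR (10 * (4 * e) * tdiss T Xs) * (4 * tmoms T q Xs Zs) ^+ 3); last by ring.
apply: ler_pM.
- by rewrite mulr_ge0 ?expR_ge0.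
- by apply: exprn_ge0; apply: sumr_ge0 => k _; exact: m0.
- apply: ler_wpM2l => //; rewrite ler_expR.
  have : tdiss T (Xs \o phi) <= 4 * tdiss T Xs := le4 _ d0; move: (tdiss T _) (tdiss T Xs) => u v uv.
  have -> : 10 * (4 * e) * v = 10 * e * (4 * v) by ring.
  by apply: ler_wpM2l => //; rewrite mulr_ge0.
- rewrite lerXn2r ?nnegrE//.
  + by apply: sumr_ge0 => k _; exact: m0.
  + by apply: mulr_ge0 => //; apply: sumr_ge0 => k _; exact: m0.
  + exact: (le4 (fun i => moms T q (Xs i) (Zs i)) m0).
Qed.

Lemma theta_pull_ge1 I (i0 : I) (T e sigma lam : R) q (xs : I -> 'rV[R]_M) Xs Zs : 0 <= T -> 0 <= e ->
  common_noise sigma lam xs Xs Zs -> 1 <= 64 * theta T (4 * e) q lam Xs Zs.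
Proof.
move=> T0 e0 hF; apply: le_trans (theta_pull (fun=> i0) q T0 e0 hF).
by have [h1 h2 _ _] := family_pull (fun _ : 'I_4 => i0) hF; exact: theta_ge1 h1 h2.
Qed.

End families.

Section family_differences.
Context {R : realType}.
Variables (sigma T e : R).
Hypotheses (T0 : 0 < T) (e0 : 0 < e) (hs : 1 / 2 < sigma <= 1).

Lemma family_first (al : R) : 0 <= al < 1 ->
  exists q0 : nat, forall q : nat, (q0 <= q)%N -> exists2 C : R, 1 <= C &
  forall (M : nat) (I : finType) (xs : I -> 'rV[R]_M) Xs Zs (u v : I) (lam t : R),
    0 < t <= T -> common_noise sigma lam xs Xs Zs ->
    nrm (Xs u t - Xs v t) <= C * t `^ (- al) * nsig (- (2 * al)) (xs u - xs v) * (64 * theta T (4 * e) q lam Xs Zs).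
Proof.
move=> hal; have [q0 _ H] := first_difference T0 e0 hs hal.
exists q0 => q qq; have [C C1 HC] := H q qq; exists C => // M I xs Xs Zs u v lam t ht hF.
pose phi (k : 'I_4) := nth u [:: u; v] k.
have [h1 h2 h3 h4] := family_pull phi hF.
have j1 : (1 < 4)%N by [].
have := HC M _ _ _ ord0 (Ordinal j1) lam t isT ht h1 h2 (h3 _ _) (h4 _ _) => h; apply: (le_trans h).
apply: ler_wpM2l; last by apply: (theta_pull phi q (ltW T0) (ltW e0) hF).
by rewrite mulr_ge0 ?nrm_ge0// mulr_ge0 ?powR_ge0// (le_trans ler01).
Qed.

Lemma family_second (al be : R) : 0 <= al < 1 -> 0 <= be < 1 -> al + be < 1 ->
  exists q0 : nat, forall q : nat, (q0 <= q)%N -> exists2 C : R, 1 <= C &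
  forall (M : nat) (I : finType) (xs : I -> 'rV[R]_M) Xs Zs (i j k l : I) (lam t : R),
    0 < t <= T -> common_noise sigma lam xs Xs Zs -> xs i - xs j = xs k - xs l ->
    nrm ((Xs i t - Xs j t) - (Xs k t - Xs l t)) <= C * t `^ (- (al + be)) *
      nsig (- (2 * al)) (xs j - xs l) * nsig (- (2 * be)) (xs k - xs l) * (64 * theta T (4 * e) q lam Xs Zs) ^+ 3.
Proof.
move=> hal hbe hab; have [q0 _ H] := second_difference T0 e0 hs hal hbe hab.
exists q0 => q qq; have [C C1 HC] := H q qq; exists C => // M I xs Xs Zs i j k l lam t ht hF hE.
pose phi (m : 'I_4) := nth i [:: i; j; k; l] m.
have [h1 h2 h3 h4] := family_pull phi hF.
have j1 : (1 < 4)%N by []. have j2 : (2 < 4)%N by []. have j3 : (3 < 4)%N by [].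
have un : uniq [:: ord0; Ordinal j1; Ordinal j2; Ordinal j3 : 'I_4] by [].
have h := HC M _ _ _ _ _ _ _ lam t un ht h1 h2 h3 hE h4; apply: (le_trans h).
have th1 : 0 <= theta T e q lam (Xs \o phi) (Zs \o phi) := le_trans ler01 (theta_ge1 q (ltW T0) (ltW e0) h1 h2).
apply: ler_wpM2l.
  by apply: mulr_ge0; [apply: mulr_ge0; [apply: mulr_ge0; [exact: le_trans C1|exact: powR_ge0]|exact: nrm_ge0]|exact: nrm_ge0].
have hle := theta_pull phi q (ltW T0) (ltW e0) hF.
by rewrite lerXn2r ?nnegrE//; exact: le_trans hle.
Qed.

Lemma nrm_interp (M : nat) (y : 'rV[R]_M) : nrm y <= Num.sqrt (nrm (Lam y) * nrm (Lam (Lam y))).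
Proof.
apply: le_of_sq; first exact: sqrtr_ge0.
rewrite sqr_sqrtr ?mulr_ge0 ?nrm_ge0// expr2; apply: ler_pM; rewrite ?nrm_ge0//; first exact: nrm_Lam_ge.
exact: le_trans (nrm_Lam_ge _) (nrm_Lam_ge _).
Qed.

Lemma third_identity (M : nat) (u u' E E' S S' G G' H H' : 'rV[R]_M) :
  u = - Lam (Lam E) + (Bq S E + 2 *: Bq G H) -> u' = - Lam (Lam E') + (Bq S' E' + 2 *: Bq G' H') ->
  u - u' = - Lam (Lam (E - E')) + (Bq S (E - E') +
   (Bq (S - S') E' + (2 *: Bq (G - G') H + 2 *: Bq G' (H - H')))).
Proof.
move=> -> ->; rewrite /Lam (dgmB kp E) (dgmB kp (dgm kp E)) !BqBr !BqBl.
move: (dgm kp (dgm kp E)) (dgm kp (dgm kp E')) (Bq S E) (Bq S E') (Bq S' E') => x x' p1 p2 p3.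
move: (Bq G H) (Bq G' H) (Bq G' H') => p4 p5 p6.
by apply/rowP => i; rewrite !mxE; ring.
Qed.

(** A third difference compares the second differences over two parallelograms, that of [c = true]
    starting from that of [c = false] shifted by [f]. For fixed [M] the initial differences are
    measured in [L^2], so no power of time appears, and [nrm_Bq_le] may be used. The source is a
    first difference times a second one, [theta^4]; the remainder adds one [theta]. *)
Lemma family_third (M : nat) : exists q0 : nat, forall q : nat, (q0 <= q)%N -> exists2 C : R, 1 <= C &
  forall (I : finType) (xs : I -> 'rV[R]_M) Xs Zs (v : bool -> 'I_4 -> I) (f g h : 'rV[R]_M) (lam t : R),
    0 < t <= T -> common_noise sigma lam xs Xs Zs -> (forall k, xs (v true k) - xs (v false k) = f) ->
    (forall c, xs (v c (inord 1)) - xs (v c (inord 3)) = g) -> (forall c, xs (v c (inord 2)) - xs (v c (inord 3)) = h) ->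
    (forall c, xs (v c (inord 0)) - xs (v c (inord 1)) = h) ->
    forall E, (forall c, E c = (Xs (v c (inord 0)) t - Xs (v c (inord 1)) t) - (Xs (v c (inord 2)) t - Xs (v c (inord 3)) t)) ->
    nrm (E true - E false) <= C * nrm f * nrm g * nrm h * (64 * theta T (4 * e) q lam Xs Zs) ^+ 5.
Proof.
have h0 : 0 <= (0 : R) < 1 by rewrite lexx ltr01.
have h00 : (0 : R) + 0 < 1 by rewrite addr0 ltr01.
have [q1 H1] := family_first h0.
have [q2 H2] := family_second h0 h0 h00.
have [q3 _ H3] := remainder_core T0 e0 hs h0.
exists (q1 + q2 + q3)%N => q qq.
have [C1 C11 HC1] := H1 q (leq_trans (leq_trans (leq_addr _ _) (leq_addr _ _)) qq).
have [C2 C21 HC2] := H2 q (leq_trans (leq_trans (leq_addl _ _) (leq_addr _ _)) qq).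
have [C3 C31 HC3] := H3 q (leq_trans (leq_addl _ _) qq).
have C10 : 0 <= C1 := le_trans ler01 C11.
have C20 : 0 <= C2 := le_trans ler01 C21.
have C30 : 0 <= C3 := le_trans ler01 C31.
pose k2 : R := 3 * kp M ^+ 2; have k20 : 0 <= k2 by rewrite mulr_ge0// sqr_ge0.
pose c : R := (2 / (1 - 0) + 8) * (1 + T).
have c0 : 0 <= c by rewrite /c subr0 mulr_ge0// addr_ge0// ltW.
pose C4 := c * (8 * (k2 * C1 * C2)).
have C40 : 0 <= C4 by apply: mulr_ge0 => //; apply: mulr_ge0 => //; apply: mulr_ge0 => //; exact: mulr_ge0.
exists (1 + (C4 + C3 * C4)); first by rewrite lerDl addr_ge0// mulr_ge0.
move=> I xs Xs Zs v f g h lam t ht hF hf hg hh hh2 E hE.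
have [t0 tT] := andP ht.
set th := 64 * _; have th1 : 1 <= th := theta_pull_ge1 (v true ord0) q (ltW T0) (ltW e0) hF.
have th0 : 0 <= th := le_trans ler01 th1.
have [F1 F2 F3 F4] := hF.
have cX i : ccont (Xs i) by case: (F2 i).
have nf := nrm_ge0 f; have ng := nrm_ge0 g; have nh := nrm_ge0 h.
have B1 (s : R) i j : 0 < s <= T -> nrm (Xs i s - Xs j s) <= C1 * nrm (xs i - xs j) * th.
  by move=> hs'; have := HC1 M I xs Xs Zs i j lam s hs' hF; rewrite oppr0 powRr0 mulr1 nsig0.
have B2 (s : R) i j k l : 0 < s <= T -> xs i - xs j = xs k - xs l ->
    nrm ((Xs i s - Xs j s) - (Xs k s - Xs l s)) <= C2 * nrm (xs j - xs l) * nrm (xs k - xs l) * th ^+ 3.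
  by move=> hs' hx; have := HC2 M I xs Xs Zs i j k l lam s hs' hF hx; rewrite addr0 oppr0 powRr0 mulr1 !nsig0.
pose X c k s := Xs (v c (inord k)) s.
pose Ec c s := (X c 0%N s - X c 1%N s) - (X c 2%N s - X c 3%N s).
pose Dg c s := X c 1%N s - X c 3%N s; pose Dh c s := X c 2%N s - X c 3%N s.
pose S c s := X c 0%N s + X c 1%N s + X c 2%N s - X c 3%N s.
have cXc c' k : ccont (X c' k) by exact: cX.
have cE c' : ccont (Ec c') by apply: ccontB; exact: ccontB.
have cDg c' : ccont (Dg c') by exact: ccontB.
have cDh c' : ccont (Dh c') by exact: ccontB.
have cS c' : ccont (S c') by apply: ccontB => //; apply: ccontD => //; exact: ccontD.
pose F s := Bq (S true s - S false s) (Ec false s) + (2 *: Bq (Dg true s - Dg false s) (Dh true s) +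
  2 *: Bq (Dg false s) (Dh true s - Dh false s)).
have cF : ccont F.
  apply: ccontD; first by apply: ccont_Bq => //; exact: ccontB.
  by apply: ccontD; apply: ccontZ; apply: ccont_Bq => //; exact: ccontB.
have [w cw w0] := duhamel cF.
set N := nrm f * nrm g * nrm h; have N0 : 0 <= N by rewrite !mulr_ge0.
have FB (s : R) : 0 < s <= T -> nrm (F s) <= 8 * (k2 * C1 * C2) * (N * th ^+ 4).
  move=> hs'.
  have b1 : nrm (S true s - S false s) <= 4 * (C1 * nrm f * th).
    have a k : nrm (X true k s - X false k s) <= C1 * nrm f * th by rewrite -(hf (inord k)); exact: B1.
    have -> : S true s - S false s = (X true 0%N s - X false 0%N s) + (X true 1%N s - X false 1%N s)
        + (X true 2%N s - X false 2%N s) - (X true 3%N s - X false 3%N s).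
      by rewrite /S; apply/rowP => i; rewrite !mxE; ring.
    have := a 0%N; have := a 1%N; have := a 2%N; have := a 3%N; move: (C1 * nrm f * th) => z.
    have := nrmB (X true 0%N s - X false 0%N s + (X true 1%N s - X false 1%N s) + (X true 2%N s - X false 2%N s)) (X true 3%N s - X false 3%N s).
    have := nrmD (X true 0%N s - X false 0%N s + (X true 1%N s - X false 1%N s)) (X true 2%N s - X false 2%N s).
    have := nrmD (X true 0%N s - X false 0%N s) (X true 1%N s - X false 1%N s).
    by clear; glra.
  have b2 : nrm (Ec false s) <= C2 * nrm g * nrm h * th ^+ 3.
    by have := B2 s _ _ _ _ hs' (etrans (hh2 false) (esym (hh false))); rewrite hg hh.
  have b3 : nrm (Dg true s - Dg false s) <= C2 * nrm f * nrm g * th ^+ 3.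
    by have := B2 s _ _ _ _ hs' (etrans (hg true) (esym (hg false))); rewrite hf hg.
  have b4 : nrm (Dh true s - Dh false s) <= C2 * nrm f * nrm h * th ^+ 3.
    by have := B2 s _ _ _ _ hs' (etrans (hh true) (esym (hh false))); rewrite hf hh.
  have b5 : nrm (Dh true s) <= C1 * nrm h * th by rewrite -(hh true); exact: B1.
  have b6 : nrm (Dg false s) <= C1 * nrm g * th by rewrite -(hg false); exact: B1.
  have key (a b : 'rV[R]_M) x y : nrm a <= x -> nrm b <= y -> nrm (Bq a b) <= k2 * (x * y).
    move=> ha hb; apply: le_trans (nrm_Bq_le _ _) _; rewrite -mulrA; apply: ler_wpM2l => //.
    by apply: ler_pM => //; exact: nrm_ge0.
  have e1 := key _ _ _ _ b1 b2; have e2 := key _ _ _ _ b3 b5; have e3 := key _ _ _ _ b6 b4.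
  apply: le_trans (nrmD _ _) _; apply: le_trans (lerD e1 (nrmD _ _)) _; rewrite !nrmZ ger0_norm//.
  move: e2 e3 => e2 e3.
  apply: le_trans (lerD (lexx _) (lerD (ler_wpM2l (ler0n R 2) e2) (ler_wpM2l (ler0n R 2) e3))) _.
  rewrite le_eqVlt; apply/orP; left; apply/eqP; rewrite /N.
  by clearbody th k2; move: (nrm f) (nrm g) (nrm h) => x y z; ring.
have wB (s : R) : 0 < s <= T -> nrm (w s) <= C4 * (N * th ^+ 4).
  move=> hs'; have K0 : 0 <= 8 * (k2 * C1 * C2) * (N * th ^+ 4).
    by apply: mulr_ge0; [apply: mulr_ge0 => //; apply: mulr_ge0 => //; exact: mulr_ge0|apply: mulr_ge0 => //; exact: exprn_ge0].
  have := @mild_estimate R M w F s T _ 0 hs' K0 h0 cw w0.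
  rewrite -/c oppr0 powRr0 mulr1 => hm.
  rewrite /C4 -mulrA; apply: hm => u y /andP[u0 us].
  rewrite powRr0 mulr1; apply: le_trans (dot_CS _ _) _.
  have hu : 0 < u <= T by rewrite u0/=; have [_ sT] := andP hs'; exact: ltW (lt_le_trans us sT).
  by apply: ler_pM; rewrite ?nrm_ge0//; [exact: FB|exact: nrm_interp].
pose D s := Ec true s - Ec false s.
have cD : curve D (fun s => - Lam (Lam (D s)) + (Bq (S true s) (D s) + F s)).
  apply: curve_eq (curveB (curveB (F4 (v true (inord 0)) (v true (inord 1))) (F4 (v true (inord 2)) (v true (inord 3))))
    (curveB (F4 (v false (inord 0)) (v false (inord 1))) (F4 (v false (inord 2)) (v false (inord 3))))) => s _.
  exact: third_identity (pair_drift _ _ _ _) (pair_drift _ _ _ _).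
pose r s := D s - w s.
have cr : curve r (fun s => - Lam (Lam (r s)) + (Bq (S true s) (r s) + Bq (S true s) (w s))).
  apply: curve_eq (curveB cD cw) => s _.
  rewrite -BqDr /r subrK /Lam [in RHS]dgmB [in RHS]dgmB.
  move: (dgm _ (dgm _ (D s))) (dgm _ (dgm _ (w s))) (F s) (Bq _ _) => p u y b.
  by apply/rowP => a; rewrite !mxE; ring.
have r0 : r 0 = 0 by rewrite /r w0 /D /Ec /X !F3 !hh2 !hh !subrr.
have sum4 (z : 'I_4 -> R) : \sum_k z k = z (inord 0) + z (inord 1) + z (inord 2) + z (inord 3).
  rewrite !big_ord_recl big_ord0 addr0 !addrA.
  by congr (z _ + z _ + z _ + z _); apply/val_inj; rewrite /= ?inordK.
have [G1 G2 _ _] := family_pull (v true) hF.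
have pull := theta_pull (v true) q (ltW T0) (ltW e0) hF; rewrite -/th in pull.
have rt : nrm (r t) <= C3 * (C4 * (N * th ^+ 4)) * t `^ (- 0) * theta T e q lam (Xs \o v true) (Zs \o v true).
  have K0 : 0 <= C4 * (N * th ^+ 4) by rewrite mulr_ge0// mulr_ge0// exprn_ge0.
  apply: (HC3 M (xs \o v true) _ _ (S true) r w lam t _ ht G1 G2 (cS true) _ _ K0 cr r0).
  - move=> s z; rewrite sum4 /= /S SfB !SfD.
    apply: le_trans (ler_normB _ _) _; rewrite lerD2r.
    by apply: le_trans (ler_normD _ _) _; rewrite lerD2r ler_normD.
  - move=> s; rewrite sum4 /= /S /Lam dgmB !dgmD.
    apply: le_trans (nrmB _ _) _; rewrite lerD2r.
    by apply: le_trans (nrmD _ _) _; rewrite lerD2r nrmD.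
  - move=> s /andP[s0 st]; rewrite oppr0 powRr0 mulr1; apply: wB; rewrite s0/=; exact: ltW (lt_le_trans st tT).
rewrite oppr0 powRr0 mulr1 in rt.
have {}rt : nrm (r t) <= C3 * (C4 * (N * th ^+ 4)) * th.
  apply: (le_trans rt); apply: ler_wpM2l => //.
  by apply: mulr_ge0 => //; apply: mulr_ge0 => //; apply: mulr_ge0 => //; exact: exprn_ge0.
have wt := wB t ht.
have {}wt : nrm (w t) <= C4 * (N * th ^+ 4) * th.
  apply: (le_trans wt); rewrite ler_peMr// mulr_ge0// mulr_ge0// exprn_ge0//.
have -> : E true - E false = r t + w t by rewrite /r subrK !hE.
apply: le_trans (nrmD _ _) _; apply: le_trans (lerD rt wt) _.
have -> : C3 * (C4 * (N * th ^+ 4)) * th + C4 * (N * th ^+ 4) * th = (C4 + C3 * C4) * (N * th ^+ 5) by ring.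
have -> : (1 + (C4 + C3 * C4)) * nrm f * nrm g * nrm h * th ^+ 5 = (1 + (C4 + C3 * C4)) * (N * th ^+ 5) by rewrite /N !mulrA.
by apply: ler_wpM2r; [rewrite mulr_ge0// exprn_ge0|rewrite lerDr].
Qed.

End family_differences.

(** * Finite differences of the transition semigroup *)

Section lipschitz_measurability.
Context {R : realType} d (Om : measurableType d) (M : nat).

Lemma measurable_countable (C : countType) (Z : Om -> C) (g : C -> R) :
  (forall c, measurable [set w | Z w = c]) -> measurable_fun setT (g \o Z).
Proof.
move=> mZ _ B mB; rewrite setTI.
have -> : (g \o Z) @^-1` B = \bigcup_(c : C) (if pselect (B (g c)) then [set w | Z w = c] else set0).
  apply/seteqP; split => w /=.
    by move=> h; exists (Z w) => //; case: pselect.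
  by move=> [c _]; case: pselect => //= h ->.
by apply: countable_bigcupT_measurable; [exact: countableP|move=> c; case: pselect => /= _; [exact: mZ|exact: measurable0]].
Qed.

(* [phi] is only continuous for the [L^2] distance: [phi] of a random point is measurable as the
   limit of its values at countably valued roundings. *)
Definition grid (m : nat) (y : 'rV[R]_M) : 'rV[int]_M := \row_i Num.floor (m.+1%:R * y ord0 i).
Definition ungrid (m : nat) (c : 'rV[int]_M) : 'rV[R]_M := \row_i ((c ord0 i)%:~R / m.+1%:R).

Lemma ungrid_grid m y : nrm (ungrid m (grid m y) - y) <= M%:R / m.+1%:R.
Proof.
have m0 : (0 : R) < m.+1%:R by rewrite ltr0n.
apply: le_trans (nrm_le_sum _) _.
apply: (@le_trans _ _ (\sum_(i < M) m.+1%:R^-1)); last by rewrite sumr_const card_ord mulr_natl.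
apply: ler_sum => i _; rewrite !mxE.
have /andP[h1 h2] := floor_itv (m.+1%:R * y ord0 i).
move: h2; rewrite intrD; move: h1; set k := (Num.floor _)%:~R => h1 h2.
have -> : k / m.+1%:R - y ord0 i = - (m.+1%:R * y ord0 i - k) / m.+1%:R by field; rewrite addrC natr1 gt_eqF.
rewrite mulNr normrN normrM ger0_norm ?subr_ge0// ger0_norm ?invr_ge0 ?(ltW m0)//.
by rewrite ler_piMl ?invr_ge0 ?(ltW m0)//; lra.
Qed.

Lemma lipschitz_measurable (F : 'rV[R]_M -> R) (K : R) (X : Om -> 'rV[R]_M) : 0 <= K ->
  (forall y h, `|F (y + h) - F y| <= K * nrm h) -> (forall i, measurable_fun setT (fun w => X w ord0 i)) ->
  measurable_fun setT (fun w => F (X w)).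
Proof.
move=> K0 HF mX.
apply: (@measurable_fun_cvg _ _ _ setT (fun m w => F (ungrid m (grid m (X w))))).
  move=> m; apply: (@measurable_countable _ (fun w => grid m (X w)) (fun c => F (ungrid m c))) => c.
  have -> : [set w | grid m (X w) = c] = \bigcap_(i in [set: 'I_M]) [set w | Num.floor (m.+1%:R * X w ord0 i) = c ord0 i].
    apply/seteqP; split => w /=; first by move=> <- i _ /=; rewrite mxE.
    by move=> h; apply/rowP => i; rewrite mxE; exact: h.
  apply: fin_bigcap_measurable => // i _.
  have -> : [set w | Num.floor (m.+1%:R * X w ord0 i) = c ord0 i] =
      (fun w => m.+1%:R * X w ord0 i) @^-1` `[(c ord0 i)%:~R, (c ord0 i + 1)%:~R[%classic.
    apply/seteqP; split => w /=; rewrite in_itv/=; first by move=> <-; exact: floor_itv.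
    exact: floor_def.
  rewrite -[X in measurable X]setTI; apply: measurable_funM; [exact: measurable_cst|exact: mX|by []|exact: measurable_itv].
move=> w _; apply/cvgrPdist_le => eps e0.
near=> m; have := HF (X w) (ungrid m (grid m (X w)) - X w); rewrite [X w + _]addrC subrK distrC => h; apply: (le_trans h).
apply: le_trans (ler_wpM2l K0 (ungrid_grid m (X w))) _.
rewrite mulrA ler_pdivrMr ?ltr0n// [leRHS]mulrC -ler_pdivrMr//.
by apply: ltW; apply: lt_trans (_ : m%:R < _); [near: m; exact: nbhs_infty_gtr|rewrite ltr_nat].
Unshelve. all: by end_near. Qed.

End lipschitz_measurability.

Section expectation_bounds.
Context {R : realType} d (Om : measurableType d) (P : probability Om R).

Lemma Ele_integrable (f : Om -> R) C : measurable_fun setT f -> Ele P (fun w => `|f w|) C ->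
  P.-integrable setT (EFin \o f).
Proof.
move=> mf hf; apply/integrableP; split; first exact/measurable_EFinP.
have h := Ele_int (measurableT_comp (@normr_measurable _ _) mf) (fun w => normr_ge0 (f w)) hf.
by apply: le_lt_trans h _; rewrite ltry.
Qed.

Lemma Ele_Rintegral (f : Om -> R) C : measurable_fun setT f -> Ele P (fun w => `|f w|) C ->
  `|Rintegral P setT f| <= C.
Proof.
move=> mf hf; have fI := Ele_integrable mf hf.
apply: le_trans (le_normr_Rintegral measurableT fI) _.
have h := Ele_int (measurableT_comp (@normr_measurable _ _) mf) (fun w => normr_ge0 (f w)) hf.
have h0 : (0 <= \int[P]_w (`|f w|)%:E)%E by apply: integral_ge0 => w _; rewrite lee_fin.
rewrite /Rintegral -lee_fin fineK// ge0_fin_numE//; exact: le_lt_trans h (ltry _).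
Qed.

End expectation_bounds.

Lemma nsigD {R : realType} (M : nat) (s : R) (a b : 'rV[R]_M) : nsig s (a + b) <= nsig s a + nsig s b.
Proof. by rewrite /nsig dgmD; exact: nrmD. Qed.

Lemma nsig_00 {R : realType} (M : nat) (s : R) : nsig s (0 : 'rV[R]_M) = 0.
Proof. by rewrite /nsig (_ : dgm _ 0 = 0) ?nrm0//; apply/rowP => i; rewrite !(dgmE, mxE) mulr0. Qed.

Lemma nrm_le_nsig {R : realType} (M : nat) (s : R) (a : 'rV[R]_M) : 0 <= s -> nrm a <= nsig s a.
Proof.
move=> s0; have := @nrm_dgm_le R M (fun=> 1) (fun i => kp i `^ s) a; rewrite dgm1//; apply => i.
by rewrite normr1 -(powRr0 (kp i)) ler_powR ?kp_ge1.
Qed.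

Section semigroup.
Context {R : realType} d (Om : measurableType d) (P : probability Om R).
Variables (W : nat -> R -> Om -> R) (e : nat -> R -> R) (q : nat -> R) (T : R) (phi : (R -> R) -> R).
Variable X : forall M : nat, 'rV[R]_M -> R -> Om -> 'rV[R]_M.
Hypotheses (HW : indep_std_BMs P W) (Hq : trace_class_eig e q) (T0 : 0 < T) (Hphi : C2_bounded_L2 phi).
Hypothesis HX : forall (M : nat) (x : 'rV[R]_M), galerkin_sol P W e q x (X x).

Let u M t (x : 'rV[R]_M) := uM P phi (@X M) t x.

Lemma galerkin_flow M (x : 'rV[R]_M) : exists N Z, flow P W e q x (fun w s => X x (Num.max s 0) w) N Z.
Proof. by have [N dN hN] := galerkin_path HW (HX x); have [Z hZ] := sol_flow dN hN; exists N, Z. Qed.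

Lemma galerkin_family M (I : finType) (xs : I -> 'rV[R]_M) (sigma lam : R) : (forall i, 1 + nsig sigma (xs i) <= lam) ->
  exists Ns Zs : I -> Om -> R -> 'rV[R]_M, let Xs (i : I) (w : Om) (s : R) := X (xs i) (Num.max s 0) w in
    (forall i, flow P W e q (xs i) (Xs i) (Ns i) (Zs i)) /\
    {ae P, forall w, common_noise sigma lam xs (Xs^~ w) (Zs^~ w)}.
Proof.
move=> hl; have /choice[Ns /choice[Zs HF]] := fun i => galerkin_flow (xs i).
exists Ns, Zs => Xs; split => //.
have A1 : {ae P, forall w i, [/\ sol_path (xs i) (Xs i w) (Ns i w), mild_path (xs i) (Xs i w) (Zs i w) & conv_path (Zs i w) (Ns i w)]}.
  by apply: filter_forall => i; case: (HF i).
have cN i : {ae P, forall w, ccont (Ns i w)}.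
  by have [_ h] := HF i; apply: filterS h => w [[_ ? _ _ _] _ _].
have A2 : {ae P, forall w (p : I * I), forall s, 0 <= s -> Ns p.1 w s = Ns p.2 w s}.
  apply: filter_forall => -[i j] /=; have [di _] := HF i; have [dj _] := HF j.
  exact: shared_noise di dj (cN i) (cN j).
apply: filterS2 A1 A2 => w h1 h2; split => // [i|i j|i j].
- by case: (h1 i).
- have [[_ _ _ xi _] _ _] := h1 i; have [[_ _ _ xj _] _ _] := h1 j.
  by rewrite xi xj.
- have [si _ _] := h1 i; have [sj _ _] := h1 j.
  exact: difference_path si sj (h2 (i, j)).
Qed.

Lemma state_moment M (x : 'rV[R]_M) : exists2 C : R, 0 <= C & forall t : R, 0 < t <= T -> Ele P (fun w => nrm (X x t w) ^+ 2) C.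
Proof.
have [a a0 [C C1 H]] := solution_moment HW Hq T0 (ltr01 : (0 : R) < 1).
have [N [Z [dN hF]]] := galerkin_flow x.
exists (a^-1 * (C * expR (1 * nrm x ^+ 2))).
  by rewrite mulr_ge0 ?invr_ge0 ?(ltW a0)// mulr_ge0 ?expR_ge0// (le_trans ler01).
move=> t /andP[t0 tT].
have hX : {ae P, forall w, sol_path x (fun s => X x (Num.max s 0) w) (N w)} by apply: filterS hF => w [].
have ht : 0 <= t <= T by rewrite tT ltW.
have h := EleZ (_ : 0 <= a^-1) (H _ _ _ _ _ ht dN hX).
apply: Ele_le (h _) => //; last by rewrite invr_ge0 ltW.
apply: filterS hX => w [cX _ _ _ _]; rewrite max_l ?(ltW t0)//.
have dX := diss_ge0 (ltW t0) cX.
rewrite -ler_pdivrMl ?invr_gt0// invrK; have := mulr_ge0 (ltW a0) dX.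
move: (diss _ _) (nrm _ ^+ 2) => D n; have := expR_ge1Dx (a * (n + 2 * D)).
by rewrite mulrDr mulrCA; lra.
Qed.

Lemma observable_measurable M (x : 'rV[R]_M) t : 0 <= t -> measurable_fun setT (fun w => phi (Sf (X x t w))).
Proof.
move=> t0; have [K K0 /(_ M)[D2 [h _ _ _]]] := observable_increments Hphi.
have [_ [mX _]] := HX x.
by apply: (lipschitz_measurable (F := fun y => phi (Sf y)) K0 h) => i; exact: mX.
Qed.

Lemma observable_integrable M (x : 'rV[R]_M) t : 0 < t <= T -> P.-integrable setT (fun w => (phi (Sf (X x t w)))%:E).
Proof.
move=> ht; have [K K0 /(_ M)[D2 [h _ _ _]]] := observable_increments Hphi.
have [C C0 HC] := state_moment x; have [t0 _] := andP ht.
have K1 : 0 <= `|phi (Sf (0 : 'rV[R]_M))| + K by rewrite addr_ge0.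
apply: (@Ele_integrable _ _ _ P (fun w => phi (Sf (X x t w))) (`|phi (Sf (0 : 'rV[R]_M))| + K + K * C)).
  exact: observable_measurable (ltW t0).
apply: Ele_le (EleD (Ele_cst P K1) (EleZ K0 (HC t ht))); last exact: lexx.
apply: nearW => w; have := h 0 (X x t w); rewrite add0r => hw.
rewrite -[phi _](subrK (phi (Sf (0 : 'rV[R]_M)))); apply: le_trans (ler_normD _ _) _.
rewrite addrC -addrA lerD2l; apply: (le_trans hw); rewrite -[X in X + _]mulr1 -mulrDr; apply: ler_wpM2l => //.
have := nrm_ge0 (X x t w); move: (nrm _) => n n0; have := sqr_ge0 (n - 1); nra.
Qed.

(** The passage from paths to [u]: a finite combination of values of [u], listed by coefficients and
    points, inherits the upper expectation of the same combination of observables. *)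
Lemma combination_bound M (l : seq (R * 'rV[R]_M)) t C : 0 < t <= T ->
  Ele P (fun w => `|\sum_(p <- l) p.1 * phi (Sf (X p.2 t w))|) C -> `|\sum_(p <- l) p.1 * u t p.2| <= C.
Proof.
move=> ht H; have [t0 _] := andP ht.
have mF (l' : seq (R * 'rV[R]_M)) : measurable_fun setT (fun w => \sum_(p <- l') p.1 * phi (Sf (X p.2 t w))).
  apply: measurable_sum => p; apply: measurable_funM; first exact: measurable_cst.
  exact: observable_measurable (ltW t0).
have E (l' : seq (R * 'rV[R]_M)) : P.-integrable setT (EFin \o (fun w => \sum_(p <- l') p.1 * phi (Sf (X p.2 t w)))) /\
    Rintegral P setT (fun w => \sum_(p <- l') p.1 * phi (Sf (X p.2 t w))) = \sum_(p <- l') p.1 * u t p.2.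
  elim: l' => [|p l' [IH1 IH2]].
    under eq_fun do rewrite big_nil; rewrite big_nil; split.
      exact: (integrable0 P).
    by rewrite Rintegral_cst// mul0r.
  have i1 := observable_integrable p.2 ht.
  have i2 : P.-integrable setT (EFin \o (fun w => p.1 * phi (Sf (X p.2 t w)))) := integrableZl measurableT p.1 i1.
  under eq_fun do rewrite big_cons; rewrite big_cons; split.
    exact: (integrableD measurableT i2 IH1).
  apply: etrans (RintegralD measurableT i2 IH1) _; rewrite IH2; congr (_ + _).
  rewrite (_ : u t p.2 = Rintegral P setT (fun w => phi (Sf (X p.2 t w)))); last by rewrite /u /uM Sf.unlock.
  exact: (RintegralZl p.1 measurableT i1).
by have [_ <-] := E l; exact: Ele_Rintegral (mF l) H.
Qed.

Definition cube M (x f g h : 'rV[R]_M) (i : bool * bool * bool) :=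
  x + (if i.1.1 then f else 0) + (if i.1.2 then g else 0) + (if i.2 then h else 0).

(** Edges of norm at most [1/3] keep the eight vertices within distance 1 of [x], so that one
    [lam = 2 + nsig sigma x] serves them all. The largest power [n] is fixed before [e0], because a
    higher power of [theta] needs a smaller coefficient in its exponent. *)
Lemma cube_bounds (sigma eps : R) (n : nat) : 1 / 2 < sigma <= 1 -> 0 < eps ->
  exists2 e0 : R, 0 < e0 & forall r k : nat, (k <= n)%N -> exists2 C : R, 1 <= C &
  forall M (x f g h : 'rV[R]_M), nsig sigma f <= 1 / 3 -> nsig sigma g <= 1 / 3 -> nsig sigma h <= 1 / 3 ->
    exists Zs : bool * bool * bool -> Om -> R -> 'rV[R]_M, let lam := 2 + nsig sigma x in let Xs (w : Om) i (s : R) := X (cube x f g h i) (Num.max s 0) w in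
      {ae P, forall w, common_noise sigma lam (cube x f g h) (Xs w) (Zs^~ w)} /\
      Ele P (fun w => (64 * theta T (4 * e0) r lam (Xs w) (Zs^~ w)) ^+ k) (C * lam ^+ k * expR (eps * nrm x ^+ 2)).
Proof.
move=> /andP[s1 s2] ep0; have s0 : 0 <= sigma by lra.
have [e0 e00 H] := theta_moment HW Hq T0 (false, false, false) n ep0.
(* Compensates the factor 4 that [theta_pull] introduces in the exponent. *)
exists (e0 / 4); first by rewrite divr_gt0.
move=> r k kn; have [C C1 HC] := H r k kn.
exists (64 ^+ k * C); first by rewrite mulr_ege1// exprn_ege1// ler1n.
move=> M x f g h hf hg hh.
have hcube i : nsig sigma (cube x f g h i) <= nsig sigma x + 1 /\ nrm (cube x f g h i) <= nrm x + 1.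
  have b (c : bool) v : nsig sigma v <= 1 / 3 -> nsig sigma (if c then v else 0 : 'rV[R]_M) <= 1 / 3.
    by case: c => // _; rewrite nsig_00; lra.
  have b1 := b i.1.1 f hf; have b2 := b i.1.2 g hg; have b3 := b i.2 h hh.
  rewrite /cube; move: (if i.1.1 then _ else _) (if i.1.2 then _ else _) (if i.2 then _ else _) b1 b2 b3 => f' g' h' b1 b2 b3.
  have := nsigD sigma (x + f' + g') h'; have := nsigD sigma (x + f') g'; have := nsigD sigma x f'.
  have := nrmD (x + f' + g') h'; have := nrmD (x + f') g'; have := nrmD x f'.
  have := nrm_le_nsig f' s0; have := nrm_le_nsig g' s0; have := nrm_le_nsig h' s0.
  move: b1 b2 b3; move: (nsig _ _) (nsig _ _) (nsig _ _) (nsig _ _) (nsig _ _) (nsig _ _) (nsig _ _).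
  move: (nrm (x + f' + g' + h')) (nrm (x + f' + g')) (nrm (x + f')) (nrm x) (nrm f') (nrm g') (nrm h').
  by clear; move=> *; split; lra.
have hl i : 1 + nsig sigma (cube x f g h i) <= 2 + nsig sigma x by have [h1 _] := hcube i; lra.
have [Ns [Zs [hF hfam]]] := galerkin_family hl.
exists Zs => lam Xs; split => //.
have l0 : 0 <= lam by rewrite addr_ge0// nrm_ge0.
have nx i : nrm (cube x f g h i) ^+ 2 <= 2 * nrm x ^+ 2 + 2.
  have [_ h1] := hcube i; have h2 := nrm_ge0 (cube x f g h i); have h3 := nrm_ge0 x.
  apply: (@le_trans _ _ ((nrm x + 1) ^+ 2)); first by rewrite ler_pXn2r ?nnegrE ?addr_ge0.
  by have := sqr_ge0 (nrm x - 1); move: (nrm x) => z; nra.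
have := HC M x _ _ _ _ lam l0 hF nx; rewrite (_ : 4 * (e0 / 4) = e0); last by field.
move=> h1; have := EleZ (exprn_ge0 k (ler0n R 64)) h1; rewrite !mulrA => h2.
by apply: Ele_le h2 => //; apply: nearW => w; rewrite exprMn.
Qed.

End semigroup.

Section increments_of_u.
Context {R : realType} d (Om : measurableType d) (P : probability Om R).
Variables (W : nat -> R -> Om -> R) (e : nat -> R -> R) (q : nat -> R) (T : R) (phi : (R -> R) -> R).
Variable X : forall M : nat, 'rV[R]_M -> R -> Om -> 'rV[R]_M.
Hypotheses (HW : indep_std_BMs P W) (Hq : trace_class_eig e q) (T0 : 0 < T) (Hphi : C2_bounded_L2 phi).
Hypothesis HX : forall (M : nat) (x : 'rV[R]_M), galerkin_sol P W e q x (X x).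

Let u M t (x : 'rV[R]_M) := uM P phi (@X M) t x.

Lemma first_increment (sigma al eps : R) : 1 / 2 < sigma <= 1 -> 0 <= al < 1 -> 0 < eps ->
  exists2 C : R, 0 < C & forall M (x h : 'rV[R]_M) t, 0 < t <= T -> nsig sigma h <= 1 / 3 ->
    `|u t (x + h) - u t x| <= C * t `^ (- al) * expR (eps * nrm x ^+ 2) * (2 + nsig sigma x) * nsig (- (2 * al)) h.
Proof.
move=> hs hal ep0; have [K K0 HK] := observable_increments Hphi.
have [e0 e00 H] := cube_bounds HW Hq T0 HX 1 hs ep0.
have [r H1] := family_first T0 e00 hs hal.
have [C1 C11 HC1] := H1 r (leqnn r).
have [C2 C21 HC2] := H r 1%N isT.
have C10 : 0 <= C1 := le_trans ler01 C11.
(* [K] may vanish; the added 1 makes the constant positive. *)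
exists (K * C1 * C2 + 1); first by rewrite ltr_wpDl// mulr_ge0 ?(le_trans ler01 C21)// mulr_ge0.
move=> M x h t ht hh; have [D2 [K1 _ _ _]] := HK M.
have z3 : nsig sigma (0 : 'rV[R]_M) <= 1 / 3 by rewrite nsig_00; lra.
have [Zs [hfam hE]] := HC2 M x 0 0 h z3 z3 hh.
have [t0 tT] := andP ht.
set lam := 2 + nsig sigma x in hfam hE *.
have l0 : 0 <= lam by rewrite addr_ge0// nrm_ge0.
set c := K * C1 * t `^ (- al) * nsig (- (2 * al)) h.
have c0 : 0 <= c by apply: mulr_ge0; [apply: mulr_ge0; [exact: mulr_ge0|exact: powR_ge0]|exact: nrm_ge0].
have x1 : cube x 0 0 h (false, false, true) = x + h by rewrite /cube/= !addr0.
have x0 : cube x 0 0 h (false, false, false) = x by rewrite /cube/= !addr0.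
have B : Ele P (fun w => `|\sum_(p <- [:: (1, x + h); (-1, x)]) p.1 * phi (Sf (X p.2 t w))|)
    (c * (C2 * lam ^+ 1 * expR (eps * nrm x ^+ 2))).
  apply: Ele_le (EleZ c0 hE) => //; apply: filterS hfam => w hw.
  have := HC1 M _ _ _ _ (false, false, true) (false, false, false) lam t ht hw.
  rewrite x1 x0 max_l ?(ltW t0)// addrAC subrr add0r => b1.
  rewrite !big_cons big_nil /= addr0 mul1r mulN1r expr1.
  have := K1 (X x t w) (X (x + h) t w - X x t w); rewrite [X x t w + _]addrC subrK => b2.
  apply: (le_trans b2); apply: le_trans (ler_wpM2l K0 b1) _.
  by rewrite /c !mulrA.
have := combination_bound HW Hq T0 Hphi HX ht B.
rewrite !big_cons big_nil /= addr0 mul1r mulN1r => h1; apply: (le_trans h1).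
set E := expR _; have E0 : 0 <= E := expR_ge0 _.
have -> : c * (C2 * lam ^+ 1 * E) = K * C1 * C2 * (t `^ (- al) * E * lam * nsig (- (2 * al)) h).
  by rewrite /c expr1; clearbody lam E; move: (t `^ _) (nsig _ h) => a b; ring.
have -> : (K * C1 * C2 + 1) * t `^ (- al) * E * lam * nsig (- (2 * al)) h =
    (K * C1 * C2 + 1) * (t `^ (- al) * E * lam * nsig (- (2 * al)) h) by rewrite !mulrA.
apply: ler_wpM2r; last by rewrite lerDl.
by apply: mulr_ge0; [apply: mulr_ge0; [apply: mulr_ge0; [exact: powR_ge0|]|]|exact: nrm_ge0].
Qed.

Lemma second_increment (sigma al be eps : R) : 1 / 2 < sigma <= 1 -> 0 <= al < 1 -> 0 <= be < 1 -> al + be < 1 -> 0 < eps ->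
  exists2 C : R, 0 < C & forall M (x g h : 'rV[R]_M) t, 0 < t <= T -> nsig sigma g <= 1 / 3 -> nsig sigma h <= 1 / 3 ->
    `|u t (x + g + h) - u t (x + g) - u t (x + h) + u t x| <=
    C * t `^ (- (al + be)) * expR (eps * nrm x ^+ 2) * (2 + nsig sigma x) ^+ 3 * nsig (- (2 * al)) g * nsig (- (2 * be)) h.
Proof.
move=> hs hal hbe hab ep0; have [K K0 HK] := observable_increments Hphi.
have [e0 e00 H] := cube_bounds HW Hq T0 HX 3 hs ep0.
have [r1 H1] := family_first T0 e00 hs hal.
have [r2 H2] := family_first T0 e00 hs hbe.
have [r3 H3] := family_second T0 e00 hs hal hbe hab.
pose r := (r1 + r2 + r3)%N.
have [C1 C11 HC1] := H1 r (leq_trans (leq_addr _ _) (leq_addr _ _)).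
have [C2 C21 HC2] := H2 r (leq_trans (leq_addl _ _) (leq_addr _ _)).
have [C3 C31 HC3] := H3 r (leq_addl _ _).
have [C4 C41 HC4] := H r 3%N isT.
have C10 : 0 <= C1 := le_trans ler01 C11. have C20 : 0 <= C2 := le_trans ler01 C21.
have C30 : 0 <= C3 := le_trans ler01 C31. have C40 : 0 <= C4 := le_trans ler01 C41.
have CC : 0 <= K * (C3 + C1 * C2) by apply: mulr_ge0 => //; apply: addr_ge0 => //; exact: mulr_ge0.
exists (K * (C3 + C1 * C2) * C4 + 1); first by rewrite ltr_wpDl// mulr_ge0.
move=> M x g h t ht hg hh; have [D2 [K1 K2 _ _]] := HK M.
have z3 : nsig sigma (0 : 'rV[R]_M) <= 1 / 3 by rewrite nsig_00; lra.
have [Zs [hfam hE]] := HC4 M x 0 g h z3 hg hh.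
have [t0 tT] := andP ht.
set lam := 2 + nsig sigma x in hfam hE *.
have l0 : 0 <= lam by rewrite addr_ge0// nrm_ge0.
set ng := nsig (- (2 * al)) g; set nh := nsig (- (2 * be)) h.
have ng0 : 0 <= ng by exact: nrm_ge0. have nh0 : 0 <= nh by exact: nrm_ge0.
set p := t `^ (- (al + be)); have p0 : 0 <= p by exact: powR_ge0.
have pE : t `^ (- al) * t `^ (- be) = p by rewrite /p pow_addN.
have c0 : 0 <= K * (C3 + C1 * C2) * (p * ng * nh) by apply: mulr_ge0 => //; apply: mulr_ge0 => //; exact: mulr_ge0.
have x11 : cube x 0 g h (false, true, true) = x + g + h by rewrite /cube/= !addr0.
have x10 : cube x 0 g h (false, true, false) = x + g by rewrite /cube/= !addr0.
have x01 : cube x 0 g h (false, false, true) = x + h by rewrite /cube/= !addr0.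
have x00 : cube x 0 g h (false, false, false) = x by rewrite /cube/= !addr0.
have dg : x + g - x = g by rewrite addrAC subrr add0r.
have dh : x + h - x = h by rewrite addrAC subrr add0r.
have dh' : x + g + h - (x + g) = h by rewrite addrAC subrr add0r.
have B : Ele P (fun w => `|\sum_(p <- [:: (1, x + g + h); (-1, x + g); (-1, x + h); (1, x)]) p.1 * phi (Sf (X p.2 t w))|)
    (K * (C3 + C1 * C2) * (p * ng * nh) * (C4 * lam ^+ 3 * expR (eps * nrm x ^+ 2))).
  apply: Ele_le (EleZ c0 hE) => //; apply: filterS hfam => w hw.
  set th := 64 * _.
  have th1 : 1 <= th := theta_pull_ge1 (false, false, false) r (ltW T0) (ltW e00) hw.
  have := HC1 M _ _ _ _ (false, true, false) (false, false, false) lam t ht hw.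
  have := HC2 M _ _ _ _ (false, false, true) (false, false, false) lam t ht hw.
  have := HC3 M _ _ _ _ (false, true, true) (false, true, false) (false, false, true) (false, false, false) lam t ht hw.
  rewrite x11 x10 x01 x00 !max_l ?(ltW t0)// dg dh -/ng -/nh -/th -/p => /(_ dh') b3 b2 b1.
  rewrite !big_cons big_nil /= addr0 !mul1r !mulN1r !addrA.
  set y := X x t w in b1 b2 b3 *; set y1 := X (x + g) t w in b1 b2 b3 *; set y2 := X (x + h) t w in b1 b2 b3 *.
  set y3 := X (x + g + h) t w in b1 b2 b3 *.
  have b4 := K2 y (y1 - y) (y2 - y); have b5 := K1 (y1 + y2 - y) (y3 - y1 - (y2 - y)).
  have E1 : y + (y1 - y) + (y2 - y) = y1 + y2 - y by apply/rowP => i; rewrite !mxE; ring.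
  have E2 : y + (y1 - y) = y1 by rewrite addrC subrK.
  have E3 : y + (y2 - y) = y2 by rewrite addrC subrK.
  have E4 : y1 + y2 - y + (y3 - y1 - (y2 - y)) = y3 by apply/rowP => i; rewrite !mxE; ring.
  rewrite E1 E2 E3 in b4; rewrite E4 in b5.
  (* The parallelogram of end points is closed by [y1 + y2 - y]. The defect is the second difference
     of the flow, of order [theta^3]; over the exact parallelogram the second derivative of [phi]
     acts on two first differences, of order [theta^2]. *)
  have -> : phi (Sf y3) - phi (Sf y1) - phi (Sf y2) + phi (Sf y) = (phi (Sf y3) - phi (Sf (y1 + y2 - y))) +
      (phi (Sf (y1 + y2 - y)) - phi (Sf y1) - phi (Sf y2) + phi (Sf y)) by ring.
  apply: le_trans (ler_normD _ _) _; apply: le_trans (lerD b5 b4) _.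
  rewrite -(mulrA K (nrm _) (nrm _)) -mulrDr.
  have b6 := ler_pM (nrm_ge0 _) (nrm_ge0 _) b1 b2.
  have E5 : C1 * t `^ (- al) * ng * th * (C2 * t `^ (- be) * nh * th) = C1 * C2 * (p * ng * nh) * th ^+ 2.
    by rewrite -pE; clearbody th ng nh; move: (t `^ _) (t `^ _) => a b; ring.
  rewrite E5 in b6.
  have b7 : C1 * C2 * (p * ng * nh) * th ^+ 2 <= C1 * C2 * (p * ng * nh) * th ^+ 3.
    apply: ler_wpM2l; first by apply: mulr_ge0; [exact: mulr_ge0|apply: mulr_ge0 => //; exact: mulr_ge0].
    by apply: ler_weXn2l.
  apply: le_trans (ler_wpM2l K0 (lerD b3 (le_trans b6 b7))) _.
  rewrite le_eqVlt; apply/orP; left; apply/eqP.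
  by clearbody th ng nh p; ring.
have := combination_bound HW Hq T0 Hphi HX ht B.
rewrite !big_cons big_nil /= addr0 !mul1r !mulN1r !addrA => h1; apply: (le_trans h1).
set E := expR _; have E0 : 0 <= E := expR_ge0 _.
have -> : K * (C3 + C1 * C2) * (p * ng * nh) * (C4 * lam ^+ 3 * E) = K * (C3 + C1 * C2) * C4 * (p * E * lam ^+ 3 * ng * nh).
  by clearbody lam E p ng nh; ring.
have -> : (K * (C3 + C1 * C2) * C4 + 1) * p * E * lam ^+ 3 * ng * nh = (K * (C3 + C1 * C2) * C4 + 1) * (p * E * lam ^+ 3 * ng * nh).
  by rewrite !mulrA.
apply: ler_wpM2r; last by rewrite lerDl.
by apply: mulr_ge0 => //; apply: mulr_ge0 => //; apply: mulr_ge0; [exact: mulr_ge0|exact: exprn_ge0].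
Qed.

End increments_of_u.

Section third_increments.
Context {R : realType}.

(** Separates the product [(1 + |X|) theta^2] into quantities whose expectations are bounded, with
    [a = theta^2] and [b = theta^6]. *)
Lemma mul_le_sq (n a b : R) : a ^+ 2 <= b -> (1 + n) * a <= 2 + 2 * n ^+ 2 + b.
Proof. by move=> ab; have := sqr_ge0 (1 + n - a); have := sqr_ge0 (n - 1); have := sqr_ge0 a; nra. Qed.

Lemma sum3_le (a b c s : R) : a < s -> b < s -> c < s -> a + b + c <= 3 * s.
Proof. by move=> *; lra. Qed.

(** The second differences of [F] over the two exact parallelograms are both compared with [D2 y0],
    up to the modulus of continuity; bilinearity then exchanges [a1, b1] for [a0, b0]. [E0] and [E1]
    are the defects by which the flow misses a parallelogram. In the bound the first term is small
    with [eps], the second with the increments. *)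
Lemma third_observable M (F : 'rV[R]_M -> R) (D2 : 'rV[R]_M -> 'rV[R]_M -> 'rV[R]_M -> R) (K eps L : R)
  (y0 y1 a0 a1 b0 b1 E0 E1 : 'rV[R]_M) (B th nf ng nh : R) : 0 <= K -> 0 <= eps -> 0 <= L ->
  (forall y h, `|F (y + h) - F y| <= K * nrm h) ->
  (forall y a b, `|F (y + a + b) - F (y + a) - F (y + b) + F y| <= K * nrm a * nrm b) ->
  (forall y a b a' b', `|D2 y a b - D2 y a' b'| <= K * (nrm (a - a') * nrm b + nrm a' * nrm (b - b'))) ->
  (forall y z a b, `|F (z + a + b) - F (z + a) - F (z + b) + F z - D2 y a b|
     <= (eps * (1 + nrm y) + L * (nrm (z - y) + nrm a + nrm b)) * nrm a * nrm b) ->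
  1 <= B -> 1 <= th -> 0 <= nf -> 0 <= ng <= 1 -> 0 <= nh <= 1 ->
  nrm a0 <= B * ng * th -> nrm a1 <= B * ng * th -> nrm b0 <= B * nh * th -> nrm b1 <= B * nh * th ->
  nrm (y1 - y0) <= B * nf * th -> nrm (a1 - a0) <= B * nf * ng * th ^+ 3 -> nrm (b1 - b0) <= B * nf * nh * th ^+ 3 ->
  nrm E0 <= B * ng * nh * th ^+ 3 -> nrm (E1 - E0) <= B * nf * ng * nh * th ^+ 5 ->
  `|(F (y1 + a1 + b1 + E1) - F (y1 + a1) - F (y1 + b1) + F y1) - (F (y0 + a0 + b0 + E0) - F (y0 + a0) - F (y0 + b0) + F y0)|
    <= ng * nh * (2 * eps * B ^+ 2 * (1 + nrm y0) * th ^+ 2 + (2 * L * B ^+ 3 + 6 * K * B ^+ 2) * (nf + ng + nh) * th ^+ 6).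
Proof.
move=> K0 e0 L0 F1 F2 F3 F4 B1 t1 f0 /andP[g0 g1] /andP[h0 h1] ha0 ha1 hb0 hb1 hy ha hb hE0 hE.
have B0 : 0 <= B := le_trans ler01 B1. have th0 : 0 <= th := le_trans ler01 t1.
set s := nf + ng + nh; have s0 : 0 <= s by rewrite !addr_ge0.
have P0 : 0 <= ng * nh by exact: mulr_ge0.
have tp i j : (i <= j)%N -> th ^+ i <= th ^+ j by move=> ij; exact: ler_weXn2l.
have fs : nf <= s by rewrite /s -addrA lerDl addr_ge0.
have BB : B <= B ^+ 2 by rewrite expr2 ler_peMl.
have curv z a b : nrm (z - y0) <= B * nf * th -> nrm a <= B * ng * th -> nrm b <= B * nh * th ->
    `|F (z + a + b) - F (z + a) - F (z + b) + F z - D2 y0 a b| <=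
    ng * nh * (eps * B ^+ 2 * (1 + nrm y0) * th ^+ 2 + L * B ^+ 3 * s * th ^+ 6).
  move=> hz h2 h3; apply: le_trans (F4 _ _ _ _) _; rewrite -mulrA.
  have n0 := nrm_ge0 y0.
  have c1 : eps * (1 + nrm y0) + L * (nrm (z - y0) + nrm a + nrm b) <= eps * (1 + nrm y0) + L * (B * s * th).
    rewrite lerD2l; apply: ler_wpM2l => //; apply: le_trans (lerD (lerD hz h2) h3) _.
    by rewrite /s; lra.
  have c2 := ler_pM (nrm_ge0 a) (nrm_ge0 b) h2 h3.
  have c3 : 0 <= eps * (1 + nrm y0) + L * (nrm (z - y0) + nrm a + nrm b).
    by apply: addr_ge0; apply: mulr_ge0 => //; rewrite ?addr_ge0 ?nrm_ge0.
  apply: le_trans (ler_pM c3 (mulr_ge0 (nrm_ge0 _) (nrm_ge0 _)) c1 c2) _.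
  have -> : (eps * (1 + nrm y0) + L * (B * s * th)) * (B * ng * th * (B * nh * th)) =
    ng * nh * (eps * B ^+ 2 * (1 + nrm y0) * th ^+ 2 + L * B ^+ 3 * s * th ^+ 3) by ring.
  apply: ler_wpM2l => //; rewrite lerD2l; apply: ler_wpM2l; last exact: tp.
  by rewrite mulr_ge0// mulr_ge0// exprn_ge0.
have r1 := curv y1 a1 b1 hy ha1 hb1.
have r2 : `|F (y0 + a0 + b0) - F (y0 + a0) - F (y0 + b0) + F y0 - D2 y0 a0 b0| <=
    ng * nh * (eps * B ^+ 2 * (1 + nrm y0) * th ^+ 2 + L * B ^+ 3 * s * th ^+ 6).
  by apply: curv => //; rewrite subrr nrm0 mulr_ge0// mulr_ge0.
pose U := ng * nh * (K * B ^+ 2 * s * th ^+ 6).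
have small (c : R) i : 0 <= c -> (i <= 6)%N -> c <= B ^+ 2 -> K * (c * nf * (ng * nh) * th ^+ i) <= U.
  move=> c0 i6 cB; rewrite /U.
  have -> : ng * nh * (K * B ^+ 2 * s * th ^+ 6) = K * (B ^+ 2 * s * (ng * nh) * th ^+ 6) by ring.
  apply: ler_wpM2l => //; apply: ler_pM; [by rewrite !mulr_ge0|exact: exprn_ge0| |exact: tp].
  by apply: ler_wpM2r => //; apply: ler_pM.
have r3 : `|D2 y0 a1 b1 - D2 y0 a0 b0| <= 2 * U.
  apply: le_trans (F3 _ _ _ _ _) _.
  have c1 := ler_pM (nrm_ge0 _) (nrm_ge0 _) ha hb1; have c2 := ler_pM (nrm_ge0 _) (nrm_ge0 _) ha0 hb.
  apply: le_trans (ler_wpM2l K0 (lerD c1 c2)) _.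
  have -> : B * nf * ng * th ^+ 3 * (B * nh * th) + B * ng * th * (B * nf * nh * th ^+ 3) = 2 * (B ^+ 2 * nf * (ng * nh) * th ^+ 4) by ring.
  by rewrite mulrCA; apply: ler_wpM2l => //; apply: small => //; exact: exprn_ge0.
have r4 : `|F (y1 + a1 + b1 + E1) - F (y1 + a1 + b1 + E0)| <= U.
  have := F1 (y1 + a1 + b1 + E0) (E1 - E0); rewrite -addrA [E0 + _]addrC subrK => c1; apply: (le_trans c1).
  apply: le_trans (ler_wpM2l K0 hE) _.
  by have := small B 5%N B0 isT BB; rewrite !mulrA.
have r5 : `|F (y1 + a1 + b1 + E0) - F (y1 + a1 + b1) - F (y0 + a0 + b0 + E0) + F (y0 + a0 + b0)| <= 3 * U.
  set z0 := y0 + a0 + b0; set z1 := y1 + a1 + b1.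
  have dz : nrm (z1 - z0) <= 3 * (B * nf * th ^+ 3).
    have -> : z1 - z0 = (y1 - y0) + (a1 - a0) + (b1 - b0) by rewrite /z1 /z0; apply/rowP => i; rewrite !mxE; ring.
    apply: le_trans (nrmD _ _) _; apply: le_trans (lerD (nrmD _ _) (lexx _)) _.
    have c1 : B * nf * th <= B * nf * th ^+ 3 by apply: ler_wpM2l; [exact: mulr_ge0|rewrite -[leLHS]expr1; exact: tp].
    have c2 : B * nf * ng * th ^+ 3 <= B * nf * th ^+ 3.
      by apply: ler_wpM2r; [exact: exprn_ge0|rewrite ler_piMr// mulr_ge0].
    have c3 : B * nf * nh * th ^+ 3 <= B * nf * th ^+ 3.
      by apply: ler_wpM2r; [exact: exprn_ge0|rewrite ler_piMr// mulr_ge0].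
    by move: hy ha hb c1 c2 c3; move: (_ * th ^+ 3) (_ * th ^+ 3) (_ * th ^+ 3) (_ * th) (nrm _) (nrm _) (nrm _); clear; move=> *; lra.
  have := F2 z0 (z1 - z0) E0; rewrite [z0 + _]addrC subrK => c1.
  apply: (le_trans c1); rewrite -mulrA.
  apply: le_trans (ler_wpM2l K0 (ler_pM (nrm_ge0 _) (nrm_ge0 _) dz hE0)) _.
  have -> : K * (3 * (B * nf * th ^+ 3) * (B * ng * nh * th ^+ 3)) = 3 * (K * (B ^+ 2 * nf * (ng * nh) * th ^+ 6)) by ring.
  by apply: ler_wpM2l => //; apply: small => //; exact: exprn_ge0.
have -> : ng * nh * (2 * eps * B ^+ 2 * (1 + nrm y0) * th ^+ 2 + (2 * L * B ^+ 3 + 6 * K * B ^+ 2) * s * th ^+ 6) =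
    2 * (ng * nh * (eps * B ^+ 2 * (1 + nrm y0) * th ^+ 2 + L * B ^+ 3 * s * th ^+ 6)) + 6 * U.
  by rewrite /U; clearbody s; move: (nrm y0) => n; ring.
move: r1 r2 r3 r4 r5; move: (ng * nh * _) (U) => V U'; rewrite !ler_norml.
move: (F (y1 + a1 + b1 + E1)) (F (y1 + a1 + b1 + E0)) (F (y1 + a1 + b1)) (F (y1 + a1)) (F (y1 + b1)) (F y1)
  (F (y0 + a0 + b0 + E0)) (F (y0 + a0 + b0)) (F (y0 + a0)) (F (y0 + b0)) (F y0) (D2 y0 a1 b1) (D2 y0 a0 b0).
by clear; move=> *; lra.
Qed.

Context d (Om : measurableType d) (P : probability Om R).
Variables (W : nat -> R -> Om -> R) (e : nat -> R -> R) (q : nat -> R) (T : R) (phi : (R -> R) -> R).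
Variable X : forall M : nat, 'rV[R]_M -> R -> Om -> 'rV[R]_M.
Hypotheses (HW : indep_std_BMs P W) (Hq : trace_class_eig e q) (T0 : 0 < T) (Hphi : C2_bounded_L2 phi).
Hypothesis HX : forall (M : nat) (x : 'rV[R]_M), galerkin_sol P W e q x (X x).

Let u M t (x : 'rV[R]_M) := uM P phi (@X M) t x.

Lemma nsig1_le M (f : 'rV[R]_M) : nsig 1 f <= kp M * nrm f.
Proof. by rewrite /nsig -Lam_pow; exact: nrm_Lam_le. Qed.

Lemma third_increment M (x : 'rV[R]_M) t (eps : R) : 0 < t <= T -> 0 < eps -> exists2 del : R, 0 < del &
  forall f g h, nrm f < del -> nrm g < del -> nrm h < del ->
   `|(u t (x + f + g + h) - u t (x + f + g) - u t (x + f + h) + u t (x + f)) -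
     (u t (x + g + h) - u t (x + g) - u t (x + h) + u t x)| <= eps * nrm g * nrm h.
Proof.
(* [sigma = 1] suffices here: for fixed [M] the [H^1] norm is at most [kp M] times the [L^2]
   norm. *)
move=> ht ep0; have hs : 1 / 2 < (1 : R) <= 1 by lra.
have h0 : 0 <= (0 : R) < 1 by rewrite lexx ltr01.
have h00 : (0 : R) + 0 < 1 by rewrite addr0 ltr01.
have [K K0 /(_ M)[D2 [F1 F2 F3 F4]]] := observable_increments Hphi.
have [e0 e00 H] := cube_bounds HW Hq T0 HX 6 hs (ltr01 : (0 : R) < 1).
have [r1 H1] := family_first T0 e00 hs h0.
have [r2 H2] := family_second T0 e00 hs h0 h0 h00.
have [r3 H3] := family_third T0 e00 hs M.
pose r := (r1 + r2 + r3)%N.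
have [C1 C11 HC1] := H1 r (leq_trans (leq_addr _ _) (leq_addr _ _)).
have [C2 C21 HC2] := H2 r (leq_trans (leq_addl _ _) (leq_addr _ _)).
have [C3 C31 HC3] := H3 r (leq_addl _ _).
have [C4 C41 HC4] := H r 6%N isT.
have [Cy Cy0 Hy] := state_moment HW Hq T0 HX x.
have C40 : 0 <= C4 := le_trans ler01 C41.
pose B := C1 + C2 + C3; have B1 : 1 <= B by rewrite /B; lra.
have B0 : 0 <= B := le_trans ler01 B1.
have CB1 : C1 <= B by rewrite /B; lra. have CB2 : C2 <= B by rewrite /B; lra. have CB3 : C3 <= B by rewrite /B; lra.
set lam := 2 + nsig 1 x; have l0 : 0 <= lam by rewrite addr_ge0// nrm_ge0.
pose C6 := C4 * lam ^+ 6 * expR (1 * nrm x ^+ 2).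
have C60 : 0 <= C6 by rewrite mulr_ge0 ?expR_ge0// mulr_ge0// exprn_ge0.
pose D := 2 * B ^+ 2 * (2 + 2 * Cy + C6) + 1.
have D0 : 0 < D by rewrite ltr_wpDl// mulr_ge0// ?addr_ge0// mulr_ge0// exprn_ge0.
(* [ep1] is fixed first, as it determines [L]; only then does [del] make the term with the
   increments small. Each takes half of [eps]. *)
pose ep1 := eps / 2 / D; have ep10 : 0 < ep1 by rewrite divr_gt0// divr_gt0.
have [L L0 HL] := F4 _ ep10.
pose G := 2 * L * B ^+ 3 + 6 * K * B ^+ 2.
have G0 : 0 <= G by rewrite addr_ge0// mulr_ge0 ?exprn_ge0// mulr_ge0.
pose A := 3 * (G * C6) + 1; have A0 : 0 < A by rewrite ltr_wpDl// mulr_ge0// mulr_ge0.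
pose del := Num.min (1 / 3 / kp M) (eps / 2 / A).
have kM1 := kp_ge1 M (R := R); have kM0 := kp_gt0 M (R := R).
exists del; first by rewrite lt_min !divr_gt0.
move=> f g h; rewrite !lt_min => /andP[f1 f2] /andP[g1 g2] /andP[hh1 hh2].
have ns (v : 'rV[R]_M) : nrm v < 1 / 3 / kp M -> nsig 1 v <= 1 / 3 /\ nrm v <= 1.
  move=> hv; have h1 : nsig 1 v <= 1 / 3 by apply: le_trans (nsig1_le v) _; rewrite mulrC -ler_pdivlMr// ltW.
  split=> //; apply: le_trans (nrm_le_nsig v ler01) _; lra.
have [nf1 nf] := ns f f1; have [ng1 ng] := ns g g1; have [nh1 nh] := ns h hh1.
have [Zs [hfam hE]] := HC4 M x f g h nf1 ng1 nh1.
have [t0 tT] := andP ht.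
have xE c a b : cube x f g h (c, a, b) = x + (if c then f else 0) + (if a then g else 0) + (if b then h else 0) by [].
pose s := nrm f + nrm g + nrm h.
have s0 : 0 <= s by rewrite !addr_ge0 ?nrm_ge0.
pose l : seq (R * 'rV[R]_M) := [:: (1, x + f + g + h); (-1, x + f + g); (-1, x + f + h); (1, x + f);
  (-1, x + g + h); (1, x + g); (1, x + h); (-1, x)].
have Ebnd : Ele P (fun w => `|\sum_(p <- l) p.1 * phi (Sf (X p.2 t w))|)
    (nrm g * nrm h * (2 * ep1 * B ^+ 2 * (2 + 2 * Cy + C6) + G * s * C6)).
  apply: (@Ele_le _ _ _ P _ (fun w => nrm g * nrm h * (2 * ep1 * B ^+ 2 * ((2 + 2 * nrm (X x t w) ^+ 2) +
     (64 * theta T (4 * e0) r lam (fun i s => X (cube x f g h i) (Num.max s 0) w) (Zs^~ w)) ^+ 6) +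
     G * s * (64 * theta T (4 * e0) r lam (fun i s => X (cube x f g h i) (Num.max s 0) w) (Zs^~ w)) ^+ 6)) _ _ _ (lexx _)); last first.
    apply: EleZ; first by rewrite mulr_ge0 ?nrm_ge0.
    have eB : 0 <= 2 * ep1 * B ^+ 2 by rewrite mulr_ge0 ?exprn_ge0// mulr_ge0// ltW.
    apply: EleD; last by apply: EleZ => //; exact: mulr_ge0.
    apply: EleZ => //; apply: EleD => //; apply: EleD; first exact: Ele_cst.
    by apply: EleZ => //; exact: Hy.
  apply: filterS hfam => w hw; set th := 64 * _.
  have th1 : 1 <= th := theta_pull_ge1 (false, false, false) r (ltW T0) (ltW e00) hw.
  have th0 : 0 <= th := le_trans ler01 th1.
  pose Y (i : bool * bool * bool) := X (cube x f g h i) t w.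
  have b1 i j : nrm (Y i - Y j) <= B * nrm (cube x f g h i - cube x f g h j) * th.
    have := HC1 M _ _ _ _ i j lam t ht hw; rewrite !max_l ?(ltW t0)// oppr0 powRr0 mulr1 nsig0 => hb.
    apply: (le_trans hb); apply: ler_wpM2r => //; apply: ler_wpM2r => //; exact: nrm_ge0.
  have b2 i j k l' : cube x f g h i - cube x f g h j = cube x f g h k - cube x f g h l' ->
      nrm ((Y i - Y j) - (Y k - Y l')) <= B * nrm (cube x f g h j - cube x f g h l') * nrm (cube x f g h k - cube x f g h l') * th ^+ 3.
    move=> hx; have := HC2 M _ _ _ _ i j k l' lam t ht hw hx; rewrite !max_l ?(ltW t0)// addr0 oppr0 powRr0 mulr1 !nsig0 => hb.
    apply: (le_trans hb); apply: ler_wpM2r; first exact: exprn_ge0.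
    by apply: ler_wpM2r; [exact: nrm_ge0|apply: ler_wpM2r => //; exact: nrm_ge0].
  have df a b : cube x f g h (true, a, b) - cube x f g h (false, a, b) = f by rewrite !xE; apply/rowP => i; rewrite !mxE; ring.
  have dg c b : cube x f g h (c, true, b) - cube x f g h (c, false, b) = g by rewrite !xE; apply/rowP => i; rewrite !mxE; ring.
  have dh c a : cube x f g h (c, a, true) - cube x f g h (c, a, false) = h by rewrite !xE; apply/rowP => i; rewrite !mxE; ring.
  pose E c := (Y (c, true, true) - Y (c, true, false)) - (Y (c, false, true) - Y (c, false, false)).
  have b3 : nrm (E true - E false) <= B * nrm f * nrm g * nrm h * th ^+ 5.
    pose v c (k : 'I_4) : bool * bool * bool := (c, (k < 2)%N, ~~ odd k).
    have := HC3 _ _ _ _ v f g h lam t ht hw.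
    have v0 c : v c (inord 0) = (c, true, true) by rewrite /v inordK.
    have v1 c : v c (inord 1) = (c, true, false) by rewrite /v inordK.
    have v2 c : v c (inord 2) = (c, false, true) by rewrite /v inordK.
    have v3 c : v c (inord 3) = (c, false, false) by rewrite /v inordK.
    move=> /(_ _ _ _ _ E) hb; apply: le_trans (hb _ _ _ _ _) _.
    - by move=> k; exact: df.
    - by move=> c; rewrite v1 v3 dg.
    - by move=> c; rewrite v2 v3 dh.
    - by move=> c; rewrite v0 v1 dh.
    - by move=> c; rewrite v0 v1 v2 v3 !max_l ?(ltW t0).
    - apply: ler_wpM2r; first exact: exprn_ge0.
      by apply: ler_wpM2r; [exact: nrm_ge0|apply: ler_wpM2r; [exact: nrm_ge0|apply: ler_wpM2r => //; exact: nrm_ge0]].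
  have YX c a b : X (x + (if c then f else 0) + (if a then g else 0) + (if b then h else 0)) t w = Y (c, a, b) by [].
  have := YX true true true; have := YX true true false; have := YX true false true; have := YX true false false.
  have := YX false true true; have := YX false true false; have := YX false false true; have := YX false false false.
  rewrite /= !addr0 => y000 y001 y010 y011 y100 y101 y110 y111 {YX}.
  rewrite /l !big_cons big_nil /= addr0 !mul1r !mulN1r y000 y001 y010 y011 y100 y101 y110 y111.
  clearbody Y.
  have key := @third_observable M (fun y => phi (Sf y)) D2 K ep1 L (Y (false, false, false)) (Y (true, false, false))
    (Y (false, true, false) - Y (false, false, false)) (Y (true, true, false) - Y (true, false, false))
    (Y (false, false, true) - Y (false, false, false)) (Y (true, false, true) - Y (true, false, false))
    (E false) (E true) B th (nrm f) (nrm g) (nrm h) K0 (ltW ep10) L0 F1 F2 F3 HL B1 th1 (nrm_ge0 f)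
    (introT andP (conj (nrm_ge0 g) ng)) (introT andP (conj (nrm_ge0 h) nh)).
  have YE (a b : 'rV[R]_M) : a + (b - a) = b by rewrite addrC subrK.
  have YE3 c : Y (c, true, false) + (Y (c, false, true) - Y (c, false, false)) + E c = Y (c, true, true).
    by rewrite /E; apply/rowP => i; rewrite !mxE; ring.
  rewrite !YE !YE3 in key.
  have {}key := key _ _ _ _ _ _ _ _ b3.
  have {}key : `|(phi (Sf (Y (true, true, true))) - phi (Sf (Y (true, true, false))) - phi (Sf (Y (true, false, true))) + phi (Sf (Y (true, false, false)))) -
    (phi (Sf (Y (false, true, true))) - phi (Sf (Y (false, true, false))) - phi (Sf (Y (false, false, true))) + phi (Sf (Y (false, false, false))))|
    <= nrm g * nrm h * (2 * ep1 * B ^+ 2 * (1 + nrm (Y (false, false, false))) * th ^+ 2 + G * s * th ^+ 6).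
    apply: key.
    - by have := b1 (false, true, false) (false, false, false); rewrite dg.
    - by have := b1 (true, true, false) (true, false, false); rewrite dg.
    - by have := b1 (false, false, true) (false, false, false); rewrite dh.
    - by have := b1 (true, false, true) (true, false, false); rewrite dh.
    - by have := b1 (true, false, false) (false, false, false); rewrite df.
    - have := b2 (true, true, false) (true, false, false) (false, true, false) (false, false, false).
      by rewrite !dg df; apply.
    - have := b2 (true, false, true) (true, false, false) (false, false, true) (false, false, false).
      by rewrite !dh df; apply.
    - have := b2 (false, true, true) (false, true, false) (false, false, true) (false, false, false).
      by rewrite !dh dg; apply.
  move: key; set V := `|_|; rewrite (_ : `|_ + (_ + _)| = V); last by rewrite /V; congr (`|_|); ring.
  move=> key.
  apply: (le_trans key); apply: ler_wpM2l; first by rewrite mulr_ge0 ?nrm_ge0.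
  rewrite lerD2r -mulrA; apply: ler_wpM2l; first by rewrite mulr_ge0 ?exprn_ge0// mulr_ge0// ltW.
  have t46 : (th ^+ 2) ^+ 2 <= th ^+ 6 by rewrite -exprM; exact: ler_weXn2l.
  exact: mul_le_sq.
have := combination_bound HW Hq T0 Hphi HX ht Ebnd.
rewrite /l !big_cons big_nil /= addr0 !mul1r !mulN1r => hb.
rewrite (_ : _ - (_ - _ - _ + _) = uM P phi (X (M:=M)) t (x + f + g + h) + (- uM P phi (X (M:=M)) t (x + f + g) +
  (- uM P phi (X (M:=M)) t (x + f + h) + (uM P phi (X (M:=M)) t (x + f) + (- uM P phi (X (M:=M)) t (x + g + h) +
  (uM P phi (X (M:=M)) t (x + g) + (uM P phi (X (M:=M)) t (x + h) - uM P phi (X (M:=M)) t x))))))); last by rewrite /u; ring.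
apply: (le_trans hb); rewrite -(mulrA eps) mulrC; apply: ler_wpM2r; first by rewrite mulr_ge0 ?nrm_ge0.
rewrite [leRHS]splitr; apply: lerD.
  have -> : 2 * ep1 * B ^+ 2 * (2 + 2 * Cy + C6) = ep1 * (D - 1) by rewrite /D; ring.
  apply: (@le_trans _ _ (ep1 * D)); first by apply: ler_wpM2l; [exact: ltW|rewrite gerBl].
  by rewrite /ep1 divfK// gt_eqF.
have sd : s <= 3 * (eps / 2 / A) by exact: sum3_le.
have -> : G * s * C6 = s * (G * C6) by ring.
have GC : 0 <= G * C6 by exact: mulr_ge0.
apply: le_trans (ler_wpM2r GC sd) _.
have -> : 3 * (eps / 2 / A) * (G * C6) = eps / 2 / A * (A - 1) by rewrite /A; ring.
have a0 : 0 <= eps / 2 / A by rewrite divr_ge0 ?divr_ge0// ltW.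
apply: (@le_trans _ _ (eps / 2 / A * A)); first by apply: ler_wpM2l => //; rewrite gerBl.
by rewrite divfK// gt_eqF.
Qed.

End third_increments.

(** * Derivatives of the transition semigroup *)

Section expansions.
Context {R : realType} {M : nat}.
Implicit Types (a b : 'rV[R]_M -> R) (p h : 'rV[R]_M).

Definition expands a p := forall eps : R, 0 < eps -> exists2 del : R, 0 < del &
  forall h, nrm h < del -> `|a h - dot p h| <= eps * nrm h.

Lemma expandsB a b p p' : expands a p -> expands b p' -> expands (fun h => a h - b h) (p - p').
Proof.
move=> ha hb eps e0; have e2 : 0 < eps / 2 by rewrite divr_gt0.
have [d1 d10 H1] := ha _ e2; have [d2 d20 H2] := hb _ e2.
exists (Num.min d1 d2); first by rewrite lt_min d10.
move=> h; rewrite lt_min => /andP[h1 h2].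
have -> : a h - b h - dot (p - p') h = (a h - dot p h) - (b h - dot p' h) by rewrite dotBl; ring.
by apply: le_trans (ler_normB _ _) _; apply: le_trans (lerD (H1 h h1) (H2 h h2)) _; rewrite -mulrDl -splitr.
Qed.

(** The derivative is homogeneous, so a bound along arbitrarily small multiples of [h] is enough;
    increments of [u] are controlled for small directions only. *)
Lemma expands_bound a p h (r B : R) : 0 < r -> expands a p ->
  (forall s, 0 < s < r -> `|a (s *: h)| <= s * B) -> `|dot p h| <= B.
Proof.
move=> r0 ha H; apply/ler_addgt0Pr => eps e0.
have n0 : 0 < nrm h + 1 by rewrite ltr_wpDl ?nrm_ge0.
have [del d0 Hd] := ha _ (divr_gt0 e0 n0).
pose s := Num.min r (del / (nrm h + 1)) / 2.
have m0 : 0 < Num.min r (del / (nrm h + 1)) by rewrite lt_min r0 divr_gt0.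
have s0 : 0 < s by rewrite divr_gt0.
have sm : s < Num.min r (del / (nrm h + 1)) by rewrite /s ltr_pdivrMr//; lra.
move: sm; rewrite lt_min => /andP[sr]; rewrite ltr_pdivlMr// => sd.
have nsh : nrm (s *: h) <= s * (nrm h + 1) by rewrite nrmZ gtr0_norm//; apply: ler_wpM2l; [exact: ltW|rewrite lerDl].
have h1 := Hd (s *: h) (le_lt_trans nsh sd); have h2 : `|a (s *: h)| <= s * B by apply: H; rewrite s0.
rewrite -(ler_pM2l s0) mulrDr -{1}(gtr0_norm s0) -normrM -dotZr.
have -> : dot p (s *: h) = a (s *: h) - (a (s *: h) - dot p (s *: h)) by ring.
apply: le_trans (ler_normB _ _) _; apply: lerD => //; apply: (le_trans h1).
apply: le_trans (ler_wpM2l _ nsh) _; first by rewrite ltW// divr_gt0.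
by rewrite mulrCA divfK// gt_eqF.
Qed.

End expansions.

Section norms.
Context {R : realType} {M : nat}.
Implicit Types (x h : 'rV[R]_M).

Lemma nsigZ (s k : R) h : 0 < k -> nsig s (k *: h) = k * nsig s h.
Proof. by move=> k0; rewrite /nsig dgmZ nrmZ gtr0_norm. Qed.

Lemma nsig_le (s s' : R) h : s <= s' -> nsig s h <= nsig s' h.
Proof.
move=> ss; apply: nrm_dgm_le => i; rewrite ger0_norm ?powR_ge0//.
by rewrite ler_powR ?kp_ge1.
Qed.

Lemma l2norm_powA (a : R) x : l2norm (powA M a (embM x)) = nsig (2 * a) x.
Proof.
rewrite /nsig -l2norm_Sf; congr l2norm; apply: funext => z; rewrite /powA [RHS]/embM.
by apply: eq_bigr => i _; rewrite dgmE coord_embM.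
Qed.

Lemma base_pow_le (n : R) k m : 0 <= n -> (k <= m)%N -> (2 + n) ^+ k <= 3 ^+ k * (1 + n ^+ m).
Proof.
move=> n0 km; have p0 := exprn_ge0 m n0.
have [n1|n1] := leP n 1.
  apply: (@le_trans _ _ (3 ^+ k)); last by rewrite ler_peMr ?exprn_ge0// lerDl.
  by rewrite lerXn2r ?nnegrE ?addr_ge0//; lra.
apply: (@le_trans _ _ ((3 * n) ^+ k)); first by rewrite lerXn2r ?nnegrE ?addr_ge0 ?mulr_ge0//; lra.
rewrite exprMn; apply: ler_wpM2l; first exact: exprn_ge0.
by apply: ler_wpDl => //; apply: ler_weXn2l => //; exact: ltW.
Qed.

End norms.

Section derivatives_of_u.
Context {R : realType} d (Om : measurableType d) (P : probability Om R).
Variables (W : nat -> R -> Om -> R) (e : nat -> R -> R) (q : nat -> R) (T : R) (phi : (R -> R) -> R).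
Variable X : forall M : nat, 'rV[R]_M -> R -> Om -> 'rV[R]_M.
Hypotheses (HW : indep_std_BMs P W) (Hq : trace_class_eig e q) (T0 : 0 < T) (Hphi : C2_bounded_L2 phi).
Hypothesis HX : forall (M : nat) (x : 'rV[R]_M), galerkin_sol P W e q x (X x).

Let u M t (x : 'rV[R]_M) := uM P phi (@X M) t x.

Let s1 : 1 / 2 < (1 : R) <= 1. Proof. lra. Qed.
Let z1 : 0 <= (0 : R) < 1. Proof. by rewrite lexx ltr01. Qed.

Lemma nsig1_small M (f : 'rV[R]_M) : nrm f < 1 / 3 / kp M -> nsig 1 f <= 1 / 3.
Proof.
move=> hf; apply: le_trans (nsig1_le f) _; have k0 := kp_gt0 M (R := R).
by rewrite mulrC -ler_pdivlMr// ltW.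
Qed.

Let rM (M : nat) : R := 1 / 3 / kp M.
Let rM0 M : 0 < rM M. Proof. by rewrite !divr_gt0// kp_gt0. Qed.

Lemma local_first M (x : 'rV[R]_M) t : 0 < t <= T -> exists2 C : R, 0 <= C &
  forall h, nrm h < rM M -> `|u t (x + h) - u t x| <= C * nrm h.
Proof.
move=> ht; have [C C0 H] := first_increment HW Hq T0 Hphi HX s1 z1 ltr01.
exists (C * expR (1 * nrm x ^+ 2) * (2 + nsig 1 x)).
  by rewrite mulr_ge0 ?addr_ge0 ?nrm_ge0// mulr_ge0 ?expR_ge0// ltW.
by move=> h hh; have := H M x h t ht (nsig1_small hh); rewrite oppr0 powRr0 mulr1 nsig0.
Qed.

Lemma local_second M (x : 'rV[R]_M) t : 0 < t <= T -> exists2 C : R, 0 <= C &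
  forall g h, nrm g < rM M -> nrm h < rM M -> `|u t (x + g + h) - u t (x + g) - u t (x + h) + u t x| <= C * nrm g * nrm h.
Proof.
move=> ht; have z2 : (0 : R) + 0 < 1 by rewrite addr0 ltr01.
have [C C0 H] := second_increment HW Hq T0 Hphi HX s1 z1 z1 z2 ltr01.
exists (C * expR (1 * nrm x ^+ 2) * (2 + nsig 1 x) ^+ 3).
  by rewrite mulr_ge0 ?exprn_ge0 ?addr_ge0 ?nrm_ge0// mulr_ge0 ?expR_ge0// ltW.
by move=> g h hg hh; have := H M x g h t ht (nsig1_small hg) (nsig1_small hh); rewrite addr0 oppr0 powRr0 mulr1 !nsig0.
Qed.

(** Second increments are [O(|f| |g|)], so first increments are additive up to [eps |g|] for small
    [f]. *)
Lemma u_expands M (x : 'rV[R]_M) t : 0 < t <= T -> exists p, expands (fun h => u t (x + h) - u t x) p.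
Proof.
move=> ht; have [C C0 H] := local_first x ht; have [D D0 H2] := local_second x ht.
apply: (@asymptotically_linear R M _ C (rM M)) => // eps e0.
have D1 : 0 < D + 1 by rewrite ltr_wpDl.
exists (Num.min (rM M) (eps / (D + 1))); first by rewrite lt_min rM0 divr_gt0.
move=> f g; rewrite !lt_min => /andP[f1 f2] /andP[g1 _].
have -> : u t (x + (f + g)) - u t x - (u t (x + f) - u t x) - (u t (x + g) - u t x) =
  u t (x + f + g) - u t (x + f) - u t (x + g) + u t x by rewrite addrA; ring.
apply: le_trans (H2 f g f1 g1) _; apply: ler_wpM2r; first exact: nrm_ge0.
apply: (@le_trans _ _ ((D + 1) * nrm f)); first by apply: ler_wpM2r; [exact: nrm_ge0|rewrite lerDl].
by move: f2; rewrite ltr_pdivlMr// mulrC => /ltW.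
Qed.

Definition gradient M t (G : 'rV[R]_M -> 'rV[R]_M) := forall x, expands (fun h => u t (x + h) - u t x) (G x).

Lemma u_gradient M t : 0 < t <= T -> exists G : 'rV[R]_M -> 'rV[R]_M, gradient t G.
Proof.
move=> ht; have /choice[G HG] : forall x : 'rV[R]_M, exists p, expands (fun h => u t (x + h) - u t x) p.
  by move=> x; exact: u_expands.
by exists G.
Qed.

Lemma gradient_increment_bound M t (G : 'rV[R]_M -> 'rV[R]_M) (x g h : 'rV[R]_M) (r B : R) : gradient t G -> 0 < r ->
  (forall s, 0 < s < r -> `|u t (x + g + s *: h) - u t (x + g) - u t (x + s *: h) + u t x| <= s * B) ->
  `|dot (G (x + g)) h - dot (G x) h| <= B.
Proof.
move=> hG r0 H; rewrite -dotBl; apply: (expands_bound r0 (expandsB (hG (x + g)) (hG x))) => s hs.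
by apply: le_trans (H s hs); rewrite le_eqVlt; apply/orP; left; apply/eqP; congr (`|_|); ring.
Qed.

Lemma gradient_second_increment_bound M t (G : 'rV[R]_M -> 'rV[R]_M) (x f g h : 'rV[R]_M) (r B : R) : gradient t G -> 0 < r ->
  (forall s, 0 < s < r -> `|(u t (x + f + g + s *: h) - u t (x + f + g) - u t (x + f + s *: h) + u t (x + f)) -
     (u t (x + g + s *: h) - u t (x + g) - u t (x + s *: h) + u t x)| <= s * B) ->
  `|dot (G (x + f + g)) h - dot (G (x + f)) h - dot (G (x + g)) h + dot (G x) h| <= B.
Proof.
move=> hG r0 H.
have := expandsB (expandsB (hG (x + f + g)) (hG (x + f))) (expandsB (hG (x + g)) (hG x)).
move: (G (x + f + g)) (G (x + f)) (G (x + g)) (G x) => p3 p2 p1 p0 hp.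
have -> : dot p3 h - dot p2 h - dot p1 h + dot p0 h = dot ((p3 - p2) - (p1 - p0)) h by rewrite !dotBl; ring.
apply: (expands_bound r0 hp) => s hs.
by apply: le_trans (H s hs); rewrite le_eqVlt; apply/orP; left; apply/eqP; congr (`|_|); ring.
Qed.

Lemma small_multiple M (h : 'rV[R]_M) (r : R) : 0 < r -> exists2 r' : R, 0 < r' & forall s, 0 < s < r' -> nrm (s *: h) < r.
Proof.
move=> r0; have n0 : 0 < nrm h + 1 by rewrite ltr_wpDl ?nrm_ge0.
exists (r / (nrm h + 1)); first by rewrite divr_gt0.
move=> s /andP[s0]; rewrite ltr_pdivlMr//; apply: le_lt_trans; rewrite nrmZ gtr0_norm//.
by apply: ler_wpM2l; [exact: ltW|rewrite lerDl].
Qed.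

(** The defect of additivity of [g -> <G (x + g), h> - <G x, h>] at [f], [g] is the limit, as [s]
    tends to 0, of the third increments of [u] along [f], [g] and [s h], divided by [s]. *)
Lemma gradient_expands M t (G : 'rV[R]_M -> 'rV[R]_M) (x h : 'rV[R]_M) : 0 < t <= T -> gradient t G ->
  exists p, expands (fun g => dot (G (x + g)) h - dot (G x) h) p.
Proof.
move=> ht hG; have [C C0 H] := local_second x ht.
have [r r0 Hr] := small_multiple h (rM0 M).
apply: (@asymptotically_linear R M _ (C * nrm h) (rM M)) => //; first by rewrite mulr_ge0 ?nrm_ge0.
  move=> g hg; apply: (gradient_increment_bound hG r0) => s hs.
  apply: le_trans (H g _ hg (Hr s hs)) _; have [s0 _] := andP hs.
  by rewrite nrmZ gtr0_norm// le_eqVlt; apply/orP; left; apply/eqP; ring.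
move=> eps e0; have n0 : 0 < nrm h + 1 by rewrite ltr_wpDl ?nrm_ge0.
have [del d0 Hd] := third_increment HW Hq T0 Hphi HX x ht (divr_gt0 e0 n0).
have [r' r'0 Hr'] := small_multiple h d0.
exists del => // f g hf hg; rewrite addrA.
have -> : dot (G (x + f + g)) h - dot (G x) h - (dot (G (x + f)) h - dot (G x) h) - (dot (G (x + g)) h - dot (G x) h) =
  dot (G (x + f + g)) h - dot (G (x + f)) h - dot (G (x + g)) h + dot (G x) h by ring.
apply: (gradient_second_increment_bound hG r'0) => s hs.
apply: le_trans (Hd f g _ hf hg (Hr' s hs)) _; have [s0 _] := andP hs.
rewrite nrmZ gtr0_norm// [leLHS](_ : _ = s * (eps * nrm g * (nrm h / (nrm h + 1)))); last by field; rewrite gt_eqF.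
apply: ler_wpM2l; first exact: ltW.
by rewrite ler_piMr ?mulr_ge0 ?nrm_ge0 ?(ltW e0)// ler_pdivrMr// mul1r lerDl.
Qed.

End derivatives_of_u.

Unset Implicit Arguments.
Set Strict Implicit.
Set Printing Implicit Defensive.

Theorem theorem4p1 (R : realType) (T : R) (d : measure_display)
  (Om : measurableType d) (P : probability Om R)
  (W : nat -> R -> Om -> R) (e : nat -> R -> R) (q : nat -> R)
  (phi : (R -> R) -> R)
  (X : forall M : nat, 'rV[R]_M -> R -> Om -> 'rV[R]_M) :
  0 < T -> indep_std_BMs P W -> trace_class_eig e q -> C2_bounded_L2 phi ->
  (forall (M : nat) (x : 'rV[R]_M), galerkin_sol P W e q x (X M x)) ->
  (forall alpha delta eps : R,
     0 <= alpha < 1 -> 0 < delta -> 0 < eps ->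
     exists2 C : R, 0 < C &
       forall (M : nat) (x h : 'rV[R]_M) (t : R), 0 < t <= T ->
         differentiable (uM P phi (X M) t) x /\
         `|'d (uM P phi (X M) t) x h|
           <= C * t `^ (- alpha) * expR (eps * l2norm (embM x) ^+ 2)
              * (1 + l2norm (powA M (4^-1 + delta) (embM x)) ^+ 6)
              * l2norm (powA M (- alpha) (embM h))) /\
  (forall alpha beta delta eps : R,
     0 <= alpha < 1 -> 0 <= beta < 1 -> alpha + beta < 1 ->
     0 < delta -> 0 < eps ->
     exists2 C : R, 0 < C &
       forall (M : nat) (x g h : 'rV[R]_M) (t : R), 0 < t <= T ->
         (forall y, differentiable (uM P phi (X M) t) y) /\
         differentiable (fun y => 'd (uM P phi (X M) t) y h) x /\
         `|'d (fun y => 'd (uM P phi (X M) t) y h) x g|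
           <= C * t `^ (- (alpha + beta)) * expR (eps * l2norm (embM x) ^+ 2)
              * (1 + l2norm (powA M (4^-1 + delta) (embM x)) ^+ 16)
              * l2norm (powA M (- alpha) (embM g))
              * l2norm (powA M (- beta) (embM h))).
Proof.
move=> T0 HW Hq Hphi HX.
(* [(- A)^(1/4 + delta)] is [nsig] of index [1/2 + 2 delta]. The minimum keeps the index at most 1,
   as the increment bounds require, and only weakens the norm. *)
pose sig (delta : R) : R := 1 / 2 + 2 * Num.min delta (1 / 4).
have hsig delta : 0 < delta -> 1 / 2 < sig delta <= 1 /\ sig delta <= 2 * (4^-1 + delta).
  move=> d0; have h1 : 0 < Num.min delta (1 / 4) by rewrite lt_min d0 divr_gt0.
  have h2 : Num.min delta (1 / 4) <= 1 / 4 by rewrite ge_min lexx orbT.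
  have h3 : Num.min delta (1 / 4) <= delta by rewrite ge_min lexx.
  have h4 : 2 * (4^-1 + delta) = 1 / 2 + 2 * delta by field.
  by rewrite h4 /sig; move: (Num.min _ _) h1 h2 h3 => m h1 h2 h3; split; [apply/andP; split|]; lra.
have key (M : nat) (x : 'rV[R]_M) delta k m : 0 < delta -> (k <= m)%N ->
    (2 + nsig (sig delta) x) ^+ k <= 3 ^+ k * (1 + nsig (2 * (4^-1 + delta)) x ^+ m).
  move=> d0 km; have [_ h] := hsig delta d0.
  apply: le_trans (base_pow_le _ km); last exact: nrm_ge0.
  by rewrite lerXn2r ?nnegrE ?addr_ge0 ?nrm_ge0// lerD2l; exact: nsig_le.
have third : (0 : R) < 1 / 3 by rewrite divr_gt0.
have small (M : nat) (v : 'rV[R]_M) sigma : sigma <= 1 -> exists2 r : R, 0 < r & forall s, 0 < s < r -> nsig sigma (s *: v) <= 1 / 3.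
  move=> s1; have r0 : 0 < 1 / 3 / kp M :> R by rewrite divr_gt0// kp_gt0.
  have [r r1 Hr] := small_multiple v r0.
  by exists r => // s hs; apply: le_trans (nsig_le _ s1) _; exact: nsig1_small (Hr s hs).
split.
  move=> alpha delta eps hal d0 ep0; have [hs _] := hsig delta d0.
  have [C C0 H] := first_increment HW Hq T0 Hphi HX hs hal ep0.
  (* [2 + n <= 3 (1 + n^6)]. *)
  exists (3 * C); first by rewrite mulr_gt0.
  move=> M x h t ht; have [G hG] := u_gradient HW Hq T0 Hphi HX M ht.
  have [Hd Ed] := differentiable_dot (hG x); split => //; rewrite Ed.
  have [_ s1] := andP hs; have [r r0 Hr] := small M h _ s1.
  rewrite !l2norm_powA l2norm_Sf mulrN.
  apply: (expands_bound r0 (hG x)) => s hsr; have [s0 _] := andP hsr.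
  apply: le_trans (H M x (s *: h) t ht (Hr s hsr)) _; rewrite nsigZ//.
  have hk := key M x delta 1%N 6 d0 isT; rewrite !expr1 in hk.
  have p0 : 0 <= C * t `^ (- alpha) * expR (eps * nrm x ^+ 2).
    by rewrite mulr_ge0 ?expR_ge0// mulr_ge0 ?powR_ge0// ltW.
  have n0 : 0 <= s * nsig (- (2 * alpha)) h by rewrite mulr_ge0 ?nrm_ge0// ltW.
  apply: le_trans (ler_wpM2r n0 (ler_wpM2l p0 hk)) _.
  by rewrite le_eqVlt; apply/orP; left; apply/eqP; move: (t `^ _) (expR _) (nsig _ x ^+ 6) (nsig _ h) => *; ring.
move=> alpha beta delta eps hal hbe hab d0 ep0; have [hs _] := hsig delta d0.
have [C C0 H] := second_increment HW Hq T0 Hphi HX hs hal hbe hab ep0.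
(* [(2 + n)^3 <= 27 (1 + n^16)]. *)
exists (27 * C); first by rewrite mulr_gt0.
move=> M x g h t ht; have [G hG] := u_gradient HW Hq T0 Hphi HX M ht.
split; first by move=> y; have [? _] := differentiable_dot (hG y).
have -> : (fun y => 'd (uM P phi (X M) t) y h) = (fun y => dot (G y) h).
  by apply: funext => y; have [_ Ed] := differentiable_dot (hG y); exact: Ed.
have [p hp] := gradient_expands HW Hq T0 Hphi HX x h ht hG.
have [Hd Ep] := @differentiable_dot R M (fun y => dot (G y) h) x p hp; split => //.
have [_ s1] := andP hs; have [r r0 Hr] := small M h _ s1; have [r' r'0 Hr'] := small M g _ s1.
rewrite Ep !l2norm_powA l2norm_Sf !mulrN.
(* First [g] is scaled down, then, for fixed [s], also [h]; the bound on second increments is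
   homogeneous in both, so the scales cancel. *)
apply: (expands_bound r'0 hp) => s hsr; have [s0 _] := andP hsr.
apply: (gradient_increment_bound hG r0) => s' hsr'; have [s'0 _] := andP hsr'.
apply: le_trans (H M x (s *: g) (s' *: h) t ht (Hr' s hsr) (Hr s' hsr')) _; rewrite !nsigZ//.
have hk := key M x delta 3 16 d0 isT.
have p0 : 0 <= C * t `^ (- (alpha + beta)) * expR (eps * nrm x ^+ 2).
  by rewrite mulr_ge0 ?expR_ge0// mulr_ge0 ?powR_ge0// ltW.
have n0 : 0 <= s * nsig (- (2 * alpha)) g by rewrite mulr_ge0 ?nrm_ge0// ltW.
have n1 : 0 <= s' * nsig (- (2 * beta)) h by rewrite mulr_ge0 ?nrm_ge0// ltW.
apply: le_trans (ler_wpM2r n1 (ler_wpM2r n0 (ler_wpM2l p0 hk))) _.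
rewrite le_eqVlt; apply/orP; left; apply/eqP.
by move: (t `^ _) (expR _) (nsig _ x ^+ 16) (nsig _ g) (nsig _ h) => *; ring.
Qed.
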